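(* Let $a\in C^\infty(\mathbb S)$ be a positive function satisfying $\frac1{2\pi}\int_0^{2\pi}a(\theta)^{-1}\,d\theta=1$. Then $\zeta_a(s)-2\zeta_R(s)\ge0$ for every real $s$. Moreover, equality $\zeta_a(s)-2\zeta_R(s)=0$ holds for some real $s\neq0$ if and only if $a$ is conformally equivalent to the constant function $\mathbf 1$.
   Context: $\mathbb S=\{e^{i\theta}\}$ is the unit circle; functions on $\mathbb S$ are identified with $2\pi$-periodic functions of $\theta$ and with the corresponding multiplication operators. $\Lambda$ is the operator on $C^\infty(\mathbb S)$ with $\Lambda e^{in\theta}=|n|e^{in\theta}$ ($n\in\mathbb Z$). For positive $a\in C^\infty(\mathbb S)$, $\Lambda_a=a^{1/2}\Lambda a^{1/2}$; it is nonnegative self-adjoint on $L^2(\mathbb S)$ with discrete spectrum $0=\lambda_0(a)<\lambda_1(a)\le\lambda_2(a)\le\dots$ (with multiplicity), the Steklov spectrum of $a$. For $a$ satisfying $\int_0^{2\pi}a^{-1}d\theta=2\pi$, $\zeta_a(s)=\sum_{k\ge1}\lambda_k(a)^{-s}$ converges for $\Re s>1$, extends meromorphically to $\mathbb C$ with a unique simple pole at $s=1$, and $\zeta_a-2\zeta_R$ is entire ($\zeta_R$ the Riemann zeta function); at $s=1$, $\zeta_a(s)-2\zeta_R(s)$ means the value of this entire function. Two functions $a,b\in C^\infty(\mathbb S)$ are conformally equivalent if there is a conformal or anticonformal automorphism $\Psi$ of the closed unit disk such that $b=|d\psi/d\theta|^{-1}\,a\circ\psi$, where $e^{i\psi(\theta)}=\Psi(e^{i\theta})$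 ($\Psi$ anticonformal means $\bar\Psi$ conformal). *)

(* Defs.v *)
From Stdlib Require Import Reals.
From Coquelicot Require Import Coquelicot.
Open Scope R_scope.

Definition smooth (f : R -> R) : Prop := forall (n : nat) (x : R), ex_derive_n f n x.

(* 2pi-periodic: functions on the unit circle S identified with periodic functions *)
Definition periodic2pi (f : R -> R) : Prop := forall x, f (x + 2 * PI) = f x.

Definition fcos (u : R -> R) (n : nat) : R :=
  / PI * RInt (fun t => u t * cos (INR n * t)) 0 (2 * PI).
Definition fsin (u : R -> R) (n : nat) : R :=
  / PI * RInt (fun t => u t * sin (INR n * t)) 0 (2 * PI).

(* Lambda e^{in t} = |n| e^{in t}, written in real form:
   u = a0/2 + sum_{n>=1} (a_n cos nt + b_n sin nt)  |->  sum_{n>=1} n (a_n cos nt + b_n sin nt) *)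
Definition Lambda (u : R -> R) (t : R) : R :=
  Series (fun m => let n := S m in
                   INR n * (fcos u n * cos (INR n * t) + fsin u n * sin (INR n * t))).

Definition Lambda_a (a u : R -> R) (t : R) : R :=
  sqrt (a t) * Lambda (fun x => sqrt (a x) * u x) t.

Definition L2ip (f g : R -> R) : R := RInt (fun t => f t * g t) 0 (2 * PI).

(* lam is the Steklov spectrum of a (nondecreasing, listed with multiplicity):
   there is a complete orthonormal system of L^2(S) of (smooth, real) eigenfunctions
   u_k of Lambda_a with Lambda_a u_k = lam k * u_k. Completeness is expressed by
   Parseval's identity on the dense subspace of smooth periodic functions. *)
Definition steklov_spectrum (a : R -> R) (lam : nat -> R) : Prop :=
  (forall k, lam k <= lam (S k)) /\
  exists u : nat -> R -> R,
    (forall k, smooth (u k) /\ periodic2pi (u k)) /\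
    (forall k t, Lambda_a a (u k) t = lam k * u k t) /\
    (forall j k, L2ip (u j) (u k) = if Nat.eqb j k then 1 else 0) /\
    (forall f, smooth f -> periodic2pi f ->
       is_series (fun k => (L2ip f (u k)) ^ 2) (L2ip f f)).

(* x^{-s} = exp(-s ln x) for real x > 0 and complex s *)
Definition cpow_neg (x : R) (s : C) : C :=
  (exp (- Re s * ln x) * cos (Im s * ln x), - (exp (- Re s * ln x) * sin (Im s * ln x))).

Definition cdiff (f : C -> C) (z : C) : Prop :=
  @ex_derive C_AbsRing C_NormedModule f z.

Definition entire (f : C -> C) : Prop := forall z, cdiff f z.

Definition zeta_diff (lam : nat -> R) (F : C -> C) : Prop :=
  entire F /\
  forall s : C, 1 < Re s ->
    exists Za Z : C,
      @is_series C_AbsRing C_NormedModule (fun k => cpow_neg (lam (S k)) s) Za /\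
      @is_series C_AbsRing C_NormedModule (fun n => cpow_neg (INR (S n)) s) Z /\
      F s = Cminus Za (Cmult (RtoC 2) Z).

Definition cis (t : R) : C := (cos t, sin t).

Definition disk_conformal_aut (P : C -> C) : Prop :=
  (forall z, Cmod z <= 1 -> Cmod (P z) <= 1) /\
  (forall z w, Cmod z <= 1 -> Cmod w <= 1 -> P z = P w -> z = w) /\
  (forall w, Cmod w <= 1 -> exists z, Cmod z <= 1 /\ P z = w) /\
  (forall z, Cmod z <= 1 -> forall eps, 0 < eps -> exists delta, 0 < delta /\
     forall w, Cmod w <= 1 -> Cmod (Cminus w z) < delta ->
       Cmod (Cminus (P w) (P z)) < eps) /\
  (forall z, Cmod z < 1 -> cdiff P z).

Definition disk_conformal_or_anti (P : C -> C) : Prop :=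
  disk_conformal_aut P \/ disk_conformal_aut (fun z => Cconj (P z)).

Definition conf_equiv (a b : R -> R) : Prop :=
  exists (P : C -> C) (psi : R -> R),
    disk_conformal_or_anti P /\
    smooth psi /\
    (forall t, P (cis t) = cis (psi t)) /\
    (forall t, b t = / Rabs (Derive psi t) * a (psi t)).

(* Main.v *)
(** With [p = 1 / a], [phi] a primitive of [p] and [g_j = sqrt a * u_j], the eigenvalue
    equation becomes [Lambda g_j = lam_j * p * g_j].  The symplectic form
    [omega f g = \int f g'] is dominated by the Dirichlet form [q] of [Lambda]:
    [2 omega f g <= q f f + q g g].  Comparing determinants of the two forms on the span of
    [cos (k phi), sin (k phi)], [k <= n], gives the Hersch-Payne-Schiffer inequality
    [lam_1 ... lam_2n <= (n!)^2].  By non-stationary phase these functions are almost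
    eigenfunctions, so that [lam_j] approaches the sequence 1, 1, 2, 2, ... faster than any
    power, and the reverse product inequality holds up to a factor tending to 1.  Hence
    [F s = \sum_n (lam_(2n-1)^-s + lam_2n^-s - 2 n^-s)] for every real [s], since both sides
    are given by everywhere convergent power series and agree for [s > 1].  Convexity of the
    exponential and summation by parts against the nonnegative partial sums of
    [ln (n^2 / (lam_(2n-1) lam_2n))], which tend to 0, yield
    [F s >= lam_1^-s - 1 + s ln lam_1 >= 0].

    If [F s = 0] with [s <> 0], then [lam_1 = 1], which is equality in Weinstock's inequality
    and means that [f = exp (i phi)] has no negative Fourier modes.  For [c] the mean of [f],
    the quotient [(f - c) / (1 - conj c * f)] is unimodular of winding number 1 with only
    positive modes, hence a constant times [exp (i theta)]; so [phi] is the boundary value of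
    a Moebius map.  Conversely, if [a] is conformally equivalent to 1, then [cos (k phi)] and
    [sin (k phi)] are exact eigenfunctions and the spectrum is 0, 1, 1, 2, 2, .... *)

Require Import Defs.
From Stdlib Require Import Reals ZArith Lra Lia Psatz FunctionalExtensionality Classical ClassicalEpsilon.
From Coquelicot Require Import Coquelicot.
From mathcomp Require all_boot all_order all_algebra ring lra Rstruct.
Open Scope R_scope.
Set Bullet Behavior "Strict Subproofs".

(** * Smooth and continuous functions *)

(** The determinant comparison passes through [rr], the form of the inverse operator: [1 / (n!)^2 =
    |det omega| <= det q <= det rr <= 1 / (lam_1 ... lam_2n)], the middle step being a duality with
    the conjugate function. For the reverse inequality the trigonometric functions of [phi] are
    projected onto the first [2n] eigenfunctions; there [omega] is controlled by the eigenvalue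
    product, and projecting changes its matrix by row sums of order [1/n]. Without this the
    logarithmic sums might tend to a positive limit, and for negative s the boundary term of the
    summation by parts, whose weight grows like [n^|s|], would not vanish. That growth is also why
    decay faster than every power is required. [F] is tied to the spectrum only for [Re s > 1], and
    entire means pointwise complex differentiability, so its power series is derived from Goursat's
    theorem, used in logarithmic polar coordinates where Fourier modes on circles are integrals over
    a period. The same fact about modes handles disk automorphisms. Equality is detected because the
    first eigenvalue alone is not linearised in the convexity estimate. *)

Definition cont (f : R -> R) : Prop := forall x, continuous f x.

Lemma is_derive_mult_R (f g : R -> R) (x a b : R) :
  is_derive f x a -> is_derive g x b ->
  is_derive (fun t => f t * g t) x (a * g x + f x * b).
Proof. intros; apply (is_derive_mult f g x a b); auto; intros; apply Rmult_comm. Qed.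

Lemma is_derive_plus_R (f g : R -> R) (x a b : R) :
  is_derive f x a -> is_derive g x b -> is_derive (fun t => f t + g t) x (a + b).
Proof. intros; now apply (is_derive_plus f g x a b). Qed.

Lemma is_derive_comp_R (f g : R -> R) (x a b : R) :
  is_derive f (g x) a -> is_derive g x b -> is_derive (fun t => f (g t)) x (b * a).
Proof. intros; now apply (is_derive_comp f g x a b). Qed.

Lemma is_derive_eq (f : R -> R) (x a b : R) : is_derive f x a -> a = b -> is_derive f x b.
Proof. now intros H <-. Qed.

(** Exhibiting a class of functions closed under differentiation replaces every formula for higher
    derivatives of products, quotients and compositions. *)
Lemma smooth_coind (P : (R -> R) -> Prop) :
  (forall f, P f -> exists f', (forall x, is_derive f x (f' x)) /\ P f') ->
  forall f, P f -> smooth f.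
Proof.
  intros HP.
  assert (H : forall n f, P f -> P (Derive_n f n)).
  { induction n; intros f Hf; [exact Hf|].
    destruct (HP _ (IHn f Hf)) as [f' [H1 H2]].
    replace (Derive_n f (S n)) with f'; [exact H2|].
    apply functional_extensionality; intros x; simpl; symmetry.
    now apply is_derive_unique. }
  intros f Hf [|n] x; [exact I|].
  destruct (HP _ (H n f Hf)) as [f' [H1 _]]. exists (f' x); apply H1.
Qed.

Lemma smooth_ex_derive f x : smooth f -> ex_derive f x.
Proof. intros H; exact (H 1%nat x). Qed.

Lemma smooth_is_derive f x : smooth f -> is_derive f x (Derive f x).
Proof. intros; now apply Derive_correct, smooth_ex_derive. Qed.

Lemma smooth_Derive f : smooth f -> smooth (Derive f).
Proof.
  intros H [|n] x; [exact I|]. simpl.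
  apply ex_derive_ext with (Derive_n f (S n)); [|exact (H (S (S n)) x)].
  intros t. change (Derive f) with (Derive_n f 1).
  now rewrite Derive_n_comp, Nat.add_1_r.
Qed.

Lemma smooth_cont f : smooth f -> cont f.
Proof. intros H x; apply (ex_derive_continuous f); now apply smooth_ex_derive. Qed.

Inductive fun_alg (G : (R -> R) -> Prop) : (R -> R) -> Prop :=
| fa_gen f : G f -> fun_alg G f
| fa_const c : fun_alg G (fun _ => c)
| fa_plus f g : fun_alg G f -> fun_alg G g -> fun_alg G (fun x => f x + g x)
| fa_mult f g : fun_alg G f -> fun_alg G g -> fun_alg G (fun x => f x * g x).

(** The derivative of a generator may be a polynomial in the generators, itself included. This
    covers solutions of polynomial differential equations, such as [/ f], [sqrt f] and the pair
    [cos f], [sin f]. *)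
Lemma fun_alg_smooth (G : (R -> R) -> Prop) :
  (forall f, G f -> exists f', (forall x, is_derive f x (f' x)) /\ fun_alg G f') ->
  forall f, fun_alg G f -> smooth f.
Proof.
  intros HG; apply (smooth_coind (fun_alg G)).
  induction 1 as [f Hf|c|f g Hf [f' [F1 F2]] Hg [g' [G1 G2]]|f g Hf [f' [F1 F2]] Hg [g' [G1 G2]]].
  - now apply HG.
  - exists (fun _ => 0); split; [intros; apply @is_derive_const|apply fa_const].
  - exists (fun x => f' x + g' x); split; [intros; now apply is_derive_plus_R|now apply fa_plus].
  - exists (fun x => f' x * g x + f x * g' x); split.
    + intros; now apply is_derive_mult_R.
    + apply (fa_plus G (fun x => f' x * g x) (fun x => f x * g' x)); now apply fa_mult.
Qed.

Lemma smooth_gen f : smooth f -> exists f', (forall x, is_derive f x (f' x)) /\ fun_alg smooth f'.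
Proof.
  intros H; exists (Derive f); split; [intros; now apply smooth_is_derive|].
  now apply fa_gen, smooth_Derive.
Qed.

Lemma smooth_const c : smooth (fun _ => c).
Proof. apply (fun_alg_smooth smooth smooth_gen), fa_const. Qed.

Lemma smooth_plus f g : smooth f -> smooth g -> smooth (fun x => f x + g x).
Proof. intros; apply (fun_alg_smooth smooth smooth_gen), fa_plus; now apply fa_gen. Qed.

Lemma smooth_mult f g : smooth f -> smooth g -> smooth (fun x => f x * g x).
Proof. intros; apply (fun_alg_smooth smooth smooth_gen), fa_mult; now apply fa_gen. Qed.

Lemma smooth_scal c f : smooth f -> smooth (fun x => c * f x).
Proof. intros; apply smooth_mult; auto using smooth_const. Qed.

Lemma smooth_opp f : smooth f -> smooth (fun x => - f x).
Proof.
  intros H. replace (fun x => - f x) with (fun x => (-1) * f x).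
  - now apply smooth_scal.
  - apply functional_extensionality; intros; ring.
Qed.

Lemma smooth_minus f g : smooth f -> smooth g -> smooth (fun x => f x - g x).
Proof. intros; apply (smooth_plus f (fun x => - g x)); auto using smooth_opp. Qed.

Lemma smooth_of_derive f f' : (forall x, is_derive f x (f' x)) -> smooth f' -> smooth f.
Proof.
  intros H H'. apply (fun_alg_smooth (fun h => smooth h \/ h = f)).
  - intros h [Hh| ->].
    + exists (Derive h); split; [intros; now apply smooth_is_derive|].
      apply fa_gen; left; now apply smooth_Derive.
    + exists f'; split; [exact H|apply fa_gen; now left].
  - apply fa_gen; now right.
Qed.

Lemma smooth_inv f : smooth f -> (forall x, f x <> 0) -> smooth (fun x => / f x).
Proof.
  intros H H0. apply (fun_alg_smooth (fun h => smooth h \/ h = fun x => / f x)).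
  - intros h [Hh| ->].
    + exists (Derive h); split; [intros; now apply smooth_is_derive|].
      apply fa_gen; left; now apply smooth_Derive.
    + exists (fun x => (-1) * (Derive f x * (/ f x * / f x))); split.
      * intros x. eapply is_derive_eq.
        { apply is_derive_inv; [now apply smooth_is_derive|apply H0]. }
        field; apply H0.
      * repeat apply fa_mult; try apply fa_const; apply fa_gen; auto using smooth_Derive.
  - apply fa_gen; now right.
Qed.

Lemma smooth_sqrt f : smooth f -> (forall x, 0 < f x) -> smooth (fun x => sqrt (f x)).
Proof.
  intros H H0. apply (fun_alg_smooth (fun h => smooth h \/ h = fun x => sqrt (f x))).
  - intros h [Hh| ->].
    + exists (Derive h); split; [intros; now apply smooth_is_derive|].
      apply fa_gen; left; now apply smooth_Derive.
    (* The derivative is written as a smooth factor times [sqrt (f x)] itself, so that it stays in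
       the algebra. *)
    + exists (fun x => (/ 2 * Derive f x * / f x) * sqrt (f x)); split.
      * intros x. eapply is_derive_eq.
        { apply is_derive_sqrt; [now apply smooth_is_derive|apply H0]. }
        pose proof (sqrt_lt_R0 _ (H0 x)) as Hs.
        replace (/ f x) with (/ (sqrt (f x) * sqrt (f x))).
        { field; lra. }
        rewrite sqrt_sqrt; [reflexivity|specialize (H0 x); lra].
      * apply fa_mult; [|apply fa_gen; now right]. apply fa_gen; left.
        apply smooth_mult; [apply smooth_scal, smooth_Derive, H|].
        apply smooth_inv; auto. intros x; specialize (H0 x); lra.
  - apply fa_gen; now right.
Qed.

Lemma smooth_trig f : smooth f -> smooth (fun x => cos (f x)) /\ smooth (fun x => sin (f x)).
Proof.
  intros H.
  pose (G := fun h => smooth h \/ h = (fun x => cos (f x)) \/ h = (fun x => sin (f x))).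
  assert (HG : forall h, G h -> exists h', (forall x, is_derive h x (h' x)) /\ fun_alg G h').
  { intros h [Hh|[-> | ->]].
    - exists (Derive h); split; [intros; now apply smooth_is_derive|].
      apply fa_gen; left; now apply smooth_Derive.
    - exists (fun x => ((-1) * Derive f x) * sin (f x)); split.
      + intros x. eapply is_derive_eq.
        { apply is_derive_comp_R; [apply is_derive_cos|now apply smooth_is_derive]. }
        ring.
      + apply fa_mult; apply fa_gen; unfold G; auto using smooth_scal, smooth_Derive.
    - exists (fun x => Derive f x * cos (f x)); split.
      + intros x. apply is_derive_comp_R; [apply is_derive_sin|now apply smooth_is_derive].
      + apply fa_mult; apply fa_gen; unfold G; auto using smooth_scal, smooth_Derive. }
  split; apply (fun_alg_smooth G HG), fa_gen; unfold G; auto.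
Qed.

Lemma smooth_cos f : smooth f -> smooth (fun x => cos (f x)).
Proof. apply smooth_trig. Qed.

Lemma smooth_sin f : smooth f -> smooth (fun x => sin (f x)).
Proof. apply smooth_trig. Qed.

Lemma smooth_id : smooth (fun x => x).
Proof.
  apply (smooth_of_derive (fun x => x) (fun _ => 1)); [intros; apply @is_derive_id|apply smooth_const].
Qed.

Lemma cont_const c : cont (fun _ => c).
Proof. intros x; apply continuous_const. Qed.
Lemma cont_id : cont (fun x => x).
Proof. intros x; apply continuous_id. Qed.
Lemma cont_plus f g : cont f -> cont g -> cont (fun x => f x + g x).
Proof. intros F G x; now apply (continuous_plus f g). Qed.
Lemma cont_minus f g : cont f -> cont g -> cont (fun x => f x - g x).
Proof. intros F G x; now apply (continuous_minus f g). Qed.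
Lemma cont_opp f : cont f -> cont (fun x => - f x).
Proof. intros F x; now apply (continuous_opp f). Qed.
Lemma cont_mult f g : cont f -> cont g -> cont (fun x => f x * g x).
Proof. intros F G x; now apply (continuous_mult f g). Qed.
Lemma cont_pow f n : cont f -> cont (fun x => f x ^ n).
Proof.
  intros F. induction n; [apply (cont_const 1)|].
  change (cont (fun x => f x * f x ^ n)). now apply cont_mult.
Qed.
Lemma cont_comp f g : cont f -> cont g -> cont (fun x => f (g x)).
Proof. intros F G x; now apply continuous_comp. Qed.
Lemma cont_cos f : cont f -> cont (fun x => cos (f x)).
Proof. intros F. apply (cont_comp cos f); auto. intros x; apply continuous_cos. Qed.
Lemma cont_sin f : cont f -> cont (fun x => sin (f x)).
Proof. intros F. apply (cont_comp sin f); auto. intros x; apply continuous_sin. Qed.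
Lemma cont_abs f : cont f -> cont (fun x => Rabs (f x)).
Proof. intros F. apply (cont_comp Rabs f); auto. intros x; apply continuous_Rabs. Qed.
Lemma cont_inv f : cont f -> (forall x, f x <> 0) -> cont (fun x => / f x).
Proof.
  intros F H0 x. apply (continuous_comp f Rinv); [apply F|].
  apply (ex_derive_continuous Rinv). auto_derive. apply H0.
Qed.

Ltac ct_step := match goal with
  | H : cont ?f |- cont ?f => exact H
  | H : smooth ?f |- cont ?f => exact (smooth_cont f H)
  | |- cont (fun _ => ?c) => exact (cont_const c)
  | |- cont (fun x => x) => exact cont_id
  | |- cont (fun x => @?f x + @?g x) => apply (cont_plus f g)
  | |- cont (fun x => @?f x - @?g x) => apply (cont_minus f g)
  | |- cont (fun x => - @?f x) => apply (cont_opp f)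
  | |- cont (fun x => @?f x * @?g x) => apply (cont_mult f g)
  | |- cont (fun x => @?f x ^ ?n) => apply (cont_pow f n)
  | |- cont (fun x => cos (@?f x)) => apply (cont_cos f)
  | |- cont (fun x => sin (@?f x)) => apply (cont_sin f)
  | |- cont (fun x => Rabs (@?f x)) => apply (cont_abs f)
  | |- cont (fun x => ?f x) => change (cont f)
  end.
Ltac ct := cbv beta; repeat (ct_step; cbv beta); auto.

(** * Integrals over the circle *)

Definition ig (f : R -> R) : R := RInt f 0 (2 * PI).

Lemma two_pi_pos : 0 < 2 * PI.
Proof. pose proof PI_RGT_0; lra. Qed.

Lemma cont_ex_RInt f a b : cont f -> ex_RInt f a b.
Proof. intros H; apply @ex_RInt_continuous; intros; apply H. Qed.

Lemma ig_ext f g : (forall x, f x = g x) -> ig f = ig g.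
Proof. intros H; apply RInt_ext; auto. Qed.

Lemma ig_plus f g : cont f -> cont g -> ig (fun x => f x + g x) = ig f + ig g.
Proof. intros F G. apply @RInt_plus; now apply cont_ex_RInt. Qed.

Lemma ig_scal c f : cont f -> ig (fun x => c * f x) = c * ig f.
Proof. intros F. apply @RInt_scal; now apply cont_ex_RInt. Qed.

Lemma ig_opp f : cont f -> ig (fun x => - f x) = - ig f.
Proof. intros F. apply @RInt_opp; now apply cont_ex_RInt. Qed.

Lemma ig_minus f g : cont f -> cont g -> ig (fun x => f x - g x) = ig f - ig g.
Proof. intros F G. apply @RInt_minus; now apply cont_ex_RInt. Qed.

Lemma ig_const c : ig (fun _ => c) = 2 * PI * c.
Proof. unfold ig. rewrite RInt_const. unfold scal; simpl; unfold mult; simpl. ring. Qed.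

Lemma ig_le f g : cont f -> cont g -> (forall x, f x <= g x) -> ig f <= ig g.
Proof.
  intros F G H. apply RInt_le; auto using cont_ex_RInt. pose proof two_pi_pos; lra.
Qed.

Lemma ig_abs_le f M : cont f -> (forall x, Rabs (f x) <= M) -> Rabs (ig f) <= 2 * PI * M.
Proof.
  intros F H. replace (2 * PI * M) with ((2 * PI - 0) * M) by ring.
  apply abs_RInt_le_const; auto using cont_ex_RInt. pose proof two_pi_pos; lra.
Qed.

Lemma ig_ge0 f : cont f -> (forall x, 0 <= f x) -> 0 <= ig f.
Proof.
  intros F H. replace 0 with (ig (fun _ => 0)) by (rewrite ig_const; ring).
  apply ig_le; auto using cont_const.
Qed.

Lemma ig_derive f f' : (forall x, is_derive f x (f' x)) -> cont f' -> ig f' = f (2 * PI) - f 0.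
Proof.
  intros H C. apply is_RInt_unique. apply (is_RInt_derive f f'); intros; [apply H|apply C].
Qed.

Lemma ig_derive0 f f' :
  (forall x, is_derive f x (f' x)) -> cont f' -> periodic2pi f -> ig f' = 0.
Proof.
  intros H C P. rewrite (ig_derive f f'); auto.
  replace (2 * PI) with (0 + 2 * PI) by ring. rewrite P; ring.
Qed.

Lemma ig_by_parts f f' g g' :
  (forall x, is_derive f x (f' x)) -> (forall x, is_derive g x (g' x)) ->
  cont f' -> cont g' -> periodic2pi f -> periodic2pi g ->
  ig (fun x => f x * g' x) = - ig (fun x => f' x * g x).
Proof.
  intros F G F' G' Pf Pg.
  assert (cont f) by (intros x; apply (ex_derive_continuous f); exists (f' x); apply F).
  assert (cont g) by (intros x; apply (ex_derive_continuous g); exists (g' x); apply G).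
  assert (E : ig (fun x => f' x * g x + f x * g' x) = 0).
  { apply (ig_derive0 (fun x => f x * g x)).
    - intros; now apply is_derive_mult_R.
    - ct.
    - intros x; now rewrite Pf, Pg. }
  rewrite ig_plus in E by ct. lra.
Qed.

Lemma periodic_nat f n x : periodic2pi f -> f (x + INR n * (2 * PI)) = f x.
Proof.
  intros P; induction n; [f_equal; simpl; ring|].
  rewrite S_INR. replace (x + (INR n + 1) * (2 * PI)) with (x + INR n * (2 * PI) + 2 * PI) by ring.
  now rewrite P.
Qed.

Lemma periodic_reduce f x : periodic2pi f -> exists y, 0 <= y < 2 * PI /\ f x = f y.
Proof.
  intros P. pose proof two_pi_pos as HP.
  destruct (archimed (x / (2 * PI))) as [H1 H2].
  set (k := (up (x / (2 * PI)) - 1)%Z).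
  assert (Hk : IZR k <= x / (2 * PI) < IZR k + 1) by (unfold k; rewrite minus_IZR; lra).
  assert (E : x = x / (2 * PI) * (2 * PI)) by (field; lra).
  exists (x - IZR k * (2 * PI)); split; [nra|].
  destruct (Z_le_dec 0 k) as [Hz|Hz].
  - rewrite <- (periodic_nat f (Z.to_nat k) (x - IZR k * (2 * PI)) P). f_equal.
    rewrite INR_IZR_INZ, Z2Nat.id by auto. ring.
  - rewrite <- (periodic_nat f (Z.to_nat (- k)) x P). f_equal.
    rewrite INR_IZR_INZ, Z2Nat.id by lia. rewrite opp_IZR. ring.
Qed.

Lemma cont_bounded f : cont f -> periodic2pi f -> exists M, 0 < M /\ forall x, Rabs (f x) <= M.
Proof.
  intros C P. pose proof two_pi_pos.
  destruct (continuity_ab_maj (fun x => Rabs (f x)) 0 (2 * PI)) as [m [Hm _]]; [lra| |].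
  { intros c _. apply continuity_pt_filterlim. apply (cont_abs f C c). }
  exists (Rabs (f m) + 1). pose proof (Rabs_pos (f m)). split; [lra|].
  intros x. destruct (periodic_reduce f x P) as [y [Hy ->]].
  specialize (Hm y ltac:(lra)). simpl in Hm. lra.
Qed.

Lemma cont_pos_lower f : cont f -> periodic2pi f -> (forall x, 0 < f x) ->
  exists c, 0 < c /\ forall x, c <= f x.
Proof.
  intros C P H0. pose proof two_pi_pos.
  destruct (continuity_ab_min f 0 (2 * PI)) as [m [Hm _]]; [lra| |].
  { intros c _. apply continuity_pt_filterlim. apply (C c). }
  exists (f m); split; [auto|].
  intros x. destruct (periodic_reduce f x P) as [y [Hy ->]].
  specialize (Hm y ltac:(lra)). simpl in Hm. lra.
Qed.

Lemma ig_ge_sub f a b c : cont f -> (forall x, 0 <= x <= 2 * PI -> 0 <= f x) -> 0 <= a -> a <= b -> b <= 2 * PI ->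
  (forall x, a <= x <= b -> c <= f x) -> c * (b - a) <= ig f.
Proof.
  intros C H0 Ha Hab Hb Hc. unfold ig.
  assert (E : RInt f 0 (2 * PI) = RInt f 0 a + (RInt f a b + RInt f b (2 * PI))).
  { rewrite <- (RInt_Chasles f 0 a (2 * PI)), <- (RInt_Chasles f a b (2 * PI));
      auto using cont_ex_RInt. }
  assert (0 <= RInt f 0 a) by (apply RInt_ge_0; auto using cont_ex_RInt; intros; apply H0; lra).
  assert (0 <= RInt f b (2 * PI)) by (apply RInt_ge_0; auto using cont_ex_RInt; intros; apply H0; lra).
  assert (RInt (fun _ => c) a b <= RInt f a b).
  { apply RInt_le; auto using cont_ex_RInt, cont_const. intros; apply Hc; lra. }
  rewrite RInt_const in H2. unfold scal in H2; simpl in H2; unfold mult in H2; simpl in H2. lra.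
Qed.

Lemma ig_zero_nonneg f : cont f -> periodic2pi f -> (forall x, 0 <= f x) -> ig f = 0 ->
  forall x, f x = 0.
Proof.
  intros C P H0 E.
  assert (HI : forall y, 0 < y < 2 * PI -> f y = 0).
  { intros y Hy. apply Rle_antisym; [|apply H0]. apply Rnot_lt_le; intros Hp.
    destruct (proj1 (filterlim_locally f (f y)) (C y) (mkposreal (f y / 2) ltac:(lra))) as [d Hd].
    pose (r := Rmin (d / 2) (Rmin (y / 2) ((2 * PI - y) / 2))).
    assert (Hr : 0 < r) by (unfold r; destruct d; simpl; repeat apply Rmin_pos; lra).
    assert (r <= d / 2 /\ r <= y / 2 /\ r <= (2 * PI - y) / 2).
    { unfold r; pose proof (Rmin_l (d/2) (Rmin (y / 2) ((2 * PI - y) / 2)));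
      pose proof (Rmin_r (d/2) (Rmin (y / 2) ((2 * PI - y) / 2)));
      pose proof (Rmin_l (y / 2) ((2 * PI - y) / 2));
      pose proof (Rmin_r (y / 2) ((2 * PI - y) / 2)); lra. }
    assert (Hs : f y / 2 * ((y + r) - (y - r)) <= ig f).
    { apply ig_ge_sub; auto; try lra.
      intros x Hx. specialize (Hd x).
      assert (Rabs (f x - f y) < f y / 2).
      { apply Hd. change (Rabs (x - y) < d). destruct d; simpl in *. apply Rabs_def1; lra. }
      apply Rabs_def2 in H1; lra. }
    nra. }
  assert (HI2 : forall y, 0 <= y < 2 * PI -> f y = 0).
  (* No neighbourhood of the end point 0 lies inside the interval of integration, but [f] already
     vanishes at interior points arbitrarily close to it. *)
  { intros y Hy. destruct (Req_dec y 0) as [->|]; [|apply HI; lra].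
    apply Rle_antisym; [|apply H0]. apply Rnot_lt_le; intros Hp.
    destruct (proj1 (filterlim_locally f (f 0)) (C 0) (mkposreal (f 0) Hp)) as [d Hd].
    pose (r := Rmin (d / 2) 1). pose proof PI2_1 as P2. unfold PI2 in P2.
    assert (Hr : 0 < r) by (unfold r; destruct d; simpl; repeat apply Rmin_pos; lra).
    assert (r <= d / 2 /\ r <= 1) by (unfold r; split; [apply Rmin_l|apply Rmin_r]).
    assert (Rabs (f r - f 0) < f 0).
    { apply Hd. change (Rabs (r - 0) < d). destruct d; simpl in *. apply Rabs_def1; lra. }
    rewrite (HI r) in H1 by lra. apply Rabs_def2 in H1; lra. }
  intros x. destruct (periodic_reduce f x P) as [y [Hy ->]]. auto.
Qed.

(** * Normally convergent series of functions *)

Lemma sum_n_SR (u : nat -> R) n : sum_n u (S n) = sum_n u n + u (S n).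
Proof. now rewrite sum_Sn. Qed.

Lemma ex_series_scalR (c : R) (u : nat -> R) : ex_series u -> ex_series (fun n => c * u n).
Proof. exact (@ex_series_scal R_AbsRing R_NormedModule c u). Qed.

Lemma is_series_extR (u v : nat -> R) (l : R) : (forall n, u n = v n) -> is_series u l -> is_series v l.
Proof. apply is_series_ext. Qed.

Lemma series_tail_le (u M : nat -> R) N :
  (forall n, Rabs (u n) <= M n) -> ex_series M ->
  Rabs (Series u - sum_n u N) <= Series M - sum_n M N.
Proof.
  intros H HM.
  assert (Hu : ex_series u) by (apply (@ex_series_le _ R_CompleteNormedModule u M); auto).
  rewrite (Series_incr_n u (S N)), (Series_incr_n M (S N)); auto; try lia. simpl Init.Nat.pred.
  rewrite <- !sum_n_Reals.
  match goal with |- Rabs (?a + ?b - ?c) <= ?d + ?e - ?f =>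
    replace (a + b - c) with b by ring; replace (d + e - f) with e by ring end.
  assert (HM' : ex_series (fun k => M (S N + k)%nat)) by now apply ex_series_incr_n.
  eapply Rle_trans; [apply Series_Rabs|apply Series_le; auto].
  - apply (@ex_series_le _ R_CompleteNormedModule _ (fun k => M (S N + k)%nat)); auto.
    intros n; unfold norm; simpl; unfold abs; simpl. rewrite Rabs_Rabsolu. apply H.
  - intros n; split; [apply Rabs_pos|apply H].
Qed.

Lemma series_tail_small (M : nat -> R) eps : ex_series M -> 0 < eps ->
  exists N, forall n, (N <= n)%nat -> Rabs (Series M - sum_n M n) < eps.
Proof.
  intros HM He. apply Series_correct in HM.
  destruct (proj1 (filterlim_locally _ _) HM (mkposreal eps He)) as [N HN].
  exists N; intros n Hn. specialize (HN n Hn).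
  change (Rabs (sum_n M n - Series M) < eps) in HN. now rewrite Rabs_minus_sym.
Qed.

Lemma cont_sum_n (f : nat -> R -> R) N : (forall n, cont (f n)) -> cont (fun t => sum_n (fun n => f n t) N).
Proof.
  intros C. induction N.
  - replace (fun t => sum_n (fun n => f n t) 0) with (f O); auto.
    apply functional_extensionality; intros; now rewrite sum_O.
  - replace (fun t => sum_n (fun n => f n t) (S N)) with (fun t => sum_n (fun n => f n t) N + f (S N) t).
    + apply cont_plus; auto.
    + apply functional_extensionality; intros; now rewrite sum_Sn.
Qed.

Lemma ig_sum_n (f : nat -> R -> R) N : (forall n, cont (f n)) ->
  ig (fun t => sum_n (fun n => f n t) N) = sum_n (fun n => ig (f n)) N.
Proof.
  intros C. induction N.
  - rewrite sum_O. apply ig_ext; intros; now rewrite sum_O.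
  - rewrite sum_Sn, <- IHN. unfold plus; simpl. rewrite <- ig_plus; auto using cont_sum_n.
    apply ig_ext; intros; now rewrite sum_Sn.
Qed.

Lemma normal_series_cont (f : nat -> R -> R) M :
  (forall n, cont (f n)) -> (forall n t, Rabs (f n t) <= M n) -> ex_series M ->
  cont (fun t => Series (fun n => f n t)).
Proof.
  intros C H HM x. apply filterlim_locally; intros eps.
  assert (He : 0 < eps / 3) by (destruct eps; simpl; lra).
  destruct (series_tail_small M _ HM He) as [N HN]. specialize (HN N (le_n N)).
  destruct (proj1 (filterlim_locally _ _) (cont_sum_n f N C x) (mkposreal _ He)) as [d Hd].
  exists d; intros y Hy. specialize (Hd y Hy).
  change (Rabs (sum_n (fun n => f n y) N - sum_n (fun n => f n x) N) < eps / 3) in Hd.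
  change (Rabs (Series (fun n => f n y) - Series (fun n => f n x)) < eps).
  pose proof (series_tail_le (fun n => f n y) M N (fun n => H n y) HM) as H1.
  pose proof (series_tail_le (fun n => f n x) M N (fun n => H n x) HM) as H2.
  pose proof (Rle_abs (Series M - sum_n M N)).
  apply Rabs_def2 in Hd. apply Rabs_le_between in H1, H2. apply Rabs_def1; lra.
Qed.

Lemma normal_series_ig (f : nat -> R -> R) M :
  (forall n, cont (f n)) -> (forall n t, Rabs (f n t) <= M n) -> ex_series M ->
  is_series (fun n => ig (f n)) (ig (fun t => Series (fun n => f n t))).
Proof.
  intros C H HM. apply filterlim_locally; intros eps.
  pose proof two_pi_pos as HP.
  assert (He : 0 < eps / (2 * PI + 1)) by (destruct eps; simpl; apply Rdiv_lt_0_compat; lra).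
  destruct (series_tail_small M _ HM He) as [N HN]. exists N; intros n Hn. specialize (HN n Hn).
  change (Rabs (sum_n (fun n => ig (f n)) n - ig (fun t => Series (fun n => f n t))) < eps).
  rewrite <- ig_sum_n, Rabs_minus_sym, <- ig_minus; auto using cont_sum_n.
  2: now apply normal_series_cont with M.
  pose proof (Rle_abs (Series M - sum_n M n)).
  assert (HS : Rabs (ig (fun t => Series (fun n => f n t) - sum_n (fun n => f n t) n))
            <= 2 * PI * (Series M - sum_n M n)).
  { apply ig_abs_le.
    - apply cont_minus; auto using cont_sum_n. now apply normal_series_cont with M.
    - intros t. apply series_tail_le; auto. }
  eapply Rle_lt_trans; [exact HS|].
  apply Rle_lt_trans with (2 * PI * (eps / (2 * PI + 1))).
  - apply Rmult_le_compat_l; lra.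
  - destruct eps as [e e0]; simpl. apply Rlt_le_trans with ((2 * PI + 1) * (e / (2 * PI + 1))).
    + apply Rmult_lt_compat_r; [simpl in He; exact He|lra].
    + right; field; lra.
Qed.

(** * Smooth periodic functions *)

Definition sp (f : R -> R) : Prop := smooth f /\ periodic2pi f.

Lemma sp_cont f : sp f -> cont f.
Proof. intros [H _]; now apply smooth_cont. Qed.

Lemma periodic_Derive f : periodic2pi f -> periodic2pi (Derive f).
Proof.
  intros P x. unfold Derive. f_equal. apply Lim_ext; intros h.
  rewrite <- (P (x + h)), <- (P x). now replace (x + 2 * PI + h) with (x + h + 2 * PI) by ring.
Qed.

Lemma sp_Derive f : sp f -> sp (Derive f).
Proof. intros [H P]; split; [now apply smooth_Derive|now apply periodic_Derive]. Qed.

Lemma sp_const c : sp (fun _ => c).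
Proof. split; [apply smooth_const|intros x; reflexivity]. Qed.

Lemma sp_plus f g : sp f -> sp g -> sp (fun x => f x + g x).
Proof. intros [F P] [G Q]; split; [now apply smooth_plus|intros x; now rewrite P, Q]. Qed.

Lemma sp_minus f g : sp f -> sp g -> sp (fun x => f x - g x).
Proof. intros [F P] [G Q]; split; [now apply smooth_minus|intros x; now rewrite P, Q]. Qed.

Lemma sp_mult f g : sp f -> sp g -> sp (fun x => f x * g x).
Proof. intros [F P] [G Q]; split; [now apply smooth_mult|intros x; now rewrite P, Q]. Qed.

Lemma sp_scal c f : sp f -> sp (fun x => c * f x).
Proof. intros [F P]; split; [now apply smooth_scal|intros x; now rewrite P]. Qed.

Lemma sp_inv f : sp f -> (forall x, f x <> 0) -> sp (fun x => / f x).
Proof. intros [F P] H; split; [now apply smooth_inv|intros x; now rewrite P]. Qed.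

(** * Elementary series and integer shifts of trigonometric functions *)

Lemma ex_series_inv_sq : ex_series (fun n => / INR (S n) ^ 2).
Proof.
  (* Comparison with the telescoping series of [1/(n+1) - 1/(n+2)]. *)
  assert (H : is_series (fun n => / (INR (S n) * INR (S (S n)))) 1).
  { assert (E : forall n, 1 - / INR (S (S n)) = sum_n (fun n => / (INR (S n) * INR (S (S n)))) n :> R).
    { induction n.
      + rewrite sum_O. simpl. field.
      + rewrite sum_n_SR, <- IHn.
        assert (0 <= INR n) by apply pos_INR.
        rewrite !S_INR. field. repeat split; lra. }
    apply filterlim_ext with (fun n => 1 - / INR (S (S n))).
    - exact E.
    - change (is_lim_seq (fun n => 1 - / INR (S (S n))) 1).
      replace (Finite 1) with (Finite (1 - 0)) by (f_equal; ring).
      apply (is_lim_seq_minus' (fun _ => 1) (fun n => / INR (S (S n))) 1 0).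
      + apply is_lim_seq_const.
      + apply (is_lim_seq_incr_1 (fun n => / INR (S n))), (is_lim_seq_incr_1 (fun n => / INR n)).
        replace (Finite 0) with (Rbar_inv p_infty) by reflexivity.
        apply is_lim_seq_inv; [apply is_lim_seq_INR|discriminate]. }
  apply (@ex_series_le _ R_CompleteNormedModule _ (fun n => 2 * / (INR (S n) * INR (S (S n))))).
  - intros n. unfold norm; simpl; unfold abs; simpl.
    assert (0 <= INR n) by apply pos_INR. change (match n with O => 1 | S _ => INR n + 1 end) with (INR (S n)).
    change (match n with O => 1 + 1 | S _ => _ end) with (INR (S (S n))).
    rewrite !S_INR, Rmult_1_r. rewrite Rabs_right.
    + replace (2 * / ((INR n + 1) * (INR n + 1 + 1))) with (/ ((INR n + 1) * (INR n + 1 + 1) / 2))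
        by (field; lra).
      apply Rinv_le_contravar; nra.
    + apply Rle_ge, Rlt_le, Rinv_0_lt_compat; nra.
  - apply (ex_series_scalR 2). now exists 1.
Qed.

Lemma is_series_single k (v : R) : is_series (fun n => (if Nat.eqb n k then v else 0) : R) v.
Proof.
  apply filterlim_ext_loc with (fun _ => v); [|apply filterlim_const].
  exists k; intros n Hn.
  assert (E : forall n, sum_n (fun n => (if Nat.eqb n k then v else 0) : R) n = (if Nat.leb k n then v else 0) :> R).
  { clear; induction n.
    - rewrite sum_O. destruct k; reflexivity.
    - rewrite sum_n_SR, IHn.
      destruct (Nat.eqb_spec (S n) k) as [<-|Hk].
      + rewrite (proj2 (Nat.leb_gt (S n) n)), Nat.leb_refl by lia. ring.
      + rewrite Rplus_0_r. destruct (Nat.leb_spec k n), (Nat.leb_spec k (S n)); auto; lia. }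
  rewrite E. now rewrite (proj2 (Nat.leb_le k n)).
Qed.

Lemma cos_sub_int_mult x n : cos (x + INR n * (2 * PI)) = cos x /\ sin (x + INR n * (2 * PI)) = sin x.
Proof.
  replace (x + INR n * (2 * PI)) with (x + 2 * INR n * PI) by ring.
  split; [apply cos_period|apply sin_period].
Qed.

Lemma trig_shift_Z x k : cos (x + IZR k * (2 * PI)) = cos x /\ sin (x + IZR k * (2 * PI)) = sin x.
Proof.
  destruct (Z_le_dec 0 k).
  - rewrite <- (Z2Nat.id k), <- INR_IZR_INZ by auto. apply cos_sub_int_mult.
  - destruct (cos_sub_int_mult (x + IZR k * (2 * PI)) (Z.to_nat (- k))) as [H1 H2].
    rewrite INR_IZR_INZ, Z2Nat.id, opp_IZR in H1, H2 by lia.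
    replace (x + IZR k * (2 * PI) + - IZR k * (2 * PI)) with x in H1, H2 by ring. auto.
Qed.

(** * Fourier series in the angular variable of a circle diffeomorphism *)

(** The lift to the line of an orientation-preserving circle diffeomorphism, with derivative [p].
    Integrals against [p] are integrals in the variable [phi], so the Fourier theory below is that
    of the angle [phi]; the identity map gives back the ordinary one. *)
Record circle_map (phi p : R -> R) : Prop := {
  cm_der : forall t, is_derive phi t (p t);
  cm_sp : sp p;
  cm_pos : forall t, 0 < p t;
  cm_shift : forall t, phi (t + 2 * PI) = phi t + 2 * PI }.

Section Fourier.
Variables phi p : R -> R.
Hypothesis CM : circle_map phi p.

Definition Cc (f : R -> R) (n : nat) : R := ig (fun t => f t * cos (INR n * phi t) * p t).
Definition Cs (f : R -> R) (n : nat) : R := ig (fun t => f t * sin (INR n * phi t) * p t).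

Lemma cm_smooth_phi : smooth phi.
Proof. apply (smooth_of_derive phi p); [apply (cm_der _ _ CM)|apply (cm_sp _ _ CM)]. Qed.

Lemma cm_cont_phi : cont phi.
Proof. apply smooth_cont, cm_smooth_phi. Qed.

Lemma cm_cont_p : cont p.
Proof. apply sp_cont, (cm_sp _ _ CM). Qed.

#[local] Hint Resolve cm_cont_phi cm_cont_p : core.

Lemma cm_trig_sp_Z k : sp (fun t => cos (IZR k * phi t)) /\ sp (fun t => sin (IZR k * phi t)).
Proof.
  assert (S := smooth_scal (IZR k) phi cm_smooth_phi).
  split; (split; [now apply (smooth_cos (fun t => IZR k * phi t)) || now apply (smooth_sin (fun t => IZR k * phi t))|]);
  intros x; rewrite (cm_shift _ _ CM), Rmult_plus_distr_l; apply trig_shift_Z.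
Qed.

Lemma cm_trig_sp n : sp (fun t => cos (INR n * phi t)) /\ sp (fun t => sin (INR n * phi t)).
Proof. rewrite INR_IZR_INZ. apply cm_trig_sp_Z. Qed.

Lemma cm_der_cos r t : is_derive (fun t => cos (r * phi t)) t (- (r * (sin (r * phi t) * p t))).
Proof.
  eapply is_derive_eq.
  { apply (is_derive_comp_R cos (fun t => r * phi t)); [apply is_derive_cos|].
    apply is_derive_scal, (cm_der _ _ CM). }
  simpl; ring.
Qed.

Lemma cm_der_sin r t : is_derive (fun t => sin (r * phi t)) t (r * (cos (r * phi t) * p t)).
Proof.
  eapply is_derive_eq.
  { apply (is_derive_comp_R sin (fun t => r * phi t)); [apply is_derive_sin|].
    apply is_derive_scal, (cm_der _ _ CM). }
  simpl; ring.
Qed.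

Lemma cm_ig_p : ig p = 2 * PI.
Proof.
  rewrite (ig_derive phi p); auto; [|apply (cm_der _ _ CM)].
  replace (2 * PI) with (0 + 2 * PI) at 1 by ring. rewrite (cm_shift _ _ CM). ring.
Qed.

Lemma cm_ig_cos k : ig (fun t => cos (IZR k * phi t) * p t) = if Z.eqb k 0 then 2 * PI else 0.
Proof.
  destruct (Z.eqb_spec k 0) as [->|Hk].
  - rewrite <- cm_ig_p. apply ig_ext; intros x. rewrite Rmult_0_l, cos_0. ring.
  - apply eq_IZR_contrapositive in Hk. apply Rmult_eq_reg_l with (IZR k); auto.
    rewrite <- ig_scal by ct. rewrite (ig_derive0 (fun t => sin (IZR k * phi t))); [ring| | |].
    + intros x; apply cm_der_sin.
    + ct.
    + apply cm_trig_sp_Z.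
Qed.

Lemma cm_ig_sin k : ig (fun t => sin (IZR k * phi t) * p t) = 0.
Proof.
  destruct (Z.eq_dec k 0) as [->|Hk].
  - transitivity (ig (fun _ => 0)); [|rewrite ig_const; ring].
    apply ig_ext; intros x. rewrite Rmult_0_l, sin_0. ring.
  - apply eq_IZR_contrapositive in Hk. apply Rmult_eq_reg_l with (- IZR k); [|lra].
    rewrite <- ig_scal by ct. rewrite (ig_ext _ (fun t => - (IZR k * (sin (IZR k * phi t) * p t))))
      by (intros; ring).
    rewrite (ig_derive0 (fun t => cos (IZR k * phi t))); [ring| | |].
    + intros x; apply cm_der_cos.
    + ct.
    + apply cm_trig_sp_Z.
Qed.

Lemma IZR_nat_minus n m : INR n - INR m = IZR (Z.of_nat n - Z.of_nat m).
Proof. now rewrite minus_IZR, <- !INR_IZR_INZ. Qed.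

Lemma IZR_nat_plus n m : INR n + INR m = IZR (Z.of_nat n + Z.of_nat m).
Proof. now rewrite plus_IZR, <- !INR_IZR_INZ. Qed.

Definition nsq (n : nat) : R := if Nat.eqb n 0 then 2 * PI else PI.

Lemma cm_ortho_cc n m :
  ig (fun t => cos (INR n * phi t) * cos (INR m * phi t) * p t) = if Nat.eqb n m then nsq n else 0.
Proof.
  rewrite (ig_ext _ (fun t => / 2 * (cos (IZR (Z.of_nat n - Z.of_nat m) * phi t) * p t)
                            + / 2 * (cos (IZR (Z.of_nat n + Z.of_nat m) * phi t) * p t))).
  - rewrite ig_plus, !ig_scal, !cm_ig_cos by ct. unfold nsq.
    repeat match goal with |- context [Z.eqb ?a ?b] => destruct (Z.eqb_spec a b) end; 
    repeat match goal with |- context [Nat.eqb ?a ?b] => destruct (Nat.eqb_spec a b) end; try lia; field.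
  - intros t. rewrite <- IZR_nat_minus, <- IZR_nat_plus, Rmult_minus_distr_r, Rmult_plus_distr_r,
      cos_minus, cos_plus. field.
Qed.

Lemma cm_ortho_ss n m :
  ig (fun t => sin (INR n * phi t) * sin (INR m * phi t) * p t)
  = if Nat.eqb n m then (if Nat.eqb n 0 then 0 else PI) else 0.
Proof.
  rewrite (ig_ext _ (fun t => / 2 * (cos (IZR (Z.of_nat n - Z.of_nat m) * phi t) * p t)
                            - / 2 * (cos (IZR (Z.of_nat n + Z.of_nat m) * phi t) * p t))).
  - rewrite ig_minus, !ig_scal, !cm_ig_cos by ct.
    repeat match goal with |- context [Z.eqb ?a ?b] => destruct (Z.eqb_spec a b) end; 
    repeat match goal with |- context [Nat.eqb ?a ?b] => destruct (Nat.eqb_spec a b) end; try lia; field.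
  - intros t. rewrite <- IZR_nat_minus, <- IZR_nat_plus, Rmult_minus_distr_r, Rmult_plus_distr_r,
      cos_minus, cos_plus. field.
Qed.

Lemma cm_ortho_sc n m :
  ig (fun t => sin (INR n * phi t) * cos (INR m * phi t) * p t) = 0.
Proof.
  rewrite (ig_ext _ (fun t => / 2 * (sin (IZR (Z.of_nat n - Z.of_nat m) * phi t) * p t)
                            + / 2 * (sin (IZR (Z.of_nat n + Z.of_nat m) * phi t) * p t))).
  - rewrite ig_plus, !ig_scal, !cm_ig_sin by ct. ring.
  - intros t. rewrite <- IZR_nat_minus, <- IZR_nat_plus, Rmult_minus_distr_r, Rmult_plus_distr_r,
      sin_minus, sin_plus. field.
Qed.

Lemma cm_mono x y : x < y -> phi x < phi y.
Proof.
  intros H. assert (0 < RInt p x y).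
  { apply RInt_gt_0; [auto|intros; apply (cm_pos _ _ CM)|intros; apply cm_cont_p]. }
  assert (E : is_RInt p x y (minus (phi y) (phi x))).
  { apply (is_RInt_derive phi p); intros; [apply (cm_der _ _ CM)|apply cm_cont_p]. }
  rewrite (is_RInt_unique p x y _ E) in H0. unfold minus, plus, opp in H0; simpl in H0. lra.
Qed.

(** Multiplying by [c + cos (phi - al)] only shifts frequencies by one, so the vanishing of all
    moments is inherited. Integer frequencies are used because k - 1 may be negative. *)
Lemma cm_moments_mult f h c al :
  cont f -> cont h ->
  (forall k : Z, ig (fun t => f t * h t * cos (IZR k * phi t) * p t) = 0 /\
                 ig (fun t => f t * h t * sin (IZR k * phi t) * p t) = 0) ->
  let h' := fun t => h t * (c + cos (phi t - al)) in
  (forall k : Z, ig (fun t => f t * h' t * cos (IZR k * phi t) * p t) = 0 /\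
                 ig (fun t => f t * h' t * sin (IZR k * phi t) * p t) = 0).
Proof.
  intros Cf Ch H h' k. unfold h'.
  destruct (H k) as [A1 A2], (H (k + 1)%Z) as [B1 B2], (H (k - 1)%Z) as [D1 D2]. split.
  - rewrite (ig_ext _ (fun t => c * (f t * h t * cos (IZR k * phi t) * p t)
      + (/ 2 * cos al * (f t * h t * cos (IZR (k + 1) * phi t) * p t)
      + (/ 2 * cos al * (f t * h t * cos (IZR (k - 1) * phi t) * p t)
      + (/ 2 * sin al * (f t * h t * sin (IZR (k + 1) * phi t) * p t)
      + - / 2 * sin al * (f t * h t * sin (IZR (k - 1) * phi t) * p t)))))).
    + rewrite !ig_plus, !ig_scal, A1, B1, B2, D1, D2 by ct. ring.
    + intros t. rewrite plus_IZR, minus_IZR, Rmult_minus_distr_r, Rmult_plus_distr_r, Rmult_1_l,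
        cos_minus, cos_plus, sin_plus, cos_minus, sin_minus. field.
  - rewrite (ig_ext _ (fun t => c * (f t * h t * sin (IZR k * phi t) * p t)
      + (/ 2 * cos al * (f t * h t * sin (IZR (k + 1) * phi t) * p t)
      + (/ 2 * cos al * (f t * h t * sin (IZR (k - 1) * phi t) * p t)
      + (- / 2 * sin al * (f t * h t * cos (IZR (k + 1) * phi t) * p t)
      + / 2 * sin al * (f t * h t * cos (IZR (k - 1) * phi t) * p t)))))).
    + rewrite !ig_plus, !ig_scal, A2, B1, B2, D1, D2 by ct. ring.
    + intros t. rewrite plus_IZR, minus_IZR, Rmult_minus_distr_r, Rmult_plus_distr_r, Rmult_1_l,
        cos_minus, cos_plus, sin_plus, cos_minus, sin_minus. field.
Qed.

Lemma cm_moments_pow f c al n :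
  cont f -> (forall m, Cc f m = 0) -> (forall m, Cs f m = 0) ->
  ig (fun t => f t * (c + cos (phi t - al)) ^ n * p t) = 0.
Proof.
  intros Cf Hc Hs.
  assert (H : forall k : Z,
    ig (fun t => f t * (c + cos (phi t - al)) ^ n * cos (IZR k * phi t) * p t) = 0 /\
    ig (fun t => f t * (c + cos (phi t - al)) ^ n * sin (IZR k * phi t) * p t) = 0).
  { induction n.
    - intros k.
      assert (Hk : exists m, IZR k = INR m \/ IZR k = - INR m).
      { destruct (Z_le_dec 0 k).
        - exists (Z.to_nat k); left. now rewrite INR_IZR_INZ, Z2Nat.id.
        - exists (Z.to_nat (- k)); right. rewrite INR_IZR_INZ, Z2Nat.id, opp_IZR by lia. ring. }
      destruct Hk as [m [-> | ->]]; split.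
      + rewrite <- (Hc m). apply ig_ext; intros; simpl; ring.
      + rewrite <- (Hs m). apply ig_ext; intros; simpl; ring.
      + rewrite <- (Hc m). apply ig_ext; intros t; simpl.
        replace (- INR m * phi t) with (- (INR m * phi t)) by ring. rewrite cos_neg. ring.
      + rewrite <- (Rmult_0_r (-1)), <- (Hs m). unfold Cs. rewrite <- ig_scal by ct.
        apply ig_ext; intros t; simpl.
        replace (- INR m * phi t) with (- (INR m * phi t)) by ring. rewrite sin_neg. ring.
    - intros k. destruct (cm_moments_mult f (fun t => (c + cos (phi t - al)) ^ n) c al Cf ltac:(ct) IHn k) as [E1 E2].
      split; [rewrite <- E1|rewrite <- E2]; apply ig_ext; intros t; simpl; ring. }
  destruct (H 0%Z) as [E _]. rewrite <- E. apply ig_ext; intros t. rewrite Rmult_0_l, cos_0. ring.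
Qed.

Lemma cos_le_outside eta y : 0 < eta <= PI -> eta <= Rabs y <= 2 * PI - eta -> cos y <= cos eta.
Proof.
  intros He Hy. replace (cos y) with (cos (Rabs y)).
  2: { unfold Rabs; destruct (Rcase_abs y); auto using cos_neg. }
  destruct (Rle_dec (Rabs y) PI).
  - apply cos_decr_1; lra.
  - replace (cos (Rabs y)) with (cos (2 * PI - Rabs y)).
    + apply cos_decr_1; lra.
    + rewrite cos_minus, cos_2PI, sin_2PI. ring.
Qed.

(** Uniqueness by a concentrating kernel: [T = 1 - cos eta + cos (phi - al)] exceeds 1 near [x0] and
    has absolute value at most 1 elsewhere on the period. If [f x0 > 0], the integral of
    [f * T^n * p] would grow with n, although it is 0 because [T^n] is a trigonometric polynomial in
    [phi]. An open period keeps the neighbourhood of [x0] from wrapping around. *)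
Lemma cm_moments_nonpos f : cont f -> periodic2pi f ->
  (forall m, Cc f m = 0) -> (forall m, Cs f m = 0) -> forall x, 0 < x < 2 * PI -> f x <= 0.
Proof.
  intros Cf Pf Hc Hs x0 Hx. apply Rnot_lt_le; intros Hp.
  destruct (proj1 (filterlim_locally f (f x0)) (Cf x0) (mkposreal (f x0 / 2) ltac:(lra))) as [d0 Hd0].
  pose (d := Rmin (d0 / 2) (Rmin x0 (2 * PI - x0))).
  assert (Hd : 0 < d) by (unfold d; destruct d0; simpl; repeat apply Rmin_pos; lra).
  assert (Hdd : d <= d0 / 2 /\ d <= x0 /\ d <= 2 * PI - x0).
  { unfold d; pose proof (Rmin_l (d0/2) (Rmin x0 (2 * PI - x0)));
      pose proof (Rmin_r (d0/2) (Rmin x0 (2 * PI - x0)));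
      pose proof (Rmin_l x0 (2 * PI - x0));
      pose proof (Rmin_r x0 (2 * PI - x0)); lra. }
  assert (Hf : forall t, Rabs (t - x0) <= d -> f x0 / 2 <= f t).
  { intros t Ht. assert (HB : Rabs (f t - f x0) < f x0 / 2).
    { apply Hd0. change (Rabs (t - x0) < d0). destruct d0; simpl in *; lra. }
    apply Rabs_def2 in HB; lra. }
  set (al := phi x0).
  (* By monotonicity, [phi] within [eta] of [al] forces the argument within [d] of [x0], where [f]
     is at least [f x0 / 2]. *)
  pose (eta := Rmin (phi (x0 + d) - al) (al - phi (x0 - d))).
  pose proof (cm_mono x0 (x0 + d) ltac:(lra)) as M1.
  pose proof (cm_mono (x0 - d) x0 ltac:(lra)) as M2. fold al in M1, M2.
  assert (Heta : 0 < eta) by (unfold eta; apply Rmin_pos; lra).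
  assert (He1 : eta <= phi (x0 + d) - al) by apply Rmin_l.
  assert (He2 : eta <= al - phi (x0 - d)) by apply Rmin_r.
  assert (Hmono : forall x y, x <= y -> phi x <= phi y).
  { intros x y [H|<-]; [left; now apply cm_mono|lra]. }
  pose proof (cm_shift _ _ CM 0) as Sh. rewrite Rplus_0_l in Sh.
  pose proof (Hmono 0 (x0 - d) ltac:(lra)) as M3.
  pose proof (Hmono (x0 + d) (2 * PI) ltac:(lra)) as M4.
  assert (HePI : eta <= PI) by lra.
  pose (T := fun t => (1 - cos eta) + cos (phi t - al)).
  assert (Hin : forall t, 0 <= t <= 2 * PI -> Rabs (phi t - al) < eta -> Rabs (t - x0) <= d).
  { intros t Ht HT. apply Rabs_def2 in HT. apply Rabs_le. split.
    - apply Rnot_lt_le; intros Hlt. pose proof (Hmono t (x0 - d) ltac:(lra)). lra.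
    - apply Rnot_lt_le; intros Hlt. pose proof (Hmono (x0 + d) t ltac:(lra)). lra. }
  assert (Hout : forall t, 0 <= t <= 2 * PI -> eta <= Rabs (phi t - al) -> Rabs (T t) <= 1).
  { intros t Ht HT. pose proof (Hmono 0 t ltac:(lra)). pose proof (Hmono t (2 * PI) ltac:(lra)).
    assert (Hc1 : cos (phi t - al) <= cos eta).
    { apply cos_le_outside; [lra|]. split; [exact HT|]. apply Rabs_le; lra. }
    unfold T. pose proof (COS_bound (phi t - al)). pose proof (COS_bound eta). apply Rabs_le; lra. }
  assert (Hge : forall r t, 0 <= r <= PI -> Rabs (phi t - al) <= r -> 1 + (cos r - cos eta) <= T t).
  { intros r t Hr HT. unfold T. assert (cos r <= cos (phi t - al)); [|lra].
    replace (cos (phi t - al)) with (cos (Rabs (phi t - al))).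
    2: { unfold Rabs; destruct (Rcase_abs (phi t - al)); auto using cos_neg. }
    apply cos_decr_1; try lra; apply Rabs_pos. }
  pose (tau := cos (eta / 2) - cos eta).
  assert (Htau : 0 < tau) by (unfold tau; apply Rlt_0_minus, cos_decreasing_1; lra).
  destruct (proj1 (filterlim_locally phi (phi x0)) (cm_cont_phi x0) (mkposreal (eta / 2) ltac:(lra))) as [e0 He0].
  pose (e := Rmin (e0 / 2) d).
  assert (Hepos : 0 < e) by (unfold e; destruct e0; simpl; apply Rmin_pos; lra).
  assert (Hee : e <= e0 / 2 /\ e <= d) by (unfold e; split; [apply Rmin_l|apply Rmin_r]).
  destruct (cont_bounded _ (cont_mult f p Cf cm_cont_p)) as [M [HM HMb]].
  { intros t. now rewrite Pf, (proj2 (cm_sp _ _ CM)). }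
  destruct (cont_pos_lower p cm_cont_p (proj2 (cm_sp _ _ CM)) (cm_pos _ _ CM)) as [pm [Hpm Hpmb]].
  assert (CT : cont T) by (unfold T; ct).
  assert (Hn : forall n, f x0 / 2 * pm * (1 + tau) ^ n * (2 * e) <= 2 * PI * M).
  { intros n.
    (* Adding the bound [M] of [f * p] makes the integrand nonnegative on the whole circle, so the
       integral can be bounded below by its part near [x0]. *)
    assert (E : ig (fun t => f t * T t ^ n * p t + M) = 2 * PI * M).
    { rewrite ig_plus, ig_const by ct. unfold T. rewrite cm_moments_pow by auto. ring. }
    rewrite <- E. replace (2 * e) with ((x0 + e) - (x0 - e)) by ring.
    assert (HT1 : forall r t, 0 <= r <= eta -> Rabs (phi t - al) <= r -> 
        (1 + (cos r - cos eta)) ^ n <= T t ^ n /\ 1 <= T t ^ n).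
    { intros r t Hr HT. assert (cos eta <= cos r) by (apply cos_decr_1; lra).
      pose proof (Hge r t ltac:(lra) HT). split; [apply pow_incr; lra|].
      rewrite <- (pow1 n). apply pow_incr; lra. }
    apply ig_ge_sub; try lra; [ct| |].
    - intros t Ht. destruct (Rlt_le_dec (Rabs (phi t - al)) eta) as [Hl|Hl].
      + pose proof (Hf t (Hin t Ht Hl)). destruct (HT1 eta t ltac:(lra) ltac:(lra)) as [_ HT].
        pose proof (cm_pos _ _ CM t). assert (0 <= f t * T t ^ n * p t) by (apply Rmult_le_pos; nra). lra.
      + assert (Rabs (f t * T t ^ n * p t) <= M).
        { replace (f t * T t ^ n * p t) with (T t ^ n * (f t * p t)) by ring.
          rewrite Rabs_mult, <- RPow_abs. rewrite <- (Rmult_1_l M).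
          apply Rmult_le_compat; [apply pow_le, Rabs_pos|apply Rabs_pos| |apply HMb].
          rewrite <- (pow1 n). apply pow_incr. split; [apply Rabs_pos|now apply Hout]. }
        apply Rabs_le_between in H. lra.
    - intros t Ht. assert (Hte : Rabs (t - x0) <= e) by (apply Rabs_le; lra).
      assert (HT : Rabs (phi t - al) < eta / 2).
      { apply He0. change (Rabs (t - x0) < e0). destruct e0; simpl in *; lra. }
      destruct (HT1 (eta / 2) t ltac:(lra) ltac:(lra)) as [HTa _]. fold tau in HTa.
      pose proof (Hf t ltac:(lra)). pose proof (Hpmb t).
      assert (0 <= (1 + tau) ^ n) by (apply pow_le; lra).
      assert (f x0 / 2 * (1 + tau) ^ n * pm <= f t * T t ^ n * p t).
      { repeat apply Rmult_le_compat; try lra. apply Rmult_le_pos; lra. }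
      lra. }
  assert (HA : 0 < f x0 / 2 * pm * (2 * e)) by (repeat apply Rmult_lt_0_compat; lra).
  (* Bernoulli's inequality [(1 + tau)^n >= 1 + n * tau] makes the left side of [Hn] exceed the
     fixed right side for this n. *)
  destruct (INR_unbounded (2 * PI * M / (f x0 / 2 * pm * (2 * e)) / tau)) as [n Hnn].
  specialize (Hn n). pose proof (poly n tau Htau) as HP.
  apply (Rmult_lt_compat_r tau) in Hnn; [|lra].
  replace (2 * PI * M / (f x0 / 2 * pm * (2 * e)) / tau * tau)
    with (2 * PI * M / (f x0 / 2 * pm * (2 * e))) in Hnn by (field; lra).
  apply (Rmult_lt_compat_l _ _ _ HA) in Hnn.
  replace (f x0 / 2 * pm * (2 * e) * (2 * PI * M / (f x0 / 2 * pm * (2 * e)))) with (2 * PI * M) in Hnn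
    by (field; lra).
  apply (Rmult_le_compat_l _ _ _ (Rlt_le _ _ HA)) in HP. nra.
Qed.

Lemma cm_moments_zero f : cont f -> periodic2pi f ->
  (forall m, Cc f m = 0) -> (forall m, Cs f m = 0) -> forall x, f x = 0.
Proof.
  intros Cf Pf Hc Hs.
  assert (H0 : forall x, 0 < x < 2 * PI -> f x = 0).
  { intros x Hx. apply Rle_antisym; [now apply cm_moments_nonpos|].
    assert (- f x <= 0); [|lra].
    apply (cm_moments_nonpos (fun t => - f t)); auto; [ct|intros t; now rewrite Pf| |];
    intros m; rewrite <- (Rmult_0_r (-1)); [rewrite <- (Hc m)|rewrite <- (Hs m)];
    unfold Cc, Cs; rewrite <- ig_scal by ct; apply ig_ext; intros; ring. }
  (* The end points are recovered from a zero integral: [f * f] is nonnegative, periodic, and zero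
     inside the period. *)
  assert (E : forall x, f x * f x = 0).
  { apply ig_zero_nonneg; [ct|intros x; now rewrite Pf|intros; nra|].
    rewrite <- (Rmult_0_r (2 * PI)), <- (ig_const 0). unfold ig. apply RInt_ext.
    pose proof two_pi_pos. rewrite Rmin_left, Rmax_right by lra.
    intros x Hx. rewrite (H0 x Hx). apply Rmult_0_l. }
  intros x. specialize (E x). nra.
Qed.

Definition fterm (f : R -> R) (t : R) (n : nat) : R :=
  / PI * (Cc f (S n) * cos (INR (S n) * phi t) + Cs f (S n) * sin (INR (S n) * phi t)).

Lemma fterm_bound f t n : Rabs (fterm f t n) <= / PI * (Rabs (Cc f (S n)) + Rabs (Cs f (S n))).
Proof.
  unfold fterm. rewrite Rabs_mult, (Rabs_right (/ PI)).
  2: { apply Rle_ge, Rlt_le, Rinv_0_lt_compat, PI_RGT_0. }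
  apply Rmult_le_compat_l; [apply Rlt_le, Rinv_0_lt_compat, PI_RGT_0|].
  eapply Rle_trans; [apply Rabs_triang|]. rewrite !Rabs_mult.
  assert (Rabs (cos (INR (S n) * phi t)) <= 1) by (apply Rabs_le, COS_bound).
  assert (Rabs (sin (INR (S n) * phi t)) <= 1) by (apply Rabs_le, SIN_bound).
  pose proof (Rabs_pos (Cc f (S n))). pose proof (Rabs_pos (Cs f (S n))). nra.
Qed.

Definition fsummable (f : R -> R) : Prop := ex_series (fun n => Rabs (Cc f (S n)) + Rabs (Cs f (S n))).

Lemma fterm_ig f g : fsummable f -> cont g -> periodic2pi g ->
  is_series (fun n => / PI * (Cc f (S n) * Cc g (S n) + Cs f (S n) * Cs g (S n)))
            (ig (fun t => Series (fterm f t) * g t * p t)).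
Proof.
  intros Hf Cg Pg.
  destruct (cont_bounded (fun t => g t * p t)) as [M [HM HMb]].
  { ct. } { intros t. now rewrite Pg, (proj2 (cm_sp _ _ CM)). }
  assert (HS : is_series (fun n => ig (fun t => g t * p t * fterm f t n))
                 (ig (fun t => Series (fun n => g t * p t * fterm f t n)))).
  { apply (normal_series_ig (fun n t => g t * p t * fterm f t n)
             (fun n => M * (/ PI * (Rabs (Cc f (S n)) + Rabs (Cs f (S n)))))).
    - intros n; unfold fterm; ct.
    - intros n t. rewrite Rabs_mult. apply Rmult_le_compat; auto using Rabs_pos, fterm_bound.
    - apply (ex_series_scalR M), (ex_series_scalR (/ PI)), Hf. }
  rewrite (ig_ext _ (fun t => Series (fun n => g t * p t * fterm f t n))).
  2: { intros t. rewrite Series_scal_l. ring. }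
  eapply is_series_extR; [|exact HS]. intros n; simpl. unfold fterm.
  rewrite (ig_ext _ (fun t => / PI * Cc f (S n) * (g t * cos (INR (S n) * phi t) * p t)
                            + / PI * Cs f (S n) * (g t * sin (INR (S n) * phi t) * p t))) by (intros; ring).
  rewrite ig_plus, !ig_scal by ct. unfold Cc, Cs. ring.
Qed.

Lemma fterm_cont f : fsummable f -> cont (fun t => Series (fterm f t)).
Proof.
  intros Hf. apply (normal_series_cont (fun n t => fterm f t n)
    (fun n => / PI * (Rabs (Cc f (S n)) + Rabs (Cs f (S n))))).
  - intros n; unfold fterm; ct.
  - intros; apply fterm_bound.
  - apply (ex_series_scalR (/ PI)), Hf.
Qed.

Lemma fterm_periodic f : periodic2pi (fun t => Series (fterm f t)).
Proof.
  intros t. apply Series_ext; intros n. unfold fterm.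
  destruct (cm_trig_sp (S n)) as [[_ P1] [_ P2]]. now rewrite (P1 t), (P2 t).
Qed.

(** The sum of the series is continuous and has the same moments as [f] minus its mean, so the
    difference has no moments and is zero. Term 0 of [fterm] has frequency 1, which is why the mean
    stands apart. *)
Lemma fourier_expansion f : cont f -> periodic2pi f -> fsummable f ->
  forall t, is_series (fterm f t) (f t - Cc f 0 / (2 * PI)).
Proof.
  intros Cf Pf Hf t. pose proof PI_RGT_0 as HPI.
  assert (Hex : ex_series (fterm f t)).
  { apply (@ex_series_le _ R_CompleteNormedModule _
      (fun n => / PI * (Rabs (Cc f (S n)) + Rabs (Cs f (S n))))).
    - intros n; apply fterm_bound.
    - apply (ex_series_scalR (/ PI)), Hf. }
  replace (f t - Cc f 0 / (2 * PI)) with (Series (fterm f t)); [now apply Series_correct|].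
  pose (S0 := fun t => Series (fterm f t)).
  assert (CS0 : cont S0) by now apply fterm_cont.
  enough (f t - Cc f 0 / (2 * PI) - S0 t = 0) by (unfold S0 in *; lra).
  assert (HC : forall m, ig (fun t => S0 t * cos (INR m * phi t) * p t) = if Nat.eqb m 0 then 0 else Cc f m).
  { intros m. destruct (cm_trig_sp m) as [HT _].
    pose proof (fterm_ig f _ Hf (sp_cont _ HT) (proj2 HT)) as HS.
    apply is_series_unique in HS. unfold S0. rewrite <- HS. apply is_series_unique.
    destruct m as [|m].
    - simpl Nat.eqb; cbv iota. eapply is_series_extR; [|apply (is_series_single 0 0)].
      intros n. unfold Cc at 2, Cs at 2.
      rewrite (ig_ext (fun t => cos (INR 0 * phi t) * sin (INR (S n) * phi t) * p t)
        (fun t => sin (INR (S n) * phi t) * cos (INR 0 * phi t) * p t)) by (intros; ring).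
      rewrite cm_ortho_sc, cm_ortho_cc. simpl Nat.eqb. destruct (Nat.eqb n 0); cbv iota; ring.
    - simpl Nat.eqb; cbv iota. eapply is_series_extR; [|apply (is_series_single m (Cc f (S m)))].
      intros n; simpl Nat.eqb. unfold Cc at 3, Cs at 2.
      rewrite (ig_ext (fun t => cos (INR (S m) * phi t) * sin (INR (S n) * phi t) * p t)
        (fun t => sin (INR (S n) * phi t) * cos (INR (S m) * phi t) * p t)) by (intros; ring).
      rewrite cm_ortho_sc, cm_ortho_cc. simpl Nat.eqb. unfold nsq; simpl Nat.eqb; cbv iota.
      destruct (Nat.eqb_spec n m) as [E1|E1], (Nat.eqb_spec m n) as [E2|E2]; try lia; try subst m; field; lra. }
  assert (HSn : forall m, ig (fun t => S0 t * sin (INR m * phi t) * p t) = if Nat.eqb m 0 then 0 else Cs f m).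
  { intros m. destruct (cm_trig_sp m) as [_ HT].
    pose proof (fterm_ig f _ Hf (sp_cont _ HT) (proj2 HT)) as HS.
    apply is_series_unique in HS. unfold S0. rewrite <- HS. apply is_series_unique.
    destruct m as [|m].
    - simpl Nat.eqb; cbv iota. eapply is_series_extR; [|apply (is_series_single 0 0)].
      intros n; simpl Nat.eqb. unfold Cc at 2, Cs at 2.
      rewrite cm_ortho_sc, cm_ortho_ss. simpl Nat.eqb. destruct (Nat.eqb n 0); cbv iota; ring.
    - simpl Nat.eqb; cbv iota. eapply is_series_extR; [|apply (is_series_single m (Cs f (S m)))].
      intros n; simpl Nat.eqb. unfold Cc at 2, Cs at 3.
      rewrite cm_ortho_sc, cm_ortho_ss. simpl Nat.eqb. cbv iota.
      destruct (Nat.eqb_spec n m) as [E1|E1], (Nat.eqb_spec m n) as [E2|E2]; try lia; try subst m; field; lra. }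
  apply (cm_moments_zero (fun t => f t - Cc f 0 / (2 * PI) - S0 t)).
  - ct.
  - intros x. rewrite Pf. unfold S0. now rewrite fterm_periodic.
  - intros m. unfold Cc at 1.
    rewrite (ig_ext _ (fun t => f t * cos (INR m * phi t) * p t
       - (Cc f 0 / (2 * PI) * (cos (INR 0 * phi t) * cos (INR m * phi t) * p t)
       + S0 t * cos (INR m * phi t) * p t))).
    2: { intros x. simpl INR. rewrite Rmult_0_l, cos_0. ring. }
    rewrite ig_minus, ig_plus, ig_scal, HC, cm_ortho_cc by ct. fold (Cc f m).
    unfold nsq. destruct m; simpl; [field; lra|ring].
  - intros m. unfold Cs at 1.
    rewrite (ig_ext _ (fun t => f t * sin (INR m * phi t) * p t
       - (Cc f 0 / (2 * PI) * (sin (INR m * phi t) * cos (INR 0 * phi t) * p t)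
       + S0 t * sin (INR m * phi t) * p t))).
    2: { intros x. simpl INR. rewrite Rmult_0_l, cos_0. ring. }
    rewrite ig_minus, ig_plus, ig_scal, HSn, cm_ortho_sc by ct. fold (Cs f m).
    destruct m; simpl; [|ring]. unfold Cs.
    rewrite (ig_ext _ (fun _ => 0)); [rewrite ig_const; ring|].
    intros x; simpl. rewrite Rmult_0_l, sin_0; ring.
Qed.

(** The expansion of [f] is integrated term by term against [g * p], so summability is asked of [f]
    only and [g] may be merely continuous. *)
Lemma parseval f g : cont f -> periodic2pi f -> fsummable f -> cont g -> periodic2pi g ->
  is_series (fun n => / PI * (Cc f (S n) * Cc g (S n) + Cs f (S n) * Cs g (S n)))
            (ig (fun t => f t * g t * p t) - Cc f 0 * Cc g 0 / (2 * PI)).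
Proof.
  intros Cf Pf Hf Cg Pg.
  replace (ig (fun t => f t * g t * p t) - Cc f 0 * Cc g 0 / (2 * PI))
    with (ig (fun t => Series (fterm f t) * g t * p t)); [now apply fterm_ig|].
  rewrite (ig_ext _ (fun t => f t * g t * p t - Cc f 0 / (2 * PI) * (g t * cos (INR 0 * phi t) * p t))).
  - rewrite ig_minus, ig_scal by ct. unfold Cc; field. apply PI_neq0.
  - intros t. rewrite (is_series_unique _ _ (fourier_expansion f Cf Pf Hf t)).
    simpl INR. rewrite Rmult_0_l, cos_0. ring.
Qed.

Lemma Cc_parts f f' n : (forall x, is_derive f x (f' x)) -> cont f' -> periodic2pi f ->
  INR n * Cc f n = - ig (fun t => f' t * sin (INR n * phi t)).
Proof.
  intros D C P.
  assert (cont f) by (intros x; apply (ex_derive_continuous f); exists (f' x); apply D).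
  unfold Cc. rewrite <- ig_scal by ct.
  rewrite <- (ig_by_parts f f' (fun t => sin (INR n * phi t)) (fun t => INR n * (cos (INR n * phi t) * p t)));
    auto; try ct.
  - apply ig_ext; intros; ring.
  - intros x; apply cm_der_sin.
  - apply cm_trig_sp.
Qed.

Lemma Cs_parts f f' n : (forall x, is_derive f x (f' x)) -> cont f' -> periodic2pi f ->
  INR n * Cs f n = ig (fun t => f' t * cos (INR n * phi t)).
Proof.
  intros D C P.
  assert (cont f) by (intros x; apply (ex_derive_continuous f); exists (f' x); apply D).
  unfold Cs. rewrite <- ig_scal by ct.
  rewrite <- (Ropp_involutive (ig (fun t => f' t * cos (INR n * phi t)))).
  rewrite <- (ig_by_parts f f' (fun t => cos (INR n * phi t)) (fun t => - (INR n * (sin (INR n * phi t) * p t))));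
    auto; try ct.
  - rewrite <- ig_opp by ct. apply ig_ext; intros; ring.
  - intros x; apply cm_der_cos.
  - apply cm_trig_sp.
Qed.

Lemma sp_div_p f : sp f -> sp (fun t => f t * / p t).
Proof.
  intros F. apply sp_mult; auto. apply sp_inv; [apply (cm_sp _ _ CM)|].
  intros x; pose proof (cm_pos _ _ CM x); lra.
Qed.

(** Differentiation in the variable [phi] is [(1 / p) d/dt], hence the factor [/ p t]. *)
Lemma Cc_Derive f n : sp f -> INR n * Cc f n = - Cs (fun t => Derive f t * / p t) n.
Proof.
  intros F. rewrite (Cc_parts f (Derive f)).
  - unfold Cs. f_equal. apply ig_ext; intros t. pose proof (cm_pos _ _ CM t). field; lra.
  - intros; now apply smooth_is_derive, F.
  - now apply sp_cont, sp_Derive.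
  - apply F.
Qed.

Lemma Cs_Derive f n : sp f -> INR n * Cs f n = Cc (fun t => Derive f t * / p t) n.
Proof.
  intros F. rewrite (Cs_parts f (Derive f)).
  - unfold Cc. apply ig_ext; intros t. pose proof (cm_pos _ _ CM t). field; lra.
  - intros; now apply smooth_is_derive, F.
  - now apply sp_cont, sp_Derive.
  - apply F.
Qed.

(** Each power of n is gained by passing from [f] to its derivative in [phi], which is again smooth
    and periodic. *)
Lemma coef_decay N : forall f, sp f -> exists M, 0 < M /\ forall n,
  INR n ^ N * Rabs (Cc f n) <= M /\ INR n ^ N * Rabs (Cs f n) <= M.
Proof.
  induction N; intros f F.
  - pose proof (sp_cont f F) as Cf.
    destruct (cont_bounded (fun t => f t * p t)) as [M [HM HMb]].
    { ct. } { intros t. now rewrite (proj2 F), (proj2 (cm_sp _ _ CM)). }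
    pose proof two_pi_pos. exists (2 * PI * M); split; [nra|]. intros n.
    rewrite !pow_O, !Rmult_1_l. unfold Cc, Cs.
    split; (apply ig_abs_le; [ct|]); intros t.
    + replace (f t * cos (INR n * phi t) * p t) with (f t * p t * cos (INR n * phi t)) by ring.
      rewrite Rabs_mult, <- (Rmult_1_r M). apply Rmult_le_compat; auto using Rabs_pos.
      apply Rabs_le, COS_bound.
    + replace (f t * sin (INR n * phi t) * p t) with (f t * p t * sin (INR n * phi t)) by ring.
      rewrite Rabs_mult, <- (Rmult_1_r M). apply Rmult_le_compat; auto using Rabs_pos.
      apply Rabs_le, SIN_bound.
  - destruct (IHN _ (sp_div_p _ (sp_Derive f F))) as [M [HM HMb]].
    exists M; split; auto. intros n. destruct (HMb n) as [H1 H2].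
    rewrite <- (Cs_Derive f n F), Rabs_mult in H1.
    rewrite <- (Ropp_involutive (Cs _ _)), <- (Cc_Derive f n F), Rabs_Ropp, Rabs_mult in H2.
    rewrite (Rabs_right (INR n)) in H1, H2 by apply Rle_ge, pos_INR.
    simpl. split; nra.
Qed.

Lemma coef_bound_inv N f : sp f -> exists M, 0 < M /\ forall n,
  Rabs (Cc f (S n)) <= M / INR (S n) ^ N /\ Rabs (Cs f (S n)) <= M / INR (S n) ^ N.
Proof.
  intros F. destruct (coef_decay N f F) as [M [HM H]]. exists M; split; auto. intros n.
  assert (Hp : 0 < INR (S n) ^ N) by (apply pow_lt, lt_0_INR; lia).
  destruct (H (S n)) as [H1 H2].
  split; apply Rmult_le_reg_l with (INR (S n) ^ N); auto; (replace (INR (S n) ^ N * (M / INR (S n) ^ N)) with M by (field; lra)); auto.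
Qed.

Lemma sp_fsummable f : sp f -> fsummable f.
Proof.
  intros F. destruct (coef_bound_inv 2 f F) as [M [HM H]].
  apply (@ex_series_le _ R_CompleteNormedModule _ (fun n => (2 * M) * / INR (S n) ^ 2)).
  - intros n. destruct (H n) as [H1 H2].
    change (Rabs (Rabs (Cc f (S n)) + Rabs (Cs f (S n))) <= 2 * M * / INR (S n) ^ 2).
    pose proof (Rabs_pos (Cc f (S n))). pose proof (Rabs_pos (Cs f (S n))).
    rewrite Rabs_right by lra. unfold Rdiv in *. lra.
  - apply (ex_series_scalR (2 * M)), ex_series_inv_sq.
Qed.

End Fourier.

Lemma circle_map_id : circle_map (fun t => t) (fun _ => 1).
Proof.
  constructor; intros; try lra; [apply @is_derive_id|apply sp_const].
Qed.

(** * Finite sums *)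

Fixpoint sm (m : nat) (f : nat -> R) : R := match m with O => 0 | S k => sm k f + f k end.

Lemma sm_ext m f g : (forall i, (i < m)%nat -> f i = g i) -> sm m f = sm m g.
Proof. induction m; simpl; intros H; [auto|]. rewrite IHm, H; auto. Qed.

Lemma sm_plus m f g : sm m (fun i => f i + g i) = sm m f + sm m g.
Proof. induction m; simpl; [ring|rewrite IHm; ring]. Qed.

Lemma sm_scal m c f : sm m (fun i => c * f i) = c * sm m f.
Proof. induction m; simpl; [ring|rewrite IHm; ring]. Qed.

Lemma sm_le m f g : (forall i, (i < m)%nat -> f i <= g i) -> sm m f <= sm m g.
Proof. induction m; simpl; intros H; [lra|]. apply Rplus_le_compat; auto. Qed.

Lemma sm_ge0 m f : (forall i, (i < m)%nat -> 0 <= f i) -> 0 <= sm m f.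
Proof. induction m; simpl; intros H; [lra|]. apply Rplus_le_le_0_compat; auto. Qed.

Lemma sm_zero m : sm m (fun _ => 0) = 0.
Proof. induction m; simpl; lra. Qed.

Lemma sm_swap m k f : sm m (fun i => sm k (fun j => f i j)) = sm k (fun j => sm m (fun i => f i j)).
Proof.
  induction m; simpl; [now rewrite sm_zero|]. rewrite IHm, <- sm_plus. reflexivity.
Qed.

Lemma sm_single m j f : (j < m)%nat -> sm m (fun i => if Nat.eqb i j then f i else 0) = f j.
Proof.
  induction m; simpl; intros H; [lia|]. destruct (Nat.eqb_spec m j) as [->|].
  - rewrite (sm_ext _ _ (fun _ => 0)), sm_zero; [ring|].
    intros i Hi. destruct (Nat.eqb_spec i j); [lia|auto].
  - rewrite IHm by lia. ring.
Qed.

Lemma sm_term_le m f j : (forall i, (i < m)%nat -> 0 <= f i) -> (j < m)%nat -> f j <= sm m f.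
Proof.
  induction m; simpl; intros H Hj; [lia|].
  assert (0 <= sm m f) by (apply sm_ge0; auto). assert (0 <= f m) by auto.
  destruct (Nat.eq_dec j m) as [->|]; [lra|]. assert (f j <= sm m f) by (apply IHm; auto; lia). lra.
Qed.

Lemma sm_abs m f : Rabs (sm m f) <= sm m (fun i => Rabs (f i)).
Proof.
  induction m; simpl; [rewrite Rabs_R0; lra|].
  eapply Rle_trans; [apply Rabs_triang|]. lra.
Qed.

Lemma sm_sum_n f m : sm (S m) f = sum_n f m.
Proof.
  induction m; [rewrite sum_O; simpl; ring|].
  rewrite sum_n_SR, <- IHm. reflexivity.
Qed.

Lemma sm_cauchy_schwarz m f g : (sm m (fun i => f i * g i)) ^ 2 <= sm m (fun i => f i ^ 2) * sm m (fun i => g i ^ 2).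
Proof.
  induction m as [|m IHm]; [simpl; lra|].
  assert (ES : forall u, sm (S m) u = sm m u + u m) by reflexivity. rewrite !ES.
  set (a := sm m (fun i => f i * g i)) in *. set (b := sm m (fun i => f i ^ 2)) in *.
  set (c := sm m (fun i => g i ^ 2)) in *.
  assert (0 <= b) by (apply sm_ge0; intros; apply pow2_ge_0).
  assert (0 <= c) by (apply sm_ge0; intros; apply pow2_ge_0).
  assert (H1 : 2 * a * (f m * g m) <= b * g m ^ 2 + c * f m ^ 2).
  { destruct (Req_dec c 0) as [Hc|Hc].
    - assert (a = 0) by (rewrite Hc, Rmult_0_r in IHm; nra). rewrite H1, Hc.
      assert (0 <= b * g m ^ 2) by (apply Rmult_le_pos; auto using pow2_ge_0). lra.
    - assert (Hcp : 0 < c) by lra. apply Rmult_le_reg_l with c; auto.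
      assert (0 <= (c * f m - a * g m) ^ 2) by apply pow2_ge_0.
      assert (a ^ 2 * g m ^ 2 <= b * c * g m ^ 2) by (apply Rmult_le_compat_r; auto using pow2_ge_0).
      nra. }
  assert (E : (b + f m ^ 2) * (c + g m ^ 2) - (a + f m * g m) ^ 2
    = (b * c - a ^ 2) + (b * g m ^ 2 + c * f m ^ 2 - 2 * a * (f m * g m))) by ring.
  lra.
Qed.

Lemma sm_series_le (f : nat -> R) (l : R) m : is_series f l -> (forall n, 0 <= f n) -> sm m f <= l.
Proof.
  intros H H0. apply Rle_trans with (sm (S m) f); [simpl; specialize (H0 m); lra|].
  rewrite sm_sum_n. assert (Hl : is_lim_seq (sum_n f) l) by exact H.
  apply (is_lim_seq_incr_compare _ _ Hl). intros n. rewrite sum_n_SR. specialize (H0 (S n)). lra.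
Qed.

(** * The quadratic form of the operator |D| *)

(** Ordinary Fourier integrals, without the factor [/ PI], are the instance of the identity circle
    map; this leaves a factor 1 in the integrands. *)
Notation A := (Cc (fun t => t) (fun _ => 1)).
Notation B := (Cs (fun t => t) (fun _ => 1)).

Lemma fcos_A f n : fcos f n = / PI * A f n.
Proof. unfold fcos, Cc, ig. f_equal. apply RInt_ext; intros; symmetry; apply Rmult_1_r. Qed.

Lemma fsin_B f n : fsin f n = / PI * B f n.
Proof. unfold fsin, Cs, ig. f_equal. apply RInt_ext; intros; symmetry; apply Rmult_1_r. Qed.

Definition lterm (f : R -> R) (t : R) (m : nat) : R :=
  INR (S m) * / PI * (A f (S m) * cos (INR (S m) * t) + B f (S m) * sin (INR (S m) * t)).

Lemma Lambda_lterm f t : Lambda f t = Series (lterm f t).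
Proof.
  unfold Lambda. apply Series_ext; intros m. cbv zeta. rewrite fcos_A, fsin_B. unfold lterm. ring.
Qed.

Lemma Rabs_trig_le x : Rabs (cos x) <= 1 /\ Rabs (sin x) <= 1.
Proof. split; apply Rabs_le; [apply COS_bound|apply SIN_bound]. Qed.

Lemma Rabs_trig_comb_le a b x M : Rabs a <= M -> Rabs b <= M -> Rabs (a * cos x + b * sin x) <= 2 * M.
Proof.
  intros Ha Hb. eapply Rle_trans; [apply Rabs_triang|]. rewrite !Rabs_mult.
  destruct (Rabs_trig_le x). pose proof (Rabs_pos a). pose proof (Rabs_pos b). nra.
Qed.

Lemma lterm_bound f : sp f -> exists M, 0 < M /\ forall n t, Rabs (lterm f t n) <= M * / INR (S n) ^ 2.
Proof.
  intros F. destruct (coef_bound_inv _ _ circle_map_id 3 f F) as [M [HM H]].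
  pose proof (Rinv_0_lt_compat _ PI_RGT_0) as HP.
  exists (2 * M * / PI); split; [apply Rmult_lt_0_compat; lra|].
  intros n t. destruct (H n) as [H1 H2]. unfold lterm.
  assert (Hn : 0 < INR (S n)) by (apply lt_0_INR; lia).
  rewrite Rabs_mult, (Rabs_right (INR (S n) * / PI)) by (apply Rle_ge, Rmult_le_pos; lra).
  eapply Rle_trans; [apply Rmult_le_compat_l; [apply Rmult_le_pos; lra|apply Rabs_trig_comb_le; eassumption]|].
  right. field. pose proof PI_RGT_0; split; lra.
Qed.

Lemma Lambda_cont f : sp f -> cont (Lambda f).
Proof.
  intros F. replace (Lambda f) with (fun t => Series (fun n => lterm f t n)).
  2: { apply functional_extensionality; intros; now rewrite Lambda_lterm. }
  destruct (lterm_bound f F) as [M [HM H]].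
  apply (normal_series_cont (fun n t => lterm f t n) (fun n => M * / INR (S n) ^ 2)); auto.
  - intros n; unfold lterm; ct.
  - apply ex_series_scalR, ex_series_inv_sq.
Qed.

Definition q (f g : R -> R) : R := ig (fun t => Lambda f t * g t).
(** The signed area enclosed by the closed curve (f, g), while [q f f] is the Dirichlet energy of
    the harmonic extension of f to the disk. *)
Definition omega (f g : R -> R) : R := ig (fun t => f t * Derive g t).

Definition qterm (f g : R -> R) (m : nat) : R :=
  INR (S m) * / PI * (A f (S m) * A g (S m) + B f (S m) * B g (S m)).

Lemma q_series f g : sp f -> cont g -> periodic2pi g -> is_series (qterm f g) (q f g).
Proof.
  intros F Cg Pg. destruct (lterm_bound f F) as [M [HM H]].
  destruct (cont_bounded g Cg Pg) as [K [HK HKb]].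
  assert (HS : is_series (fun n => ig (fun t => g t * lterm f t n)) (ig (fun t => Series (fun n => g t * lterm f t n)))).
  { apply (normal_series_ig (fun n t => g t * lterm f t n) (fun n => K * (M * / INR (S n) ^ 2))).
    - intros n; unfold lterm; ct.
    - intros n t. rewrite Rabs_mult. apply Rmult_le_compat; auto using Rabs_pos.
    - apply ex_series_scalR, ex_series_scalR, ex_series_inv_sq. }
  unfold q. rewrite (ig_ext _ (fun t => Series (fun n => g t * lterm f t n))).
  2: { intros t. rewrite Lambda_lterm, Series_scal_l. ring. }
  eapply is_series_extR; [|exact HS]. intros n. unfold qterm, lterm.
  rewrite (ig_ext _ (fun t => INR (S n) * / PI * A f (S n) * (g t * cos (INR (S n) * t) * 1)
     + INR (S n) * / PI * B f (S n) * (g t * sin (INR (S n) * t) * 1))) by (intros; ring).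
  rewrite ig_plus, !ig_scal by ct. unfold Cc, Cs. ring.
Qed.

Lemma q_sym f g : sp f -> sp g -> q f g = q g f.
Proof.
  intros F G.
  pose proof (q_series f g F (sp_cont g G) (proj2 G)) as H1.
  pose proof (q_series g f G (sp_cont f F) (proj2 F)) as H2.
  apply is_series_unique in H1, H2. rewrite <- H1, <- H2. apply Series_ext; intros n; unfold qterm; ring.
Qed.

Lemma A_Derive g n : sp g -> A (Derive g) n = INR n * B g n.
Proof.
  intros G. rewrite (Cs_Derive _ _ circle_map_id g n G). apply ig_ext; intros; field.
Qed.

Lemma B_Derive g n : sp g -> B (Derive g) n = - (INR n * A g n).
Proof.
  intros G. rewrite (Cc_Derive _ _ circle_map_id g n G), Ropp_involutive. apply ig_ext; intros; field.
Qed.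

Lemma omega_series f g : sp f -> sp g ->
  is_series (fun m => INR (S m) * / PI * (A f (S m) * B g (S m) - B f (S m) * A g (S m))) (omega f g).
Proof.
  intros F G. pose proof (sp_Derive g G) as G'.
  pose proof (parseval _ _ circle_map_id f (Derive g) (sp_cont f F) (proj2 F)
     (sp_fsummable _ _ circle_map_id f F) (sp_cont _ G') (proj2 G')) as H.
  rewrite (A_Derive g 0 G) in H. simpl INR in H.
  replace (omega f g) with (ig (fun t => f t * Derive g t * 1) - A f 0 * (0 * B g 0) / (2 * PI)).
  - eapply is_series_extR; [|exact H]. intros n; cbv beta. rewrite A_Derive, B_Derive by auto. ring.
  - unfold omega. rewrite (ig_ext _ (fun t => f t * Derive g t)) by (intros; ring). field. apply PI_neq0.
Qed.

(** The two squared quantities are the real and imaginary parts of the mode -n of [f + i g], up to a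
    constant. Thus the area inequality is an equality exactly when all negative modes vanish, which
    drives the rigidity argument. *)
Lemma q_omega_gap f g : sp f -> sp g ->
  is_series (fun m => INR (S m) * / PI * ((A f (S m) - B g (S m)) ^ 2 + (B f (S m) + A g (S m)) ^ 2))
            (q f f + q g g - 2 * omega f g).
Proof.
  intros F G.
  pose proof (q_series f f F (sp_cont f F) (proj2 F)) as H1.
  pose proof (q_series g g G (sp_cont g G) (proj2 G)) as H2.
  pose proof (omega_series f g F G) as H3.
  pose proof (is_series_plus _ _ _ _ H1 H2) as H4.
  pose proof (is_series_minus _ _ _ _ H4 (is_series_scal 2 _ _ H3)) as H5.
  eapply is_series_extR; [|exact H5]. intros n.
  unfold plus, opp, scal; simpl plus; simpl opp; simpl scal. unfold mult; simpl mult. unfold qterm.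
  change (INR (S n) * / PI * (A f (S n) * A f (S n) + B f (S n) * B f (S n))
   + INR (S n) * / PI * (A g (S n) * A g (S n) + B g (S n) * B g (S n))
   + - (2 * (INR (S n) * / PI * (A f (S n) * B g (S n) - B f (S n) * A g (S n)))) 
   = INR (S n) * / PI * ((A f (S n) - B g (S n)) ^ 2 + (B f (S n) + A g (S n)) ^ 2)).
  ring.
Qed.

Lemma INR_inv_PI_pos m : 0 < INR (S m) * / PI.
Proof. apply Rmult_lt_0_compat; [apply lt_0_INR; lia|apply Rinv_0_lt_compat, PI_RGT_0]. Qed.

Lemma is_series_ge0 (u : nat -> R) (l : R) : is_series u l -> (forall n, 0 <= u n) -> 0 <= l.
Proof. intros H H0. apply (sm_series_le u l 0 H H0). Qed.

Lemma is_series_zero_terms (u : nat -> R) (l : R) : is_series u l -> (forall n, 0 <= u n) -> l <= 0 ->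
  forall n, u n = 0.
Proof.
  intros H H0 Hl n. pose proof (sm_series_le u l (S n) H H0) as H1.
  pose proof (sm_term_le (S n) u n (fun i _ => H0 i) ltac:(lia)). specialize (H0 n). lra.
Qed.

Lemma omega_le_q f g : sp f -> sp g -> 2 * omega f g <= q f f + q g g.
Proof.
  intros F G. assert (0 <= q f f + q g g - 2 * omega f g); [|lra].
  apply (is_series_ge0 _ _ (q_omega_gap f g F G)). intros n. pose proof (INR_inv_PI_pos n).
  apply Rmult_le_pos; [lra|]. apply Rplus_le_le_0_compat; apply pow2_ge_0.
Qed.

Lemma q_ge0 f : sp f -> 0 <= q f f.
Proof.
  intros F. apply (is_series_ge0 _ _ (q_series f f F (sp_cont f F) (proj2 F))). intros n. unfold qterm.
  pose proof (INR_inv_PI_pos n). apply Rmult_le_pos; [lra|]. nra.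
Qed.

Lemma q_zero_const f : sp f -> q f f = 0 -> forall t, f t = A f 0 / (2 * PI).
Proof.
  intros F E t.
  assert (HZ : forall n, qterm f f n = 0).
  { apply (is_series_zero_terms _ _ (q_series f f F (sp_cont f F) (proj2 F))); [|lra].
    intros n; unfold qterm. pose proof (INR_inv_PI_pos n). apply Rmult_le_pos; [lra|]. nra. }
  pose proof (fourier_expansion _ _ circle_map_id f (sp_cont f F) (proj2 F) (sp_fsummable _ _ circle_map_id f F) t) as H.
  assert (H0 : is_series (fterm (fun t => t) (fun _ => 1) f t) 0).
  { eapply is_series_extR; [|apply (is_series_single 0 0)]. intros n.
    specialize (HZ n). unfold qterm in HZ. pose proof (INR_inv_PI_pos n).
    assert (A f (S n) = 0 /\ B f (S n) = 0) as [E1 E2].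
    { apply Rmult_integral in HZ. destruct HZ as [HZ|HZ]; [lra|]. split; nra. }
    unfold fterm. rewrite E1, E2. destruct (Nat.eqb n 0); ring. }
  apply is_series_unique in H, H0. lra.
Qed.

Lemma q_lin_r f g h c : sp f -> cont g -> cont h -> q f (fun t => g t + c * h t) = q f g + c * q f h.
Proof.
  intros F G H. pose proof (Lambda_cont f F). unfold q.
  rewrite <- ig_scal, <- ig_plus by ct. apply ig_ext; intros; ring.
Qed.

Lemma q_lin_l f g h c : sp f -> sp g -> sp h -> q (fun t => f t + c * g t) h = q f h + c * q g h.
Proof.
  intros F G H. rewrite q_sym; auto using sp_plus, sp_scal.
  rewrite q_lin_r, (q_sym h f), (q_sym h g); auto using sp_cont.
Qed.

Lemma omega_lin_l f g h c : sp f -> sp g -> sp h -> omega (fun t => f t + c * g t) h = omega f h + c * omega g h.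
Proof.
  intros F G H. pose proof (sp_cont f F). pose proof (sp_cont g G). pose proof (sp_cont _ (sp_Derive h H)).
  unfold omega. rewrite <- ig_scal, <- ig_plus by ct. apply ig_ext; intros; ring.
Qed.

Lemma omega_anti f g : sp f -> sp g -> omega f g = - omega g f.
Proof.
  intros F G. unfold omega. rewrite (ig_by_parts f (Derive f) g (Derive g)); try apply F; try apply G.
  - f_equal. apply ig_ext; intros; ring.
  - intros; now apply smooth_is_derive, F.
  - intros; now apply smooth_is_derive, G.
  - now apply sp_cont, sp_Derive.
  - now apply sp_cont, sp_Derive.
Qed.

Lemma omega_lin_r f g h c : sp f -> sp g -> sp h -> omega f (fun t => g t + c * h t) = omega f g + c * omega f h.
Proof.
  intros F G H. rewrite omega_anti; auto using sp_plus, sp_scal.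
  rewrite omega_lin_l, (omega_anti f g), (omega_anti f h); auto. ring.
Qed.

(** * Linear combinations *)

Definition comb (m : nat) (x : nat -> R) (T : nat -> R -> R) (t : R) : R := sm m (fun i => x i * T i t).

Lemma comb_S m x T : comb (S m) x T = fun t => comb m x T t + x m * T m t.
Proof. reflexivity. Qed.

Lemma comb_sp m x T : (forall i, sp (T i)) -> sp (comb m x T).
Proof.
  intros H. induction m; [exact (sp_const 0)|]. rewrite comb_S. auto using sp_plus, sp_scal.
Qed.

Section Bilinear.
Variable b : (R -> R) -> (R -> R) -> R.
Hypothesis lin_l : forall f g h c, sp f -> sp g -> sp h -> b (fun t => f t + c * g t) h = b f h + c * b g h.
Hypothesis lin_r : forall f g h c, sp f -> sp g -> sp h -> b f (fun t => g t + c * h t) = b f g + c * b f h.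

Lemma bilinear_zero_l h : sp h -> b (fun _ => 0) h = 0.
Proof.
  (* With c = -1 and zero functions, linearity reads [b 0 h = b 0 h - b 0 h]. *)
  intros H. pose proof (lin_l (fun _ => 0) (fun _ => 0) h (-1) (sp_const 0) (sp_const 0) H) as E.
  cbv beta in E. replace (fun _ : R => 0 + -1 * 0) with (fun _ : R => 0) in E by (apply functional_extensionality; intros; ring).
  lra.
Qed.

Lemma bilinear_zero_r h : sp h -> b h (fun _ => 0) = 0.
Proof.
  intros H. pose proof (lin_r h (fun _ => 0) (fun _ => 0) (-1) H (sp_const 0) (sp_const 0)) as E.
  cbv beta in E. replace (fun _ : R => 0 + -1 * 0) with (fun _ : R => 0) in E by (apply functional_extensionality; intros; ring).
  lra.
Qed.

Lemma bilinear_comb_l m x T h : (forall i, sp (T i)) -> sp h ->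
  b (comb m x T) h = sm m (fun i => x i * b (T i) h).
Proof.
  intros HT Hh. induction m; [now apply bilinear_zero_l|].
  rewrite comb_S, lin_l, IHm; auto using comb_sp.
Qed.

Lemma bilinear_comb_r m x T h : (forall i, sp (T i)) -> sp h ->
  b h (comb m x T) = sm m (fun i => x i * b h (T i)).
Proof.
  intros HT Hh. induction m; [now apply bilinear_zero_r|].
  rewrite comb_S, lin_r, IHm; auto using comb_sp.
Qed.

Lemma bilinear_comb m k x y T U : (forall i, sp (T i)) -> (forall i, sp (U i)) ->
  b (comb m x T) (comb k y U) = sm m (fun i => sm k (fun j => x i * y j * b (T i) (U j))).
Proof.
  intros HT HU. rewrite bilinear_comb_l; auto using comb_sp.
  apply sm_ext; intros i _. rewrite bilinear_comb_r, <- sm_scal by auto.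
  apply sm_ext; intros; ring.
Qed.
End Bilinear.

Lemma q_comb m k x y T U : (forall i, sp (T i)) -> (forall i, sp (U i)) ->
  q (comb m x T) (comb k y U) = sm m (fun i => sm k (fun j => x i * y j * q (T i) (U j))).
Proof.
  apply bilinear_comb; [apply q_lin_l|]. intros; apply q_lin_r; auto using sp_cont.
Qed.

Lemma omega_comb m k x y T U : (forall i, sp (T i)) -> (forall i, sp (U i)) ->
  omega (comb m x T) (comb k y U) = sm m (fun i => sm k (fun j => x i * y j * omega (T i) (U j))).
Proof. apply bilinear_comb; [apply omega_lin_l|apply omega_lin_r]. Qed.

(** * Partial sums of the conjugate function *)

(** The conjugate function of [h] is its partner in the equality case of [2 omega <= q + q]: pairing
    and energy both equal the energy of [h]. Truncation gives a trigonometric polynomial, for which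
    nothing about convergence has to be known. *)
Fixpoint conj_sum (h : R -> R) (N : nat) (t : R) : R := match N with
  | O => 0
  | S n => conj_sum h n t + / PI * (B h (S n) * cos (INR (S n) * t) - A h (S n) * sin (INR (S n) * t))
  end.

Lemma conj_sum_S h n t : conj_sum h (S n) t
  = conj_sum h n t + / PI * (B h (S n) * cos (INR (S n) * t) - A h (S n) * sin (INR (S n) * t)).
Proof. reflexivity. Qed.

Lemma conj_sum_sp h N : sp (conj_sum h N).
Proof.
  induction N; [exact (sp_const 0)|]. destruct (cm_trig_sp _ _ circle_map_id (S N)) as [H1 H2].
  simpl. apply (sp_plus (conj_sum h N)
    (fun t => / PI * (B h (S N) * cos (INR (S N) * t) - A h (S N) * sin (INR (S N) * t)))); auto.
  apply sp_scal, sp_minus; now apply sp_scal.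
Qed.

Lemma conj_sum_coef h N n :
  A (conj_sum h N) (S n) = (if Nat.ltb n N then B h (S n) else 0) /\
  B (conj_sum h N) (S n) = (if Nat.ltb n N then - A h (S n) else 0).
Proof.
  pose proof PI_RGT_0 as HPI.
  induction N.
  - simpl. unfold Cc, Cs. split; (transitivity (ig (fun _ => 0)); [apply ig_ext; intros; simpl conj_sum; ring|rewrite ig_const; ring]).
  - destruct IHN as [IA IB]. pose proof (sp_cont _ (conj_sum_sp h N)) as C.
    split.
    + unfold Cc at 1. rewrite (ig_ext _ (fun t => conj_sum h N t * cos (INR (S n) * t) * 1
        + (/ PI * B h (S N) * (cos (INR (S N) * t) * cos (INR (S n) * t) * 1)
        + - / PI * A h (S N) * (sin (INR (S N) * t) * cos (INR (S n) * t) * 1)))) by (intros; rewrite conj_sum_S; ring).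
      rewrite !ig_plus, !ig_scal by ct.
      rewrite (cm_ortho_cc _ _ circle_map_id (S N) (S n)), (cm_ortho_sc _ _ circle_map_id (S N) (S n)).
      fold (A (conj_sum h N) (S n)). rewrite IA. unfold nsq. simpl Nat.eqb.
      destruct (Nat.eqb_spec N n), (Nat.ltb_spec n N), (Nat.ltb_spec n (S N));
      try lia; try subst n; field; lra.
    + unfold Cs at 1. rewrite (ig_ext _ (fun t => conj_sum h N t * sin (INR (S n) * t) * 1
        + (/ PI * B h (S N) * (sin (INR (S n) * t) * cos (INR (S N) * t) * 1)
        + - / PI * A h (S N) * (sin (INR (S N) * t) * sin (INR (S n) * t) * 1)))) by (intros; rewrite conj_sum_S; ring).
      rewrite !ig_plus, !ig_scal by ct.
      rewrite (cm_ortho_ss _ _ circle_map_id (S N) (S n)), (cm_ortho_sc _ _ circle_map_id (S n) (S N)).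
      fold (B (conj_sum h N) (S n)). rewrite IB. simpl Nat.eqb.
      destruct (Nat.eqb_spec N n), (Nat.ltb_spec n N), (Nat.ltb_spec n (S N));
      try lia; try subst n; field; lra.
Qed.

Lemma is_series_truncated (u : nat -> R) N : is_series (fun n => (if Nat.ltb n N then u n else 0) : R) (sm N u).
Proof.
  apply filterlim_ext_loc with (fun _ => sm N u); [|apply filterlim_const].
  exists N; intros n Hn. rewrite <- sm_sum_n.
  assert (E : forall k, (N <= k)%nat -> sm k (fun n => if Nat.ltb n N then u n else 0) = sm N u).
  { induction k as [|k IH]; intros Hk.
    - now replace N with O by lia.
    - destruct (Nat.eq_dec N (S k)) as [->|].
      + apply sm_ext; intros i Hi. now rewrite (proj2 (Nat.ltb_lt i (S k)) Hi).
      + simpl sm. rewrite IH by lia. rewrite (proj2 (Nat.ltb_ge k N)) by lia. ring. }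
  symmetry. apply E. lia.
Qed.

Lemma q_conj_sum h N : sp h -> q (conj_sum h N) (conj_sum h N) = sm N (qterm h h).
Proof.
  intros H. pose proof (conj_sum_sp h N) as S.
  rewrite <- (is_series_unique _ _ (q_series _ _ S (sp_cont _ S) (proj2 S))).
  apply is_series_unique. eapply is_series_extR; [|apply is_series_truncated].
  intros n. unfold qterm. destruct (conj_sum_coef h N n) as [-> ->].
  destruct (Nat.ltb n N); ring.
Qed.

Lemma omega_conj_sum h N : sp h -> omega (conj_sum h N) h = sm N (qterm h h).
Proof.
  intros H. pose proof (conj_sum_sp h N) as S.
  rewrite <- (is_series_unique _ _ (omega_series _ _ S H)).
  apply is_series_unique. eapply is_series_extR; [|apply is_series_truncated].
  intros n. unfold qterm. destruct (conj_sum_coef h N n) as [-> ->].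
  destruct (Nat.ltb n N); ring.
Qed.

(** * Non-stationary phase *)

Section Phase.
Variables phi p : R -> R.
Hypothesis CM : circle_map phi p.

Definition mixp (e t : R) : R := (1 - e) * p t + e.

(* The symbols produced by repeated integration by parts of exp (i r Phi_e), where
   Phi_e = (1 - e) phi + e theta has derivative mixp e; all bounds are uniform in e. *)
Inductive symb : (R -> R -> R) -> Prop :=
| symb_sp f : sp f -> symb (fun _ t => f t)
| symb_par c M : (forall e, 0 <= e <= 1 -> Rabs (c e) <= M) -> symb (fun e _ => c e)
| symb_inv : symb (fun e t => / mixp e t)
| symb_plus f g : symb f -> symb g -> symb (fun e t => f e t + g e t)
| symb_mult f g : symb f -> symb g -> symb (fun e t => f e t * g e t).

Lemma mixp_lower : exists c, 0 < c /\ forall e t, 0 <= e <= 1 -> c <= mixp e t.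
Proof.
  destruct (cont_pos_lower p (cm_cont_p _ _ CM) (proj2 (cm_sp _ _ CM)) (cm_pos _ _ CM)) as [c [Hc H]].
  exists (Rmin c 1); split; [apply Rmin_pos; lra|].
  intros e t He. unfold mixp. specialize (H t).
  pose proof (Rmin_l c 1). pose proof (Rmin_r c 1). nra.
Qed.

Lemma mixp_pos e t : 0 <= e <= 1 -> 0 < mixp e t.
Proof. destruct mixp_lower as [c [Hc H]]. intros He; specialize (H e t He); lra. Qed.

Lemma symb_derive f : symb f ->
  exists f', symb f' /\ forall e t, 0 <= e <= 1 -> is_derive (f e) t (f' e t).
Proof.
  induction 1 as [f F|c M Hc| |f g Hf [f' [F1 F2]] Hg [g' [G1 G2]]|f g Hf [f' [F1 F2]] Hg [g' [G1 G2]]].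
  - exists (fun _ => Derive f); split; [now apply symb_sp, sp_Derive|].
    intros; now apply smooth_is_derive, F.
  - exists (fun _ _ => 0); split; [apply (symb_sp (fun _ => 0)), sp_const|].
    intros; apply @is_derive_const.
  - exists (fun e t => (- (1 - e)) * (Derive p t * (/ mixp e t * / mixp e t))); split.
    + apply (symb_mult (fun e _ => - (1 - e)) (fun e t => Derive p t * (/ mixp e t * / mixp e t))).
      * apply (symb_par _ 1). intros; apply Rabs_le; lra.
      * apply (symb_mult (fun _ => Derive p) (fun e t => / mixp e t * / mixp e t)).
        -- apply symb_sp, sp_Derive, (cm_sp _ _ CM).
        -- apply (symb_mult (fun e t => / mixp e t) (fun e t => / mixp e t)); apply symb_inv.
    + intros e t He. pose proof (mixp_pos e t He).
      eapply is_derive_eq.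
      { apply (is_derive_inv (fun t => (1 - e) * p t + e) t ((1 - e) * Derive p t + 0)); [|unfold mixp in *; lra].
        apply is_derive_plus_R; [|apply @is_derive_const].
        apply is_derive_scal, smooth_is_derive, (cm_sp _ _ CM). }
      unfold mixp in *. field. lra.
  - exists (fun e t => f' e t + g' e t); split; [now apply symb_plus|].
    intros; apply is_derive_plus_R; auto.
  - exists (fun e t => f' e t * g e t + f e t * g' e t); split.
    + apply (symb_plus (fun e t => f' e t * g e t) (fun e t => f e t * g' e t)); now apply symb_mult.
    + intros; apply is_derive_mult_R; auto.
Qed.

Lemma symb_bounded f : symb f -> exists M, 0 < M /\ forall e t, 0 <= e <= 1 -> Rabs (f e t) <= M.
Proof.
  induction 1 as [f F|c M Hc| |f g Hf [M [HM F]] Hg [K [HK G]]|f g Hf [M [HM F]] Hg [K [HK G]]].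
  - destruct (cont_bounded f (sp_cont f F) (proj2 F)) as [M [HM H]]. exists M; auto.
  - exists (Rabs M + 1). pose proof (Rabs_pos M). pose proof (Rle_abs M). split; [lra|].
    intros e t He. specialize (Hc e He); lra.
  - destruct mixp_lower as [c [Hc H]]. exists (/ c); split; [now apply Rinv_0_lt_compat|].
    intros e t He. specialize (H e t He). rewrite Rabs_right.
    + now apply Rinv_le_contravar.
    + apply Rle_ge, Rlt_le, Rinv_0_lt_compat; lra.
  - exists (M + K); split; [lra|]. intros e t He. eapply Rle_trans; [apply Rabs_triang|].
    specialize (F e t He). specialize (G e t He). lra.
  - exists (M * K); split; [nra|]. intros e t He. rewrite Rabs_mult.
    apply Rmult_le_compat; auto using Rabs_pos.
Qed.

Lemma symb_periodic f : symb f -> forall e, periodic2pi (f e).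
Proof.
  induction 1 as [f F|c M Hc| |f g Hf F Hg G|f g Hf F Hg G]; intros e t.
  - apply F.
  - reflexivity.
  - unfold mixp. now rewrite (proj2 (cm_sp _ _ CM)).
  - now rewrite F, G.
  - now rewrite F, G.
Qed.

Lemma symb_cont f e : symb f -> 0 <= e <= 1 -> cont (f e).
Proof.
  intros H He t. destruct (symb_derive f H) as [f' [_ H']].
  apply (ex_derive_continuous (f e)). exists (f' e t); auto.
Qed.

(** This is [k + m] times the phase [Phi_e] with [e = m / (k + m)], whose derivative is bounded
    below independently of e. Hence the decay below is in [k + m], uniformly in the ratio of k and
    m. *)
Definition phase (k m : nat) (t : R) : R := INR k * phi t + INR m * t.

Lemma phase_cont k m : cont (phase k m).
Proof. unfold phase. pose proof (cm_cont_phi _ _ CM). ct. Qed.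

Lemma phase_periodic k m : periodic2pi (fun t => cos (phase k m t)) /\ periodic2pi (fun t => sin (phase k m t)).
Proof.
  assert (E : forall t, phase k m (t + 2 * PI) = phase k m t + INR (k + m) * (2 * PI)).
  { intros t. unfold phase. rewrite (cm_shift _ _ CM), plus_INR. ring. }
  split; intros t; rewrite E; apply cos_sub_int_mult.
Qed.

Lemma phase_derive k m t : (0 < k + m)%nat ->
  is_derive (phase k m) t (INR (k + m) * mixp (INR m / INR (k + m)) t).
Proof.
  intros H. assert (Hr : 0 < INR (k + m)) by now apply lt_0_INR.
  eapply is_derive_eq.
  { apply (is_derive_plus_R (fun t => INR k * phi t) (fun t => INR m * t)).
    - apply is_derive_scal, (cm_der _ _ CM).
    - apply is_derive_scal, @is_derive_id. }
  unfold mixp, one; simpl. rewrite plus_INR in *. field. lra.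
Qed.

Lemma phase_ratio k m : (0 < k + m)%nat -> 0 <= INR m / INR (k + m) <= 1.
Proof.
  intros H. assert (Hr : 0 < INR (k + m)) by now apply lt_0_INR.
  pose proof (pos_INR k). pose proof (pos_INR m).
  split; [apply Rmult_le_pos; [lra|apply Rlt_le, Rinv_0_lt_compat; lra]|].
  apply Rmult_le_reg_r with (INR (k + m)); auto. unfold Rdiv.
  rewrite Rmult_assoc, Rinv_l by lra. rewrite plus_INR; lra.
Qed.

(** One integration by parts divides by the phase derivative [(k + m) * mixp] and replaces the
    symbol [f] by the derivative of [f / mixp], again a symbol. Each round gains a factor
    [1 / (k + m)]. *)
Lemma phase_decay N : forall f, symb f -> exists M, 0 < M /\ forall k m, (0 < k + m)%nat ->
  INR (k + m) ^ N * Rabs (ig (fun t => f (INR m / INR (k + m)) t * cos (phase k m t))) <= M /\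
  INR (k + m) ^ N * Rabs (ig (fun t => f (INR m / INR (k + m)) t * sin (phase k m t))) <= M.
Proof.
  induction N; intros f F.
  - destruct (symb_bounded f F) as [M [HM H]]. pose proof two_pi_pos.
    exists (2 * PI * M); split; [nra|]. intros k m Hkm.
    pose proof (phase_ratio k m Hkm) as He. pose proof (symb_cont f _ F He). pose proof (phase_cont k m).
    rewrite !pow_O, !Rmult_1_l.
    split; (apply ig_abs_le; [ct|]); intros t; rewrite Rabs_mult, <- (Rmult_1_r M);
      (apply Rmult_le_compat; auto using Rabs_pos); apply Rabs_trig_le.
  - pose (g := fun e t => f e t * / mixp e t).
    assert (G : symb g) by (apply symb_mult; [exact F|apply symb_inv]).
    destruct (symb_derive g G) as [g' [G' D]].
    destruct (IHN g' G') as [M [HM H]]. exists M; split; auto. intros k m Hkm.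
    destruct (H k m Hkm) as [H1 H2]. pose proof (phase_ratio k m Hkm) as He.
    set (e := INR m / INR (k + m)) in *. set (r := INR (k + m)) in *.
    assert (Hr : 0 < r) by now apply lt_0_INR.
    pose proof (symb_cont f e F He). pose proof (symb_cont g e G He). pose proof (symb_cont g' e G' He).
    pose proof (phase_cont k m) as PC.
    assert (Cm : cont (mixp e)) by (unfold mixp; pose proof (cm_cont_p _ _ CM); ct).
    destruct (phase_periodic k m) as [P1 P2].
    assert (E1 : r * ig (fun t => f e t * cos (phase k m t)) = - ig (fun t => g' e t * sin (phase k m t))).
    { rewrite <- (ig_by_parts (g e) (g' e) (fun t => sin (phase k m t)) (fun t => r * mixp e t * cos (phase k m t)));
        auto; try ct; [|intros; apply (is_derive_comp_R sin); [apply is_derive_sin|now apply phase_derive]|now apply symb_periodic].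
      rewrite <- ig_scal by ct. apply ig_ext; intros t. unfold g. pose proof (mixp_pos e t He). field; lra. }
    assert (E2 : r * ig (fun t => f e t * sin (phase k m t)) = ig (fun t => g' e t * cos (phase k m t))).
    { rewrite <- (Ropp_involutive (ig (fun t => g' e t * cos (phase k m t)))).
      rewrite <- (ig_by_parts (g e) (g' e) (fun t => cos (phase k m t)) (fun t => r * mixp e t * - sin (phase k m t)));
        auto; try ct; [|intros; apply (is_derive_comp_R cos); [apply is_derive_cos|now apply phase_derive]|now apply symb_periodic].
      rewrite <- ig_scal, <- ig_opp by ct. apply ig_ext; intros t. unfold g. pose proof (mixp_pos e t He). field; lra. }
    apply (f_equal Rabs) in E1, E2. rewrite Rabs_Ropp in E1. rewrite Rabs_mult, (Rabs_right r) in E1, E2 by lra.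
    simpl. split; [rewrite <- E1 in H2|rewrite <- E2 in H1]; nra.
Qed.

(** [Ic k m + i Is k m] is, up to [2 pi], the Fourier coefficient of [exp (i k phi)] at the negative
    frequency -m. *)
Definition Ic (k m : nat) : R := ig (fun t => cos (phase k m t)).
Definition Is (k m : nat) : R := ig (fun t => sin (phase k m t)).

Lemma Ic_Is_decay N : exists M, 0 < M /\ forall k m, (0 < k + m)%nat ->
  Rabs (Ic k m) <= M / INR (k + m) ^ N /\ Rabs (Is k m) <= M / INR (k + m) ^ N.
Proof.
  destruct (phase_decay N (fun _ _ => 1)) as [M [HM H]]; [apply (symb_sp (fun _ => 1)), sp_const|].
  exists M; split; auto. intros k m Hkm. destruct (H k m Hkm) as [H1 H2].
  assert (Hp : 0 < INR (k + m) ^ N) by (apply pow_lt, lt_0_INR; lia).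
  split; apply Rmult_le_reg_l with (INR (k + m) ^ N); auto;
    (replace (INR (k + m) ^ N * (M / INR (k + m) ^ N)) with M by (field; lra)).
  - unfold Ic. erewrite ig_ext; [exact H1|]. intros; simpl; ring.
  - unfold Is. erewrite ig_ext; [exact H2|]. intros; simpl; ring.
Qed.

Lemma coef_phase k m :
  A (fun t => cos (INR k * phi t)) m - B (fun t => sin (INR k * phi t)) m = Ic k m /\
  B (fun t => cos (INR k * phi t)) m + A (fun t => sin (INR k * phi t)) m = Is k m.
Proof.
  pose proof (cm_cont_phi _ _ CM). unfold Cc, Cs, Ic, Is, phase.
  rewrite <- ig_minus, <- ig_plus by ct. split; apply ig_ext; intros t.
  - rewrite cos_plus. ring.
  - rewrite sin_plus. ring.
Qed.

Lemma Derive_trig k t :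
  Derive (fun t => sin (INR k * phi t)) t = INR k * cos (INR k * phi t) * p t /\
  Derive (fun t => cos (INR k * phi t)) t = - (INR k * sin (INR k * phi t) * p t).
Proof.
  split; apply is_derive_unique.
  - eapply is_derive_eq; [apply (cm_der_sin _ _ CM)|ring].
  - eapply is_derive_eq; [apply (cm_der_cos _ _ CM)|ring].
Qed.

Lemma Derive_expansion f t : sp f ->
  is_series (fun m => INR (S m) * / PI * (B f (S m) * cos (INR (S m) * t) - A f (S m) * sin (INR (S m) * t)))
            (Derive f t).
Proof.
  intros F. pose proof (sp_Derive f F) as F'.
  pose proof (fourier_expansion _ _ circle_map_id (Derive f) (sp_cont _ F') (proj2 F')
    (sp_fsummable _ _ circle_map_id _ F') t) as H.
  rewrite (A_Derive f 0 F) in H.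
  replace (Derive f t) with (Derive f t - INR 0 * B f 0 / (2 * PI)) by (simpl; field; apply PI_neq0).
  eapply is_series_extR; [|exact H]. intros n. unfold fterm. rewrite A_Derive, B_Derive by auto. ring.
Qed.

Lemma Lambda_is_series f t : sp f -> is_series (lterm f t) (Lambda f t).
Proof.
  intros F. rewrite Lambda_lterm. apply Series_correct. destruct (lterm_bound f F) as [M [HM H]].
  apply (@ex_series_le _ R_CompleteNormedModule _ (fun n => M * / INR (S n) ^ 2)).
  - intros n; apply H.
  - apply ex_series_scalR, ex_series_inv_sq.
Qed.

Lemma is_series_minusR (u v : nat -> R) (a b : R) :
  is_series u a -> is_series v b -> is_series (fun n => u n - v n) (a - b).
Proof. apply (@is_series_minus R_AbsRing R_NormedModule). Qed.

Lemma is_series_plusR (u v : nat -> R) (a b : R) :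
  is_series u a -> is_series v b -> is_series (fun n => u n + v n) (a + b).
Proof. apply (@is_series_plus R_AbsRing R_NormedModule). Qed.

(** For [F = exp (i k phi)], the operator [Lambda F + i F'] multiplies mode n by [|n| - n], so only
    negative modes survive. The statement is its real part, and [Lambda_sin_defect] the imaginary
    part. *)
Lemma Lambda_cos_defect k t :
  is_series (fun m => INR (S m) * / PI * (Ic k (S m) * cos (INR (S m) * t) + Is k (S m) * sin (INR (S m) * t)))
   (Lambda (fun t => cos (INR k * phi t)) t - INR k * cos (INR k * phi t) * p t).
Proof.
  destruct (cm_trig_sp _ _ CM k) as [HC HS]. rewrite <- (proj1 (Derive_trig k t)).
  eapply is_series_extR; [|apply is_series_minusR; [apply (Lambda_is_series _ t HC)|apply (Derive_expansion _ t HS)]].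
  intros m. destruct (coef_phase k (S m)) as [<- <-]. unfold lterm. ring.
Qed.

Lemma Lambda_sin_defect k t :
  is_series (fun m => INR (S m) * / PI * (Is k (S m) * cos (INR (S m) * t) + - Ic k (S m) * sin (INR (S m) * t)))
   (Lambda (fun t => sin (INR k * phi t)) t - INR k * sin (INR k * phi t) * p t).
Proof.
  destruct (cm_trig_sp _ _ CM k) as [HC HS].
  replace (INR k * sin (INR k * phi t) * p t) with (- Derive (fun t => cos (INR k * phi t)) t).
  2: { rewrite (proj2 (Derive_trig k t)). ring. }
  unfold Rminus. rewrite Ropp_involutive.
  eapply is_series_extR; [|apply is_series_plusR; [apply (Lambda_is_series _ t HS)|apply (Derive_expansion _ t HC)]].
  intros m. destruct (coef_phase k (S m)) as [<- <-]. unfold lterm. ring.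
Qed.

Lemma defect_bound_aux N : exists M, 0 < M /\ forall (k : nat) (a b : nat -> R) (t l : R), (0 < k)%nat ->
  (forall m, (Rabs (a m) = Rabs (Ic k (S m)) \/ Rabs (a m) = Rabs (Is k (S m))) /\
             (Rabs (b m) = Rabs (Ic k (S m)) \/ Rabs (b m) = Rabs (Is k (S m)))) ->
  is_series (fun m => INR (S m) * / PI * (a m * cos (INR (S m) * t) + b m * sin (INR (S m) * t))) l ->
  Rabs l <= M / INR k ^ N.
Proof.
  (* Of the N + 3 powers of k + m, N are spent on k and three on m: one against the factor m of the
     series and two for its convergence. *)
  destruct (Ic_Is_decay (N + 3)) as [M [HM H]].
  pose proof ex_series_inv_sq as HQ. set (Q := Series (fun n => / INR (S n) ^ 2)).
  assert (HQ0 : 0 <= Q).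
  { apply (is_series_ge0 (fun n => / INR (S n) ^ 2)); [now apply Series_correct|].
    intros n. apply Rlt_le, Rinv_0_lt_compat, pow_lt, lt_0_INR; lia. }
  pose proof (Rinv_0_lt_compat _ PI_RGT_0) as HP.
  assert (HMP : 0 < M * / PI) by nra.
  exists (2 * (M * / PI) * (Q + 1)); split; [nra|]. intros k a b t l Hk Hab Hs.
  assert (Hk0 : 0 < INR k) by now apply lt_0_INR.
  assert (HkN : 0 < INR k ^ N) by now apply pow_lt.
  assert (HB : forall m, Rabs (INR (S m) * / PI * (a m * cos (INR (S m) * t) + b m * sin (INR (S m) * t)))
               <= 2 * (M * / PI) / INR k ^ N * / INR (S m) ^ 2).
  { intros m. assert (Hm : 0 < INR (S m)) by (apply lt_0_INR; lia).
    destruct (H k (S m) ltac:(lia)) as [H1 H2].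
    assert (HI : M / INR (k + S m) ^ (N + 3) <= M / (INR k ^ N * INR (S m) ^ 3)).
    { apply Rmult_le_compat_l; [lra|]. apply Rinv_le_contravar.
      - apply Rmult_lt_0_compat; auto. now apply pow_lt.
      - rewrite pow_add, plus_INR. apply Rmult_le_compat; try (apply pow_le; lra); apply pow_incr; lra. }
    assert (Ha : Rabs (a m) <= M / (INR k ^ N * INR (S m) ^ 3)) by (destruct (Hab m) as [[-> | ->] _]; lra).
    assert (Hb : Rabs (b m) <= M / (INR k ^ N * INR (S m) ^ 3)) by (destruct (Hab m) as [_ [-> | ->]]; lra).
    rewrite Rabs_mult, (Rabs_right (INR (S m) * / PI)) by (apply Rle_ge, Rmult_le_pos; lra).
    eapply Rle_trans; [apply Rmult_le_compat_l; [apply Rmult_le_pos; lra|apply Rabs_trig_comb_le; eassumption]|].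
    right. field. pose proof PI_RGT_0. repeat split; lra. }
  rewrite <- (is_series_unique _ _ Hs).
  assert (HE : ex_series (fun m => 2 * (M * / PI) / INR k ^ N * / INR (S m) ^ 2)) by now apply ex_series_scalR.
  eapply Rle_trans; [apply Series_Rabs|].
  - apply (@ex_series_le _ R_CompleteNormedModule _ _ (fun n => eq_ind_r (fun x => x <= _) (HB n) (Rabs_Rabsolu _)) HE).
  - eapply Rle_trans; [apply Series_le; [intros n; split; [apply Rabs_pos|apply HB]|exact HE]|].
    rewrite Series_scal_l. fold Q. unfold Rdiv.
    replace (2 * (M * / PI) * / INR k ^ N * Q) with (2 * (M * / PI) * Q * / INR k ^ N) by ring.
    apply Rmult_le_compat_r; [apply Rlt_le, Rinv_0_lt_compat; lra|nra].
Qed.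

Lemma Lambda_trig_defect_bound N : exists M, 0 < M /\ forall k t, (0 < k)%nat ->
  Rabs (Lambda (fun t => cos (INR k * phi t)) t - INR k * cos (INR k * phi t) * p t) <= M / INR k ^ N /\
  Rabs (Lambda (fun t => sin (INR k * phi t)) t - INR k * sin (INR k * phi t) * p t) <= M / INR k ^ N.
Proof.
  destruct (defect_bound_aux N) as [M [HM H]]. exists M; split; auto. intros k t Hk. split.
  - refine (H k _ _ t _ Hk _ (Lambda_cos_defect k t)). intros m; auto.
  - refine (H k _ _ t _ Hk _ (Lambda_sin_defect k t)). intros m; rewrite Rabs_Ropp; auto.
Qed.

End Phase.

(** * Determinant inequalities for semidefinite matrices, by Schur complements *)

Module PsdDet.
Import all_boot all_order all_algebra.
From mathcomp Require Import ring lra.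
Import Order.TTheory GRing.Theory Num.Theory.
Local Open Scope ring_scope.
Set Implicit Arguments.
Unset Strict Implicit.

Section Psd.
Variable F : realFieldType.

Definition qf n (M : 'M[F]_n) (x : 'rV_n) : F := (x *m M *m x^T) 0 0.

Lemma qf_block n (a : F) (b : 'cV[F]_n) (S : 'M_n) (t : F) (y : 'rV_n) :
  qf (block_mx a%:M b^T b S : 'M_(1 + n)) (row_mx t%:M y) = t ^+ 2 * a + 2 * t * (y *m b) 0 0 + qf S y.
Proof.
rewrite /qf mul_row_block tr_row_mx mul_row_col tr_scalar_mx !mulmxDl.
rewrite -scalar_mxM !mul_mx_scalar mul_scalar_mx -scalemxAl -trmx_mul !mxE eqxx.
rewrite /=; ring.
Qed.

Lemma sym_block n (P : 'M[F]_(1 + n)) : P^T = P ->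
  P = block_mx (P 0 0)%:M (dlsubmx P)^T (dlsubmx P) (drsubmx P).
Proof.
move=> sP; rewrite -[LHS]submxK; congr block_mx.
- by rewrite [LHS]mx11_scalar; congr (_%:M); rewrite !mxE; congr (P _ _); apply/val_inj.
- by rewrite -[in RHS]sP -trmx_ursub trmxK.
Qed.

Lemma det_schur n (a : F) (b : 'cV[F]_n) (S : 'M_n) : a != 0 ->
  \det (block_mx a%:M b^T b S : 'M_(1 + n)) = a * \det (S - a^-1 *: (b *m b^T)).
Proof.
move=> a0.
have E : block_mx 1%:M 0 (- a^-1 *: b) 1%:M *m block_mx a%:M b^T b S
       = block_mx a%:M b^T 0 (S - a^-1 *: (b *m b^T)) :> 'M_(1 + n).
  rewrite mulmx_block !mul1mx !mul0mx !addr0 mul_mx_scalar -scalemxAl; congr block_mx.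
    by rewrite scalerA mulrN mulfV // scaleN1r addNr.
  by rewrite scaleNr addrC.
have /(congr1 determinant) := E.
by rewrite det_mulmx det_lblock det_ublock !det1 !mul1r det_scalar expr1.
Qed.

(** The form of the Schur complement is the critical value of the full form in its first coordinate,
    the minimum when [a > 0]; the first coordinate shown is the critical point. *)
Lemma qf_schur n (a : F) (b : 'cV[F]_n) (S : 'M_n) y : a != 0 ->
  qf (S - a^-1 *: (b *m b^T)) y
  = qf (block_mx a%:M b^T b S : 'M_(1 + n)) (row_mx (- ((y *m b) 0 0 / a))%:M y).
Proof.
move=> a0; rewrite qf_block /qf mulmxBr mulmxBl -scalemxAr -scalemxAl.
have -> : y *m (b *m b^T) *m y^T = (((y *m b) 0 0) ^+ 2)%:M.
  rewrite mulmxA -mulmxA -trmx_mul.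
  by rewrite [y *m b]mx11_scalar tr_scalar_mx -scalar_mxM !mxE eqxx mulr1n expr2.
move: (y *m S *m y^T) ((y *m b) 0 0) => W z; rewrite !mxE eqxx mulr1n; field; exact: a0.
Qed.

Lemma qf_block0 n (a : F) (b : 'cV[F]_n) (S : 'M_n) t :
  qf (block_mx a%:M b^T b S : 'M_(1 + n)) (row_mx t%:M 0) = t ^+ 2 * a.
Proof. by rewrite qf_block /qf !mul0mx !mxE mulr0 !addr0. Qed.

(** With a zero corner the form is affine in the first coordinate, with slope [2 (y b)]. If some
    [b i] is nonzero, a suitable first coordinate gives the value -1. *)
Lemma qf_block_zero n (b : 'cV[F]_n) (S : 'M_n) :
  (forall x, 0 <= qf (block_mx 0%:M b^T b S : 'M_(1 + n)) x) -> b = 0.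
Proof.
move=> H; apply/colP => i; rewrite [RHS]mxE; apply/eqP/contraT => bi.
pose y : 'rV[F]_n := delta_mx 0 i.
have Hy : (y *m b) 0 0 = b i 0 by rewrite -rowE mxE.
have := H (row_mx (- (qf S y + 1) / (2 * b i 0))%:M y).
rewrite qf_block Hy; set w := qf S y; set z := b i 0.
have -> : (- (w + 1) / (2 * z)) ^+ 2 * 0 + 2 * (- (w + 1) / (2 * z)) * z + w = -1.
  by field; exact: bi.
lra.
Qed.

Lemma schur_tr n (a : F) (b : 'cV[F]_n) (S : 'M_n) : S^T = S ->
  (S - a^-1 *: (b *m b^T))^T = S - a^-1 *: (b *m b^T).
Proof. by move=> sS; rewrite linearB linearZ /= trmx_mul trmxK sS. Qed.

Lemma det_block_zero n (S : 'M[F]_n) : \det (block_mx 0%:M 0^T 0 S : 'M_(1 + n)) = 0.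
Proof. by rewrite trmx0 det_ublock det_scalar expr1 mul0r. Qed.

Lemma psd_det_ge0 n (P : 'M[F]_n) : P^T = P -> (forall x, 0 <= qf P x) -> 0 <= \det P.
Proof.
elim: n P => [|n IH] P sP H; first by rewrite det_mx00.
have sS : (drsubmx (P : 'M_(1 + n)))^T = drsubmx (P : 'M_(1 + n)) by rewrite trmx_drsub sP.
move: H; rewrite (sym_block sP).
set a := P 0 0; set b := dlsubmx _; set S := drsubmx _ in sS *.
move=> H.
have a0 : 0 <= a by have := H (row_mx 1%:M 0); rewrite qf_block0 expr1n mul1r.
have [ap|an] := eqVneq a 0.
  have b0 : b = 0 by apply: (@qf_block_zero _ b S) => x; have := H x; rewrite ap.
  by rewrite ap b0 det_block_zero.
rewrite det_schur // mulr_ge0 // IH ?schur_tr // => y; rewrite qf_schur //; exact: H.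
Qed.

(** By induction with [det = a * det (Schur complement)]. Both factors grow with the matrix: the
    corner is a value of the form, and the Schur complement is a minimum of the form over one
    coordinate. *)
Lemma psd_det_mono n (P Q : 'M[F]_n) : P^T = P -> Q^T = Q -> (forall x, 0 <= qf P x) ->
  (forall x, qf P x <= qf Q x) -> \det P <= \det Q.
Proof.
elim: n P Q => [|n IH] P Q sP sQ HP HQ; first by rewrite !det_mx00.
have HQ0 x : 0 <= qf Q x by apply: le_trans (HQ x); apply: HP.
have dQ := psd_det_ge0 sQ HQ0.
have sS : (drsubmx (P : 'M_(1 + n)))^T = drsubmx (P : 'M_(1 + n)) by rewrite trmx_drsub sP.
have sT : (drsubmx (Q : 'M_(1 + n)))^T = drsubmx (Q : 'M_(1 + n)) by rewrite trmx_drsub sQ.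
move: HP HQ HQ0 dQ; rewrite (sym_block sP) (sym_block sQ).
set a := P 0 0; set b := dlsubmx _; set S := drsubmx _ in sS *.
set c := Q 0 0; set d := dlsubmx _; set T := drsubmx _ in sT *.
move=> HP HQ HQ0 dQ.
have a0 : 0 <= a by have := HP (row_mx 1%:M 0); rewrite qf_block0 expr1n mul1r.
have ac : a <= c by have := HQ (row_mx 1%:M 0); rewrite !qf_block0 expr1n !mul1r.
have [ap|an] := eqVneq a 0.
  have b0 : b = 0 by apply: (@qf_block_zero _ b S) => x; have := HP x; rewrite ap.
  by rewrite [X in X <= _](_ : _ = 0) // ap b0 det_block_zero.
have ap : 0 < a by rewrite lt_def an.
have cn : c != 0 by rewrite gt_eqF // (lt_le_trans ap).
rewrite !det_schur //.
have H1 y : 0 <= qf (S - a^-1 *: (b *m b^T)) y by rewrite qf_schur //; exact: HP.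
apply: ler_pM => //; first by apply: psd_det_ge0 => //; rewrite schur_tr.
apply: IH; rewrite ?schur_tr // => y.
rewrite (qf_schur d T y cn); apply: le_trans (HQ _).
pose t : F := - ((y *m d) 0 0 / c); rewrite (qf_schur b S y an) !qf_block -/t.
set z := (y *m b) 0 0; set w := qf S y.
have -> : (- (z / a)) ^+ 2 * a + 2 * - (z / a) * z + w = w - z ^+ 2 / a by field.
have -> : t ^+ 2 * a + 2 * t * z + w = (w - z ^+ 2 / a) + a * (t + z / a) ^+ 2 by field.
by rewrite lerDl mulr_ge0 // sqr_ge0.
Qed.

Lemma qf_sq n m (x : 'rV[F]_n) (C : 'M[F]_(n, m)) : qf (C *m C^T) x = \sum_j ((x *m C) 0 j) ^+ 2.
Proof.
rewrite /qf mulmxA -mulmxA -trmx_mul [LHS]mxE; apply: eq_bigr => j _; by rewrite [X in _ * X]mxE expr2.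
Qed.

(** Choosing the best y for each x turns the hypothesis into [O^T Q^-1 O <= Q] as forms. Comparing
    determinants gives [det O ^ 2 / det Q <= det Q]. *)
Lemma det_le_of_pairing n (Q O : 'M[F]_n) : Q^T = Q -> (forall x, x != 0 -> 0 < qf Q x) ->
  (forall x y : 'rV_n, 2 * (y *m O *m x^T) 0 0 <= qf Q x + qf Q y) -> `|\det O| <= \det Q.
Proof.
move=> sQ HQ HO.
have HQ0 x : 0 <= qf Q x.
  have [->|/HQ /ltW //] := eqVneq x 0; by rewrite /qf !mul0mx mxE.
have dQ : 0 < \det Q.
  rewrite lt_def psd_det_ge0 // andbT; apply/det0P => -[v v0 vQ].
  by have := HQ v v0; rewrite /qf vQ mul0mx mxE ltxx.
have uQ : Q \in unitmx by rewrite unitmxE unitfE gt_eqF.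
pose P := O^T *m invmx Q *m O.
have sP : P^T = P by rewrite /P !trmx_mul trmxK trmx_inv sQ mulmxA.
(* For this optimal partner the pairing and the [Q]-form both equal the [P]-form of x, so the
   hypothesis reads [2 P <= Q + P]. *)
pose y (x : 'rV_n) := x *m O^T *m invmx Q.
have Ey x : (y x *m O *m x^T) 0 0 = qf P x by rewrite /y /qf /P !mulmxA.
have Eq x : qf Q (y x) = qf P x.
  rewrite -Ey /qf /y mulmxKV // !trmx_mul trmxK trmx_inv sQ !mulmxA //.
have HP x : 0 <= qf P x by rewrite -Eq.
have HPQ x : qf P x <= qf Q x by have := HO x (y x); rewrite Ey Eq; lra.
have := psd_det_mono sP sQ HP HPQ.
rewrite /P !det_mulmx det_tr det_inv => H.
rewrite -ler_sqr ?nnegrE ?normr_ge0 ?(ltW dQ) // real_normK ?num_real //.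
move: H; rewrite mulrAC ler_pdivrMr // -!expr2 //.
Qed.

(** Sylvester's identity: two block eliminations of the same matrix [W]. The second leaves a factor
    [mu^n] on both sides, cancelled because [mu] is nonzero. *)
Lemma det_mulC n (X Y : 'M[F]_n) (mu : F) : mu != 0 ->
  \det (X *m Y + mu%:M) = \det (Y *m X + mu%:M).
Proof.
move=> m0; pose W := block_mx mu%:M (- X) Y 1%:M : 'M_(n + n).
have E1 : block_mx 1%:M X 0 1%:M *m W = block_mx (X *m Y + mu%:M) 0 Y 1%:M.
  by rewrite mulmx_block !mul1mx !mul0mx !mulmx1 add0r [0 + _]add0r addNr [mu%:M + _]addrC.
have E2 : block_mx 1%:M 0 (- Y) mu%:M *m W = block_mx mu%:M (- X) 0 (Y *m X + mu%:M).
  rewrite mulmx_block !mul1mx !mul0mx !addr0 mulmx1 mul_mx_scalar mul_scalar_mx scalerN addNr.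
  by rewrite mulNmx mulmxN opprK.
have := congr1 determinant E2; have := congr1 determinant E1.
rewrite !det_mulmx !det_lblock !det_ublock !det1 !mul1r mulr1 => ->.
rewrite det_scalar => /mulfI; apply; by rewrite expf_neq0.
Qed.

(** With [z = y C^T], the square sum of z is the pairing of [z C] with y, at most half the sum of
    their square sums; the first of these is at most that of z. *)
Lemma contraction_tr n (C : 'M[F]_n) :
  (forall x : 'rV_n, \sum_j ((x *m C) 0 j) ^+ 2 <= \sum_j (x 0 j) ^+ 2) ->
  (forall y : 'rV_n, \sum_j ((y *m C^T) 0 j) ^+ 2 <= \sum_j (y 0 j) ^+ 2).
Proof.
move=> H y; set z := y *m C^T.
have E : \sum_j (z 0 j) ^+ 2 = \sum_j ((z *m C) 0 j * y 0 j).
  have -> : \sum_j (z 0 j) ^+ 2 = (z *m z^T) 0 0.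
    by rewrite mxE; apply: eq_bigr => j _; rewrite [X in _ * X]mxE expr2.
  rewrite {2}/z trmx_mul trmxK mulmxA [LHS]mxE; apply: eq_bigr => j _; by rewrite [X in _ * X]mxE.
have H1 := H z.
have : \sum_j 2 * ((z *m C) 0 j * y 0 j) <= \sum_j (((z *m C) 0 j) ^+ 2 + (y 0 j) ^+ 2).
  apply: ler_sum => j _; set u := (_ *m _) 0 j; set v := y 0 j.
  have := sqr_ge0 (u - v); rewrite sqrrB; lra.
rewrite -mulr_sumr -E big_split /=; lra.
Qed.

Lemma contraction_det n (C : 'M[F]_n) :
  (forall x : 'rV_n, \sum_j ((x *m C) 0 j) ^+ 2 <= \sum_j (x 0 j) ^+ 2) -> `|\det C| <= 1.
Proof.
move=> H.
have : \det (C *m C^T) <= \det (1%:M : 'M[F]_n).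
  apply: psd_det_mono; rewrite ?trmx1 ?trmx_mul ?trmxK // => x; rewrite qf_sq.
    by apply: sumr_ge0 => j _; rewrite sqr_ge0.
  have -> : 1%:M = 1%:M *m 1%:M^T :> 'M[F]_n by rewrite trmx1 mulmx1.
  by rewrite qf_sq mulmx1.
rewrite det_mulmx det_tr det1 -expr2 -real_normK ?num_real //.
by rewrite expr_le1 // normr_ge0.
Qed.

(** Expansion along the first row; the rows of each minor are parts of the remaining rows, so their
    absolute sums only decrease. *)
Lemma det_abs_le n (M : 'M[F]_n) : `|\det M| <= \prod_i \sum_j `|M i j|.
Proof.
elim: n M => [|n IH] M; first by rewrite det_mx00 big_ord0 normr1.
rewrite (expand_det_row _ ord0) [leRHS]big_ord_recl mulr_suml.
apply: le_trans (ler_norm_sum _ _ _) _; apply: ler_sum => j _.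
rewrite normrM ler_wpM2l ?normr_ge0 // /cofactor normrM normrX normrN normr1 expr1n mul1r.
apply: le_trans (IH _) _; apply: ler_prod => i _; rewrite sumr_ge0 //=.
rewrite [leRHS](bigD1_ord j) //=; under eq_bigr do rewrite !mxE.
by rewrite lerDr normr_ge0.
Qed.

(** The rows of the identity are replaced one at a time by those of [1 + Y]. By linearity in row k,
    each replacement adds the determinant of a matrix [C] with [Y]'s row in that place, bounded by
    row sums; these bounds add up to the expanded product. *)
Lemma det_near1 n (Y : 'M[F]_n) :
  `|\det (1%:M + Y) - 1| <= \prod_i (1 + \sum_j `|Y i j|) - 1.
Proof.
pose r i := \sum_j `|Y i j|.
have r0 i : 0 <= r i by apply: sumr_ge0.
pose M k := \matrix_(i, j) ((i == j)%:R + (if (i < k)%N then Y i j else 0)) : 'M[F]_n.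
have row_bound i k : \sum_j `|M k i j| <= 1 + (if (i < k)%N then r i else 0).
  have -> : 1 = \sum_j `|(i == j)%:R : F|.
    rewrite (bigD1 i) //= eqxx normr1 big1 ?addr0 // => j; rewrite eq_sym => /negPf ->; by rewrite normr0.
  case: ifP => Hk; rewrite -?big_split /=; last rewrite addr0.
    apply: ler_sum => j _; rewrite mxE Hk; exact: ler_normD.
  by apply: ler_sum => j _; rewrite mxE Hk addr0.
have main k : (k <= n)%N ->
  `|\det (M k) - 1| <= \prod_(i < n | (i < k)%N) (1 + r i) - 1.
  elim: k => [|k IH] Hk.
    have -> : M 0%N = 1%:M by apply/matrixP => i j; rewrite !mxE ltn0 addr0.
    by rewrite det1 subrr normr0 big_pred0 ?subrr.
  pose i0 := Ordinal Hk.
  pose C := \matrix_(i, j) (if i == i0 then Y i j else M k i j) : 'M[F]_n.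
  have E : \det (M k.+1) = 1 * \det (M k) + 1 * \det C.
    apply: (@determinant_multilinear _ _ _ _ _ i0).
    apply/rowP => j; rewrite !mxE eqxx ltnn ltnSn addr0; ring.
    apply/matrixP => i j; rewrite !mxE ltnS [(lift i0 i <= k)%N]leq_eqVlt.
      have -> : (val (lift i0 i) == k) = false by apply/negP => /eqP H; have := neq_lift i0 i; rewrite -val_eqE H /= eqxx.
      by [].
    apply/matrixP => i j; rewrite !mxE eq_sym (negPf (neq_lift i0 i)) ltnS [(lift i0 i <= k)%N]leq_eqVlt.
      have -> : (val (lift i0 i) == k) = false by apply/negP => /eqP H; have := neq_lift i0 i; rewrite -val_eqE H /= eqxx.
      by [].
  have HC : `|\det C| <= r i0 * \prod_(i < n | (i < k)%N) (1 + r i).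
    apply: le_trans (det_abs_le _) _; rewrite (bigD1 i0) //=.
    apply: ler_pM => //; first by apply: sumr_ge0.
    by apply: prodr_ge0 => i _; apply: sumr_ge0.
    by rewrite /r; under eq_bigr do rewrite mxE eqxx.
    rewrite [leRHS](_ : _ = \prod_(i < n | i != i0) (if (i < k)%N then 1 + r i else 1)); last first.
        rewrite -big_mkcondr /=; apply: eq_bigl => i; case: (eqVneq i i0) => [->|//]; by rewrite ltnn.
      apply: ler_prod => i Hi; rewrite sumr_ge0 //=.
      under eq_bigr do rewrite mxE (negPf Hi).
      by apply: le_trans (row_bound i k) _; case: ifP; rewrite ?addr0.
  rewrite E !mul1r.
  have -> : \prod_(i < n | (i < k.+1)%N) (1 + r i) = (1 + r i0) * \prod_(i < n | (i < k)%N) (1 + r i).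
    rewrite (bigD1 i0) //=; congr (_ * _); apply: eq_bigl => i.
    rewrite ltnS leq_eqVlt -val_eqE /=; case: (eqVneq (val i) k) => [->|Hne] /=; by rewrite ?ltnn ?andbT ?andbF.
  have -> : \det (M k) + \det C - 1 = (\det (M k) - 1) + \det C by ring.
  apply: le_trans (ler_normD _ _) _; have := IH (ltnW Hk).
  set p := \prod_(i < n | _) _ in HC *; lra.
have := main n (leqnn n).
have -> : M n = 1%:M + Y by apply/matrixP => i j; rewrite !mxE ltn_ord.
rewrite [X in _ <= X - 1 -> _](_ : _ = \prod_i (1 + r i)) //.
by apply: eq_bigl => i; rewrite ltn_ord.
Qed.

(** With [X = C diag(s)] the hypothesis is [R <= X X^T + mu]. Exchanging the factors gives
    [det (X^T X + mu)], where the contraction now sits between the diagonal matrices and can be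
    bounded by the identity. *)
Lemma det_le_prod_shift n (R C : 'M[F]_n) (s : 'rV[F]_n) (mu : F) : 0 < mu -> R^T = R ->
  (forall x, 0 <= qf R x) ->
  (forall x : 'rV_n, \sum_j ((x *m C) 0 j) ^+ 2 <= \sum_j (x 0 j) ^+ 2) ->
  (forall x : 'rV_n, qf R x <= \sum_j (s 0 j * (x *m C) 0 j) ^+ 2 + mu * \sum_j (x 0 j) ^+ 2) ->
  \det R <= \prod_j (s 0 j ^+ 2 + mu).
Proof.
move=> mu0 sR R0 HC HR.
have qfmu x : qf (mu%:M : 'M_n) x = mu * \sum_j (x 0 j) ^+ 2.
  rewrite /qf mul_mx_scalar -scalemxAl mxE; congr (_ * _).
  by rewrite mxE; apply: eq_bigr => j _; rewrite [X in _ * X]mxE expr2.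
have qfD M N x : qf (M + N : 'M_n) x = qf M x + qf N x by rewrite /qf mulmxDr mulmxDl mxE.
have sqtr (M : 'M[F]_n) : (M *m M^T)^T = M *m M^T by rewrite trmx_mul trmxK.
pose X := C *m diag_mx s.
have H1 : \det R <= \det (X *m X^T + mu%:M).
  apply: psd_det_mono => //; first by rewrite linearD /= sqtr tr_scalar_mx.
  move=> x; rewrite qfD qf_sq qfmu; apply: le_trans (HR x) _; rewrite lerD2r.
  by apply: ler_sum => j _; rewrite /X mulmxA mul_mx_diag mxE mulrC.
apply: le_trans H1 _; rewrite det_mulC ?gt_eqF //.
have -> : \prod_j (s 0 j ^+ 2 + mu) = \det (diag_mx s *m (diag_mx s)^T + mu%:M).
  have -> : diag_mx s *m (diag_mx s)^T + mu%:M = diag_mx (\row_j (s 0 j ^+ 2 + mu)).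
    apply/matrixP => i j; rewrite tr_diag_mx mul_diag_mx !mxE; case: eqVneq => [->|_];
      rewrite ?mulr1n ?mulr0n ?mulr0 ?addr0 // expr2.
  by rewrite det_diag; apply: eq_bigr => j _; rewrite mxE.
have Etr : X^T *m X = X^T *m (X^T)^T by rewrite trmxK.
rewrite Etr; apply: psd_det_mono.
- by rewrite linearD /= sqtr tr_scalar_mx.
- by rewrite linearD /= sqtr tr_scalar_mx.
- move=> x; rewrite qfD qf_sq qfmu addr_ge0 ?mulr_ge0 ?(ltW mu0) //; apply: sumr_ge0 => j _; exact: sqr_ge0.
- move=> x; rewrite !qfD !qf_sq lerD2r /X trmx_mul mulmxA tr_diag_mx.
  exact: (contraction_tr HC).
Qed.

Lemma exists_left_kernel n m (C : 'M[F]_(n, m)) : (m < n)%N -> exists2 x : 'rV_n, x != 0 & x *m C = 0.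
Proof.
move=> Hmn; have : kermx C != 0.
  rewrite kermx_eq0 /row_free; apply/negP => /eqP E.
  by have := rank_leq_col C; rewrite E leqNgt Hmn.
by case/rowV0Pn => v /sub_kermxP vC v0; exists v.
Qed.

End Psd.
End PsdDet.

(** * Real matrices indexed by natural numbers *)

Fixpoint pd (m : nat) (f : nat -> R) : R := match m with O => 1 | S k => pd k f * f k end.

Definition bform (m : nat) (M : nat -> nat -> R) (x y : nat -> R) : R :=
  sm m (fun i => sm m (fun j => x i * y j * M i j)).

Module RealDet.
Import all_boot all_order all_algebra Rstruct.
Import Order.TTheory GRing.Theory Num.Theory PsdDet.
Delimit Scope R_scope with coqR.
Delimit Scope ring_scope with R.
Local Open Scope ring_scope.

Definition mat m (M : nat -> nat -> R) : 'M[R]_m := \matrix_(i, j) M i j.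
Definition mdet m (M : nat -> nat -> R) : R := \det (mat m M).
Definition rv m (x : nat -> R) : 'rV[R]_m := \row_i x i.
Definition unrv m (v : 'rV[R]_m) (k : nat) : R := if insub k is Some i then v 0 i else 0.

Lemma unrvK m (v : 'rV[R]_m) : rv m (unrv m v) = v.
Proof. by apply/rowP => i; rewrite mxE /unrv valK. Qed.

Lemma smE m f : sm m f = \sum_(i < m) f i.
Proof. by elim: m => [|m IH]; rewrite ?big_ord0 // big_ord_recr /= IH. Qed.

Lemma pdE m f : pd m f = \prod_(i < m) f i.
Proof. by elim: m => [|m IH]; rewrite ?big_ord0 // big_ord_recr /= IH. Qed.

Lemma bformE m M x y : bform m M x y = (rv m x *m mat m M *m (rv m y)^T) 0 0.
Proof.
rewrite /bform smE [RHS]mxE; under [RHS]eq_bigr => j _ do rewrite [X in _ * X]mxE [X in _ * X]mxE [X in X * _]mxE mulr_suml.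
rewrite exchange_big; apply: eq_bigr => i _; rewrite smE; apply: eq_bigr => j _.
rewrite !mxE; exact: mulrAC.
Qed.

Lemma qfE m M x : qf (mat m M) (rv m x) = bform m M x x.
Proof. by rewrite bformE. Qed.

Lemma mat_sym m M : (forall i j, M i j = M j i) -> (mat m M)^T = mat m M.
Proof. by move=> H; apply/matrixP => i j; rewrite !mxE. Qed.

Lemma sum_sqE m x : sm m (fun i => (x i ^ 2)%coqR) = \sum_j (rv m x 0 j) ^+ 2.
Proof. by rewrite smE; apply: eq_bigr => j _; rewrite mxE RpowE. Qed.

Lemma mulmxE_sm m (C : nat -> nat -> R) x j :
  (rv m x *m mat m C) 0 j = sm m (fun i => x i * C i j)%coqR.
Proof. by rewrite mxE smE; apply: eq_bigr => i _; rewrite !mxE. Qed.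

Lemma sum_sq_mulE m C x : sm m (fun j => (sm m (fun i => x i * C i j) ^ 2)%coqR)
  = \sum_j ((rv m x *m mat m C) 0 j) ^+ 2.
Proof. by rewrite smE; apply: eq_bigr => j _; rewrite mulmxE_sm RpowE. Qed.

Lemma rv_neq0 m x : rv m x != 0 -> exists i, (i < m)%coq_nat /\ x i <> 0%coqR.
Proof.
move=> H; have [i Hi] : exists i, rv m x 0 i != 0.
  by apply/existsP; apply: contraNT H; rewrite negb_exists => /forallP H; apply/eqP/rowP => i;
     rewrite [RHS]mxE; apply/eqP; have := H i; rewrite negbK.
exists i; split; first exact/ssrnat.ltP.
by move: Hi; rewrite mxE => /eqP.
Qed.

Lemma mdet_pairing m Q O : (forall i j, Q i j = Q j i) ->
  (forall x, (exists i, (i < m)%coq_nat /\ x i <> 0%coqR) -> (0 < bform m Q x x)%coqR) ->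
  (forall x y, (2 * bform m O y x <= bform m Q x x + bform m Q y y)%coqR) ->
  (Rabs (mdet m O) <= mdet m Q)%coqR.
Proof.
move=> sQ HQ HO; apply/RleP; rewrite RabsE; apply: det_le_of_pairing; first exact: mat_sym.
- move=> x; rewrite -(unrvK _ x) qfE => /rv_neq0 /HQ /RltP; exact.
- move=> x y; rewrite -(unrvK _ x) -(unrvK _ y) !qfE -bformE.
  by have /RleP := HO (unrv m x) (unrv m y).
Qed.

Lemma mdet_mono m P Q : (forall i j, P i j = P j i) -> (forall i j, Q i j = Q j i) ->
  (forall x, (0 <= bform m P x x)%coqR) -> (forall x, (bform m P x x <= bform m Q x x)%coqR) ->
  (mdet m P <= mdet m Q)%coqR.
Proof.
move=> sP sQ HP HQ; apply/RleP/psd_det_mono; try exact: mat_sym.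
- by move=> x; rewrite -(unrvK _ x) qfE; apply/RleP.
- by move=> x; rewrite -(unrvK _ x) !qfE; apply/RleP.
Qed.

Lemma mdet_le_prod_shift m P C s mu : (0 < mu)%coqR -> (forall i j, P i j = P j i) ->
  (forall x, (0 <= bform m P x x)%coqR) ->
  (forall x, (sm m (fun j => sm m (fun i => x i * C i j) ^ 2) <= sm m (fun i => x i ^ 2))%coqR) ->
  (forall x, (bform m P x x <= sm m (fun j => (s j * sm m (fun i => x i * C i j)) ^ 2) + mu * sm m (fun i => x i ^ 2))%coqR) ->
  (mdet m P <= pd m (fun j => s j ^ 2 + mu))%coqR.
Proof.
move=> mu0 sP P0 HC HP; apply/RleP.
have -> : pd m (fun j => (s j ^ 2 + mu)%coqR) = \prod_j (rv m s 0 j ^+ 2 + mu).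
  by rewrite pdE; apply: eq_bigr => j _; rewrite mxE RpowE.
apply: (@det_le_prod_shift _ _ _ (mat m C)); first exact/RltP; first exact: mat_sym.
- by move=> x; rewrite -(unrvK _ x) qfE; apply/RleP.
- by move=> x; rewrite -(unrvK _ x) -sum_sqE -sum_sq_mulE; apply/RleP.
- move=> x; rewrite -(unrvK _ x) -sum_sqE qfE; have /RleP := HP (unrv m x).
  congr (_ <= _ + _); rewrite smE; apply: eq_bigr => j _; by rewrite RpowE mulmxE_sm mxE.
Qed.

Lemma mdet_mul m P Q : mdet m (fun i j => sm m (fun l => P i l * Q l j)%coqR) = (mdet m P * mdet m Q)%coqR.
Proof.
rewrite /mdet RmultE -det_mulmx; congr (\det _); apply/matrixP => i j.
by rewrite !mxE smE; apply: eq_bigr => l _; rewrite !mxE.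
Qed.

Lemma mdet_tr m P : mdet m (fun i j => P j i) = mdet m P.
Proof. by rewrite /mdet -[RHS]det_tr; congr (\det _); apply/matrixP => i j; rewrite !mxE. Qed.

Lemma mdet_diag m d : mdet m (fun i j => if Nat.eqb i j then d i else 0%coqR) = pd m d.
Proof.
rewrite /mdet (_ : mat m _ = diag_mx (rv m d)) ?det_diag.
  by rewrite pdE; apply: eq_bigr => i _; rewrite mxE.
apply/matrixP => i j; rewrite !mxE -val_eqE /=.
case: (PeanoNat.Nat.eqb_spec i j) => [->|H]; first by rewrite eqxx mulr1n.
by case: eqP => // H'; rewrite mulr0n.
Qed.

Lemma mdet_ext m P Q : (forall i j, (i < m)%coq_nat -> (j < m)%coq_nat -> P i j = Q i j) -> mdet m P = mdet m Q.
Proof. by move=> H; congr (\det _); apply/matrixP => i j; rewrite !mxE; apply: H; apply/ssrnat.ltP. Qed.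

Lemma mdet_near1 m Y :
  (Rabs (mdet m (fun i j => (if Nat.eqb i j then 1 else 0) + Y i j) - 1)
     <= pd m (fun i => 1 + sm m (fun j => Rabs (Y i j))) - 1)%coqR.
Proof.
apply/RleP; rewrite RabsE; have := det_near1 (mat m Y).
have -> : 1%:M + mat m Y = mat m (fun i j => ((if Nat.eqb i j then 1 else 0) + Y i j)%coqR).
  apply/matrixP => i j; rewrite !mxE -val_eqE /=; congr (_ + _).
  case: (PeanoNat.Nat.eqb_spec i j) => [->|H]; first by rewrite eqxx.
  by case: eqP.
congr (_ <= _ - _); rewrite pdE; apply: eq_bigr => i _; congr (_ + _).
by rewrite smE; apply: eq_bigr => j _; rewrite mxE RabsE.
Qed.

Lemma mdet_contraction m C :
  (forall x, (sm m (fun j => sm m (fun i => x i * C i j) ^ 2) <= sm m (fun i => x i ^ 2))%coqR) ->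
  (Rabs (mdet m C) <= 1)%coqR.
Proof.
move=> H; apply/RleP; rewrite RabsE; apply: contraction_det.
by move=> x; rewrite -(unrvK _ x) -sum_sqE -sum_sq_mulE; apply/RleP.
Qed.

Lemma exists_kernel n m (C : nat -> nat -> R) : (m < n)%coq_nat ->
  exists x : nat -> R, (exists i, (i < n)%coq_nat /\ x i <> 0%coqR) /\
    forall j, (j < m)%coq_nat -> sm n (fun i => x i * C i j)%coqR = 0%coqR.
Proof.
move/ssrnat.ltP => Hmn; have [v v0 vC] := exists_left_kernel (\matrix_(i < n, j < m) C i j) Hmn.
exists (unrv n v); split; first by apply: rv_neq0; rewrite unrvK.
move=> j /ssrnat.ltP Hj; have /matrixP /(_ 0 (Ordinal Hj)) := vC; rewrite !mxE => E; apply: etrans E.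
by rewrite smE; apply: eq_bigr => i _; rewrite !mxE /unrv valK.
Qed.

End RealDet.
Notation mdet := RealDet.mdet.

(** * Block antidiagonal matrices *)

(** Indices 2k and 2k + 1 will label the cosine and the sine of frequency k + 1. [prt] exchanges the
    partners and [sg] is the sign of their quarter turn, so [blockJ s] has the 2 by 2 blocks of a
    rotation, with rows scaled by s. *)
Definition prt (i : nat) : nat := if Nat.even i then S i else pred i.
Definition sg (i : nat) : R := if Nat.even i then 1 else -1.
Definition blockJ (s : nat -> R) (i j : nat) : R := if Nat.eqb j (prt i) then sg i * s i else 0.

Lemma prt_cases i : (exists k, i = (2 * k)%nat /\ prt i = (2 * k + 1)%nat /\ sg i = 1) \/
                    (exists k, i = (2 * k + 1)%nat /\ prt i = (2 * k)%nat /\ sg i = -1).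
Proof.
  unfold prt, sg. destruct (Nat.even i) eqn:E.
  - left. apply Nat.even_spec in E. destruct E as [k ->]. exists k. repeat split; lia.
  - right. assert (O : Nat.odd i = true) by (now rewrite <- Nat.negb_even, E).
    apply Nat.odd_spec in O. destruct O as [k ->]. exists k. repeat split; lia.
Qed.

Lemma prt_invol i : prt (prt i) = i.
Proof.
  destruct (prt_cases i) as [[k [-> [-> _]]]|[k [-> [-> _]]]].
  - destruct (prt_cases (2 * k + 1)) as [[l H]|[l [H [-> _]]]]; lia.
  - destruct (prt_cases (2 * k)) as [[l [H [-> _]]]|[l H]]; lia.
Qed.

Lemma prt_lt n i : (i < 2 * n)%nat -> (prt i < 2 * n)%nat.
Proof. intros H. destruct (prt_cases i) as [[k [E [-> _]]]|[k [E [-> _]]]]; lia. Qed.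

Lemma sg_sq i : sg i * sg i = 1.
Proof. unfold sg; destruct (Nat.even i); ring. Qed.

Lemma pd_ext m f g : (forall i, (i < m)%nat -> f i = g i) -> pd m f = pd m g.
Proof. induction m; simpl; intros H; [auto|]. rewrite IHm, H; auto. Qed.

Lemma pd_pos m f : (forall i, (i < m)%nat -> 0 < f i) -> 0 < pd m f.
Proof. induction m; simpl; intros H; [lra|]. apply Rmult_lt_0_compat; auto. Qed.

Lemma pd_mult m f g : pd m (fun i => f i * g i) = pd m f * pd m g.
Proof. induction m; simpl; [ring|rewrite IHm; ring]. Qed.

Lemma pd_inv m f : pd m (fun i => / f i) = / pd m f.
Proof. induction m; simpl; [now rewrite Rinv_1|]. now rewrite IHm, Rinv_mult. Qed.

Lemma pd_le m f g : (forall i, (i < m)%nat -> 0 <= f i <= g i) -> 0 <= pd m f <= pd m g.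
Proof.
  induction m; simpl; intros H; [lra|].
  destruct IHm as [H1 H2]; [auto|]. destruct (H m) as [H3 H4]; [lia|].
  split; [now apply Rmult_le_pos|apply Rmult_le_compat; auto].
Qed.

Lemma blockJ_row s m i f : (prt i < m)%nat -> sm m (fun l => blockJ s i l * f l) = sg i * s i * f (prt i).
Proof.
  intros H. rewrite <- (sm_single m (prt i) (fun l => sg i * s i * f l) H).
  apply sm_ext; intros l _. unfold blockJ. destruct (Nat.eqb l (prt i)); ring.
Qed.

(** The matrix times its transpose is diagonal with entries [s i ^ 2], which determines the
    determinant up to sign. *)
Lemma mdet_blockJ n s : (forall i, 0 <= s i) -> Rabs (mdet (2 * n) (blockJ s)) = pd (2 * n) s.
Proof.
  intros Hs.
  assert (E : mdet (2 * n) (blockJ s) * mdet (2 * n) (blockJ s) = pd (2 * n) s * pd (2 * n) s).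
  { rewrite <- (RealDet.mdet_tr _ (blockJ s)) at 2. rewrite <- RealDet.mdet_mul, <- pd_mult, <- RealDet.mdet_diag.
    apply RealDet.mdet_ext. intros i j Hi Hj. rewrite blockJ_row by now apply prt_lt.
    unfold blockJ. destruct (Nat.eqb_spec (prt i) (prt j)) as [H|H], (Nat.eqb_spec i j) as [->|H'].
    - pose proof (sg_sq j). nra.
    - exfalso; apply H'. rewrite <- (prt_invol i), <- (prt_invol j). now f_equal.
    - congruence.
    - ring. }
  assert (0 <= pd (2 * n) s) by (destruct (pd_le (2 * n) s s); auto; intros; split; auto; lra).
  rewrite <- (Rabs_right (pd (2 * n) s)) by lra. apply Rsqr_eq_abs_0. exact E.
Qed.

(** * The weighted eigenvalue problem *)

Definition wip (p f g : R -> R) : R := ig (fun t => f t * g t * p t).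

(** Since [p dt = d phi], the eigenfunctions [g j] and the normalised trigonometric functions of
    [phi] are orthonormal systems for the same product [wip p]. Everything that follows compares
    these two bases. *)
Record spectral (phi p : R -> R) (g : nat -> R -> R) (lam : nat -> R) : Prop := {
  sc_cm : circle_map phi p;
  sc_sp : forall j, sp (g j);
  sc_eig : forall j t, Lambda (g j) t = lam j * (g j t * p t);
  sc_on : forall i j, wip p (g i) (g j) = if Nat.eqb i j then 1 else 0;
  sc_pars : forall f, sp f -> is_series (fun j => wip p f (g j) ^ 2) (wip p f f);
  sc_mono : forall j, lam j <= lam (S j) }.

Section Spectral.
Variables (phi p : R -> R) (g : nat -> R -> R) (lam : nat -> R).
Hypothesis SC : spectral phi p g lam.

Let CM : circle_map phi p := sc_cm _ _ _ _ SC.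
Let Cp : cont p := cm_cont_p _ _ CM.
Let Cphi : cont phi := cm_cont_phi _ _ CM.
Notation w := (wip p).
#[local] Hint Resolve Cp Cphi sp_cont : core.
#[local] Hint Extern 1 (cont (g _)) => (apply sp_cont, (sc_sp _ _ _ _ SC)) : core.

Lemma wip_sym f h : w f h = w h f.
Proof. apply ig_ext; intros; ring. Qed.

Lemma wip_lin_l f h k c : cont f -> cont h -> cont k -> w (fun t => f t + c * h t) k = w f k + c * w h k.
Proof. intros. unfold wip. rewrite <- ig_scal, <- ig_plus by ct. apply ig_ext; intros; ring. Qed.

Lemma wip_lin_r f h k c : cont f -> cont h -> cont k -> w k (fun t => f t + c * h t) = w k f + c * w k h.
Proof. intros. rewrite !(wip_sym k). now apply wip_lin_l. Qed.

Lemma wip_comb m k x y T U : (forall i, sp (T i)) -> (forall i, sp (U i)) ->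
  w (comb m x T) (comb k y U) = sm m (fun i => sm k (fun j => x i * y j * w (T i) (U j))).
Proof. apply bilinear_comb; intros; [apply wip_lin_l|apply wip_lin_r]; auto. Qed.

Lemma wip_comb_l m x T h : (forall i, sp (T i)) -> sp h -> w (comb m x T) h = sm m (fun i => x i * w (T i) h).
Proof. apply bilinear_comb_l; intros; apply wip_lin_l; auto. Qed.

Lemma wip_comb_r m x T h : cont h -> (forall i, sp (T i)) -> w h (comb m x T) = sm m (fun i => x i * w h (T i)).
Proof.
  intros C HT. induction m.
  - unfold comb; simpl. unfold wip. rewrite (ig_ext _ (fun _ => 0)), ig_const by (intros; ring). ring.
  - rewrite comb_S, wip_lin_r, IHm by (auto using comb_sp). reflexivity.
Qed.

Lemma wip_ge0 f : cont f -> 0 <= w f f.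
Proof.
  intros. apply ig_ge0; [ct|]. intros x. pose proof (cm_pos _ _ CM x). nra.
Qed.

Lemma wip_cauchy_schwarz f h : cont f -> cont h -> w f h ^ 2 <= w f f * w h h.
Proof.
  intros F H. pose proof (wip_ge0 f F) as W1. pose proof (wip_ge0 h H) as W2.
  assert (HP : forall c, 0 <= w f f + 2 * c * w f h + c * c * w h h).
  { intros c. pose proof (wip_ge0 (fun t => f t + c * h t) ltac:(ct)) as W.
    rewrite wip_lin_l, !wip_lin_r, (wip_sym h f) in W by ct. lra. }
  destruct (Req_dec (w h h) 0) as [E|E].
  - rewrite E, Rmult_0_r. destruct (Req_dec (w f h) 0) as [E'|E']; [rewrite E'; lra|].
    (* Here the quadratic polynomial in c is affine, and this c gives it the value -1. *)
    pose proof (HP (- (w f f + 1) / (2 * w f h))) as HX. rewrite E in HX.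
    replace (w f f + 2 * (- (w f f + 1) / (2 * w f h)) * w f h +
      - (w f f + 1) / (2 * w f h) * (- (w f f + 1) / (2 * w f h)) * 0) with (-1) in HX by (field; auto). lra.
  - pose proof (HP (- w f h / w h h)) as HX.
    apply (Rmult_le_compat_r (w h h) _ _ W2) in HX. rewrite Rmult_0_l in HX.
    replace ((w f f + 2 * (- w f h / w h h) * w f h + - w f h / w h h * (- w f h / w h h) * w h h) * w h h)
      with (w f f * w h h - w f h ^ 2) in HX by (field; auto). lra.
Qed.

Lemma q_eig j f : cont f -> q (g j) f = lam j * w (g j) f.
Proof.
  intros F. unfold q, wip. rewrite <- ig_scal by ct. apply ig_ext; intros t.
  rewrite (sc_eig _ _ _ _ SC). ring.
Qed.

Lemma lam_q j : lam j = q (g j) (g j).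
Proof. rewrite q_eig by auto. rewrite (sc_on _ _ _ _ SC), Nat.eqb_refl. ring. Qed.

Lemma lam_ge0 j : 0 <= lam j.
Proof. rewrite lam_q. apply q_ge0, (sc_sp _ _ _ _ SC). Qed.

Lemma q_const f : sp f -> q f (fun _ => 1) = 0.
Proof.
  intros F. pose proof (q_series f (fun _ => 1) F (cont_const 1) (proj2 (sp_const 1))) as H.
  rewrite <- (is_series_unique _ _ H). apply is_series_unique.
  eapply is_series_extR; [|apply (is_series_single 0 0)]. intros n. unfold qterm.
  assert (A (fun _ => 1) (S n) = 0).
  { unfold Cc. rewrite (ig_ext _ (fun t => cos (IZR (Z.of_nat (S n)) * t) * 1)).
    - rewrite (cm_ig_cos _ _ circle_map_id). destruct (Z.eqb_spec (Z.of_nat (S n)) 0); [lia|auto].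
    - intros t. rewrite <- INR_IZR_INZ. ring. }
  assert (B (fun _ => 1) (S n) = 0).
  { unfold Cs. rewrite (ig_ext _ (fun t => sin (IZR (Z.of_nat (S n)) * t) * 1)).
    - apply (cm_ig_sin _ _ circle_map_id).
    - intros t. rewrite <- INR_IZR_INZ. ring. }
  rewrite H0, H1. destruct (Nat.eqb n 0); ring.
Qed.

Lemma lam_mono i j : (i <= j)%nat -> lam i <= lam j.
Proof. induction 1; [lra|]. pose proof (sc_mono _ _ _ _ SC m). lra. Qed.

(** The constant 1 lies in the kernel of [q], and completeness prevents it from being orthogonal to
    every [g j]. An eigenvalue with nonzero overlap must be 0, and the ordering moves it to index
    0. *)
Lemma lam_0 : lam 0 = 0.
Proof.
  destruct (classic (exists j, w (fun _ => 1) (g j) <> 0)) as [[j Hj]|HN].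
  - assert (lam j = 0).
    { pose proof (q_const (g j) (sc_sp _ _ _ _ SC j)) as E. rewrite q_eig, (wip_sym (g j)) in E by ct.
      apply Rmult_integral in E. tauto. }
    pose proof (lam_mono 0 j ltac:(lia)). pose proof (lam_ge0 0). lra.
  - exfalso. pose proof (sc_pars _ _ _ _ SC (fun _ => 1) (sp_const 1)) as H.
    assert (H0 : is_series (fun j => w (fun _ => 1) (g j) ^ 2) 0).
    { eapply is_series_extR; [|apply (is_series_single 0 0)]. intros n.
      destruct (Req_dec (w (fun _ => 1) (g n)) 0) as [E|E]; [|exfalso; apply HN; now exists n].
      rewrite E. destruct (Nat.eqb n 0); ring. }
    apply is_series_unique in H, H0. rewrite H in H0.
    unfold wip in H0. rewrite (ig_ext _ p) in H0 by (intros; ring).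
    rewrite (cm_ig_p _ _ CM) in H0. pose proof PI_RGT_0. lra.
Qed.

Lemma g0_const : exists c, c <> 0 /\ forall t, g 0 t = c.
Proof.
  assert (E : q (g 0) (g 0) = 0) by (rewrite <- lam_q; apply lam_0).
  pose proof (q_zero_const (g 0) (sc_sp _ _ _ _ SC 0) E) as H.
  exists (A (g 0) 0 / (2 * PI)); split; auto. intros H0.
  pose proof (sc_on _ _ _ _ SC 0 0) as O. simpl in O. unfold wip in O.
  rewrite (ig_ext _ (fun _ => 0)), ig_const in O; [lra|]. intros t. rewrite H, H0. ring.
Qed.

(** The zero eigenvalue is dropped: [mu 0] is the first positive one, so that the index j matches
    the basis function [tb j] below. *)
Definition mu (j : nat) : R := lam (S j).
Definition gm (j : nat) : R -> R := g (S j).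

Lemma gm_sp j : sp (gm j).
Proof. apply (sc_sp _ _ _ _ SC). Qed.
#[local] Hint Resolve gm_sp : core.

(** Only constants have zero energy, and a second constant eigenfunction could not be orthogonal to
    [g 0]. *)
Lemma mu_pos j : 0 < mu j.
Proof.
  unfold mu. destruct (Rle_lt_or_eq_dec _ _ (lam_ge0 (S j))) as [H|H]; auto. exfalso.
  destruct g0_const as [c [Hc E0]].
  assert (E : q (g (S j)) (g (S j)) = 0) by now rewrite <- lam_q.
  pose proof (q_zero_const (g (S j)) (sc_sp _ _ _ _ SC (S j)) E) as H1.
  set (d := A (g (S j)) 0 / (2 * PI)) in *.
  pose proof (sc_on _ _ _ _ SC 0 (S j)) as O1. pose proof (sc_on _ _ _ _ SC (S j) (S j)) as O2.
  rewrite Nat.eqb_refl in O2. simpl in O1. unfold wip in O1, O2.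
  rewrite (ig_ext _ (fun t => c * d * p t)), ig_scal, (cm_ig_p _ _ CM) in O1 by (auto; intros; now rewrite E0, H1).
  rewrite (ig_ext _ (fun t => d * d * p t)), ig_scal, (cm_ig_p _ _ CM) in O2 by (auto; intros; now rewrite H1).
  pose proof PI_RGT_0. assert (d = 0) by nra. subst d. rewrite H2 in O2. lra.
Qed.

Lemma mu_mono i j : (i <= j)%nat -> mu i <= mu j.
Proof. intros; unfold mu; apply lam_mono; lia. Qed.

Lemma gm_on i j : w (gm i) (gm j) = if Nat.eqb i j then 1 else 0.
Proof. unfold gm. rewrite (sc_on _ _ _ _ SC). reflexivity. Qed.

Lemma q_gm j f : cont f -> q (gm j) f = mu j * w (gm j) f.
Proof. apply q_eig. Qed.

Lemma gm_mean j : w (gm j) (fun _ => 1) = 0.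
Proof.
  pose proof (q_const (gm j) (gm_sp j)) as E. rewrite q_gm in E by ct.
  pose proof (mu_pos j). apply Rmult_integral in E. destruct E; [lra|auto].
Qed.

Lemma wip_mean_g0 f : cont f -> w f (fun _ => 1) = 0 -> w f (g 0) = 0.
Proof.
  intros F E. destruct g0_const as [c [Hc H]]. unfold wip in *.
  rewrite (ig_ext _ (fun t => c * (f t * 1 * p t))) by (intros; rewrite H; ring).
  rewrite ig_scal, E by ct. ring.
Qed.

Lemma gm_parseval f : sp f -> w f (fun _ => 1) = 0 -> is_series (fun j => w f (gm j) ^ 2) (w f f).
Proof.
  intros F E. pose proof (sc_pars _ _ _ _ SC f F) as H.
  apply (is_series_incr_1 (fun j => w f (g j) ^ 2)). rewrite (wip_mean_g0 f) by auto.
  assert (E2 : @plus R_AbelianMonoid (w f f) (0 ^ 2) = w f f) by (unfold plus; simpl; ring).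
  rewrite <- E2 in H. exact H.
Qed.

Lemma gm_ex_series f : sp f -> ex_series (fun j => w f (gm j) ^ 2).
Proof.
  intros F. apply (ex_series_incr_1 (fun j => w f (g j) ^ 2)).
  eexists; now apply (sc_pars _ _ _ _ SC).
Qed.

Lemma gm_bessel h J : cont h -> sm J (fun j => w h (gm j) ^ 2) <= w h h.
Proof.
  intros C. set (k := comb J (fun j => w h (gm j)) gm).
  assert (K : sp k) by (apply comb_sp; auto).
  assert (E1 : w h k = sm J (fun j => w h (gm j) ^ 2)).
  { unfold k. rewrite wip_comb_r by auto. apply sm_ext; intros; ring. }
  assert (E2 : w k k = sm J (fun j => w h (gm j) ^ 2)).
  { unfold k. rewrite wip_comb by auto. apply sm_ext; intros i Hi.
    rewrite (sm_ext _ _ (fun j => if Nat.eqb j i then w h (gm j) ^ 2 else 0)).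
    - now rewrite (sm_single J i (fun j => w h (gm j) ^ 2)).
    - intros j Hj. rewrite gm_on, Nat.eqb_sym. destruct (Nat.eqb_spec j i) as [->|]; ring. }
  assert (HP : 0 <= w (fun t => h t + (-1) * k t) (fun t => h t + (-1) * k t)) by (apply wip_ge0; ct; auto).
  rewrite wip_lin_l, !wip_lin_r, (wip_sym k h), E1, E2 in HP by (ct; auto). lra.
Qed.

Lemma gm_parseval_mixed h f : cont h -> sp f -> w f (fun _ => 1) = 0 ->
  is_series (fun j => w h (gm j) * w f (gm j)) (w h f).
Proof.
  intros C F E0. pose proof (gm_parseval f F E0) as HP.
  apply filterlim_locally; intros eps.
  pose proof (wip_ge0 h C) as W0.
  (* Cauchy-Schwarz multiplies the tail of the Parseval series by [w h h]; the summand 1 covers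
     [w h h = 0]. *)
  assert (He : 0 < (eps * eps) / (w h h + 1)).
  { destruct eps as [e e0]; simpl. apply Rdiv_lt_0_compat; nra. }
  destruct (proj1 (filterlim_locally _ _) HP (mkposreal _ He)) as [N HN].
  exists N; intros n Hn. specialize (HN n Hn).
  change (Rabs (sum_n (fun j => w f (gm j) ^ 2) n - w f f) < (eps * eps) / (w h h + 1)) in HN.
  change (Rabs (sum_n (fun j => w h (gm j) * w f (gm j)) n - w h f) < eps).
  rewrite <- sm_sum_n in *. set (J := S n) in *.
  set (k := comb J (fun j => w f (gm j)) gm).
  assert (K : sp k) by (apply comb_sp; auto).
  assert (E1 : forall h, cont h -> w h k = sm J (fun j => w h (gm j) * w f (gm j))).
  { intros k' C'. unfold k. rewrite wip_comb_r by auto. apply sm_ext; intros; ring. }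
  assert (E2 : w k k = sm J (fun j => w f (gm j) ^ 2)).
  { unfold k at 1. rewrite wip_comb_l by auto. apply sm_ext; intros i Hi.
    rewrite (wip_sym (gm i) k). unfold k. rewrite wip_comb_l by auto.
    rewrite (sm_ext _ _ (fun j => if Nat.eqb j i then w f (gm j) else 0)).
    - rewrite (sm_single J i (fun j => w f (gm j))) by auto. ring.
    - intros j Hj. rewrite gm_on. destruct (Nat.eqb j i); ring. }
  set (d := fun t => f t + (-1) * k t).
  assert (D : cont d) by (unfold d; ct; auto).
  assert (Ed : w d d = w f f - sm J (fun j => w f (gm j) ^ 2)).
  { unfold d. rewrite wip_lin_l, !wip_lin_r, (wip_sym k f), E2, (E1 f) by (ct; auto).
    rewrite (sm_ext J (fun j => w f (gm j) * w f (gm j)) (fun j => w f (gm j) ^ 2)) by (intros; ring). ring. }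
  assert (Eh : sm J (fun j => w h (gm j) * w f (gm j)) - w h f = - w h d).
  { unfold d. rewrite wip_lin_r, (E1 h) by (ct; auto). ring. }
  rewrite Eh, Rabs_Ropp. pose proof (wip_cauchy_schwarz h d C D) as CS.
  rewrite Ed in CS. destruct eps as [e e0]; simpl pos in *.
  apply Rabs_def2 in HN. pose proof (wip_ge0 d D) as Wd. rewrite Ed in Wd.
  assert (HB : w f f - sm J (fun j => w f (gm j) ^ 2) < e * e / (w h h + 1)) by lra.
  assert (w h d ^ 2 < e * e).
  { eapply Rle_lt_trans; [exact CS|].
    destruct (Req_dec (w h h) 0) as [Z|Z]; [rewrite Z; nra|].
    apply Rle_lt_trans with (w h h * (e * e / (w h h + 1))); [apply Rmult_le_compat_l; lra|].
    apply Rlt_le_trans with ((w h h + 1) * (e * e / (w h h + 1))).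
    - apply Rmult_lt_compat_r; lra.
    - right; field; lra. }
  apply Rabs_def1; nra.
Qed.

(** With [h = Lambda f / p] the product [w h k] is [q f k], and symmetry of [q] turns the
    coefficient at [gm j] into [mu j * w f (gm j)]. *)
Lemma gm_q_series f : sp f -> w f (fun _ => 1) = 0 -> is_series (fun j => mu j * w f (gm j) ^ 2) (q f f).
Proof.
  intros F E0. set (h := fun t => Lambda f t * / p t).
  assert (Hp0 : forall t, p t <> 0) by (intros t; pose proof (cm_pos _ _ CM t); lra).
  assert (C : cont h) by (unfold h; pose proof (Lambda_cont f F); apply cont_mult; auto using cont_inv).
  assert (Eh : forall k, w h k = q f k).
  { intros k. apply ig_ext; intros t. unfold h. field. auto. }
  rewrite <- Eh. eapply is_series_extR; [|apply (gm_parseval_mixed h f C F E0)].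
  intros j. cbv beta. rewrite Eh, q_sym, q_gm, (wip_sym (gm j)) by auto. ring.
Qed.

(** * The trigonometric basis in the variable phi *)

(** The frequencies 1, 1, 2, 2, ... are also the nonzero eigenvalues of the unit disk, the sequence
    to which [mu] is compared. *)
Definition fr (i : nat) : nat := S (Nat.div2 i).
Definition tb (i : nat) (t : R) : R :=
  / sqrt PI * (if Nat.even i then cos (INR (fr i) * phi t) else sin (INR (fr i) * phi t)).

Lemma sqrt_PI_pos : 0 < sqrt PI.
Proof. apply sqrt_lt_R0, PI_RGT_0. Qed.

Lemma sqrt_PI_sq : sqrt PI * sqrt PI = PI.
Proof. apply sqrt_sqrt. pose proof PI_RGT_0; lra. Qed.

Lemma tb_even k : tb (2 * k) = fun t => / sqrt PI * cos (INR (S k) * phi t).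
Proof.
  unfold tb, fr. rewrite Nat.div2_double, Nat.even_mul. reflexivity.
Qed.

Lemma tb_odd k : tb (2 * k + 1) = fun t => / sqrt PI * sin (INR (S k) * phi t).
Proof.
  unfold tb, fr. rewrite Nat.add_1_r, Nat.div2_succ_double, Nat.even_succ, Nat.odd_mul. reflexivity.
Qed.

Lemma fr_even k : fr (2 * k) = S k.
Proof. unfold fr. now rewrite Nat.div2_double. Qed.

Lemma fr_odd k : fr (2 * k + 1) = S k.
Proof. unfold fr. now rewrite Nat.add_1_r, Nat.div2_succ_double. Qed.

Lemma fr_pos i : 1 <= INR (fr i).
Proof. unfold fr. rewrite S_INR. pose proof (pos_INR (Nat.div2 i)). lra. Qed.

Lemma parity i : exists k, i = (2 * k)%nat \/ i = (2 * k + 1)%nat.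
Proof. destruct (prt_cases i) as [[k H]|[k H]]; exists k; tauto. Qed.

Lemma fr_prt i : fr (prt i) = fr i.
Proof.
  destruct (prt_cases i) as [[k [-> [-> _]]]|[k [-> [-> _]]]]; now rewrite fr_even, fr_odd.
Qed.

Lemma tb_sp i : sp (tb i).
Proof.
  unfold tb. destruct (cm_trig_sp _ _ CM (fr i)). destruct (Nat.even i); now apply sp_scal.
Qed.
#[local] Hint Resolve tb_sp : core.

Lemma tb_on i j : w (tb i) (tb j) = if Nat.eqb i j then 1 else 0.
Proof.
  pose proof sqrt_PI_pos as HS. pose proof sqrt_PI_sq as HQ.
  unfold wip.
  destruct (parity i) as [k [-> | ->]], (parity j) as [l [-> | ->]]; rewrite ?tb_even, ?tb_odd.
  - rewrite (ig_ext _ (fun t => / sqrt PI * (/ sqrt PI * (cos (INR (S k) * phi t) * cos (INR (S l) * phi t) * p t))))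
      by (intros; ring).
    rewrite !ig_scal by ct. rewrite (cm_ortho_cc _ _ CM). unfold nsq. simpl (Nat.eqb (S k) 0).
    destruct (Nat.eqb_spec (S k) (S l)), (Nat.eqb_spec (2 * k) (2 * l)); try lia; try ring.
    cbv iota. set (s := sqrt PI) in *. rewrite <- HQ. field. lra.
  - rewrite (ig_ext _ (fun t => / sqrt PI * (/ sqrt PI * (sin (INR (S l) * phi t) * cos (INR (S k) * phi t) * p t))))
      by (intros; ring).
    rewrite !ig_scal by ct. rewrite (cm_ortho_sc _ _ CM).
    destruct (Nat.eqb_spec (2 * k) (2 * l + 1)); [lia|ring].
  - rewrite (ig_ext _ (fun t => / sqrt PI * (/ sqrt PI * (sin (INR (S k) * phi t) * cos (INR (S l) * phi t) * p t))))
      by (intros; ring).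
    rewrite !ig_scal by ct. rewrite (cm_ortho_sc _ _ CM).
    destruct (Nat.eqb_spec (2 * k + 1) (2 * l)); [lia|ring].
  - rewrite (ig_ext _ (fun t => / sqrt PI * (/ sqrt PI * (sin (INR (S k) * phi t) * sin (INR (S l) * phi t) * p t))))
      by (intros; ring).
    rewrite !ig_scal by ct. rewrite (cm_ortho_ss _ _ CM). simpl (Nat.eqb (S k) 0).
    destruct (Nat.eqb_spec (S k) (S l)), (Nat.eqb_spec (2 * k + 1) (2 * l + 1)); try lia; try ring.
    cbv iota. set (s := sqrt PI) in *. rewrite <- HQ. field. lra.
Qed.

Lemma tb_mean i : w (tb i) (fun _ => 1) = 0.
Proof.
  unfold wip. destruct (parity i) as [k [-> | ->]]; rewrite ?tb_even, ?tb_odd.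
  - rewrite (ig_ext _ (fun t => / sqrt PI * (cos (IZR (Z.of_nat (S k)) * phi t) * p t))).
    + rewrite ig_scal, (cm_ig_cos _ _ CM) by ct. destruct (Z.eqb_spec (Z.of_nat (S k)) 0); [lia|ring].
    + intros; rewrite <- INR_IZR_INZ; ring.
  - rewrite (ig_ext _ (fun t => / sqrt PI * (sin (IZR (Z.of_nat (S k)) * phi t) * p t))).
    + rewrite ig_scal, (cm_ig_sin _ _ CM) by ct. ring.
    + intros; rewrite <- INR_IZR_INZ; ring.
Qed.

Lemma tb_parseval f : sp f -> w f (fun _ => 1) = 0 ->
  is_series (fun n => w f (tb (2 * n)) ^ 2 + w f (tb (2 * n + 1)) ^ 2) (w f f).
Proof.
  intros F E0. pose proof (sp_cont f F) as Cf.
  pose proof (parseval _ _ CM f f Cf (proj2 F) (sp_fsummable _ _ CM f F) Cf (proj2 F)) as H.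
  assert (E1 : Cc phi p f 0 = 0).
  { rewrite <- E0. apply ig_ext; intros t. simpl. rewrite Rmult_0_l, cos_0. ring. }
  rewrite E1 in H. replace (w f f) with (ig (fun t => f t * f t * p t) - 0 * 0 / (2 * PI)).
  2: { unfold wip. field. apply PI_neq0. }
  eapply is_series_extR; [|exact H]. intros n. cbv beta. rewrite tb_even, tb_odd. unfold wip.
  rewrite (ig_ext (fun t => f t * (/ sqrt PI * cos (INR (S n) * phi t)) * p t)
     (fun t => / sqrt PI * (f t * cos (INR (S n) * phi t) * p t))) by (intros; ring).
  rewrite (ig_ext (fun t => f t * (/ sqrt PI * sin (INR (S n) * phi t)) * p t)
     (fun t => / sqrt PI * (f t * sin (INR (S n) * phi t) * p t))) by (intros; ring).
  rewrite !ig_scal by ct. fold (Cc phi p f (S n)). fold (Cs phi p f (S n)).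
  pose proof sqrt_PI_pos as HS. pose proof sqrt_PI_sq as HQ. set (s := sqrt PI) in *. rewrite <- HQ. field. lra.
Qed.

Lemma tb_comb_sq m x : w (comb m x tb) (comb m x tb) = sm m (fun i => x i ^ 2).
Proof.
  rewrite wip_comb by auto. apply sm_ext; intros i Hi.
  rewrite (sm_ext _ _ (fun j => if Nat.eqb j i then x i * x j else 0)).
  - rewrite (sm_single m i (fun j => x i * x j)) by auto. ring.
  - intros j _. rewrite tb_on, Nat.eqb_sym. destruct (Nat.eqb j i); ring.
Qed.

Lemma gm_comb_sq m x : w (comb m x gm) (comb m x gm) = sm m (fun i => x i ^ 2).
Proof.
  rewrite wip_comb by auto. apply sm_ext; intros i Hi.
  rewrite (sm_ext _ _ (fun j => if Nat.eqb j i then x i * x j else 0)).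
  - rewrite (sm_single m i (fun j => x i * x j)) by auto. ring.
  - intros j _. rewrite gm_on, Nat.eqb_sym. destruct (Nat.eqb j i); ring.
Qed.

Lemma comb_mean m x T : (forall i, sp (T i)) -> (forall i, w (T i) (fun _ => 1) = 0) -> w (comb m x T) (fun _ => 1) = 0.
Proof.
  intros H E. rewrite wip_comb_l by auto using sp_const.
  rewrite (sm_ext _ _ (fun _ => 0)), sm_zero; auto. intros; rewrite E; ring.
Qed.

Definition cf (i l : nat) : R := w (tb i) (gm l).

Lemma cf_def i l : cf i l = w (tb i) (gm l).
Proof. reflexivity. Qed.

(** * Hersch-Payne-Schiffer inequality *)

(* A primitive of tb i * p; up to scaling the rotation of tb i inside its pair. *)
Definition tt (i : nat) (t : R) : R := sg i * / INR (fr i) * tb (prt i) t.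

Lemma tt_sp i : sp (tt i).
Proof. unfold tt. now apply sp_scal. Qed.
#[local] Hint Resolve tt_sp : core.

Lemma tb_derive i t : is_derive (tb i) t (- sg i * INR (fr i) * tb (prt i) t * p t).
Proof.
  destruct (prt_cases i) as [[k [-> [-> ->]]]|[k [-> [-> ->]]]]; rewrite ?fr_even, ?fr_odd, tb_even, tb_odd.
  - eapply is_derive_eq; [apply is_derive_scal, (cm_der_cos _ _ CM)|ring].
  - eapply is_derive_eq; [apply is_derive_scal, (cm_der_sin _ _ CM)|ring].
Qed.

Lemma sg_prt i : sg (prt i) = - sg i.
Proof.
  destruct (prt_cases i) as [[k [E1 [E2 ->]]]|[k [E1 [E2 ->]]]];
  destruct (prt_cases (prt i)) as [[l [E3 [_ ->]]]|[l [E3 [_ ->]]]]; try lra; lia.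
Qed.

Lemma tt_derive i t : is_derive (tt i) t (tb i t * p t).
Proof.
  pose proof (fr_pos i). unfold tt.
  eapply is_derive_eq; [apply is_derive_scal, tb_derive|].
  rewrite fr_prt, prt_invol, sg_prt. pose proof (sg_sq i).
  replace (sg i * / INR (fr i) * (- - sg i * INR (fr i) * tb i t * p t))
    with ((sg i * sg i) * (/ INR (fr i) * INR (fr i)) * tb i t * p t) by ring.
  rewrite H0, Rinv_l by lra. ring.
Qed.

Lemma comb_tt_derive m x t : is_derive (comb m x tt) t (comb m x tb t * p t).
Proof.
  induction m.
  - unfold comb; simpl. eapply is_derive_eq; [apply @is_derive_const|]. unfold zero; simpl; ring.
  - rewrite !comb_S. eapply is_derive_eq.
    { apply is_derive_plus_R; [exact IHm|apply is_derive_scal, tt_derive]. }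
    ring.
Qed.

(** The form of the inverse of the operator [Lambda / p] on functions of mean zero, dual to [q] with
    respect to [wip p]. *)
Definition rr (f h : R -> R) : R := Series (fun l => w f (gm l) * w h (gm l) / mu l).

Lemma rr_ex f h : sp f -> sp h -> ex_series (fun l => w f (gm l) * w h (gm l) / mu l).
Proof.
  intros F H.
  apply (@ex_series_le _ R_CompleteNormedModule _ (fun l => / mu 0 * (w f (gm l) ^ 2 + w h (gm l) ^ 2))).
  - intros l. change (Rabs (w f (gm l) * w h (gm l) / mu l) <= / mu 0 * (w f (gm l) ^ 2 + w h (gm l) ^ 2)).
    pose proof (mu_pos 0). pose proof (mu_pos l). pose proof (mu_mono 0 l ltac:(lia)).
    unfold Rdiv. rewrite Rabs_mult, Rmult_comm. rewrite (Rabs_right (/ mu l)).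
    2: { apply Rle_ge, Rlt_le, Rinv_0_lt_compat; lra. }
    apply Rmult_le_compat; [apply Rlt_le, Rinv_0_lt_compat; lra|apply Rabs_pos|apply Rinv_le_contravar; lra|].
    apply Rabs_le. nra.
  - apply ex_series_scalR, (@ex_series_plus R_AbsRing R_NormedModule); now apply gm_ex_series.
Qed.

Lemma rr_sym f h : rr f h = rr h f.
Proof. apply Series_ext; intros; unfold Rdiv; ring. Qed.

Lemma rr_lin_l f h k c : sp f -> sp h -> sp k -> rr (fun t => f t + c * h t) k = rr f k + c * rr h k.
Proof.
  intros F H K. unfold rr. rewrite <- Series_scal_l, <- Series_plus.
  - apply Series_ext; intros l. rewrite wip_lin_l by auto. unfold Rdiv; ring.
  - now apply rr_ex.
  - now apply ex_series_scalR, rr_ex.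
Qed.

Lemma rr_lin_r f h k c : sp f -> sp h -> sp k -> rr f (fun t => h t + c * k t) = rr f h + c * rr f k.
Proof. intros F H K. rewrite !(rr_sym f). now apply rr_lin_l. Qed.

Lemma rr_ge0 f : sp f -> 0 <= rr f f.
Proof.
  intros F. apply (is_series_ge0 (fun l => w f (gm l) * w f (gm l) / mu l)).
  - now apply Series_correct, rr_ex.
  - intros l. pose proof (Rinv_0_lt_compat _ (mu_pos l)). unfold Rdiv. nra.
Qed.

(** Let y be the conjugate function of h. Then [w f y = omega y h] equals both [q y y] and [q h h],
    while Young's inequality in the eigenbasis gives [2 w f y <= rr f f + q y y]. Truncated
    conjugates give this for partial sums, and a limit finishes. *)
Lemma q_le_rr f h : sp f -> sp h -> w f (fun _ => 1) = 0 -> (forall t, is_derive h t (f t * p t)) -> q h h <= rr f f.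
Proof.
  intros F H E0 D.
  assert (HN : forall N, sm N (qterm h h) <= rr f f).
  { intros N. set (y0 := conj_sum h N). pose proof (conj_sum_sp h N) as Y0.
    (* The eigenfunction expansions require mean zero for [p]. Subtracting a constant changes
       neither [q y y] nor, as [f] has mean zero, [w f y]. *)
    set (c := w y0 (fun _ => 1) / (2 * PI)). set (y := fun t => y0 t + (- c) * 1).
    assert (Y : sp y) by (unfold y; apply (sp_plus y0 (fun _ => - c * 1)); auto using sp_const).
    assert (E1 : w (fun _ => 1) (fun _ => 1) = 2 * PI).
    { unfold wip. rewrite <- (cm_ig_p _ _ CM). apply ig_ext; intros; ring. }
    assert (My : w y (fun _ => 1) = 0).
    { unfold y. rewrite (wip_lin_l y0 (fun _ => 1)), E1 by (auto using cont_const). unfold c. field. apply PI_neq0. }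
    assert (Qy : q y y = sm N (qterm h h)).
    { rewrite <- (q_conj_sum h N H). fold y0. unfold y at 1.
      rewrite (q_lin_l y0 (fun _ => 1)) by (auto using sp_const).
      rewrite (q_sym (fun _ => 1) y) by (auto using sp_const). rewrite (q_const y Y). unfold y.
      rewrite (q_lin_r y0 y0 (fun _ => 1)), q_const by (auto using cont_const). ring. }
    assert (Wy : w f y = sm N (qterm h h)).
    { rewrite <- (omega_conj_sum h N H). fold y0. unfold y. rewrite (wip_lin_r y0 (fun _ => 1)), E0 by (auto using cont_const).
      unfold wip, omega. rewrite Rmult_0_r, Rplus_0_r. apply ig_ext; intros t.
      rewrite (is_derive_unique _ _ _ (D t)). ring. }
    pose proof (gm_parseval_mixed f y (sp_cont f F) Y My) as S1.
    pose proof (gm_q_series y Y My) as S2.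
    pose proof (Series_correct _ (rr_ex f f F F)) as S3. fold (rr f f) in S3.
    assert (0 <= rr f f + q y y - 2 * w f y); [|rewrite Qy, Wy in *; lra].
    assert (S4 : is_series (fun l => (w f (gm l) * w f (gm l) / mu l + mu l * w y (gm l) ^ 2)
        - 2 * (w f (gm l) * w y (gm l))) (rr f f + q y y - 2 * w f y)).
    { apply is_series_minusR; [now apply is_series_plusR|]. apply (is_series_scal 2 _ _ S1). }
    apply (is_series_ge0 _ _ S4). intros l. pose proof (mu_pos l) as Hm.
    replace (w f (gm l) * w f (gm l) / mu l + mu l * w y (gm l) ^ 2 - 2 * (w f (gm l) * w y (gm l)))
      with (/ mu l * (w f (gm l) - mu l * w y (gm l)) ^ 2) by (field; lra).
    apply Rmult_le_pos; [apply Rlt_le, Rinv_0_lt_compat; lra|apply pow2_ge_0]. }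
  pose proof (q_series h h H (sp_cont h H) (proj2 H)) as S.
  assert (Hl : is_lim_seq (sum_n (qterm h h)) (q h h)) by exact S.
  apply (is_lim_seq_le (sum_n (qterm h h)) (fun _ => rr f f) (q h h) (rr f f)); auto.
  - intros n. rewrite <- sm_sum_n. apply HN.
  - apply is_lim_seq_const.
Qed.

Lemma sm_pos_ex m x : (exists i, (i < m)%nat /\ x i <> 0) -> 0 < sm m (fun i => x i ^ 2).
Proof.
  intros [i [Hi Hx]]. pose proof (sm_term_le m (fun i => x i ^ 2) i (fun i _ => pow2_ge_0 (x i)) Hi) as H.
  simpl in H. assert (0 < x i * (x i * 1)) by nra. eapply Rlt_le_trans; [eassumption|exact H].
Qed.

(** For l >= m one has [/ mu l <= / mu (m - 1)], so the infinite tail is absorbed in a multiple of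
    the norm. The remaining finite part has nonnegative weights, which is the shape demanded by
    [mdet_le_prod_shift]. *)
Lemma rr_upper m f : (0 < m)%nat -> sp f -> w f (fun _ => 1) = 0 ->
  rr f f <= sm m (fun l => (/ mu l - / mu (pred m)) * w f (gm l) ^ 2) + / mu (pred m) * w f f.
Proof.
  intros Hm F E0. set (M := / mu (pred m)).
  pose proof (gm_parseval f F E0) as S1.
  pose proof (Series_correct _ (rr_ex f f F F)) as S3. fold (rr f f) in S3.
  pose proof (is_series_truncated (fun l => (/ mu l - M) * w f (gm l) ^ 2) m) as S2.
  assert (S4 : is_series (fun l => ((if Nat.ltb l m then (/ mu l - M) * w f (gm l) ^ 2 else 0) : R) + M * w f (gm l) ^ 2
      - w f (gm l) * w f (gm l) / mu l)
      (sm m (fun l => (/ mu l - M) * w f (gm l) ^ 2) + M * w f f - rr f f)).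
  { apply is_series_minusR; [apply is_series_plusR; [exact S2|apply (is_series_scal M _ _ S1)]|exact S3]. }
  apply is_series_ge0 in S4; [lra|]. intros l. unfold Rdiv.
  destruct (Nat.ltb_spec l m).
  - right. ring.
  - assert (/ mu l <= M).
    { apply Rinv_le_contravar; [apply mu_pos|apply mu_mono; lia]. }
    pose proof (pow2_ge_0 (w f (gm l))). nra.
Qed.

(** On the primitives [tt] the matrix of [omega] is [blockJ] with entries [/ fr]. The chain is [/
    prod fr = |det Om| <= det Qm <= det Rm <= / prod mu], by the area inequality, by [q_le_rr], and
    by the Bessel contraction [cf]. *)
Theorem prod_mu_le n : pd (2 * n) mu <= pd (2 * n) (fun i => INR (fr i)).
Proof.
  destruct n as [|n']; [simpl; lra|]. set (n := S n'). set (m := (2 * n)%nat).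
  assert (Hm : (0 < m)%nat) by lia.
  pose (Rm := fun i j => rr (tb i) (tb j)). pose (Qm := fun i j => q (tt i) (tt j)).
  pose (Om := fun i j => omega (tt i) (tt j)).
  assert (FR : forall x, bform m Rm x x = rr (comb m x tb) (comb m x tb)).
  { intros x. symmetry. apply (bilinear_comb rr); auto using rr_lin_l, rr_lin_r. }
  assert (FQ : forall x y, bform m Qm x y = q (comb m x tt) (comb m y tt)).
  { intros x y. symmetry. now apply q_comb. }
  assert (FO : forall x y, bform m Om x y = omega (comb m x tt) (comb m y tt)).
  { intros x y. symmetry. now apply omega_comb. }
  assert (Spt : forall x, sp (comb m x tt)) by (intros; now apply comb_sp).
  assert (Spb : forall x, sp (comb m x tb)) by (intros; now apply comb_sp).
  assert (Mb : forall x, w (comb m x tb) (fun _ => 1) = 0) by (intros; apply comb_mean; auto using tb_mean).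
  assert (SQ : forall i j, Qm i j = Qm j i) by (intros; now apply q_sym).
  assert (S1 : Rabs (mdet m Om) <= mdet m Qm).
  { apply RealDet.mdet_pairing; auto.
    - intros x Hx. rewrite FQ. pose proof (q_ge0 _ (Spt x)) as H0.
      destruct (Rle_lt_or_eq_dec _ _ H0) as [H|H]; auto. exfalso. symmetry in H.
      (* Zero energy makes the combination of primitives constant; its derivative is [p] times the
         same combination of the orthonormal [tb], which would then vanish. *)
      pose proof (q_zero_const _ (Spt x) H) as HC.
      assert (Z : forall t, comb m x tb t = 0).
      { intros t. pose proof (comb_tt_derive m x t) as D.
        assert (D0 : is_derive (comb m x tt) t 0).
        { apply (is_derive_ext (fun _ => A (comb m x tt) 0 / (2 * PI))); [intros; now rewrite HC|apply @is_derive_const]. }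
        apply is_derive_unique in D, D0. rewrite D in D0. pose proof (cm_pos _ _ CM t).
        apply Rmult_integral in D0. destruct D0; [auto|lra]. }
      pose proof (sm_pos_ex m x Hx) as HP. rewrite <- tb_comb_sq in HP. unfold wip in HP.
      rewrite (ig_ext _ (fun _ => 0)), ig_const in HP by (intros; rewrite Z; ring). lra.
    - intros x y. rewrite FO, !FQ. pose proof (omega_le_q _ _ (Spt y) (Spt x)). lra. }
  assert (S2 : mdet m Qm <= mdet m Rm).
  { apply RealDet.mdet_mono; auto.
    - intros; apply rr_sym.
    - intros x. rewrite FQ. now apply q_ge0.
    - intros x. rewrite FQ, FR. apply q_le_rr; auto using comb_tt_derive. }
  (* The weights left by [rr_upper] are written as squares; adding the shift back restores [/ mu l]
     in the final product. *)
  set (s := fun l => sqrt (/ mu l - / mu (pred m))).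
  assert (Hs : forall l, (l < m)%nat -> s l ^ 2 = / mu l - / mu (pred m)).
  { intros l Hl. unfold s. apply pow2_sqrt.
    assert (/ mu (pred m) <= / mu l); [|lra].
    apply Rinv_le_contravar; [apply mu_pos|apply mu_mono; lia]. }
  assert (Ecf : forall x l, sm m (fun i => x i * cf i l) = w (comb m x tb) (gm l)).
  { intros x l. rewrite wip_comb_l by auto. reflexivity. }
  assert (S3 : mdet m Rm <= pd m (fun l => s l ^ 2 + / mu (pred m))).
  { apply (RealDet.mdet_le_prod_shift m Rm cf).
    - apply Rinv_0_lt_compat, mu_pos.
    - intros; apply rr_sym.
    - intros x. rewrite FR. now apply rr_ge0.
    - intros x. rewrite <- (tb_comb_sq m x).
      rewrite (sm_ext _ _ (fun l => w (comb m x tb) (gm l) ^ 2)) by (intros; now rewrite Ecf).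
      apply gm_bessel. auto.
    - intros x. rewrite FR, <- (tb_comb_sq m x).
      rewrite (sm_ext _ _ (fun l => (/ mu l - / mu (pred m)) * w (comb m x tb) (gm l) ^ 2)).
      + apply rr_upper; auto.
      + intros l Hl. rewrite Ecf, Rpow_mult_distr, Hs; auto. }
  rewrite (pd_ext m _ (fun l => / mu l)) in S3 by (intros l Hl; rewrite Hs; auto; ring).
  rewrite pd_inv in S3.
  assert (S4 : Rabs (mdet m Om) = / pd m (fun i => INR (fr i))).
  { rewrite <- pd_inv. unfold m. rewrite <- mdet_blockJ.
    - f_equal. apply RealDet.mdet_ext. intros i j _ _. unfold Om, omega, blockJ.
      rewrite (ig_ext _ (fun t => (sg i * / INR (fr i)) * (tb (prt i) t * tb j t * p t))).
      + rewrite ig_scal by (pose proof (sp_cont _ (tb_sp (prt i))); pose proof (sp_cont _ (tb_sp j)); ct).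
        fold (w (tb (prt i)) (tb j)). rewrite tb_on, Nat.eqb_sym. destruct (Nat.eqb j (prt i)); ring.
      + intros t. rewrite (is_derive_unique _ _ _ (tt_derive j t)). unfold tt. ring.
    - intros i. apply Rlt_le, Rinv_0_lt_compat. pose proof (fr_pos i). lra. }
  assert (P1 : 0 < pd m mu) by (apply pd_pos; intros; apply mu_pos).
  assert (P2 : 0 < pd m (fun i => INR (fr i))) by (apply pd_pos; intros i _; pose proof (fr_pos i); lra).
  assert (HI : / pd m (fun i => INR (fr i)) <= / pd m mu) by lra.
  apply Rinv_le_contravar in HI; [|now apply Rinv_0_lt_compat]. now rewrite !Rinv_inv in HI.
Qed.

End Spectral.

(** * Spectral asymptotics *)

Definition Qsum : R := Series (fun n => / INR (S n) ^ 2).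

Lemma INR_S_pos n : 0 < INR (S n).
Proof. apply lt_0_INR; lia. Qed.

Lemma inv_sq_pos n : 0 < / INR (S n) ^ 2.
Proof. apply Rinv_0_lt_compat, pow_lt, INR_S_pos. Qed.

Lemma Qsum_series : is_series (fun n => / INR (S n) ^ 2) Qsum.
Proof. apply Series_correct, ex_series_inv_sq. Qed.

Lemma Qsum_pos : 0 < Qsum.
Proof.
  pose proof (sm_series_le _ _ 1 Qsum_series (fun n => Rlt_le _ _ (inv_sq_pos n))) as H.
  simpl in H. lra.
Qed.

Lemma sm_double m f : sm (2 * m) f = sm m (fun k => f (2 * k)%nat + f (2 * k + 1)%nat).
Proof.
  induction m; [reflexivity|].
  replace (2 * S m)%nat with (S (S (2 * m))) by lia. change (sm (S (S (2 * m))) f) with (sm (2 * m) f + f (2 * m)%nat + f (S (2 * m))). rewrite IHm.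
  change (sm (S m) (fun k => f (2 * k)%nat + f (2 * k + 1)%nat)) with
    (sm m (fun k => f (2 * k)%nat + f (2 * k + 1)%nat) + (f (2 * m)%nat + f (2 * m + 1)%nat)).
  rewrite (Nat.add_1_r (2 * m)). ring.
Qed.

Lemma sm_fr_inv_sq m : sm (2 * m) (fun i => / INR (fr i) ^ 2) <= 2 * Qsum.
Proof.
  rewrite sm_double.
  rewrite (sm_ext _ _ (fun k => 2 * / INR (S k) ^ 2)) by (intros; rewrite fr_even, fr_odd; ring).
  rewrite sm_scal. apply Rmult_le_compat_l; [lra|].
  apply sm_series_le; [apply Qsum_series|]. intros; apply Rlt_le, inv_sq_pos.
Qed.

(** The function [4k (n + 1/2 - k)] is concave in k and at least n + 1 at both ends k = 1 and k = n.
    The point is the growth of the gap in n, paid for with a power of k that the decay of [kap] can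
    afford. *)
Lemma gap_bound n k x : 1 <= k <= n -> n + / 2 <= x -> (n + 1) / (4 * k) <= x - k.
Proof.
  intros Hk Hx. apply Rle_trans with (n + / 2 - k); [|lra].
  apply Rmult_le_reg_r with (4 * k); [lra|]. unfold Rdiv. rewrite Rmult_assoc, Rinv_l by lra. nra.
Qed.

Lemma series_le_bound (u : nat -> R) (l c : R) : is_series u l -> (forall N, sm N u <= c) -> l <= c.
Proof.
  intros H HN. assert (Hl : is_lim_seq (sum_n u) l) by exact H.
  apply (is_lim_seq_le (sum_n u) (fun _ => c) l c); auto.
  - intros n. rewrite <- sm_sum_n. apply HN.
  - apply is_lim_seq_const.
Qed.

Section Asymptotics.
Variables (phi p : R -> R) (g : nat -> R -> R) (lam : nat -> R).
Hypothesis SC : spectral phi p g lam.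

Let CM : circle_map phi p := sc_cm _ _ _ _ SC.
Let Cp : cont p := cm_cont_p _ _ CM.
Let Cphi : cont phi := cm_cont_phi _ _ CM.
Notation w := (wip p).
Notation tb := (tb phi).
Notation gm := (gm g).
Notation mu := (mu lam).
Notation cf := (cf phi p g).

Let Htb i : sp (tb i) := tb_sp _ _ _ _ SC i.
Let Hgm j : sp (gm j) := gm_sp _ _ _ _ SC j.
Let Hmu j : 0 < mu j := mu_pos _ _ _ _ SC j.
#[local] Hint Resolve Cp Cphi sp_cont Htb Hgm : core.

(** The residual of [tb i] as an approximate eigenfunction of [Lambda / p] with eigenvalue [fr i];
    [kap] is its squared norm. *)
Definition Kt (i : nat) (t : R) : R := Lambda (tb i) t * / p t - INR (fr i) * tb i t.
Definition kap (i : nat) : R := w (Kt i) (Kt i).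

Lemma p_neq0 t : p t <> 0.
Proof. pose proof (cm_pos _ _ CM t). lra. Qed.

Lemma Kt_cont i : cont (Kt i).
Proof.
  unfold Kt. pose proof (Lambda_cont _ (Htb i)). pose proof (cont_inv p Cp p_neq0). pose proof (sp_cont _ (Htb i)). ct.
Qed.
#[local] Hint Resolve Kt_cont : core.

Lemma Kt_wip i h : cont h -> w (Kt i) h = q (tb i) h - INR (fr i) * w (tb i) h.
Proof.
  intros H. unfold wip, q. pose proof (Lambda_cont _ (Htb i)). pose proof (sp_cont _ (Htb i)).
  rewrite <- ig_scal, <- ig_minus by ct. apply ig_ext; intros t. unfold Kt.
  field. apply p_neq0.
Qed.

(** This identity turns small residuals into small overlaps: [cf i j] can be large only where [mu j]
    is close to [fr i]. *)
Lemma Kt_gm i j : w (Kt i) (gm j) = (mu j - INR (fr i)) * cf i j.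
Proof.
  rewrite Kt_wip, q_sym, (q_gm _ _ _ _ SC), (wip_sym p (gm j)) by auto. rewrite !cf_def. ring.
Qed.

Lemma A_B_scal c f n : cont f -> A (fun t => c * f t) n = c * A f n /\ B (fun t => c * f t) n = c * B f n.
Proof.
  intros F. unfold Cc, Cs. rewrite <- !ig_scal by ct. split; apply ig_ext; intros; ring.
Qed.

Lemma Lambda_scal c f t : cont f -> Lambda (fun t => c * f t) t = c * Lambda f t.
Proof.
  intros F. rewrite !Lambda_lterm, <- Series_scal_l. apply Series_ext; intros n. unfold lterm.
  destruct (A_B_scal c f (S n) F) as [-> ->]. ring.
Qed.

Lemma Kt_defect i t : Kt i t = / sqrt PI * / p t * (if Nat.even i
  then Lambda (fun t => cos (INR (fr i) * phi t)) t - INR (fr i) * cos (INR (fr i) * phi t) * p t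
  else Lambda (fun t => sin (INR (fr i) * phi t)) t - INR (fr i) * sin (INR (fr i) * phi t) * p t).
Proof.
  pose proof (p_neq0 t). pose proof sqrt_PI_pos. unfold Kt.
  replace (tb i) with (fun t => / sqrt PI * (if Nat.even i then cos (INR (fr i) * phi t) else sin (INR (fr i) * phi t)))
    by reflexivity. destruct (Nat.even i);
  (rewrite Lambda_scal; [field; split; lra|]).
  - pose proof Cphi. ct.
  - pose proof Cphi. ct.
Qed.

Lemma kap_bound N : exists M, 0 < M /\ forall i, kap i <= M / INR (fr i) ^ N.
Proof.
  destruct (Lambda_trig_defect_bound _ _ CM N) as [M [HM H]].
  destruct (cont_pos_lower p Cp (proj2 (cm_sp _ _ CM)) (cm_pos _ _ CM)) as [c [Hc Hcb]].
  pose proof (Rinv_0_lt_compat _ sqrt_PI_pos) as HS. pose proof (Rinv_0_lt_compat _ Hc) as HC.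
  set (D := / sqrt PI * / c * M). assert (HD : 0 < D) by (unfold D; repeat apply Rmult_lt_0_compat; lra).
  pose proof two_pi_pos as HP. exists (2 * PI * (D * D)); split; [apply Rmult_lt_0_compat; [lra|nra]|]. intros i.
  pose proof (fr_pos i) as Hf. set (P := INR (fr i) ^ N) in *.
  assert (HPp : 1 <= P) by (apply pow_R1_Rle; lra).
  assert (HB : forall t, Rabs (Kt i t) <= D / P).
  { intros t. rewrite Kt_defect. destruct (H (fr i) t) as [H1 H2]; [apply Nat.lt_0_succ|]. fold P in H1, H2.
    rewrite !Rabs_mult, (Rabs_right (/ sqrt PI)) by lra.
    pose proof (cm_pos _ _ CM t). rewrite (Rabs_right (/ p t)) by (apply Rle_ge, Rlt_le, Rinv_0_lt_compat; lra).
    replace (D / P) with (/ sqrt PI * (/ c * (M / P))) by (unfold D, Rdiv; ring).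
    rewrite Rmult_assoc. apply Rmult_le_compat_l; [lra|]. apply Rmult_le_compat; try apply Rabs_pos.
    - apply Rlt_le, Rinv_0_lt_compat; lra.
    - apply Rinv_le_contravar; auto.
    - destruct (Nat.even i); auto. }
  unfold kap, wip.
  apply Rle_trans with (ig (fun t => (D / P) * (D / P) * p t)).
  - apply ig_le.
    + pose proof (Kt_cont i). ct.
    + ct.
    + intros t. pose proof (cm_pos _ _ CM t). apply Rmult_le_compat_r; [lra|].
      rewrite <- (Rabs_right (Kt i t * Kt i t)) by (apply Rle_ge; nra). rewrite Rabs_mult.
      apply Rmult_le_compat; auto using Rabs_pos.
  - rewrite ig_scal, (cm_ig_p _ _ CM) by auto.
    replace (D / P * (D / P) * (2 * PI)) with (2 * PI * (D * D) / P * / P) by (field; lra).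
    rewrite <- (Rmult_1_r (2 * PI * (D * D) / P)) at 2. apply Rmult_le_compat_l.
    + apply Rmult_le_pos; [|apply Rlt_le, Rinv_0_lt_compat; lra].
      apply Rmult_le_pos; [lra|nra].
    + rewrite <- Rinv_1. apply Rinv_le_contravar; lra.
Qed.

Lemma Kt_bessel i J : sm J (fun j => w (Kt i) (gm j) ^ 2) <= kap i.
Proof. exact (gm_bessel _ _ _ _ SC (Kt i) J (Kt_cont i)). Qed.

Lemma Kt_bessel1 i j : w (Kt i) (gm j) ^ 2 <= kap i.
Proof.
  eapply Rle_trans; [|apply (Kt_bessel i (S j))].
  apply (sm_term_le (S j) (fun j => w (Kt i) (gm j) ^ 2)); [intros; apply pow2_ge_0|lia].
Qed.

Lemma cf_far i j : / 2 <= Rabs (mu j - INR (fr i)) -> cf i j ^ 2 <= 4 * w (Kt i) (gm j) ^ 2.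
Proof.
  intros H. rewrite Kt_gm, Rpow_mult_distr.
  assert (/ 4 <= (mu j - INR (fr i)) ^ 2).
  { rewrite <- (pow2_abs (mu j - INR (fr i))). nra. }
  pose proof (pow2_ge_0 (cf i j)). nra.
Qed.

Lemma cf_above n i j : (fr i <= n)%nat -> INR n + / 2 <= mu j ->
  cf i j ^ 2 <= 16 * INR (fr i) ^ 2 / (INR n + 1) ^ 2 * w (Kt i) (gm j) ^ 2.
Proof.
  intros Hi Hj. pose proof (fr_pos i) as Hf. apply le_INR in Hi.
  pose proof (gap_bound (INR n) (INR (fr i)) (mu j) (conj Hf Hi) Hj) as HG.
  set (k := INR (fr i)) in *. set (N := INR n + 1) in *. assert (0 < N) by (unfold N; lra).
  rewrite Kt_gm, Rpow_mult_distr. fold k.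
  assert (HQ : (N / (4 * k)) ^ 2 <= (mu j - k) ^ 2).
  { apply pow_incr. split; [|exact HG]. apply Rlt_le, Rdiv_lt_0_compat; lra. }
  pose proof (pow2_ge_0 (cf i j)) as HC.
  apply Rle_trans with (16 * k ^ 2 / N ^ 2 * ((N / (4 * k)) ^ 2 * cf i j ^ 2)).
  - right. field. lra.
  - apply Rmult_le_compat_l.
    + apply Rmult_le_pos; [nra|]. apply Rlt_le, Rinv_0_lt_compat, pow_lt; lra.
    + apply Rmult_le_compat_r; auto.
Qed.

(** Otherwise 2n + 1 eigenfunctions have eigenvalues at most n + 1/2, and some combination of them
    is orthogonal to the 2n trigonometric functions of frequency at most n. Its norm then sits on
    higher frequencies, at distance at least 1/2 from all these eigenvalues, where the overlaps are
    too small to carry it. *)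
Lemma mu_upper_count n e : 0 <= e -> 4 * e * Qsum < 1 ->
  (forall k, (n <= k)%nat -> kap (2 * k) + kap (2 * k + 1) <= e / INR (S k) ^ 2) -> INR n + / 2 < mu (2 * n).
Proof.
  intros He HeQ Hk. apply Rnot_le_lt; intros Hmu0.
  set (m := S (2 * n)).
  destruct (RealDet.exists_kernel m (2 * n) (fun i j => cf j i)) as [x [Hx Hker]]; [unfold m; lia|].
  set (f := comb m x gm).
  assert (F : sp f) by (apply comb_sp; auto).
  assert (E0 : w f (fun _ => 1) = 0) by (apply (comb_mean _ _ _ _ SC); auto; apply (gm_mean _ _ _ _ SC)).
  pose proof (sm_pos_ex m x Hx) as Hpos. set (X := sm m (fun i => x i ^ 2)) in *.
  assert (Ef : w f f = X) by apply (gm_comb_sq _ _ _ _ SC).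
  assert (Wf : forall i, w f (tb i) = sm m (fun l => x l * cf i l)).
  { intros i. unfold f. rewrite (wip_comb_l _ _ _ _ SC) by auto. apply sm_ext; intros l _.
    rewrite !cf_def. now rewrite wip_sym. }
  assert (HB : forall i, (n < fr i)%nat -> w f (tb i) ^ 2 <= 4 * X * kap i).
  { intros i Hi. rewrite Wf. eapply Rle_trans; [apply (sm_cauchy_schwarz m x (cf i))|]. fold X.
    replace (4 * X * kap i) with (X * (4 * kap i)) by ring. apply Rmult_le_compat_l; [lra|].
    apply Rle_trans with (sm m (fun l => 4 * w (Kt i) (gm l) ^ 2)).
    - apply sm_le; intros l Hl. apply cf_far.
      assert (mu l <= mu (2 * n)) by (apply (mu_mono _ _ _ _ SC); unfold m in Hl; lia).
      apply le_INR in Hi. rewrite S_INR in Hi. rewrite Rabs_minus_sym.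
      eapply Rle_trans; [|apply Rle_abs]. lra.
    - rewrite sm_scal. apply Rmult_le_compat_l; [lra|]. apply Kt_bessel. }
  pose proof (tb_parseval _ _ _ _ SC f F E0) as HP.
  assert (X <= 4 * X * e * Qsum); [|nra]. rewrite <- Ef at 1.
  apply (series_le_bound _ _ _ HP). intros N.
  apply Rle_trans with (sm N (fun k => 4 * X * e * / INR (S k) ^ 2)).
  - apply sm_le; intros k _. pose proof (inv_sq_pos k).
    destruct (le_lt_dec n k) as [Hnk|Hnk].
    + pose proof (HB (2 * k)%nat ltac:(rewrite fr_even; lia)).
      pose proof (HB (2 * k + 1)%nat ltac:(rewrite fr_odd; lia)).
      specialize (Hk k Hnk). unfold Rdiv in Hk.
      assert (4 * X * (kap (2 * k) + kap (2 * k + 1)) <= 4 * X * (e * / INR (S k) ^ 2)) by (apply Rmult_le_compat_l; lra).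
      lra.
    + rewrite !Wf, !Hker by lia. assert (0 <= 4 * X * e) by (apply Rmult_le_pos; lra). nra.
  - rewrite sm_scal. apply Rmult_le_compat_l; [apply Rmult_le_pos; lra|].
    apply sm_series_le; [apply Qsum_series|]. intros; apply Rlt_le, inv_sq_pos.
Qed.

(** The dual count: otherwise some combination of the 2n trigonometric functions of frequency at
    most n is orthogonal to the first 2n - 1 eigenfunctions, and its norm would be carried by
    eigenvalues above n + 1/2, where [cf_above] makes the overlaps too small. *)
Lemma mu_lower_count n : (1 <= n)%nat ->
  sm (2 * n) (fun i => 16 * INR (fr i) ^ 2 * kap i) < (INR n + 1) ^ 2 -> mu (2 * n - 1) <= INR n + / 2.
Proof.
  intros Hn HK. apply Rnot_lt_le; intros Hmu0.
  set (m := (2 * n)%nat) in *.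
  destruct (RealDet.exists_kernel m (m - 1) cf) as [x [Hx Hker]]; [unfold m; lia|].
  set (f := comb m x tb).
  assert (F : sp f) by (apply comb_sp; auto).
  assert (E0 : w f (fun _ => 1) = 0) by (apply (comb_mean _ _ _ _ SC); auto; apply (tb_mean _ _ _ _ SC)).
  pose proof (sm_pos_ex m x Hx) as Hpos. set (X := sm m (fun i => x i ^ 2)) in *.
  assert (Ef : w f f = X) by apply (tb_comb_sq _ _ _ _ SC).
  assert (Wf : forall l, w f (gm l) = sm m (fun i => x i * cf i l)).
  { intros l. unfold f. rewrite (wip_comb_l _ _ _ _ SC) by auto. reflexivity. }
  pose proof (gm_parseval _ _ _ _ SC f F E0) as HP.
  set (N1 := (INR n + 1) ^ 2) in *. assert (HN1 : 0 < N1) by (apply pow_lt; pose proof (pos_INR n); lra).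
  set (K := sm m (fun i => 16 * INR (fr i) ^ 2 * kap i)) in *.
  assert (X <= X * (K / N1)).
  { rewrite <- Ef at 1. apply (series_le_bound _ _ _ HP). intros L.
    apply Rle_trans with (sm L (fun l => X * sm m (fun i => 16 * INR (fr i) ^ 2 / N1 * w (Kt i) (gm l) ^ 2))).
    - apply sm_le; intros l _. destruct (le_lt_dec (m - 1) l) as [Hl|Hl].
      + rewrite Wf. eapply Rle_trans; [apply (sm_cauchy_schwarz m x (fun i => cf i l))|]. fold X.
        apply Rmult_le_compat_l; [lra|]. apply sm_le; intros i Hi. apply cf_above.
        * unfold fr. assert (Nat.div2 i < n)%nat; [|lia]. destruct (parity i) as [k [-> | ->]].
          -- rewrite Nat.div2_double. unfold m in Hi. lia.
          -- rewrite Nat.add_1_r, Nat.div2_succ_double. unfold m in Hi. lia.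
        * assert (mu (m - 1) <= mu l) by (apply (mu_mono _ _ _ _ SC); lia). lra.
      + rewrite Wf, Hker by lia. rewrite pow_ne_zero by lia. apply Rmult_le_pos; [lra|].
        apply sm_ge0; intros i _. apply Rmult_le_pos; [|apply pow2_ge_0].
        apply Rmult_le_pos; [|apply Rlt_le, Rinv_0_lt_compat; lra]. pose proof (pow2_ge_0 (INR (fr i))). lra.
    - rewrite sm_scal, sm_swap. apply Rmult_le_compat_l; [lra|].
      unfold Rdiv. rewrite Rmult_comm. unfold K. rewrite <- sm_scal. apply sm_le; intros i _.
      rewrite sm_scal. pose proof (Kt_bessel i L) as HB.
      replace (/ N1 * (16 * INR (fr i) ^ 2 * kap i)) with (16 * INR (fr i) ^ 2 * / N1 * kap i) by ring.
      apply Rmult_le_compat_l; auto.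
      apply Rmult_le_pos; [|apply Rlt_le, Rinv_0_lt_compat; lra]. pose proof (pow2_ge_0 (INR (fr i))). lra. }
  assert (K / N1 < 1).
  { apply Rmult_lt_reg_r with N1; auto. unfold Rdiv. rewrite Rmult_assoc, Rinv_l by lra. lra. }
  nra.
Qed.

Lemma INR_ge_exists (c : R) : exists n0, forall n, (n0 <= n)%nat -> c < INR n.
Proof.
  destruct (INR_unbounded c) as [n0 H]. exists n0. intros n Hn. apply le_INR in Hn. lra.
Qed.

Lemma mu_upper_ev : exists n0, forall n, (n0 <= n)%nat -> INR n + / 2 < mu (2 * n).
Proof.
  (* Two powers are needed for summation over the frequencies k >= n; the third makes the constant
     of order 1/n. *)
  destruct (kap_bound 3) as [M [HM H]]. pose proof Qsum_pos.
  destruct (INR_ge_exists (8 * M * Qsum)) as [n0 Hn0]. exists n0; intros n Hn. specialize (Hn0 n Hn).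
  assert (HS : 0 < INR (S n)) by apply INR_S_pos.
  apply (mu_upper_count n (2 * M / INR (S n))).
  - apply Rlt_le, Rdiv_lt_0_compat; lra.
  - apply Rmult_lt_reg_r with (INR (S n)); auto.
    replace (4 * (2 * M / INR (S n)) * Qsum * INR (S n)) with (8 * M * Qsum) by (field; lra).
    rewrite S_INR in *. lra.
  - intros k Hk. pose proof (H (2 * k)%nat) as H1. pose proof (H (2 * k + 1)%nat) as H2.
    rewrite fr_even in H1. rewrite fr_odd in H2.
    assert (HSk : INR (S n) <= INR (S k)) by (apply le_INR; lia).
    assert (HI : M / INR (S k) ^ 3 <= M / INR (S n) / INR (S k) ^ 2).
    { replace (M / INR (S k) ^ 3) with (M / INR (S k) ^ 2 * / INR (S k)) by (field; lra).
      replace (M / INR (S n) / INR (S k) ^ 2) with (M / INR (S k) ^ 2 * / INR (S n)) by (field; split; lra).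
      apply Rmult_le_compat_l; [|apply Rinv_le_contravar; lra].
      apply Rlt_le, Rdiv_lt_0_compat; [lra|apply pow_lt; lra]. }
    replace (2 * M / INR (S n) / INR (S k) ^ 2) with (M / INR (S n) / INR (S k) ^ 2 + M / INR (S n) / INR (S k) ^ 2)
      by (field; split; lra).
    lra.
Qed.

Lemma mu_lower_ev : exists n0, forall n, (n0 <= n)%nat -> mu (2 * n - 1) <= INR n + / 2.
Proof.
  (* Two of the four powers cancel the factor [fr i ^ 2], two make the sum bounded, and the right
     side grows with n. *)
  destruct (kap_bound 4) as [M [HM H]]. pose proof Qsum_pos as HQ.
  destruct (INR_ge_exists (32 * M * Qsum)) as [n0 Hn0]. exists (n0 + 1)%nat; intros n Hn.
  specialize (Hn0 n ltac:(lia)). apply mu_lower_count; [lia|].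
  apply Rle_lt_trans with (16 * M * (2 * Qsum)).
  - apply Rle_trans with (sm (2 * n) (fun i => 16 * M * / INR (fr i) ^ 2)).
    + apply sm_le; intros i _. pose proof (fr_pos i). specialize (H i).
      replace (16 * M * / INR (fr i) ^ 2) with (16 * INR (fr i) ^ 2 * (M / INR (fr i) ^ 4)) by (field; lra).
      apply Rmult_le_compat_l; auto. pose proof (pow2_ge_0 (INR (fr i))). lra.
    + rewrite sm_scal. apply Rmult_le_compat_l; [lra|apply sm_fr_inv_sq].
  - assert (0 < 32 * M * Qsum) by (repeat apply Rmult_lt_0_compat; lra). nra.
Qed.

(** The counts put [mu (2k)] and [mu (2k+1)] within 1/2 of k + 1. Then the eigenfunction overlaps
    all other frequencies by at most half of its norm in total, so at least half lies on frequency k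
    + 1, and the residual of those two functions bounds the error. *)
Lemma mu_close_ev N : exists C k0, 0 < C /\ forall k j, (k0 <= k)%nat -> (j = 2 * k \/ j = 2 * k + 1)%nat ->
  (mu j - INR (S k)) ^ 2 <= C / INR (S k) ^ N.
Proof.
  destruct mu_upper_ev as [n1 Hup]. destruct mu_lower_ev as [n2 Hlow].
  destruct (kap_bound 4) as [M [HM H4]]. destruct (kap_bound N) as [C [HC HN]].
  pose proof Qsum_pos as HQ.
  destruct (INR_ge_exists (64 * M * Qsum)) as [n3 Hn3].
  exists (4 * C), (n1 + n2 + n3)%nat; split; [lra|]. intros k j Hk Hj.
  assert (J1 : INR k + / 2 < mu j).
  { eapply Rlt_le_trans; [apply (Hup k); lia|]. apply (mu_mono _ _ _ _ SC); lia. }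
  assert (J2 : mu j <= INR k + 3 / 2).
  { apply Rle_trans with (mu (2 * (S k) - 1)); [apply (mu_mono _ _ _ _ SC); lia|].
    pose proof (Hlow (S k) ltac:(lia)) as HL. rewrite S_INR in HL. lra. }
  specialize (Hn3 k ltac:(lia)). pose proof (INR_S_pos k) as HSk.
  (* The overlap with frequency l + 1 is at most [D / (l+1)^2]: for l < k from [cf_above] with gap
     of order k / l, for l > k from [cf_far] and the extra decay of [kap]. *)
  set (D := 16 * M / INR (S k) ^ 2).
  assert (HD : 0 < D) by (unfold D; apply Rdiv_lt_0_compat; [lra|now apply pow_lt]).
  assert (Hfar : forall l i, l <> k -> (i = 2 * l \/ i = 2 * l + 1)%nat -> cf i j ^ 2 <= D * / INR (S l) ^ 2).
  { intros l i Hlk Hi. assert (Ef : fr i = S l) by (destruct Hi as [-> | ->]; [apply fr_even|apply fr_odd]).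
    pose proof (H4 i) as K4. pose proof (Kt_bessel1 i j) as KB. rewrite Ef in K4. pose proof (INR_S_pos l) as HSl.
    destruct (lt_dec l k) as [Hl|Hl].
    - pose proof (cf_above k i j ltac:(lia) ltac:(lra)) as HA. rewrite Ef, <- (S_INR k) in HA.
      eapply Rle_trans; [exact HA|]. 
      apply Rle_trans with (16 * INR (S l) ^ 2 / INR (S k) ^ 2 * (M / INR (S l) ^ 4)).
      + apply Rmult_le_compat_l; [|lra]. apply Rmult_le_pos; [nra|].
        apply Rlt_le, Rinv_0_lt_compat, pow_lt; lra.
      + unfold D. right. field. lra.
    - assert (Hl' : INR (S k) <= INR l) by (apply le_INR; lia).
      assert (cf i j ^ 2 <= 4 * w (Kt i) (gm j) ^ 2).
      { apply cf_far. rewrite Ef, Rabs_minus_sym. eapply Rle_trans; [|apply Rle_abs].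
        rewrite !S_INR in *. lra. }
      apply Rle_trans with (4 * (M / INR (S l) ^ 4)); [lra|].
      unfold D. replace (16 * M / INR (S k) ^ 2 * / INR (S l) ^ 2) with (16 * (M / INR (S l) ^ 2) * / INR (S k) ^ 2) by (field; lra).
      replace (4 * (M / INR (S l) ^ 4)) with (4 * (M / INR (S l) ^ 2) * / INR (S l) ^ 2) by (field; lra).
      assert (0 < M / INR (S l) ^ 2) by (apply Rdiv_lt_0_compat; [lra|now apply pow_lt]).
      apply Rmult_le_compat; try lra.
      + apply Rlt_le, Rinv_0_lt_compat, pow_lt; lra.
      + apply Rinv_le_contravar; [apply pow_lt; lra|]. apply pow_incr. rewrite (S_INR l). lra. }
  assert (Hmean : w (gm j) (fun _ => 1) = 0) by apply (gm_mean _ _ _ _ SC).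
  pose proof (tb_parseval _ _ _ _ SC (gm j) (Hgm j) Hmean) as HP.
  rewrite (gm_on _ _ _ _ SC), Nat.eqb_refl in HP.
  set (ck := cf (2 * k) j ^ 2 + cf (2 * k + 1) j ^ 2).
  assert (Hck0 : 0 <= ck) by (unfold ck; pose proof (pow2_ge_0 (cf (2 * k) j)); pose proof (pow2_ge_0 (cf (2 * k + 1) j)); lra).
  assert (Hck : 1 <= ck + 2 * D * Qsum).
  { apply (series_le_bound _ _ _ HP). intros L.
    apply Rle_trans with (sm L (fun l => (if Nat.eqb l k then ck else 0) + 2 * D * / INR (S l) ^ 2)).
    - apply sm_le; intros l _. rewrite !(wip_sym p (gm j)). fold (cf (2 * l) j). fold (cf (2 * l + 1) j).
      pose proof (inv_sq_pos l). destruct (Nat.eqb_spec l k) as [->|Hlk].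
      + fold ck. nra.
      + pose proof (Hfar l (2 * l)%nat Hlk (or_introl eq_refl)).
        pose proof (Hfar l (2 * l + 1)%nat Hlk (or_intror eq_refl)). lra.
    - rewrite sm_plus, sm_scal. apply Rplus_le_compat.
      + destruct (lt_dec k L) as [HkL|HkL].
        * rewrite (sm_single L k (fun _ => ck)) by auto. lra.
        * rewrite (sm_ext _ _ (fun _ => 0)), sm_zero; auto.
          intros i Hi. destruct (Nat.eqb_spec i k); [lia|auto].
      + apply Rmult_le_compat_l; [lra|]. apply sm_series_le; [apply Qsum_series|]. intros; apply Rlt_le, inv_sq_pos. }
  assert (HDQ : 2 * D * Qsum <= / 2).
  { unfold D. assert (1 <= INR (S k)) by (rewrite S_INR; pose proof (pos_INR k); lra).
    apply Rmult_le_reg_r with (INR (S k) ^ 2); [apply pow_lt; lra|].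
    replace (2 * (16 * M / INR (S k) ^ 2) * Qsum * INR (S k) ^ 2) with (32 * M * Qsum) by (field; lra).
    rewrite S_INR in *. nra. }
  (* Together with [ck >= 1/2], from [Hck] and [HDQ], this bounds the squared distance by twice the
     sum of two residuals. *)
  assert (Hfin : (mu j - INR (S k)) ^ 2 * ck <= kap (2 * k) + kap (2 * k + 1)).
  { pose proof (Kt_bessel1 (2 * k) j) as B1. pose proof (Kt_bessel1 (2 * k + 1) j) as B2.
    rewrite Kt_gm, fr_even, Rpow_mult_distr in B1. rewrite Kt_gm, fr_odd, Rpow_mult_distr in B2.
    unfold ck. lra. }
  pose proof (HN (2 * k)%nat) as N1. pose proof (HN (2 * k + 1)%nat) as N2.
  rewrite fr_even in N1. rewrite fr_odd in N2.
  pose proof (pow2_ge_0 (mu j - INR (S k))) as Hsq.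
  replace (4 * C / INR (S k) ^ N) with (4 * (C / INR (S k) ^ N)) by (unfold Rdiv; ring). nra.
Qed.

Lemma finite_bound (f : nat -> R) n : exists C, 0 < C /\ forall i, (i < n)%nat -> f i <= C.
Proof.
  induction n as [|n [C [HC H]]]; [exists 1; split; [lra|intros; lia]|].
  exists (C + Rabs (f n)). pose proof (Rabs_pos (f n)). pose proof (Rle_abs (f n)). split; [lra|].
  intros i Hi. destruct (Nat.eq_dec i n) as [->|]; [lra|]. specialize (H i ltac:(lia)). lra.
Qed.

(** The estimate for squares is used with exponent N + N, and the finitely many indices before it
    takes effect are absorbed in the constant. *)
Theorem mu_asymptotics N : exists C, 0 < C /\ forall j, Rabs (mu j - INR (fr j)) <= C / INR (fr j) ^ N.
Proof.
  destruct (mu_close_ev (N + N)) as [C [k0 [HC H]]].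
  destruct (finite_bound (fun j => Rabs (mu j - INR (fr j)) * INR (fr j) ^ N) (2 * k0)) as [D [HD HDb]].
  exists (sqrt C + D). pose proof (sqrt_lt_R0 C HC). split; [lra|]. intros j.
  pose proof (fr_pos j) as Hf. assert (HP : 0 < INR (fr j) ^ N) by (apply pow_lt; lra).
  apply Rmult_le_reg_r with (INR (fr j) ^ N); auto.
  replace ((sqrt C + D) / INR (fr j) ^ N * INR (fr j) ^ N) with (sqrt C + D) by (field; lra).
  destruct (lt_dec j (2 * k0)) as [Hj|Hj]; [specialize (HDb j Hj); cbv beta in HDb; lra|].
  destruct (parity j) as [k Hk].
  assert (Ef : fr j = S k) by (destruct Hk as [-> | ->]; [apply fr_even|apply fr_odd]).
  pose proof (H k j ltac:(lia) Hk) as HB. rewrite <- Ef, pow_add in HB.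
  assert (Rabs (mu j - INR (fr j)) * INR (fr j) ^ N <= sqrt C); [|lra].
  rewrite <- (sqrt_Rsqr (Rabs (mu j - INR (fr j)) * INR (fr j) ^ N)).
  2: { apply Rmult_le_pos; [apply Rabs_pos|lra]. }
  apply sqrt_le_1_alt. unfold Rsqr.
  replace (Rabs (mu j - INR (fr j)) * INR (fr j) ^ N * (Rabs (mu j - INR (fr j)) * INR (fr j) ^ N))
    with (Rabs (mu j - INR (fr j)) ^ 2 * (INR (fr j) ^ N * INR (fr j) ^ N)) by ring.
  rewrite pow2_abs. apply Rle_trans with (C / (INR (fr j) ^ N * INR (fr j) ^ N) * (INR (fr j) ^ N * INR (fr j) ^ N)).
  - apply Rmult_le_compat_r; [nra|exact HB].
  - right. field. lra.
Qed.

(** Without residuals both counts hold for every n, so [mu j] lies within 1/2 of [fr j]. As [gm j]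
    overlaps some [tb i], its eigenvalue is exactly an integer [fr i], and only one integer is
    left. *)
Theorem mu_exact : (forall i, kap i = 0) -> forall j, mu j = INR (fr j).
Proof.
  intros HK j. destruct (parity j) as [k Hk].
  assert (Ef : fr j = S k) by (destruct Hk as [-> | ->]; [apply fr_even|apply fr_odd]).
  assert (J1 : INR k + / 2 < mu j).
  { apply Rlt_le_trans with (mu (2 * k)); [|apply (mu_mono _ _ _ _ SC); lia].
    apply (mu_upper_count k 0); try lra. intros l _. rewrite !HK. unfold Rdiv. rewrite Rmult_0_l. lra. }
  assert (J2 : mu j <= INR (S k) + / 2).
  { apply Rle_trans with (mu (2 * (S k) - 1)); [apply (mu_mono _ _ _ _ SC); lia|].
    apply mu_lower_count; [lia|]. rewrite (sm_ext _ _ (fun _ => 0)), sm_zero by (intros; rewrite HK; ring).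
    apply pow_lt. pose proof (pos_INR (S k)). lra. }
  assert (Hcf : forall i, (mu j - INR (fr i)) * cf i j = 0).
  { intros i. rewrite <- Kt_gm. pose proof (Kt_bessel1 i j) as HB. rewrite HK in HB.
    pose proof (pow2_ge_0 (w (Kt i) (gm j))). nra. }
  destruct (classic (exists i, cf i j <> 0)) as [[i Hi]|HN].
  - specialize (Hcf i). apply Rmult_integral in Hcf. destruct Hcf as [E|E]; [|contradiction].
    assert (E' : mu j = INR (fr i)) by lra. rewrite E' in *. rewrite S_INR in J2.
    f_equal. rewrite Ef. assert (INR k < INR (fr i)) by lra. assert (INR (fr i) < INR (S (S k))) by (rewrite !S_INR; lra).
    apply INR_lt in H, H0. lia.
  - exfalso. assert (Hmean : w (gm j) (fun _ => 1) = 0) by apply (gm_mean _ _ _ _ SC).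
    pose proof (tb_parseval _ _ _ _ SC (gm j) (Hgm j) Hmean) as HP.
    rewrite (gm_on _ _ _ _ SC), Nat.eqb_refl in HP.
    assert (Z : forall i, w (gm j) (tb i) = 0).
    { intros i. rewrite wip_sym. destruct (Req_dec (cf i j) 0) as [E|E]; [exact E|exfalso; apply HN; now exists i]. }
    assert (1 <= 0); [|lra]. apply (series_le_bound _ _ _ HP). intros L.
    rewrite (sm_ext _ _ (fun _ => 0)), sm_zero; [lra|]. intros; rewrite !Z; ring.
Qed.

End Asymptotics.

(** * Lower bound for products of eigenvalues *)

Lemma pd_le_exp m f : (forall i, (i < m)%nat -> 0 <= f i) -> pd m (fun i => 1 + f i) <= exp (sm m f).
Proof.
  induction m; simpl; intros H; [rewrite exp_0; lra|].
  rewrite exp_plus. apply Rmult_le_compat.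
  - apply Rlt_le, pd_pos. intros i Hi. specialize (H i ltac:(lia)). lra.
  - specialize (H m ltac:(lia)). lra.
  - apply IHm; auto.
  - apply exp_ineq1_le.
Qed.

Lemma blockJ_col s m j f : (prt j < m)%nat ->
  sm m (fun l => f l * blockJ s l j) = f (prt j) * (sg (prt j) * s (prt j)).
Proof.
  intros H. rewrite <- (sm_single m (prt j) (fun l => f l * (sg l * s l)) H).
  apply sm_ext; intros l _. unfold blockJ.
  destruct (Nat.eqb_spec j (prt l)) as [E1|E1], (Nat.eqb_spec l (prt j)) as [E2|E2]; try ring.
  - exfalso; apply E2. now rewrite E1, prt_invol.
  - exfalso; apply E1. now rewrite E2, prt_invol.
Qed.

Lemma Rabs_sg i : Rabs (sg i) = 1.
Proof. unfold sg, Rabs. destruct (Nat.even i), (Rcase_abs _); lra. Qed.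

(* Factor the block matrix out on the right and use that [1 + Y] has determinant near 1. *)
Lemma mdet_perturb_blockJ n (s v : nat -> R) (E : nat -> nat -> R) eta :
  0 <= eta -> (forall i, 1 <= s i) -> (forall i, 0 <= v i) -> (forall i, v (prt i) = v i) ->
  (forall k l, (k < 2 * n)%nat -> (l < 2 * n)%nat -> Rabs (E k l) <= eta * (v k * v l)) ->
  pd (2 * n) s * (2 - exp (eta * sm (2 * n) v * sm (2 * n) v))
    <= Rabs (mdet (2 * n) (fun k l => blockJ s k l + E k l)).
Proof.
  intros He Hs Hv Hvp HE. set (m := (2 * n)%nat) in *.
  (* This is [E] times the inverse of [blockJ s]. *)
  pose (Y := fun k l => E k (prt l) * (sg l * / s l)).
  assert (EZ : mdet m (fun k l => blockJ s k l + E k l)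
    = mdet m (fun i j => (if Nat.eqb i j then 1 else 0) + Y i j) * mdet m (blockJ s)).
  { rewrite <- RealDet.mdet_mul. apply RealDet.mdet_ext. intros k l Hk Hl.
    rewrite (blockJ_col s m l (fun l0 => (if Nat.eqb k l0 then 1 else 0) + Y k l0)) by now apply prt_lt.
    unfold Y. rewrite prt_invol. specialize (Hs (prt l)).
    replace (((if Nat.eqb k (prt l) then 1 else 0) + E k l * (sg (prt l) * / s (prt l))) * (sg (prt l) * s (prt l)))
      with ((if Nat.eqb k (prt l) then 1 else 0) * (sg (prt l) * s (prt l))
           + E k l * (sg (prt l) * sg (prt l))) by (field; lra).
    rewrite sg_sq, Rmult_1_r. f_equal. unfold blockJ.
    destruct (Nat.eqb_spec l (prt k)) as [E1|E1], (Nat.eqb_spec k (prt l)) as [E2|E2].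
    - rewrite <- E2. ring.
    - exfalso; apply E2. now rewrite E1, prt_invol.
    - exfalso; apply E1. now rewrite E2, prt_invol.
    - ring. }
  assert (EB : Rabs (mdet m (blockJ s)) = pd m s) by (apply mdet_blockJ; intros i; specialize (Hs i); lra).
  rewrite EZ, Rabs_mult, EB.
  assert (Ps : 0 < pd m s) by (apply pd_pos; intros i _; specialize (Hs i); lra).
  rewrite Rmult_comm. apply Rmult_le_compat_r; [lra|].
  pose proof (RealDet.mdet_near1 m Y) as HN.
  set (D := mdet m (fun i j => (if Nat.eqb i j then 1 else 0) + Y i j)) in *.
  assert (HY : forall k l, (k < m)%nat -> (l < m)%nat -> Rabs (Y k l) <= eta * (v k * v l)).
  { intros k l Hk Hl. unfold Y. rewrite !Rabs_mult.
    rewrite Rabs_sg. specialize (Hs l). rewrite (Rabs_right (/ s l)) by (apply Rle_ge, Rlt_le, Rinv_0_lt_compat; lra).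
    pose proof (HE k (prt l) Hk (prt_lt n l Hl)) as HB. rewrite Hvp in HB.
    assert (0 < / s l <= 1).
    { split; [apply Rinv_0_lt_compat; lra|]. rewrite <- Rinv_1. apply Rinv_le_contravar; lra. }
    pose proof (Rabs_pos (E k (prt l))). nra. }
  set (S := sm m v). assert (HS : 0 <= S) by (apply sm_ge0; auto).
  assert (HP : pd m (fun i => 1 + sm m (fun j => Rabs (Y i j))) <= exp (eta * S * S)).
  { apply Rle_trans with (pd m (fun i => 1 + eta * S * v i)).
    - apply pd_le. intros i Hi. assert (H0 : 0 <= sm m (fun j => Rabs (Y i j))) by (apply sm_ge0; intros; apply Rabs_pos).
      split; [lra|]. apply Rplus_le_compat_l.
      apply Rle_trans with (sm m (fun j => (eta * v i) * v j)).
      + apply sm_le; intros j Hj. specialize (HY i j Hi Hj). lra.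
      + rewrite sm_scal. fold S. lra.
    - replace (eta * S * S) with (sm m (fun i => eta * S * v i)) by (rewrite sm_scal; reflexivity).
      apply pd_le_exp. intros i _. repeat apply Rmult_le_pos; auto. }
  apply Rabs_le_between in HN. pose proof (Rle_abs D). lra.
Qed.

Section LowerProduct.
Variables (phi p : R -> R) (g : nat -> R -> R) (lam : nat -> R).
Hypothesis SC : spectral phi p g lam.

Let CM : circle_map phi p := sc_cm _ _ _ _ SC.
Let Cp : cont p := cm_cont_p _ _ CM.
Notation w := (wip p).
Notation tb := (tb phi).
Notation gm := (gm g).
Notation mu := (mu lam).
Notation cf := (cf phi p g).
Notation Kt := (Kt phi p).
Notation kap := (kap phi p).

Let Htb i : sp (tb i) := tb_sp _ _ _ _ SC i.
Let Hgm j : sp (gm j) := gm_sp _ _ _ _ SC j.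
Let Hmu j : 0 < mu j := mu_pos _ _ _ _ SC j.
Let HKt i : cont (Kt i) := Kt_cont _ _ _ _ SC i.
#[local] Hint Resolve Cp sp_cont Htb Hgm HKt : core.

(** The orthogonal projection of [tb i] onto the first m eigenfunctions, with remainder [dd].
    Eigenfunctions are orthogonal for [q] too, so the splitting is orthogonal for both forms. *)
Definition pr (m i : nat) : R -> R := comb m (cf i) gm.
Definition dd (m i : nat) (t : R) : R := tb i t + (-1) * pr m i t.

Lemma pr_sp m i : sp (pr m i).
Proof. apply comb_sp; auto. Qed.

Lemma dd_sp m i : sp (dd m i).
Proof. unfold dd. apply sp_plus; auto. apply sp_scal, pr_sp. Qed.
#[local] Hint Resolve pr_sp dd_sp : core.

Lemma pr_gm m i j : (j < m)%nat -> w (pr m i) (gm j) = cf i j.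
Proof.
  intros Hj. unfold pr. rewrite (wip_comb_l _ _ _ _ SC) by auto.
  rewrite (sm_ext _ _ (fun l => if Nat.eqb l j then cf i l else 0)); [now apply sm_single|].
  intros l _. rewrite (gm_on _ _ _ _ SC). destruct (Nat.eqb l j); ring.
Qed.

Lemma dd_gm m i j : (j < m)%nat -> w (dd m i) (gm j) = 0.
Proof.
  intros Hj. unfold dd. rewrite (wip_lin_l _ _ _ _ SC), pr_gm by auto. rewrite ?cf_def. ring.
Qed.

Lemma dd_pr m i k : w (dd m i) (pr m k) = 0.
Proof.
  unfold pr. rewrite (wip_comb_r _ _ _ _ SC) by auto. rewrite (sm_ext _ _ (fun _ => 0)), sm_zero; auto.
  intros l Hl. rewrite dd_gm by auto. ring.
Qed.

Lemma dd_tb m i k : w (dd m i) (tb k) = w (dd m i) (dd m k).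
Proof.
  unfold dd at 3. rewrite (wip_lin_r _ _ _ _ SC), dd_pr by auto. ring.
Qed.

(** Only eigenfunctions of index 2n and beyond contribute, and their eigenvalues are at least n +
    1/2, above the frequency of [tb i]. *)
Lemma dd_norm n i : (fr i <= n)%nat -> INR n + / 2 <= mu (2 * n) ->
  w (dd (2 * n) i) (dd (2 * n) i) <= 16 * INR (fr i) ^ 2 / (INR n + 1) ^ 2 * kap i.
Proof.
  intros Hi Hn. set (m := (2 * n)%nat) in *.
  assert (E0 : w (dd m i) (fun _ => 1) = 0).
  { unfold dd. rewrite (wip_lin_l _ _ _ _ SC) by (auto using cont_const).
    rewrite (tb_mean _ _ _ _ SC). unfold pr. rewrite (comb_mean _ _ _ _ SC); auto; [ring|].
    apply (gm_mean _ _ _ _ SC). }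
  pose proof (gm_parseval _ _ _ _ SC _ (dd_sp m i) E0) as HP.
  apply (series_le_bound _ _ _ HP). intros L.
  set (c := 16 * INR (fr i) ^ 2 / (INR n + 1) ^ 2).
  assert (Hc : 0 <= c).
  { unfold c. apply Rmult_le_pos; [pose proof (pow2_ge_0 (INR (fr i))); lra|].
    apply Rlt_le, Rinv_0_lt_compat, pow_lt. pose proof (pos_INR n). lra. }
  apply Rle_trans with (sm L (fun j => c * w (Kt i) (gm j) ^ 2)).
  - apply sm_le; intros j _. destruct (lt_dec j m) as [Hj|Hj].
    + rewrite dd_gm by auto. rewrite pow_ne_zero by lia. apply Rmult_le_pos; [auto|apply pow2_ge_0].
    + replace (w (dd m i) (gm j)) with (cf i j).
      * apply (cf_above _ _ _ _ SC); auto. eapply Rle_trans; [exact Hn|]. apply (mu_mono _ _ _ _ SC). lia.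
      * unfold dd. rewrite (wip_lin_l _ _ _ _ SC) by auto. unfold pr. rewrite (wip_comb_l _ _ _ _ SC) by auto.
        rewrite (sm_ext _ _ (fun _ => 0)), sm_zero; [rewrite ?cf_def; ring|].
        intros l Hl. rewrite (gm_on _ _ _ _ SC). destruct (Nat.eqb_spec l j); [lia|ring].
  - rewrite sm_scal. apply Rmult_le_compat_l; auto. apply (Kt_bessel _ _ _ _ SC).
Qed.

(** The projected part is [q]-orthogonal to [dd], which leaves [q (tb i) (dd m i)]; the residual
    [Kt] then replaces [Lambda] by multiplication with the frequency. *)
Lemma q_dd m i : q (dd m i) (dd m i) = INR (fr i) * w (dd m i) (dd m i) + w (Kt i) (dd m i).
Proof.
  assert (Ep : q (pr m i) (dd m i) = 0).
  { unfold pr. rewrite (bilinear_comb_l q q_lin_l) by auto.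
    rewrite (sm_ext _ _ (fun _ => 0)), sm_zero; auto. intros l Hl.
    rewrite (q_gm _ _ _ _ SC), (wip_sym p (gm l)), dd_gm by auto. ring. }
  assert (Eq : q (dd m i) (dd m i) = q (tb i) (dd m i)).
  { unfold dd at 1. rewrite q_lin_l, Ep by auto. ring. }
  rewrite Eq, (Kt_wip _ _ _ _ SC) by auto. rewrite (wip_sym p (tb i)), dd_tb. ring.
Qed.

(** Scaling f by [/ a] and h by [/ b] balances the energies before the area inequality is used; the
    sign c gives both bounds. The summand 0 only brings the functions into the shape of the
    linearity lemmas. *)
Lemma omega_abs_le f h e a b : sp f -> sp h -> 0 < a -> 0 < b -> q f f <= e * a ^ 2 -> q h h <= e * b ^ 2 ->
  Rabs (omega f h) <= e * (a * b).
Proof.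
  intros F H Ha Hb Qf Qh.
  assert (HP : forall c, c * c = 1 -> 2 * (c * omega f h) <= 2 * (e * (a * b))).
  { intros c Hc.
    pose proof (omega_le_q (fun t => 0 + / a * f t) (fun t => 0 + c / b * h t)
      (sp_plus _ _ (sp_const 0) (sp_scal _ _ F)) (sp_plus _ _ (sp_const 0) (sp_scal _ _ H))) as HO.
    rewrite (omega_lin_l (fun _ => 0) f) in HO by (auto using sp_const, sp_plus, sp_scal).
    rewrite (omega_lin_r f (fun _ => 0) h) in HO by (auto using sp_const).
    rewrite (q_lin_l (fun _ => 0) f) in HO by (auto using sp_const, sp_plus, sp_scal).
    rewrite (q_lin_r f (fun _ => 0) f) in HO by (auto using cont_const).
    rewrite (q_lin_l (fun _ => 0) h) in HO by (auto using sp_const, sp_plus, sp_scal).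
    rewrite (q_lin_r h (fun _ => 0) h) in HO by (auto using cont_const).
    assert (Zl : forall k, sp k -> q (fun _ => 0) k = 0) by (intros; apply (bilinear_zero_l q q_lin_l); auto).
    assert (Zr : forall k, sp k -> q k (fun _ => 0) = 0) by (intros k K; rewrite q_sym; auto using sp_const).
    assert (Ol : forall k, sp k -> omega (fun _ => 0) k = 0) by (intros; apply (bilinear_zero_l omega omega_lin_l); auto).
    assert (Or : forall k, sp k -> omega k (fun _ => 0) = 0) by (intros; apply (bilinear_zero_r omega omega_lin_r); auto).
    rewrite !Zl, !Zr, Ol, Or in HO by (auto using sp_const, sp_plus, sp_scal).
    assert (H1 : / a * (/ a * q f f) <= e).
    { apply Rmult_le_reg_r with (a ^ 2); [now apply pow_lt|].
      replace (/ a * (/ a * q f f) * a ^ 2) with (q f f) by (field; lra). exact Qf. }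
    assert (H2 : c / b * (c / b * q h h) <= e).
    { apply Rmult_le_reg_r with (b ^ 2); [now apply pow_lt|].
      replace (c / b * (c / b * q h h) * b ^ 2) with ((c * c) * q h h) by (field; lra). rewrite Hc. lra. }
    assert (H3 : 2 * (/ a * (c / b * omega f h)) <= 2 * e) by lra.
    apply (Rmult_le_compat_r (a * b)) in H3; [|nra].
    replace (2 * (/ a * (c / b * omega f h)) * (a * b)) with (2 * (c * omega f h)) in H3 by (field; split; lra). lra. }
  pose proof (HP 1 ltac:(ring)). pose proof (HP (-1) ltac:(ring)). apply Rabs_le. lra.
Qed.

Lemma wip_abs_le f h e a b : cont f -> cont h -> 0 <= e -> 0 < a -> 0 < b -> w f f <= e * a ^ 2 -> w h h <= e * b ^ 2 ->
  Rabs (w f h) <= e * (a * b).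
Proof.
  intros F H He Ha Hb Wf Wh. pose proof (wip_cauchy_schwarz _ _ _ _ SC f h F H) as CS.
  pose proof (wip_ge0 _ _ _ _ SC f F). pose proof (wip_ge0 _ _ _ _ SC h H).
  assert (Hab : 0 < a * b) by nra.
  rewrite <- (Rabs_right (e * (a * b))) by nra. apply Rsqr_le_abs_0. unfold Rsqr.
  apply Rle_trans with (w f f * w h h); [lra|].
  replace (e * (a * b) * (e * (a * b))) with ((e * a ^ 2) * (e * b ^ 2)) by ring.
  apply Rmult_le_compat; auto.
Qed.

Lemma omega_tb f l : cont f -> omega f (tb l) = - (sg l * INR (fr l)) * w f (tb (prt l)).
Proof.
  intros F. unfold omega, wip. rewrite <- ig_scal by (pose proof (sp_cont _ (Htb (prt l))); ct).
  apply ig_ext; intros t. rewrite (is_derive_unique _ _ _ (tb_derive _ _ _ _ SC l t)). ring.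
Qed.

Lemma omega_tb_tb k l : omega (tb k) (tb l) = blockJ (fun i => INR (fr i)) k l.
Proof.
  rewrite omega_tb by auto. rewrite (tb_on _ _ _ _ SC). unfold blockJ.
  destruct (Nat.eqb_spec l (prt k)) as [E1|E1], (Nat.eqb_spec k (prt l)) as [E2|E2].
  - rewrite E1, sg_prt, fr_prt. ring.
  - exfalso; apply E2. now rewrite E1, prt_invol.
  - exfalso; apply E1. now rewrite E2, prt_invol.
  - ring.
Qed.

(** The matrix factors as [cf Om cf^T] with [Om] the area form on eigenfunctions. By Bessel's
    inequality [cf] is a contraction, and on eigenfunctions [q] is diagonal with entries [mu], so
    the area inequality bounds [det Om]. *)
Lemma omega_pr_abs m : Rabs (mdet m (fun k l => omega (pr m k) (pr m l))) <= pd m mu.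
Proof.
  set (Om := fun i j => omega (gm i) (gm j)).
  assert (E : mdet m (fun k l => omega (pr m k) (pr m l)) = mdet m cf * mdet m Om * mdet m cf).
  { rewrite <- (RealDet.mdet_tr m cf) at 2. rewrite Rmult_assoc, <- !RealDet.mdet_mul.
    apply RealDet.mdet_ext. intros k l _ _. unfold pr. rewrite omega_comb by auto.
    apply sm_ext; intros i _. rewrite <- sm_scal. apply sm_ext; intros j _. unfold Om. ring. }
  assert (HC : Rabs (mdet m cf) <= 1).
  { apply RealDet.mdet_contraction. intros x. rewrite <- (tb_comb_sq _ _ _ _ SC m x).
    rewrite (sm_ext _ _ (fun j => w (comb m x tb) (gm j) ^ 2)).
    - apply (gm_bessel _ _ _ _ SC). apply sp_cont, comb_sp; auto.
    - intros j _. rewrite (wip_comb_l _ _ _ _ SC) by auto. reflexivity. }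
  assert (HO : Rabs (mdet m Om) <= pd m mu).
  { rewrite <- RealDet.mdet_diag.
    set (Q := fun i j => if Nat.eqb i j then mu i else 0).
    assert (FQ : forall x, bform m Q x x = q (comb m x gm) (comb m x gm)).
    { intros x. rewrite q_comb by auto. unfold bform. apply sm_ext; intros i _. apply sm_ext; intros j _.
      unfold Q. rewrite (q_gm _ _ _ _ SC), (gm_on _ _ _ _ SC) by auto. destruct (Nat.eqb i j); ring. }
    assert (FQ2 : forall x, bform m Q x x = sm m (fun i => mu i * x i ^ 2)).
    { intros x. unfold bform. apply sm_ext; intros i Hi.
      rewrite (sm_ext _ _ (fun j => if Nat.eqb j i then x i * x j * mu i else 0)).
      - rewrite (sm_single m i (fun j => x i * x j * mu i)) by auto. ring.
      - intros j _. unfold Q. rewrite Nat.eqb_sym. destruct (Nat.eqb j i); ring. }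
    apply RealDet.mdet_pairing.
    - intros i j. unfold Q. rewrite Nat.eqb_sym. destruct (Nat.eqb_spec j i) as [->|]; auto.
    - intros x [i [Hi Hx]]. rewrite FQ2.
      apply Rlt_le_trans with (mu i * x i ^ 2).
      + apply Rmult_lt_0_compat; [apply Hmu|]. simpl. nra.
      + apply (sm_term_le m (fun i => mu i * x i ^ 2)); auto. intros j _.
        apply Rmult_le_pos; [apply Rlt_le, Hmu|apply pow2_ge_0].
    - intros x y. rewrite !FQ. replace (bform m Om y x) with (omega (comb m y gm) (comb m x gm)) by now apply omega_comb.
      pose proof (omega_le_q (comb m y gm) (comb m x gm) (comb_sp m y gm Hgm) (comb_sp m x gm Hgm)). lra. }
  rewrite E, !Rabs_mult. pose proof (Rabs_pos (mdet m cf)). pose proof (Rabs_pos (mdet m Om)).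
  assert (Rabs (mdet m cf) * Rabs (mdet m Om) <= 1 * pd m mu) by (apply Rmult_le_compat; auto).
  nra.
Qed.

Lemma fr_le n i : (i < 2 * n)%nat -> (fr i <= n)%nat.
Proof.
  intros H. destruct (parity i) as [k [-> | ->]]; rewrite ?fr_even, ?fr_odd; lia.
Qed.

(** On the functions [tb] the area form is exactly [blockJ fr], of determinant [prod fr] up to sign.
    Replacing [tb] by [pr] perturbs it by entries of order [v k * v l / n] with v summable, so the
    determinant changes by a factor tending to 1. *)
Theorem prod_mu_ge : exists C n0, 0 < C /\ forall n, (n0 <= n)%nat ->
  pd (2 * n) (fun i => INR (fr i)) * (2 - exp (C / (INR n + 1))) <= pd (2 * n) mu.
Proof.
  (* Ten powers are enough: two are lost in [dd_norm], the rest is halved by taking square roots,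
     and one more is lost to the derivative in [omega]; at least two must remain for summability. *)
  destruct (mu_upper_ev _ _ _ _ SC) as [n0 Hn0]. destruct (kap_bound _ _ _ _ SC 10) as [M [HM HK]].
  pose proof Qsum_pos as HQ.
  exists (52 * M * (2 * Qsum) * (2 * Qsum)), n0. split; [repeat apply Rmult_lt_0_compat; lra|]. intros n Hn.
  specialize (Hn0 n Hn). set (m := (2 * n)%nat) in *.
  pose proof (pos_INR n) as Pn. set (N := INR n + 1) in *. assert (HN : 1 <= N) by (unfold N; lra).
  eapply Rle_trans; [|apply (omega_pr_abs m)].
  set (E := fun k l => omega (pr m k) (pr m l) - blockJ (fun i => INR (fr i)) k l).
  rewrite (RealDet.mdet_ext m _ (fun k l => blockJ (fun i => INR (fr i)) k l + E k l)) by (intros; unfold E; ring).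
  pose (v := fun i => / INR (fr i) ^ 2).
  assert (Hv : forall i, 0 < v i) by (intros i; apply Rinv_0_lt_compat, pow_lt; pose proof (fr_pos i); lra).
  assert (HB : forall i, (i < m)%nat ->
     w (dd m i) (dd m i) <= 16 * M / N ^ 2 * (/ INR (fr i) ^ 4) ^ 2 /\ q (dd m i) (dd m i) <= 20 * M / N * (/ INR (fr i) ^ 3) ^ 2).
  { intros i Hi. pose proof (fr_pos i) as Hf. set (k := INR (fr i)) in *.
    assert (Hk0 : 0 < k) by lra.
    assert (HW : w (dd m i) (dd m i) <= 16 * M / N ^ 2 * (/ k ^ 4) ^ 2).
    { eapply Rle_trans; [apply (dd_norm n i); [now apply fr_le|fold m; lra]|]. fold k. fold N.
      apply Rle_trans with (16 * k ^ 2 / N ^ 2 * (M / k ^ 10)).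
      - apply Rmult_le_compat_l; [|apply HK]. apply Rmult_le_pos; [nra|apply Rlt_le, Rinv_0_lt_compat, pow_lt; lra].
      - right. field. lra. }
    split; [exact HW|]. rewrite q_dd. fold k.
    assert (HX : Rabs (w (Kt i) (dd m i)) <= 4 * M / N * / k ^ 9).
    { pose proof (wip_cauchy_schwarz _ _ _ _ SC (Kt i) (dd m i) (HKt i) (sp_cont _ (dd_sp m i))) as CS.
      assert (HR : 0 <= 4 * M / N * / k ^ 9).
      { apply Rmult_le_pos; [apply Rlt_le, Rdiv_lt_0_compat; lra|apply Rlt_le, Rinv_0_lt_compat, pow_lt; lra]. }
      rewrite <- (Rabs_right (4 * M / N * / k ^ 9)) by lra. apply Rsqr_le_abs_0. unfold Rsqr.
      apply Rle_trans with (w (Kt i) (Kt i) * w (dd m i) (dd m i)); [lra|].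
      replace (4 * M / N * / k ^ 9 * (4 * M / N * / k ^ 9)) with ((M / k ^ 10) * (16 * M / N ^ 2 * (/ k ^ 4) ^ 2))
        by (field; split; lra).
      apply Rmult_le_compat; auto; [apply (wip_ge0 _ _ _ _ SC), HKt|apply (wip_ge0 _ _ _ _ SC); auto|apply HK]. }
    pose proof (Rle_abs (w (Kt i) (dd m i))) as HA.
    assert (H1 : k * w (dd m i) (dd m i) <= 16 * M / N * (/ k ^ 3) ^ 2).
    { apply Rle_trans with (k * (16 * M / N ^ 2 * (/ k ^ 4) ^ 2)); [apply Rmult_le_compat_l; lra|].
      replace (k * (16 * M / N ^ 2 * (/ k ^ 4) ^ 2)) with (16 * M / N * (/ k ^ 3) ^ 2 * (/ N * / k)) by (field; split; lra).
      rewrite <- (Rmult_1_r (16 * M / N * (/ k ^ 3) ^ 2)) at 2. apply Rmult_le_compat_l.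
      - apply Rmult_le_pos; [apply Rlt_le, Rdiv_lt_0_compat; lra|apply pow2_ge_0].
      - rewrite <- Rinv_mult, <- Rinv_1. apply Rinv_le_contravar; nra. }
    assert (H2 : 4 * M / N * / k ^ 9 <= 4 * M / N * (/ k ^ 3) ^ 2).
    { apply Rmult_le_compat_l; [apply Rlt_le, Rdiv_lt_0_compat; lra|].
      replace ((/ k ^ 3) ^ 2) with (/ k ^ 6) by (field; lra).
      apply Rinv_le_contravar; [apply pow_lt; lra|]. apply Rle_pow; [lra|lia]. }
    replace (20 * M / N * (/ k ^ 3) ^ 2) with (16 * M / N * (/ k ^ 3) ^ 2 + 4 * M / N * (/ k ^ 3) ^ 2) by (field; split; lra).
    lra. }
  assert (Hpow : forall i a, (2 <= a)%nat -> 0 < / INR (fr i) ^ a <= v i).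
  { intros i a Ha. pose proof (fr_pos i). split; [apply Rinv_0_lt_compat, pow_lt; lra|].
    apply Rinv_le_contravar; [apply pow_lt; lra|]. apply Rle_pow; [lra|auto]. }
  assert (HMN : 0 < M / N) by (apply Rdiv_lt_0_compat; lra).
  assert (Hdt : forall k l, (k < m)%nat -> (l < m)%nat -> Rabs (omega (dd m k) (tb l)) <= 16 * (M / N) * (v k * v l)).
  { intros k l Hk Hl. rewrite omega_tb by auto. rewrite dd_tb.
    destruct (HB k Hk) as [W1 _]. destruct (HB (prt l) (prt_lt n l Hl)) as [W2 _]. rewrite fr_prt in W2.
    pose proof (fr_pos k) as F1. pose proof (fr_pos l) as F2.
    assert (P1 : 0 < / INR (fr k) ^ 4) by (apply Rinv_0_lt_compat, pow_lt; lra).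
    assert (P2 : 0 < / INR (fr l) ^ 4) by (apply Rinv_0_lt_compat, pow_lt; lra).
    assert (HW : Rabs (w (dd m k) (dd m (prt l))) <= 16 * M / N ^ 2 * (/ INR (fr k) ^ 4 * / INR (fr l) ^ 4)).
    { apply wip_abs_le; auto. apply Rlt_le, Rdiv_lt_0_compat; [lra|apply pow_lt; lra]. }
    rewrite Rabs_mult, Rabs_Ropp, Rabs_mult.
    rewrite Rabs_sg, Rmult_1_l, (Rabs_right (INR (fr l))) by lra.
    eapply Rle_trans; [apply Rmult_le_compat_l; [lra|exact HW]|].
    replace (INR (fr l) * (16 * M / N ^ 2 * (/ INR (fr k) ^ 4 * / INR (fr l) ^ 4)))
      with (16 * (M / N) * (/ INR (fr k) ^ 4 * / INR (fr l) ^ 3) * / N) by (field; repeat split; lra).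
    destruct (Hpow k 4%nat ltac:(lia)) as [A1 A2]. destruct (Hpow l 3%nat ltac:(lia)) as [B1 B2].
    assert (/ INR (fr k) ^ 4 * / INR (fr l) ^ 3 <= v k * v l) by (apply Rmult_le_compat; lra).
    assert (0 < / N <= 1) by (split; [apply Rinv_0_lt_compat; lra|rewrite <- Rinv_1; apply Rinv_le_contravar; lra]).
    assert (0 <= / INR (fr k) ^ 4 * / INR (fr l) ^ 3) by nra.
    assert (0 <= 16 * (M / N) * (/ INR (fr k) ^ 4 * / INR (fr l) ^ 3)) by nra.
    apply Rle_trans with (16 * (M / N) * (/ INR (fr k) ^ 4 * / INR (fr l) ^ 3)); nra. }
  assert (HE : forall k l, (k < m)%nat -> (l < m)%nat -> Rabs (E k l) <= 52 * (M / N) * (v k * v l)).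
  { intros k l Hk Hl.
    assert (Epr : forall i, pr m i = fun t => tb i t + (-1) * dd m i t).
    { intros i. apply functional_extensionality; intros t. unfold dd. ring. }
    (* Expansion of [omega (tb k - dd k) (tb l - dd l)]. The two mixed terms contribute 16 each and
       the last one 20, hence the constant 52. *)
    assert (EE : E k l = - omega (dd m k) (tb l) + (omega (dd m l) (tb k) + omega (dd m k) (dd m l))).
    { unfold E. rewrite <- omega_tb_tb, !Epr, omega_lin_l, !omega_lin_r by (auto using sp_plus, sp_scal).
      rewrite (omega_anti (tb k) (dd m l)) by auto. ring. }
    assert (HD : Rabs (omega (dd m k) (dd m l)) <= 20 * M / N * (/ INR (fr k) ^ 3 * / INR (fr l) ^ 3)).
    { pose proof (fr_pos k). pose proof (fr_pos l).
      apply omega_abs_le; auto; try (apply Rinv_0_lt_compat, pow_lt; lra); apply HB; auto. }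
    destruct (Hpow k 3%nat ltac:(lia)) as [A1 A2]. destruct (Hpow l 3%nat ltac:(lia)) as [B1 B2].
    assert (HV : / INR (fr k) ^ 3 * / INR (fr l) ^ 3 <= v k * v l) by (apply Rmult_le_compat; lra).
    assert (HD2 : Rabs (omega (dd m k) (dd m l)) <= 20 * (M / N) * (v k * v l)).
    { eapply Rle_trans; [exact HD|]. replace (20 * M / N) with (20 * (M / N)) by (unfold Rdiv; ring).
      apply Rmult_le_compat_l; [lra|exact HV]. }
    pose proof (Hdt k l Hk Hl) as T1. pose proof (Hdt l k Hl Hk) as T2.
    rewrite EE. eapply Rle_trans; [apply Rabs_triang|]. rewrite Rabs_Ropp.
    pose proof (Rabs_triang (omega (dd m l) (tb k)) (omega (dd m k) (dd m l))). lra. }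
  assert (HS : 0 <= sm m v <= 2 * Qsum).
  { split; [apply sm_ge0; intros; apply Rlt_le, Hv|]. apply sm_fr_inv_sq. }
  eapply Rle_trans; [|apply (mdet_perturb_blockJ n (fun i => INR (fr i)) v E (52 * (M / N)))]; auto.
  - fold m. apply Rmult_le_compat_l.
    + apply Rlt_le, pd_pos. intros i _. pose proof (fr_pos i). lra.
    + apply Rplus_le_compat_l, Ropp_le_contravar.
      assert (HL : 52 * (M / N) * sm m v * sm m v <= 52 * M * (2 * Qsum) * (2 * Qsum) / N).
      { replace (52 * M * (2 * Qsum) * (2 * Qsum) / N) with (52 * (M / N) * ((2 * Qsum) * (2 * Qsum))) by (unfold Rdiv; ring).
        rewrite Rmult_assoc. apply Rmult_le_compat_l; [lra|]. apply Rmult_le_compat; lra. }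
      destruct HL as [HL|HL]; [left; now apply exp_increasing|right; now rewrite HL].
  - lra.
  - apply fr_pos.
  - intros i. apply Rlt_le, Hv.
  - intros i. unfold v. now rewrite fr_prt.
Qed.

End LowerProduct.

(** * Goursat's theorem for rectangles *)

(* At (x, y) both P and Q are differentiable, and dP/dy = dQ/dx = c. *)
Definition closed_at (P Q : R -> R -> R) (x y : R) : Prop := exists px c qy, forall eps, 0 < eps ->
  exists delta, 0 < delta /\ forall x' y', Rabs (x' - x) < delta -> Rabs (y' - y) < delta ->
    Rabs (P x' y' - (P x y + px * (x' - x) + c * (y' - y))) <= eps * (Rabs (x' - x) + Rabs (y' - y)) /\
    Rabs (Q x' y' - (Q x y + c * (x' - x) + qy * (y' - y))) <= eps * (Rabs (x' - x) + Rabs (y' - y)).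

Section Goursat.
(** The half-plane x < X corresponds, through the exponential, to the punctured disk of radius
    [exp X], where the theorem will be applied. *)
Variables (P Q : R -> R -> R) (X : R).
Hypothesis HPQ : forall x y, x < X -> closed_at P Q x y.

Lemma closed_at_cont x y : x < X ->
  continuous (fun x => P x y) x /\ continuous (fun y => P x y) y /\
  continuous (fun x => Q x y) x /\ continuous (fun y => Q x y) y.
Proof.
  intros Hx. destruct (HPQ x y Hx) as [px [c [qy H]]].
  destruct (H 1 ltac:(lra)) as [d [Hd Hb]].
  assert (HC : forall (f : R -> R) (x0 L : R), 0 < L -> (forall x', Rabs (x' - x0) < d -> Rabs (f x' - f x0) <= L * Rabs (x' - x0)) -> continuous f x0).
  { intros f x0 L HL Hf. apply filterlim_locally; intros eps.
    assert (He : 0 < Rmin d (eps / L)).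
    { apply Rmin_pos; auto. destruct eps; simpl. apply Rdiv_lt_0_compat; lra. }
    exists (mkposreal _ He). intros x' Hx'. change (Rabs (x' - x0) < Rmin d (eps / L)) in Hx'.
    change (Rabs (f x' - f x0) < eps).
    pose proof (Rmin_l d (eps / L)). pose proof (Rmin_r d (eps / L)).
    eapply Rle_lt_trans; [apply Hf; lra|]. apply Rlt_le_trans with (L * (eps / L)).
    - apply Rmult_lt_compat_l; lra.
    - right; field; lra. }
  assert (HT : forall u v k h, Rabs (u - (v + k * h)) <= 1 * Rabs h -> Rabs (u - v) <= (Rabs k + 1) * Rabs h).
  { intros u v k h Hh. replace (u - v) with ((u - (v + k * h)) + k * h) by ring.
    eapply Rle_trans; [apply Rabs_triang|]. rewrite (Rabs_mult k h). lra. }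
  assert (Z0 : Rabs 0 < d) by (rewrite Rabs_R0; auto).
  repeat split.
  - apply (HC (fun x => P x y) x (Rabs px + 1)); [pose proof (Rabs_pos px); lra|]. intros x' Hx'.
    destruct (Hb x' y Hx') as [B1 _]; [now replace (y - y) with 0 by ring|]. apply HT.
    replace (y - y) with 0 in B1 by ring. rewrite Rabs_R0, Rmult_0_r, !Rplus_0_r in B1. exact B1.
  - apply (HC (fun y => P x y) y (Rabs c + 1)); [pose proof (Rabs_pos c); lra|]. intros y' Hy'.
    destruct (Hb x y') as [B1 _]; [now replace (x - x) with 0 by ring|auto|]. apply HT.
    replace (x - x) with 0 in B1 by ring. rewrite Rabs_R0, Rmult_0_r, Rplus_0_r, Rplus_0_l in B1. exact B1.
  - apply (HC (fun x => Q x y) x (Rabs c + 1)); [pose proof (Rabs_pos c); lra|]. intros x' Hx'.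
    destruct (Hb x' y Hx') as [_ B1]; [now replace (y - y) with 0 by ring|]. apply HT.
    replace (y - y) with 0 in B1 by ring. rewrite Rabs_R0, Rmult_0_r, !Rplus_0_r in B1. exact B1.
  - apply (HC (fun y => Q x y) y (Rabs qy + 1)); [pose proof (Rabs_pos qy); lra|]. intros y' Hy'.
    destruct (Hb x y') as [_ B1]; [now replace (x - x) with 0 by ring|auto|]. apply HT.
    replace (x - x) with 0 in B1 by ring. rewrite Rabs_R0, Rmult_0_r, Rplus_0_r, Rplus_0_l in B1. exact B1.
Qed.

Definition hint (y x1 x2 : R) : R := RInt (fun x => P x y) x1 x2.
Definition vint (x y1 y2 : R) : R := RInt (fun y => Q x y) y1 y2.
Definition circ (x1 x2 y1 y2 : R) : R := hint y1 x1 x2 - hint y2 x1 x2 + (vint x2 y1 y2 - vint x1 y1 y2).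

Lemma ex_hint y x1 x2 : x1 <= x2 -> x2 < X -> ex_RInt (fun x => P x y) x1 x2.
Proof.
  intros H1 H2. apply @ex_RInt_continuous. rewrite Rmin_left, Rmax_right by lra. intros x Hx.
  apply closed_at_cont; lra.
Qed.

Lemma ex_vint x y1 y2 : x < X -> ex_RInt (fun y => Q x y) y1 y2.
Proof. intros H. apply @ex_RInt_continuous. intros y _. now apply closed_at_cont. Qed.

Lemma circ_split_x x1 x2 x3 y1 y2 : x1 <= x2 -> x2 <= x3 -> x3 < X ->
  circ x1 x3 y1 y2 = circ x1 x2 y1 y2 + circ x2 x3 y1 y2.
Proof.
  intros H1 H2 H3. unfold circ, hint.
  rewrite <- (RInt_Chasles (fun x => P x y1) x1 x2 x3) by (apply ex_hint; lra).
  rewrite <- (RInt_Chasles (fun x => P x y2) x1 x2 x3) by (apply ex_hint; lra).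
  unfold plus; simpl. ring.
Qed.

Lemma circ_split_y x1 x2 y1 y2 y3 : x1 <= x2 -> x2 < X ->
  circ x1 x2 y1 y3 = circ x1 x2 y1 y2 + circ x1 x2 y2 y3.
Proof.
  intros H1 H2. unfold circ, vint.
  rewrite <- (RInt_Chasles (fun y => Q x1 y) y1 y2 y3) by (apply ex_vint; lra).
  rewrite <- (RInt_Chasles (fun y => Q x2 y) y1 y2 y3) by (apply ex_vint; lra).
  unfold plus; simpl. ring.
Qed.

Lemma RInt_affine_error (f : R -> R) a b al be e : a <= b -> ex_RInt f a b ->
  (forall x, a <= x <= b -> Rabs (f x - (al + be * x)) <= e) ->
  Rabs (RInt f a b - (al * (b - a) + be * (b ^ 2 - a ^ 2) / 2)) <= (b - a) * e.
Proof.
  intros Hab Hf He.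
  assert (HA : is_RInt (fun x => al + be * x) a b (al * (b - a) + be * (b ^ 2 - a ^ 2) / 2)).
  { replace (al * (b - a) + be * (b ^ 2 - a ^ 2) / 2) with
      (minus (al * b + be * b ^ 2 / 2) (al * a + be * a ^ 2 / 2)) by (unfold minus, plus, opp; simpl; field).
    apply (is_RInt_derive (fun x => al * x + be * x ^ 2 / 2)).
    - intros x _. auto_derive; [auto|]. field.
    - intros x _. apply (cont_plus (fun _ => al) (fun x => be * x)); ct. }
  rewrite <- (is_RInt_unique _ _ _ _ HA).
  assert (HM : RInt f a b - RInt (fun x => al + be * x) a b = RInt (fun x => f x - (al + be * x)) a b).
  { symmetry. apply (RInt_minus f (fun x => al + be * x)); auto. eexists; apply HA. }
  rewrite HM. apply abs_RInt_le_const; auto.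
  apply @ex_RInt_minus; auto. eexists; apply HA.
Qed.

(** The affine parts of P and Q at the point have zero circulation because they share the
    coefficient c; only the differentiability error remains, of the size of the side lengths
    squared. *)
Lemma circ_small x y eps : x < X -> 0 < eps -> exists d, 0 < d /\ forall x1 x2 y1 y2,
  x1 <= x <= x2 -> y1 <= y <= y2 -> x2 - x1 < d -> y2 - y1 < d -> x2 < X ->
  Rabs (circ x1 x2 y1 y2) <= eps * ((x2 - x1) + (y2 - y1)) ^ 2.
Proof.
  intros HxX He. destruct (HPQ x y HxX) as [px [c [qy H]]].
  destruct (H (eps / 2) ltac:(lra)) as [d [Hd Hb]]. exists d; split; auto.
  intros x1 x2 y1 y2 Hx Hy Dx Dy HX. set (s := (x2 - x1) + (y2 - y1)).
  assert (Hs : forall x' y', x1 <= x' <= x2 -> y1 <= y' <= y2 ->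
     Rabs (x' - x) < d /\ Rabs (y' - y) < d /\ eps / 2 * (Rabs (x' - x) + Rabs (y' - y)) <= eps / 2 * s).
  { intros x' y' Hx' Hy'.
    assert (Rabs (x' - x) <= x2 - x1) by (apply Rabs_le; lra).
    assert (Rabs (y' - y) <= y2 - y1) by (apply Rabs_le; lra).
    repeat split; try lra. apply Rmult_le_compat_l; unfold s; lra. }
  assert (HP : forall y', y1 <= y' <= y2 ->
    Rabs (hint y' x1 x2 - ((P x y - px * x + c * (y' - y)) * (x2 - x1) + px * (x2 ^ 2 - x1 ^ 2) / 2)) <= (x2 - x1) * (eps / 2 * s)).
  { intros y' Hy'. apply RInt_affine_error; [lra|apply ex_hint; lra|]. intros x' Hx'.
    destruct (Hs x' y' Hx' Hy') as [A1 [A2 A3]]. destruct (Hb x' y' A1 A2) as [B1 _].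
    replace (P x y - px * x + c * (y' - y) + px * x') with (P x y + px * (x' - x) + c * (y' - y)) by ring. lra. }
  assert (HQ : forall x', x1 <= x' <= x2 ->
    Rabs (vint x' y1 y2 - ((Q x y + c * (x' - x) - qy * y) * (y2 - y1) + qy * (y2 ^ 2 - y1 ^ 2) / 2)) <= (y2 - y1) * (eps / 2 * s)).
  { intros x' Hx'. apply RInt_affine_error; [lra|apply ex_vint; lra|]. intros y' Hy'.
    destruct (Hs x' y' Hx' Hy') as [A1 [A2 A3]]. destruct (Hb x' y' A1 A2) as [_ B1].
    replace (Q x y + c * (x' - x) - qy * y + qy * y') with (Q x y + c * (x' - x) + qy * (y' - y)) by ring. lra. }
  pose proof (HP y1 ltac:(lra)) as P1. pose proof (HP y2 ltac:(lra)) as P2.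
  pose proof (HQ x1 ltac:(lra)) as Q1. pose proof (HQ x2 ltac:(lra)) as Q2.
  apply Rabs_le_between in P1, P2, Q1, Q2. unfold circ. apply Rabs_le.
  assert (E : (x2 - x1) * (eps / 2 * s) + (x2 - x1) * (eps / 2 * s) + ((y2 - y1) * (eps / 2 * s) + (y2 - y1) * (eps / 2 * s)) = eps * s ^ 2)
    by (unfold s; field).
  lra.
Qed.

Record rect := Rect { rx1 : R; rx2 : R; ry1 : R; ry2 : R }.
Definition rcirc (r : rect) : R := circ (rx1 r) (rx2 r) (ry1 r) (ry2 r).

(** The half kept carries at least half of the circulation. Halving in x and then in y divides both
    sides by 2 and the circulation by at most 4. *)
Definition halve_x (r : rect) : rect :=
  let m := (rx1 r + rx2 r) / 2 in
  let l := Rect (rx1 r) m (ry1 r) (ry2 r) in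
  if Rle_dec (Rabs (rcirc r) / 2) (Rabs (rcirc l)) then l else Rect m (rx2 r) (ry1 r) (ry2 r).

Definition halve_y (r : rect) : rect :=
  let m := (ry1 r + ry2 r) / 2 in
  let l := Rect (rx1 r) (rx2 r) (ry1 r) m in
  if Rle_dec (Rabs (rcirc r) / 2) (Rabs (rcirc l)) then l else Rect (rx1 r) (rx2 r) m (ry2 r).

Fixpoint nest (r : rect) (n : nat) : rect := match n with O => r | S n => halve_y (halve_x (nest r n)) end.

Definition good (r : rect) : Prop := rx1 r <= rx2 r /\ rx2 r < X /\ ry1 r <= ry2 r.

Lemma halve_x_spec r : good r -> good (halve_x r) /\
  rx1 r <= rx1 (halve_x r) /\ rx2 (halve_x r) <= rx2 r /\ ry1 (halve_x r) = ry1 r /\ ry2 (halve_x r) = ry2 r /\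
  rx2 (halve_x r) - rx1 (halve_x r) = (rx2 r - rx1 r) / 2 /\ Rabs (rcirc r) / 2 <= Rabs (rcirc (halve_x r)).
Proof.
  intros [G1 [G2 G3]]. unfold halve_x, good. destruct (Rle_dec _ _) as [H|H]; simpl; (repeat split; try lra).
  apply Rnot_le_lt in H. unfold rcirc in *; simpl in *.
  rewrite (circ_split_x (rx1 r) ((rx1 r + rx2 r) / 2) (rx2 r)) in * by lra.
  set (u := circ (rx1 r) _ _ _) in *. set (v := circ _ (rx2 r) _ _) in *.
  pose proof (Rabs_triang u v). lra.
Qed.

Lemma halve_y_spec r : good r -> good (halve_y r) /\
  ry1 r <= ry1 (halve_y r) /\ ry2 (halve_y r) <= ry2 r /\ rx1 (halve_y r) = rx1 r /\ rx2 (halve_y r) = rx2 r /\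
  ry2 (halve_y r) - ry1 (halve_y r) = (ry2 r - ry1 r) / 2 /\ Rabs (rcirc r) / 2 <= Rabs (rcirc (halve_y r)).
Proof.
  intros [G1 [G2 G3]]. unfold halve_y, good. destruct (Rle_dec _ _) as [H|H]; simpl; (repeat split; try lra).
  apply Rnot_le_lt in H. unfold rcirc in *; simpl in *.
  rewrite (circ_split_y (rx1 r) (rx2 r) (ry1 r) ((ry1 r + ry2 r) / 2) (ry2 r)) in * by lra.
  set (u := circ _ _ (ry1 r) _) in *. set (v := circ _ _ _ (ry2 r)) in *.
  pose proof (Rabs_triang u v). lra.
Qed.

Lemma nest_spec r : good r -> forall n, let r' := nest r n in good r' /\
  rx2 r' - rx1 r' = (rx2 r - rx1 r) / 2 ^ n /\ ry2 r' - ry1 r' = (ry2 r - ry1 r) / 2 ^ n /\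
  Rabs (rcirc r) / 4 ^ n <= Rabs (rcirc r') /\
  rx1 r' <= rx1 (nest r (S n)) /\ rx2 (nest r (S n)) <= rx2 r' /\
  ry1 r' <= ry1 (nest r (S n)) /\ ry2 (nest r (S n)) <= ry2 r'.
Proof.
  intros G n.
  assert (HS : forall r', good r' -> let r1 := halve_y (halve_x r') in good r1 /\
    rx2 r1 - rx1 r1 = (rx2 r' - rx1 r') / 2 /\ ry2 r1 - ry1 r1 = (ry2 r' - ry1 r') / 2 /\
    Rabs (rcirc r') / 4 <= Rabs (rcirc r1) /\
    rx1 r' <= rx1 r1 /\ rx2 r1 <= rx2 r' /\ ry1 r' <= ry1 r1 /\ ry2 r1 <= ry2 r').
  { intros r' G'. destruct (halve_x_spec r' G') as [H0 [H1 [H2 [H3 [H4 [H5 H6]]]]]].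
    destruct (halve_y_spec _ H0) as [K0 [K1 [K2 [K3 [K4 [K5 K6]]]]]].
    cbv zeta. repeat split; try apply K0; try lra. }
  induction n.
  - destruct (HS r G) as [H0 [H1 [H2 [H3 [H4 [H5 [H6 H7]]]]]]].
    simpl nest in *. rewrite !pow_O. repeat split; try apply G; try lra.
  - destruct IHn as [I0 [I1 [I2 [I3 _]]]].
    destruct (HS _ I0) as [H0 [H1 [H2 [H3 _]]]]. destruct (HS _ H0) as [_ [_ [_ [_ [H4 [H5 [H6 H7]]]]]]].
    change (nest r (S (S n))) with (halve_y (halve_x (nest r (S n)))).
    change (nest r (S n)) with (halve_y (halve_x (nest r n))). cbv zeta.
    assert (2 ^ n <> 0) by (apply pow_nonzero; lra). assert (4 ^ n <> 0) by (apply pow_nonzero; lra).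
    repeat split; try apply H0; auto.
    + rewrite H1, I1. simpl. field; auto.
    + rewrite H2, I2. simpl. field; auto.
    + apply Rle_trans with (Rabs (rcirc (nest r n)) / 4); [|exact H3].
      replace (Rabs (rcirc r) / 4 ^ S n) with (Rabs (rcirc r) / 4 ^ n / 4) by (simpl; field; auto). lra.
Qed.

Lemma nested_point (a b : nat -> R) : (forall n, a n <= a (S n)) -> (forall n, b (S n) <= b n) ->
  (forall n, a n <= b n) -> exists x, forall n, a n <= x <= b n.
Proof.
  intros Ha Hb Hab.
  assert (Ma : forall n m, (n <= m)%nat -> a n <= a m) by (induction 1; [lra|specialize (Ha m); lra]).
  assert (Mb : forall n m, (n <= m)%nat -> b m <= b n) by (induction 1; [lra|specialize (Hb m); lra]).
  assert (Hc : forall n m, a n <= b m).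
  { intros n m. destruct (le_lt_dec n m) as [H|H].
    - pose proof (Ma n m H). specialize (Hab m). lra.
    - pose proof (Mb m n ltac:(lia)). specialize (Hab n). lra. }
  destruct (completeness (fun x => exists n, x = a n)) as [x [H1 H2]].
  - exists (b O). intros y [n ->]. apply Hc.
  - exists (a O). now exists O.
  - exists x. intros n. split; [apply H1; now exists n|]. apply H2. intros y [m ->]. apply Hc.
Qed.

Lemma pow2_small c d : 0 < d -> exists n, c / 2 ^ n < d.
Proof.
  intros Hd. destruct (INR_unbounded (c / d)) as [n Hn]. exists n.
  assert (H2 : INR n <= 2 ^ n).
  { clear. induction n; [simpl; lra|]. rewrite S_INR. simpl.
    assert (1 <= 2 ^ n) by (apply pow_R1_Rle; lra). lra. }
  assert (0 < 2 ^ n) by (apply pow_lt; lra).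
  apply Rmult_lt_reg_r with (2 ^ n); auto. unfold Rdiv. rewrite Rmult_assoc, Rinv_l, Rmult_1_r by lra.
  apply (Rmult_lt_compat_r d) in Hn; auto. unfold Rdiv in Hn. rewrite Rmult_assoc, Rinv_l, Rmult_1_r in Hn by lra. nra.
Qed.

Theorem goursat x1 x2 y1 y2 : x1 <= x2 -> x2 < X -> y1 <= y2 -> circ x1 x2 y1 y2 = 0.
Proof.
  intros Hx HX Hy. set (r := Rect x1 x2 y1 y2).
  assert (G : good r) by (repeat split; auto).
  pose proof (nest_spec r G) as HN.
  destruct (nested_point (fun n => rx1 (nest r n)) (fun n => rx2 (nest r n))) as [x Hxn];
    try (intros n; destruct (HN n) as [[G1 [G2 G3]] [_ [_ [_ [? [? _]]]]]]; auto).
  destruct (nested_point (fun n => ry1 (nest r n)) (fun n => ry2 (nest r n))) as [y Hyn];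
    try (intros n; destruct (HN n) as [[G1 [G2 G3]] [_ [_ [_ [_ [_ [? ?]]]]]]]; auto).
  change (circ x1 x2 y1 y2) with (rcirc r).
  apply NNPP; intros HZ. assert (HA : 0 < Rabs (rcirc r)) by now apply Rabs_pos_lt.
  set (s := (x2 - x1) + (y2 - y1)). assert (Hs : 0 <= s) by (unfold s; lra).
  (* Chosen so that [eps * s^2] is smaller than the circulation; the summand 1 covers [s = 0]. *)
  set (eps := Rabs (rcirc r) / (2 * (s ^ 2 + 1))).
  assert (Hs2 : 0 < s ^ 2 + 1) by (pose proof (pow2_ge_0 s); lra).
  assert (He : 0 < eps) by (apply Rdiv_lt_0_compat; lra).
  assert (HxX : x < X) by (pose proof (Hxn O) as H0; simpl in H0; lra).
  destruct (circ_small x y eps HxX He) as [d [Hd Hb]].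
  destruct (pow2_small s d Hd) as [n Hn].
  destruct (HN n) as [[G1 [G2 G3]] [W1 [W2 [W3 _]]]].
  assert (P2 : 0 < 2 ^ n) by (apply pow_lt; lra).
  assert (Hsn : (x2 - x1) / 2 ^ n + (y2 - y1) / 2 ^ n = s / 2 ^ n) by (unfold s; field; lra).
  assert (0 <= (x2 - x1) / 2 ^ n) by (apply Rmult_le_pos; [lra|apply Rlt_le, Rinv_0_lt_compat; lra]).
  assert (0 <= (y2 - y1) / 2 ^ n) by (apply Rmult_le_pos; [lra|apply Rlt_le, Rinv_0_lt_compat; lra]).
  simpl in W1, W2.
  pose proof (Hb _ _ _ _ (Hxn n) (Hyn n) ltac:(lra) ltac:(lra) G2) as HB. fold (rcirc (nest r n)) in HB.
  rewrite W1, W2, Hsn in HB.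
  assert (P4 : 4 ^ n = 2 ^ n * 2 ^ n) by (rewrite <- Rpow_mult_distr; f_equal; ring).
  assert (HF : Rabs (rcirc r) <= eps * s ^ 2).
  { apply Rmult_le_reg_r with (/ 4 ^ n); [apply Rinv_0_lt_compat, pow_lt; lra|].
    replace (eps * s ^ 2 * / 4 ^ n) with (eps * (s / 2 ^ n) ^ 2) by (rewrite P4; field; lra).
    unfold Rdiv in W3. lra. }
  assert (eps * s ^ 2 < Rabs (rcirc r)); [|lra].
  unfold eps. apply Rmult_lt_reg_r with (2 * (s ^ 2 + 1)); [lra|].
  replace (Rabs (rcirc r) / (2 * (s ^ 2 + 1)) * s ^ 2 * (2 * (s ^ 2 + 1))) with (Rabs (rcirc r) * s ^ 2) by (field; lra).
  pose proof (pow2_ge_0 s). nra.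
Qed.

(** The horizontal sides of the rectangle cancel by periodicity, leaving the two vertical
    integrals. *)
Lemma goursat_periodic x1 x2 : (forall x, P x (2 * PI) = P x 0) -> x1 <= x2 -> x2 < X ->
  ig (Q x1) = ig (Q x2).
Proof.
  intros HP H1 H2. pose proof (goursat x1 x2 0 (2 * PI) H1 H2 (Rlt_le _ _ two_pi_pos)) as E.
  unfold circ, hint, vint in E.
  rewrite (RInt_ext (fun x => P x (2 * PI)) (fun x => P x 0)) in E by (intros; apply HP).
  unfold ig. change (RInt (Q x1) 0 (2 * PI)) with (RInt (fun y => Q x1 y) 0 (2 * PI)).
  change (RInt (Q x2) 0 (2 * PI)) with (RInt (fun y => Q x2 y) 0 (2 * PI)). lra.
Qed.

End Goursat.

(** * Complex differentiable functions *)

Definition cd (F : C -> C) (z l : C) : Prop := forall eps, 0 < eps -> exists d, 0 < d /\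
  forall w, Cmod (w - z) < d -> Cmod (F w - F z - l * (w - z)) <= eps * Cmod (w - z).

Lemma cd_is_derive F z l : cd F z l <-> @is_derive C_AbsRing C_NormedModule F z l.
Proof.
  split.
  - intros H. split; [apply (@is_linear_scal_l C_AbsRing C_NormedModule)|].
    intros x Hx. apply (@is_filter_lim_locally_unique C_AbsRing (AbsRing_NormedModule C_AbsRing)) in Hx. subst x. intros eps.
    destruct (H eps (cond_pos eps)) as [d [Hd Hb]]. exists (mkposreal d Hd). intros w Hw.
    specialize (Hb w Hw).
    change (Cmod (F w - F z - (w - z) * l) <= eps * Cmod (w - z)). now rewrite (Cmult_comm (w - z) l).
  - intros [_ H] eps He. destruct (H z (fun P HP => HP) (mkposreal eps He)) as [d Hb].
    exists d; split; [apply cond_pos|]. intros w Hw. specialize (Hb w Hw).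
    change (Cmod (F w - F z - (w - z) * l) <= eps * Cmod (w - z)) in Hb. now rewrite (Cmult_comm l (w - z)).
Qed.

(** C carries two normed-module structures: [cdiff] is stated with [C_NormedModule], while the
    product rule and the inner function of a composition live over the ring structure. [cd] mediates
    between them. *)
Lemma cd_is_derive_ring F z l : cd F z l <-> @is_derive C_AbsRing (AbsRing_NormedModule C_AbsRing) F z l.
Proof.
  split.
  - intros H. split; [apply (@is_linear_scal_l C_AbsRing (AbsRing_NormedModule C_AbsRing))|].
    intros x Hx. apply (@is_filter_lim_locally_unique C_AbsRing (AbsRing_NormedModule C_AbsRing)) in Hx. subst x. intros eps.
    destruct (H eps (cond_pos eps)) as [d [Hd Hb]]. exists (mkposreal d Hd). intros w Hw.
    specialize (Hb w Hw).
    change (Cmod (F w - F z - (w - z) * l) <= eps * Cmod (w - z)). now rewrite (Cmult_comm (w - z) l).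
  - intros [_ H] eps He. destruct (H z (fun P HP => HP) (mkposreal eps He)) as [d Hb].
    exists d; split; [apply cond_pos|]. intros w Hw. specialize (Hb w Hw).
    change (Cmod (F w - F z - (w - z) * l) <= eps * Cmod (w - z)) in Hb. now rewrite (Cmult_comm l (w - z)).
Qed.

Lemma cdiff_cd F z : cdiff F z <-> exists l, cd F z l.
Proof. split; intros [l H]; exists l; now apply cd_is_derive. Qed.

Lemma cd_comp F G z k l : cd F (G z) l -> cd G z k -> cd (fun w => F (G w)) z (k * l).
Proof.
  intros HF HG. apply cd_is_derive. apply cd_is_derive in HF. apply cd_is_derive_ring in HG.
  exact (@is_derive_comp C_AbsRing C_NormedModule F G z l k HF HG).
Qed.

Lemma cd_mult F G z k l : cd F z k -> cd G z l -> cd (fun w => F w * G w)%C z (k * G z + F z * l).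
Proof.
  intros HF HG. apply cd_is_derive_ring. apply cd_is_derive_ring in HF, HG.
  exact (@is_derive_mult C_AbsRing F G z k l HF HG Cmult_comm).
Qed.

Lemma cd_const c z : cd (fun _ => c) z 0.
Proof.
  intros eps He. exists 1; split; [lra|]. intros w _.
  replace (c - c - 0 * (w - z))%C with (RtoC 0) by ring. rewrite Cmod_0.
  apply Rmult_le_pos; [lra|apply Cmod_ge_0].
Qed.

Lemma cd_affine a b z : cd (fun w => a + b * w)%C z b.
Proof.
  intros eps He. exists 1; split; [lra|]. intros w _.
  replace (a + b * w - (a + b * z) - b * (w - z))%C with (RtoC 0) by ring. rewrite Cmod_0.
  apply Rmult_le_pos; [lra|apply Cmod_ge_0].
Qed.

Lemma cd_pow F z l n : cd F z l -> exists k, cd (fun w => Cpow (F w) n) z k.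
Proof.
  intros H. induction n as [|n [k IH]]; [exists 0; apply (cd_const 1)|].
  eexists. exact (cd_mult F (fun w => Cpow (F w) n) z l k H IH).
Qed.

Lemma Cmod_le_abs (z : C) : Cmod z <= Rabs (fst z) + Rabs (snd z).
Proof.
  pose proof (Rabs_pos (fst z)). pose proof (Rabs_pos (snd z)).
  unfold Cmod. rewrite <- (sqrt_Rsqr (Rabs (fst z) + Rabs (snd z))) by lra.
  apply sqrt_le_1_alt. unfold Rsqr. rewrite <- (pow2_abs (fst z)), <- (pow2_abs (snd z)). nra.
Qed.

Lemma Cmod_ge_abs (z : C) : Rabs (fst z) <= Cmod z /\ Rabs (snd z) <= Cmod z.
Proof.
  pose proof (Rmax_Cmod z). pose proof (Rmax_l (Rabs (fst z)) (Rabs (snd z))).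
  pose proof (Rmax_r (Rabs (fst z)) (Rabs (snd z))). lra.
Qed.

Definition Cexp (z : C) : C := (exp (fst z) * cos (snd z), exp (fst z) * sin (snd z)).

Lemma Cexp_plus z w : Cexp (z + w) = (Cexp z * Cexp w)%C.
Proof.
  destruct z as [x y], w as [x' y']. unfold Cexp, Cplus, Cmult; simpl.
  rewrite exp_plus, cos_plus, sin_plus. f_equal; ring.
Qed.

Lemma Cmod_Cexp z : Cmod (Cexp z) = exp (fst z).
Proof.
  unfold Cmod, Cexp; simpl.
  replace (exp (fst z) * cos (snd z) * (exp (fst z) * cos (snd z) * 1) + exp (fst z) * sin (snd z) * (exp (fst z) * sin (snd z) * 1))
    with ((exp (fst z))² * ((sin (snd z))² + (cos (snd z))²)) by (unfold Rsqr; ring).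
  rewrite sin2_cos2, Rmult_1_r. apply sqrt_Rsqr, Rlt_le, exp_pos.
Qed.

Lemma derive_0_error (f : R -> R) l : derivable_pt_lim f 0 l -> forall eps, 0 < eps -> exists d, 0 < d /\
  forall h, Rabs h < d -> Rabs (f h - f 0 - l * h) <= eps * Rabs h.
Proof.
  intros H eps He. destruct (H eps He) as [d Hd]. exists d; split; [apply cond_pos|]. intros h Hh.
  destruct (Req_dec h 0) as [->|Hn].
  - replace (f 0 - f 0 - l * 0) with 0 by ring. rewrite Rabs_R0. lra.
  - specialize (Hd h Hn Hh). rewrite Rplus_0_l in Hd.
    replace (f h - f 0 - l * h) with (((f h - f 0) / h - l) * h) by (field; auto).
    rewrite Rabs_mult. apply Rmult_le_compat_r; [apply Rabs_pos|lra].
Qed.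

Lemma Cexp_0_error eps : 0 < eps -> exists d, 0 < d /\
  forall h, Cmod h < d -> Cmod (Cexp h - 1 - h) <= eps * Cmod h.
Proof.
  (* Each coordinate of the error is at most [3 e] times the modulus, hence the factor 6. *)
  intros He. pose (e := Rmin (eps / 6) 1).
  assert (He0 : 0 < e) by (apply Rmin_pos; lra).
  assert (He1 : e <= eps / 6 /\ e <= 1) by (split; [apply Rmin_l|apply Rmin_r]).
  pose proof (derivable_pt_lim_exp 0) as D1. rewrite exp_0 in D1.
  pose proof (derivable_pt_lim_cos 0) as D2. rewrite sin_0, Ropp_0 in D2.
  destruct (derive_0_error _ _ D1 e He0) as [d1 [P1 H1]].
  destruct (derive_0_error _ _ D2 e He0) as [d2 [P2 H2]].
  destruct (derive_0_error _ _ derivable_pt_lim_sin_0 e He0) as [d3 [P3 H3]].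
  rewrite exp_0 in H1. rewrite cos_0 in H2. rewrite sin_0 in H3.
  pose (d := Rmin (Rmin d1 d2) (Rmin d3 (e / 2))).
  assert (Hd : 0 < d) by (unfold d; repeat apply Rmin_pos; lra).
  assert (Hdd : d <= d1 /\ d <= d2 /\ d <= d3 /\ d <= e / 2).
  { unfold d. pose proof (Rmin_l (Rmin d1 d2) (Rmin d3 (e / 2))). pose proof (Rmin_r (Rmin d1 d2) (Rmin d3 (e / 2))).
    pose proof (Rmin_l d1 d2). pose proof (Rmin_r d1 d2). pose proof (Rmin_l d3 (e / 2)). pose proof (Rmin_r d3 (e / 2)). lra. }
  exists d; split; auto. intros [x y] Hh. destruct (Cmod_ge_abs (x, y)) as [A1 A2]; simpl in A1, A2.
  specialize (H1 x ltac:(lra)). specialize (H2 y ltac:(lra)). specialize (H3 y ltac:(lra)).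
  eapply Rle_trans; [apply Cmod_le_abs|]. simpl.
  set (m := Cmod (x, y)) in *. assert (Hm : 0 <= m) by apply Cmod_ge_0.
  assert (E1 : Rabs (exp x - 1) <= e).
  { replace (exp x - 1) with ((exp x - 1 - 1 * x) + x) by ring. eapply Rle_trans; [apply Rabs_triang|].
    pose proof (Rabs_pos x). nra. }
  assert (E2 : Rabs (exp x) <= 2).
  { replace (exp x) with ((exp x - 1) + 1) by ring. eapply Rle_trans; [apply Rabs_triang|]. rewrite Rabs_R1. lra. }
  assert (F1 : Rabs (exp x * cos y + - (1) + - x) <= e * m + 2 * (e * m)).
  { replace (exp x * cos y + - (1) + - x) with ((exp x - 1 - 1 * x) + exp x * (cos y - 1 - 0 * y)) by ring.
    eapply Rle_trans; [apply Rabs_triang|]. rewrite Rabs_mult. pose proof (Rabs_pos (cos y - 1 - 0 * y)).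
    pose proof (Rabs_pos (exp x)). apply Rplus_le_compat; [nra|].
    apply Rmult_le_compat; auto. nra. }
  assert (F2 : Rabs (exp x * sin y + - 0 + - y) <= 2 * (e * m) + e * m).
  { replace (exp x * sin y + - 0 + - y) with (exp x * (sin y - 0 - 1 * y) + (exp x - 1) * y) by ring.
    eapply Rle_trans; [apply Rabs_triang|]. rewrite !Rabs_mult. pose proof (Rabs_pos (sin y - 0 - 1 * y)).
    pose proof (Rabs_pos (exp x)). pose proof (Rabs_pos (exp x - 1)). pose proof (Rabs_pos y).
    apply Rplus_le_compat; apply Rmult_le_compat; auto. nra. }
  nra.
Qed.

Lemma cd_Cexp z : cd Cexp z (Cexp z).
Proof.
  intros eps He. pose proof (Cmod_Cexp z) as HC. pose proof (exp_pos (fst z)) as HE.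
  destruct (Cexp_0_error (eps / exp (fst z))) as [d [Hd Hb]]; [apply Rdiv_lt_0_compat; lra|].
  exists d; split; auto. intros w Hw. specialize (Hb _ Hw).
  replace (Cexp w - Cexp z - Cexp z * (w - z))%C with (Cexp z * (Cexp (w - z) - 1 - (w - z)))%C.
  - rewrite Cmod_mult, HC. apply Rle_trans with (exp (fst z) * (eps / exp (fst z) * Cmod (w - z))).
    + apply Rmult_le_compat_l; lra.
    + right. field. lra.
  - replace (Cexp w) with (Cexp (z + (w - z))) by (f_equal; ring). rewrite Cexp_plus. ring.
Qed.

(** The Cauchy-Riemann equations: real and imaginary part of [G dz] are closed forms. *)
Lemma cd_closed G x y l : cd G (x, y) l ->
  closed_at (fun x y => fst (G (x, y))) (fun x y => - snd (G (x, y))) x y /\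
  closed_at (fun x y => snd (G (x, y))) (fun x y => fst (G (x, y))) x y.
Proof.
  intros H. destruct l as [l1 l2].
  assert (HB : forall eps, 0 < eps -> exists delta, 0 < delta /\ forall x' y',
    Rabs (x' - x) < delta -> Rabs (y' - y) < delta ->
    Rabs (fst (G (x', y')) - (fst (G (x, y)) + l1 * (x' - x) + - l2 * (y' - y))) <= eps * (Rabs (x' - x) + Rabs (y' - y)) /\
    Rabs (snd (G (x', y')) - (snd (G (x, y)) + l2 * (x' - x) + l1 * (y' - y))) <= eps * (Rabs (x' - x) + Rabs (y' - y))).
  { intros eps He. destruct (H eps He) as [d [Hd Hb]]. exists (d / 2); split; [lra|]. intros x' y' Hx Hy.
    assert (Hm : Cmod ((x', y') - (x, y)) <= Rabs (x' - x) + Rabs (y' - y)).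
    { eapply Rle_trans; [apply Cmod_le_abs|]. simpl. unfold Rminus. lra. }
    specialize (Hb (x', y') ltac:(lra)).
    destruct (Cmod_ge_abs (G (x', y') - G (x, y) - (l1, l2) * ((x', y') - (x, y)))) as [A1 A2].
    assert (Hle : eps * Cmod ((x', y') - (x, y)) <= eps * (Rabs (x' - x) + Rabs (y' - y))) by (apply Rmult_le_compat_l; lra).
    split.
    - eapply Rle_trans; [|exact Hle]. eapply Rle_trans; [|exact Hb]. eapply Rle_trans; [|exact A1].
      right. f_equal. simpl. ring.
    - eapply Rle_trans; [|exact Hle]. eapply Rle_trans; [|exact Hb]. eapply Rle_trans; [|exact A2].
      right. f_equal. simpl. ring. }
  split.
  - exists l1, (- l2), (- l1). intros eps He. destruct (HB eps He) as [d [Hd Hb]]. exists d; split; auto.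
    intros x' y' Hx Hy. destruct (Hb x' y' Hx Hy) as [B1 B2]. split; auto.
    rewrite <- Rabs_Ropp. eapply Rle_trans; [|exact B2]. right. f_equal. ring.
  - exists l2, l1, (- l2). intros eps He. destruct (HB eps He) as [d [Hd Hb]]. exists d; split; auto.
    intros x' y' Hx Hy. destruct (Hb x' y' Hx Hy) as [B1 B2]. split; auto.
Qed.

(** * Fourier coefficients on circles *)

Section Polar.
Variables (H : C -> C) (X : R).
Hypothesis HH : forall z, Cmod z < exp X -> exists l, cd H z l.

Definition polarU (r t : R) : R := fst (H (r * cos t, r * sin t)).
Definition polarV (r t : R) : R := snd (H (r * cos t, r * sin t)).

(** In the variable [w = exp z] this is [H w * w^k]. Its integral over a vertical period at x = ln r
    is [r^k] times the integral of [H (r exp(it)) exp(ikt)], and Goursat's theorem makes it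
    independent of r. *)
Let G (k : Z) (z : C) : C := (H (Cexp z) * Cexp (0 + RtoC (IZR k) * z))%C.

Lemma polar_G_val k x t :
  fst (G k (x, t)) = exp (IZR k * x) * (polarU (exp x) t * cos (IZR k * t) - polarV (exp x) t * sin (IZR k * t)) /\
  snd (G k (x, t)) = exp (IZR k * x) * (polarU (exp x) t * sin (IZR k * t) + polarV (exp x) t * cos (IZR k * t)).
Proof.
  unfold G, polarU, polarV, Cexp. simpl. 
  replace (0 + (IZR k * x - 0 * t)) with (IZR k * x) by ring.
  replace (0 + (IZR k * t + 0 * x)) with (IZR k * t) by ring. split; ring.
Qed.

Lemma polar_G_cd k x t : x < X -> exists l, cd (G k) (x, t) l.
Proof.
  intros Hx. destruct (HH (Cexp (x, t))) as [l Hl].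
  { rewrite Cmod_Cexp. now apply exp_increasing. }
  eexists. apply (cd_mult (fun z => H (Cexp z)) (fun z => Cexp (0 + RtoC (IZR k) * z))).
  - apply (cd_comp H Cexp); [exact Hl|apply cd_Cexp].
  - apply (cd_comp Cexp (fun z => (0 + RtoC (IZR k) * z)%C)); [apply cd_Cexp|apply cd_affine].
Qed.

Lemma polar_G_periodic k x : G k (x, 2 * PI) = G k (x, 0).
Proof.
  assert (E : Cexp (x, 2 * PI) = Cexp (x, 0)) by (unfold Cexp; simpl; now rewrite cos_2PI, sin_2PI, cos_0, sin_0).
  unfold G. rewrite E. f_equal. unfold Cexp. simpl.
  replace (0 + (IZR k * (2 * PI) + 0 * x)) with (0 + IZR k * (2 * PI)) by ring.
  replace (0 + (IZR k * 0 + 0 * x)) with 0 by ring.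
  destruct (trig_shift_Z 0 k) as [-> ->]. replace (0 + (IZR k * x - 0 * (2 * PI))) with (0 + (IZR k * x - 0 * 0)) by ring.
  reflexivity.
Qed.

Lemma polar_cont r : 0 < r < exp X -> cont (polarU r) /\ cont (polarV r).
Proof.
  intros Hr. assert (HX : ln r < X) by (rewrite <- (ln_exp X); apply ln_increasing; lra).
  assert (Er : exp (ln r) = r) by (apply exp_ln; lra).
  assert (E : forall t, polarU r t = fst (G 0 (ln r, t)) /\ polarV r t = snd (G 0 (ln r, t))).
  { intros t. destruct (polar_G_val 0 (ln r) t) as [-> ->].
    rewrite !Rmult_0_l, exp_0, cos_0, sin_0, Er. split; ring. }
  assert (HCl : forall x y, x < X ->
    closed_at (fun x y => fst (G 0 (x, y))) (fun x y => - snd (G 0 (x, y))) x y /\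
    closed_at (fun x y => snd (G 0 (x, y))) (fun x y => fst (G 0 (x, y))) x y).
  { intros x y Hx. destruct (polar_G_cd 0 x y Hx) as [l Hl]. exact (cd_closed _ _ _ l Hl). }
  split; intros t.
  - apply (continuous_ext (fun t => fst (G 0 (ln r, t)))); [intros; symmetry; apply E|].
    destruct (closed_at_cont (fun x y => fst (G 0 (x, y))) (fun x y => - snd (G 0 (x, y))) X
      (fun x y Hx => proj1 (HCl x y Hx)) (ln r) t HX) as [_ [K _]]. exact K.
  - apply (continuous_ext (fun t => snd (G 0 (ln r, t)))); [intros; symmetry; apply E|].
    destruct (closed_at_cont (fun x y => snd (G 0 (x, y))) (fun x y => fst (G 0 (x, y))) X
      (fun x y Hx => proj2 (HCl x y Hx)) (ln r) t HX) as [_ [K _]]. exact K.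
Qed.

Lemma polar_periodic r : periodic2pi (polarU r) /\ periodic2pi (polarV r).
Proof.
  split; intros t; unfold polarU, polarV; pose proof (cos_period t 1) as E1; pose proof (sin_period t 1) as E2;
  simpl INR in E1, E2; rewrite Rmult_1_r in E1, E2; now rewrite E1, E2.
Qed.

Definition IU (k : Z) (r : R) : R := ig (fun t => polarU r t * cos (IZR k * t) - polarV r t * sin (IZR k * t)).
Definition IV (k : Z) (r : R) : R := ig (fun t => polarU r t * sin (IZR k * t) + polarV r t * cos (IZR k * t)).

Lemma polar_const k x1 x2 : x1 <= x2 -> x2 < X ->
  exp (IZR k * x1) * IU k (exp x1) = exp (IZR k * x2) * IU k (exp x2) /\
  exp (IZR k * x1) * IV k (exp x1) = exp (IZR k * x2) * IV k (exp x2).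
Proof.
  intros H1 H2.
  assert (Cn : forall x, x < X -> cont (polarU (exp x)) /\ cont (polarV (exp x))).
  { intros x Hx. apply polar_cont. split; [apply exp_pos|now apply exp_increasing]. }
  destruct (Cn x1 ltac:(lra)) as [C1 C2]. destruct (Cn x2 H2) as [C3 C4].
  unfold IU, IV. rewrite <- !ig_scal by ct.
  assert (EU : forall x, ig (fun t => exp (IZR k * x) * (polarU (exp x) t * cos (IZR k * t) - polarV (exp x) t * sin (IZR k * t)))
     = ig (fun y => fst (G k (x, y)))).
  { intros x. apply ig_ext; intros t. symmetry. apply polar_G_val. }
  assert (EV : forall x, x < X -> ig (fun t => exp (IZR k * x) * (polarU (exp x) t * sin (IZR k * t) + polarV (exp x) t * cos (IZR k * t)))
     = - ig (fun y => - snd (G k (x, y)))).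
  { intros x Hx. destruct (Cn x Hx) as [C5 C6].
    rewrite (ig_ext (fun y => - snd (G k (x, y)))
      (fun t => - (exp (IZR k * x) * (polarU (exp x) t * sin (IZR k * t) + polarV (exp x) t * cos (IZR k * t))))).
    - rewrite ig_opp by ct. ring.
    - intros t. now rewrite (proj2 (polar_G_val k x t)). }
  rewrite !EU, !EV by lra. split; [|f_equal].
  - apply (goursat_periodic (fun x y => snd (G k (x, y))) (fun x y => fst (G k (x, y))) X); auto.
    + intros x y Hx. destruct (polar_G_cd k x y Hx) as [l Hl]. apply (cd_closed _ _ _ l Hl).
    + intros x. now rewrite polar_G_periodic.
  - apply (goursat_periodic (fun x y => fst (G k (x, y))) (fun x y => - snd (G k (x, y))) X); auto.
    + intros x y Hx. destruct (polar_G_cd k x y Hx) as [l Hl]. apply (cd_closed _ _ _ l Hl).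
    + intros x. now rewrite polar_G_periodic.
Qed.

Lemma polar_const_r k r1 r2 : 0 < r1 < exp X -> 0 < r2 < exp X ->
  exp (IZR k * ln r1) * IU k r1 = exp (IZR k * ln r2) * IU k r2 /\
  exp (IZR k * ln r1) * IV k r1 = exp (IZR k * ln r2) * IV k r2.
Proof.
  intros H1 H2.
  assert (HX : forall r, 0 < r < exp X -> ln r < X) by (intros r Hr; rewrite <- (ln_exp X); apply ln_increasing; lra).
  pose proof (HX r1 H1). pose proof (HX r2 H2).
  assert (E : forall r, 0 < r -> exp (ln r) = r) by (intros; now apply exp_ln).
  destruct (Rle_dec (ln r1) (ln r2)) as [Hl|Hl].
  - pose proof (polar_const k (ln r1) (ln r2) Hl ltac:(lra)) as P. now rewrite !E in P by lra.
  - pose proof (polar_const k (ln r2) (ln r1) ltac:(lra) ltac:(lra)) as P. rewrite !E in P by lra. destruct P; split; auto.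
Qed.

Lemma exp_nat_ln m r : 0 < r -> exp (IZR (Z.of_nat m) * ln r) = r ^ m.
Proof. intros Hr. rewrite <- INR_IZR_INZ. fold (Rpower r (INR m)). now apply Rpower_pow. Qed.

Lemma polar_near_0 : exists d M, 0 < d /\ 0 < M /\ forall r t, 0 <= r < d -> Rabs (polarU r t) <= M /\ Rabs (polarV r t) <= M.
Proof.
  destruct (HH 0) as [l Hl]; [rewrite Cmod_0; apply exp_pos|].
  destruct (Hl 1 ltac:(lra)) as [d [Hd Hb]].
  exists d, (Cmod (H 0) + (Cmod l + 1) * d). pose proof (Cmod_ge_0 (H 0)). pose proof (Cmod_ge_0 l).
  split; auto. split; [nra|]. intros r t Hr.
  assert (Hm : Cmod (r * cos t, r * sin t) = r).
  { unfold Cmod; simpl. replace (r * cos t * (r * cos t * 1) + r * sin t * (r * sin t * 1)) with (r² * ((sin t)² + (cos t)²)) by (unfold Rsqr; ring).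
    rewrite sin2_cos2, Rmult_1_r. apply sqrt_Rsqr; lra. }
  set (z := (r * cos t, r * sin t) : C) in *. fold z.
  assert (Ez : (z - 0)%C = z) by ring.
  specialize (Hb z). rewrite Ez, Hm in Hb. specialize (Hb ltac:(lra)).
  assert (HM : Cmod (H z) <= Cmod (H 0) + (Cmod l + 1) * d).
  { replace (H z) with (H 0 + (l * z + (H z - H 0 - l * z)))%C by ring.
    eapply Rle_trans; [apply Cmod_triangle|]. apply Rplus_le_compat_l.
    eapply Rle_trans; [apply Cmod_triangle|]. rewrite Cmod_mult, Hm. nra. }
  destruct (Cmod_ge_abs (H z)) as [A1 A2]. unfold polarU, polarV. fold z. lra.
Qed.

(** The product of [r^m] with the mode at frequency -m does not depend on r and tends to 0 as r
    does, because [H] is bounded near 0. *)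
Lemma polar_neg_modes m r : (0 < m)%nat -> 0 < r < exp X -> IU (Z.of_nat m) r = 0 /\ IV (Z.of_nat m) r = 0.
Proof.
  intros Hm Hr. destruct polar_near_0 as [d [M [Hd [HM Hb]]]].
  assert (Hbound : forall r', 0 < r' < exp X -> r' < d ->
    Rabs (IU (Z.of_nat m) r') <= 2 * PI * (2 * M) /\ Rabs (IV (Z.of_nat m) r') <= 2 * PI * (2 * M)).
  { intros r' Hr' Hrd. destruct (polar_cont r' Hr') as [C1 C2].
    split; (apply ig_abs_le; [ct|]); intros t; destruct (Hb r' t ltac:(lra)) as [B1 B2].
    - replace (polarU r' t * cos (IZR (Z.of_nat m) * t) - polarV r' t * sin (IZR (Z.of_nat m) * t))
        with (polarU r' t * cos (IZR (Z.of_nat m) * t) + (- polarV r' t) * sin (IZR (Z.of_nat m) * t)) by ring.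
      apply Rabs_trig_comb_le; [auto|now rewrite Rabs_Ropp].
    - rewrite Rplus_comm. apply Rabs_trig_comb_le; auto. }
  set (K := 2 * PI * (2 * M)) in *. assert (HK : 0 < K) by (unfold K; pose proof PI_RGT_0; nra).
  assert (Hrm : 0 < r ^ m) by (apply pow_lt; lra).
  assert (HZ : forall I : R -> R, (forall r', 0 < r' < exp X -> r' < d -> Rabs (I r') <= K) ->
     (forall r', 0 < r' < exp X -> r' ^ m * I r' = r ^ m * I r) -> I r = 0).
  { intros I HI HC. apply NNPP; intros Hn. assert (HA : 0 < Rabs (I r)) by now apply Rabs_pos_lt.
    set (e := r ^ m * Rabs (I r) / K). assert (He : 0 < e) by (apply Rdiv_lt_0_compat; nra).
    set (r' := Rmin (Rmin (d / 2) (exp X / 2)) (Rmin (e / 2) 1)).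
    pose proof (exp_pos X) as HeX.
    assert (Hr' : 0 < r') by (unfold r'; repeat apply Rmin_pos; lra).
    assert (Hrr : r' <= d / 2 /\ r' <= exp X / 2 /\ r' <= e / 2 /\ r' <= 1).
    { unfold r'. pose proof (Rmin_l (Rmin (d / 2) (exp X / 2)) (Rmin (e / 2) 1)). pose proof (Rmin_r (Rmin (d / 2) (exp X / 2)) (Rmin (e / 2) 1)).
      pose proof (Rmin_l (d / 2) (exp X / 2)). pose proof (Rmin_r (d / 2) (exp X / 2)).
      pose proof (Rmin_l (e / 2) 1). pose proof (Rmin_r (e / 2) 1). lra. }
    pose proof (HC r' ltac:(lra)) as E. apply (f_equal Rabs) in E. rewrite !Rabs_mult in E.
    assert (Hp : 0 < r' ^ m) by (apply pow_lt; lra).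
    rewrite (Rabs_right (r' ^ m)), (Rabs_right (r ^ m)) in E by lra.
    assert (Hpm : r' ^ m <= r').
    { destruct m as [|m']; [lia|]. simpl. assert (r' ^ m' <= 1) by (rewrite <- (pow1 m'); apply pow_incr; lra). nra. }
    pose proof (HI r' ltac:(lra) ltac:(lra)) as HB. pose proof (Rabs_pos (I r')).
    assert (Hlt : r ^ m * Rabs (I r) <= e / 2 * K).
    { rewrite <- E. apply Rmult_le_compat; lra. }
    assert (e / 2 * K = r ^ m * Rabs (I r) / 2) by (unfold e; field; lra). nra. }
  split; [apply (HZ (IU (Z.of_nat m)))|apply (HZ (IV (Z.of_nat m)))];
    try (intros r' A1 A2; destruct (Hbound r' A1 A2); assumption).
  - intros r' Hr'. destruct (polar_const_r (Z.of_nat m) r' r Hr' Hr) as [E _]. now rewrite !exp_nat_ln in E by lra.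
  - intros r' Hr'. destruct (polar_const_r (Z.of_nat m) r' r Hr' Hr) as [_ E]. now rewrite !exp_nat_ln in E by lra.
Qed.

Lemma polar_pos_modes m r1 r2 : 0 < r1 < exp X -> 0 < r2 < exp X ->
  IU (- Z.of_nat m) r1 * r2 ^ m = IU (- Z.of_nat m) r2 * r1 ^ m /\
  IV (- Z.of_nat m) r1 * r2 ^ m = IV (- Z.of_nat m) r2 * r1 ^ m.
Proof.
  intros H1 H2.
  assert (E : forall r, 0 < r -> exp (IZR (- Z.of_nat m) * ln r) = / r ^ m).
  { intros r Hr. rewrite opp_IZR, Ropp_mult_distr_l_reverse, exp_Ropp, exp_nat_ln by auto. reflexivity. }
  destruct (polar_const_r (- Z.of_nat m) r1 r2 H1 H2) as [P1 P2]. rewrite !E in P1, P2 by lra.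
  assert (0 < r1 ^ m) by (apply pow_lt; lra). assert (0 < r2 ^ m) by (apply pow_lt; lra).
  split.
  - apply Rmult_eq_reg_l with (/ r1 ^ m * / r2 ^ m); [|apply Rgt_not_eq, Rmult_lt_0_compat; apply Rinv_0_lt_compat; lra].
    transitivity (/ r1 ^ m * IU (- Z.of_nat m) r1); [field; lra|]. rewrite P1. field; lra.
  - apply Rmult_eq_reg_l with (/ r1 ^ m * / r2 ^ m); [|apply Rgt_not_eq, Rmult_lt_0_compat; apply Rinv_0_lt_compat; lra].
    transitivity (/ r1 ^ m * IV (- Z.of_nat m) r1); [field; lra|]. rewrite P2. field; lra.
Qed.

(** As the modes at negative frequency vanish, the conjugate of H contributes nothing at frequency
    m, so the real part carries exactly half of that mode. *)
Lemma polar_coef m r : (0 < m)%nat -> 0 < r < exp X ->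
  2 * A (polarU r) m = IU (- Z.of_nat m) r /\ 2 * B (polarU r) m = - IV (- Z.of_nat m) r.
Proof.
  intros Hm Hr. destruct (polar_cont r Hr) as [C1 C2].
  destruct (polar_neg_modes m r Hm Hr) as [N1 N2]. unfold IU, IV in *.
  unfold Cc, Cs. rewrite <- INR_IZR_INZ in N1, N2.
  rewrite ig_minus in N1 by ct. rewrite ig_plus in N2 by ct.
  assert (En : forall t, IZR (- Z.of_nat m) * t = - (INR m * t)).
  { intros t. rewrite opp_IZR, <- INR_IZR_INZ. ring. }
  rewrite (ig_ext (fun t => polarU r t * cos (INR m * t) * 1) (fun t => polarU r t * cos (INR m * t))) by (intros; ring).
  rewrite (ig_ext (fun t => polarU r t * sin (INR m * t) * 1) (fun t => polarU r t * sin (INR m * t))) by (intros; ring).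
  rewrite (ig_ext (fun t => polarU r t * cos (IZR (- Z.of_nat m) * t) - polarV r t * sin (IZR (- Z.of_nat m) * t))
    (fun t => polarU r t * cos (INR m * t) + polarV r t * sin (INR m * t))) by (intros; rewrite En, cos_neg, sin_neg; ring).
  rewrite (ig_ext (fun t => polarU r t * sin (IZR (- Z.of_nat m) * t) + polarV r t * cos (IZR (- Z.of_nat m) * t))
    (fun t => polarV r t * cos (INR m * t) - polarU r t * sin (INR m * t))) by (intros; rewrite En, cos_neg, sin_neg; ring).
  rewrite ig_plus, ig_minus by ct. lra.
Qed.

End Polar.

Lemma ex_series_half : ex_series (fun n => (/ 2) ^ n).
Proof. apply ex_series_geom. rewrite Rabs_right; lra. Qed.

(** The real part of F on the circle of radius r about c is expanded in a Fourier series. Its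
    coefficients are proportional to [r^m], so evaluation at the angles 0 and [PI] gives one power
    series in s - c, valid for every real s. *)
Lemma entire_real_taylor_Re (F : C -> C) (c : R) : entire F ->
  exists al : nat -> R, forall s, is_series (fun n => al n * (s - c) ^ n) (fst (F (RtoC s))).
Proof.
  intros HF. set (H := fun z => F (RtoC c + 1 * z)%C).
  assert (HH : forall X z, Cmod z < exp X -> exists l, cd H z l).
  { intros X z _. destruct (proj1 (cdiff_cd F (RtoC c + 1 * z)%C) (HF _)) as [l Hl].
    eexists. apply (cd_comp F (fun z => (RtoC c + 1 * z)%C)); [exact Hl|apply cd_affine]. }
  assert (Hbig : forall r, 0 < r -> 0 < r < exp (ln r + 1)).
  { intros r Hr. split; auto. rewrite <- (exp_ln r Hr) at 1. apply exp_increasing. lra. }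
  assert (Hbig2 : forall r s, 0 < r -> 0 < s -> 0 < s < exp (ln (r + s) + 1)).
  { intros r s Hr Hs. split; auto. pose proof (Hbig (r + s) ltac:(lra)). lra. }
  assert (HC : forall r, 0 < r -> cont (polarU H r)) by (intros r Hr; apply (polar_cont H _ (HH (ln r + 1)) r (Hbig r Hr))).
  assert (HPer : forall r, periodic2pi (polarU H r)) by (intros; apply polar_periodic).
  set (be := fun m => A (polarU H 1) m / PI).
  assert (Escale : forall m r, (0 < m)%nat -> 0 < r ->
     A (polarU H r) m = A (polarU H 1) m * r ^ m /\ B (polarU H r) m = B (polarU H 1) m * r ^ m).
  { intros m r Hm Hr.
    pose proof (Hbig2 1 r ltac:(lra) Hr) as R1. rewrite (Rplus_comm 1 r) in R1. pose proof (Hbig2 r 1 Hr ltac:(lra)) as R2.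
    destruct (polar_coef H _ (HH (ln (r + 1) + 1)) m r Hm R1) as [E1 E2].
    destruct (polar_coef H _ (HH (ln (r + 1) + 1)) m 1 Hm R2) as [E3 E4].
    destruct (polar_pos_modes H _ (HH (ln (r + 1) + 1)) m r 1 R1 R2) as [E5 E6].
    rewrite pow1, !Rmult_1_r in E5, E6. rewrite <- E1, <- E3 in E5. 
    split; [lra|]. assert (IV H (- Z.of_nat m) r = IV H (- Z.of_nat m) 1 * r ^ m) by lra. nra. }
  assert (HAB : forall f m M, cont f -> (forall t, Rabs (f t) <= M) -> 0 <= M -> Rabs (A f m) <= 2 * PI * M /\ Rabs (B f m) <= 2 * PI * M).
  { intros f m M Cf Hf HM. split; (apply ig_abs_le; [ct|]); intros t; rewrite Rmult_1_r, Rabs_mult, <- (Rmult_1_r M);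
    (apply Rmult_le_compat; auto using Rabs_pos); apply Rabs_trig_le. }
  (* The coefficients at radius r are those at radius 2r, which are bounded, divided by [2^m]. *)
  assert (Hsum : forall r, 0 < r -> fsummable (fun t => t) (fun _ => 1) (polarU H r)).
  { intros r Hr. destruct (cont_bounded _ (HC (2 * r) ltac:(lra)) (HPer (2 * r))) as [M [HM HMb]].
    apply (@ex_series_le _ R_CompleteNormedModule _ (fun n => 2 * (2 * PI * M) * (/ 2) ^ n)); [|apply ex_series_scalR, ex_series_half].
    intros n. set (m := S n).
    change (Rabs (Rabs (A (polarU H r) m) + Rabs (B (polarU H r) m)) <= 2 * (2 * PI * M) * (/ 2) ^ n).
    rewrite Rabs_right by (apply Rle_ge, Rplus_le_le_0_compat; apply Rabs_pos).
    destruct (HAB (polarU H (2 * r)) m M (HC (2 * r) ltac:(lra)) HMb ltac:(lra)) as [B1 B2].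
    destruct (Escale m r ltac:(unfold m; lia) Hr) as [E1 E2].
    destruct (Escale m (2 * r) ltac:(unfold m; lia) ltac:(lra)) as [E3 E4].
    assert (Hh : (2 * r) ^ m * (/ 2) ^ m = r ^ m).
    { rewrite <- Rpow_mult_distr. f_equal. field. }
    assert (Hle : (/ 2) ^ m <= (/ 2) ^ n) by (unfold m; simpl; assert (0 < (/ 2) ^ n) by (apply pow_lt; lra); lra).
    assert (Hp : 0 < (/ 2) ^ m) by (apply pow_lt; lra).
    assert (F1 : A (polarU H r) m = A (polarU H (2 * r)) m * (/ 2) ^ m) by (rewrite E1, E3, <- Hh; ring).
    assert (F2 : B (polarU H r) m = B (polarU H (2 * r)) m * (/ 2) ^ m) by (rewrite E2, E4, <- Hh; ring).
    rewrite F1, F2, !Rabs_mult, (Rabs_right ((/ 2) ^ m)) by lra.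
    assert (0 <= 2 * PI * M) by (pose proof PI_RGT_0; nra).
    apply Rle_trans with ((2 * PI * M) * (/ 2) ^ m + (2 * PI * M) * (/ 2) ^ m); [|nra].
    apply Rplus_le_compat; apply Rmult_le_compat_r; lra. }
  set (a0 := fst (F (RtoC c))).
  (* The mean value property: the mean does not depend on the radius, and on small circles it is
     close to the value at the centre. *)
  assert (Hmean : forall r, 0 < r -> A (polarU H r) 0 = 2 * PI * a0).
  { intros r Hr. apply cond_eq. intros eps He.
    destruct (HH 0 0) as [l Hl]; [rewrite Cmod_0; apply exp_pos|].
    destruct (Hl 1 ltac:(lra)) as [d [Hd Hb]].
    pose proof (Cmod_ge_0 l) as Hl0. pose proof two_pi_pos as HP.
    set (L := 2 * PI * (Cmod l + 1)). assert (HL : 0 < L) by (unfold L; nra).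
    set (r' := Rmin (d / 2) (eps / (2 * L))).
    assert (Hr' : 0 < r') by (unfold r'; apply Rmin_pos; [lra|apply Rdiv_lt_0_compat; lra]).
    assert (Hrr : r' <= d / 2 /\ r' <= eps / (2 * L)) by (split; [apply Rmin_l|apply Rmin_r]).
    assert (Econst : A (polarU H r) 0 = A (polarU H r') 0).
    { assert (E0 : forall rho, A (polarU H rho) 0 = IU H 0 rho).
      { intros rho. unfold Cc, IU. apply ig_ext; intros t. simpl INR. rewrite !Rmult_0_l, cos_0, sin_0. ring. }
      rewrite !E0.
      destruct (polar_const_r H _ (HH (ln (r + r') + 1)) 0 r r') as [E _].
      - pose proof (Hbig2 r' r Hr' Hr) as HB. rewrite (Rplus_comm r' r) in HB. exact HB.
      - now apply Hbig2.
      - rewrite !Rmult_0_l, exp_0, !Rmult_1_l in E. exact E. }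
    rewrite Econst. rewrite <- (ig_const a0). unfold Cc. rewrite <- ig_minus by (pose proof (HC r' Hr'); ct).
    apply Rle_lt_trans with (2 * PI * ((Cmod l + 1) * r')).
    - apply ig_abs_le; [pose proof (HC r' Hr'); ct|]. intros t. simpl INR. rewrite Rmult_0_l, cos_0, !Rmult_1_r.
      assert (Hm : Cmod (r' * cos t, r' * sin t) = r').
      { unfold Cmod; simpl. replace (r' * cos t * (r' * cos t * 1) + r' * sin t * (r' * sin t * 1)) with (r'² * ((sin t)² + (cos t)²)) by (unfold Rsqr; ring).
        rewrite sin2_cos2, Rmult_1_r. apply sqrt_Rsqr; lra. }
      unfold polarU. set (z := (r' * cos t, r' * sin t) : C) in *.
      specialize (Hb z). replace (z - 0)%C with z in Hb by ring. rewrite Hm in Hb. specialize (Hb ltac:(lra)).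
      assert (HD : Cmod (H z - H 0) <= (Cmod l + 1) * r').
      { replace (H z - H 0)%C with (l * z + (H z - H 0 - l * z))%C by ring.
        eapply Rle_trans; [apply Cmod_triangle|]. rewrite Cmod_mult, Hm. lra. }
      destruct (Cmod_ge_abs (H z - H 0)) as [A1 _].
      assert (E0 : a0 = fst (H 0)) by (unfold a0, H; do 2 f_equal; ring).
      rewrite E0. eapply Rle_trans; [|exact HD]. eapply Rle_trans; [|exact A1]. right. f_equal.
    - fold L. replace (2 * PI * ((Cmod l + 1) * r')) with (L * r') by (unfold L; ring).
      apply Rle_lt_trans with (L * (eps / (2 * L))); [apply Rmult_le_compat_l; lra|].
      replace (L * (eps / (2 * L))) with (eps / 2) by (field; lra). lra. }
  exists (fun n => match n with O => a0 | S _ => be n end). intros s.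
  assert (Hser : forall r t, 0 < r -> is_series (fterm (fun t => t) (fun _ => 1) (polarU H r) t) (polarU H r t - a0)).
  { intros r t Hr. pose proof (fourier_expansion _ _ circle_map_id (polarU H r) (HC r Hr) (HPer r) (Hsum r Hr) t) as E.
    rewrite Hmean in E by auto. replace (2 * PI * a0 / (2 * PI)) with a0 in E by (field; apply PI_neq0). exact E. }
  apply (@is_series_decr_1 R_AbsRing R_NormedModule).
  change (is_series (fun k => be (S k) * (s - c) ^ S k) (fst (F (RtoC s)) + - (a0 * (s - c) ^ 0))).
  rewrite pow_O, Rmult_1_r.
  destruct (Rtotal_order s c) as [Hs|[Hs|Hs]].
  (* A point left of the centre is reached at angle [PI], where the cosines supply the signs of
     [(s - c)^n]. *)
  - pose proof (Hser (c - s) PI ltac:(lra)) as E.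
    replace (fst (F (RtoC s)) + - a0) with (polarU H (c - s) PI - a0).
    + eapply is_series_extR; [|exact E]. intros n. unfold fterm. cbv beta.
      destruct (Escale (S n) (c - s) ltac:(lia) ltac:(lra)) as [-> _].
      assert (Hcs : cos (INR (S n) * PI) = (-1) ^ (S n) /\ sin (INR (S n) * PI) = 0).
      { induction (S n) as [|k IH]; [simpl; rewrite Rmult_0_l, cos_0, sin_0; auto|].
        rewrite S_INR, Rmult_plus_distr_r, Rmult_1_l, cos_plus, sin_plus, cos_PI, sin_PI.
        destruct IH as [-> ->]. simpl. split; ring. }
      destruct Hcs as [-> ->]. unfold be.
      replace ((s - c) ^ S n) with ((-1) ^ (S n) * (c - s) ^ (S n)) by (rewrite <- Rpow_mult_distr; f_equal; ring).
      field. apply PI_neq0.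
    + unfold polarU, H. unfold Rminus at 1. f_equal. f_equal. f_equal. rewrite cos_PI, sin_PI.
      unfold RtoC, Cplus, Cmult; simpl. f_equal; ring.
  - subst s. replace (fst (F (RtoC c)) + - a0) with 0 by (unfold a0; ring).
    eapply is_series_extR; [|apply (is_series_single 0 0)]. intros n. simpl.
    replace (c - c) with 0 by ring. destruct (Nat.eqb n 0); ring.
  - pose proof (Hser (s - c) 0 ltac:(lra)) as E.
    replace (fst (F (RtoC s)) + - a0) with (polarU H (s - c) 0 - a0).
    + eapply is_series_extR; [|exact E]. intros n. unfold fterm. cbv beta.
      destruct (Escale (S n) (s - c) ltac:(lia) ltac:(lra)) as [-> _].
      rewrite Rmult_0_r, cos_0, sin_0. unfold be. field. apply PI_neq0.
    + unfold polarU, H. unfold Rminus at 1. f_equal. f_equal. f_equal. rewrite cos_0, sin_0.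
      unfold RtoC, Cplus, Cmult; simpl. f_equal; ring.
Qed.

Theorem entire_real_taylor (F : C -> C) (c : R) : entire F ->
  exists al be : nat -> R, forall s,
    is_series (fun n => al n * (s - c) ^ n) (fst (F (RtoC s))) /\
    is_series (fun n => be n * (s - c) ^ n) (snd (F (RtoC s))).
Proof.
  intros HF. destruct (entire_real_taylor_Re F c HF) as [al Hal].
  (* The imaginary part of F is the real part of [- i F]. *)
  destruct (entire_real_taylor_Re (fun z => (0 + - Ci * F z)%C) c) as [be Hbe].
  - intros z. apply cdiff_cd. destruct (proj1 (cdiff_cd F z) (HF z)) as [l Hl]. eexists.
    apply (cd_comp (fun w => (0 + - Ci * w)%C) F); [apply cd_affine|exact Hl].
  - exists al, be. intros s. split; auto.
    replace (snd (F (RtoC s))) with (fst (0 + - Ci * F (RtoC s))%C); auto. simpl. ring.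
Qed.

(** * Double series *)

Lemma is_series_absR (u b : nat -> R) : (forall n, Rabs (u n) <= b n) -> ex_series b -> ex_series u.
Proof. intros H Hb. apply (@ex_series_le _ R_CompleteNormedModule u b); auto. Qed.

Lemma Series_abs_le (u b : nat -> R) : (forall n, Rabs (u n) <= b n) -> ex_series b -> Rabs (Series u) <= Series b.
Proof.
  intros H Hb. eapply Rle_trans; [apply Series_Rabs|].
  - apply (is_series_absR _ b); auto. intros n. now rewrite Rabs_Rabsolu.
  - apply Series_le; auto. intros n; split; [apply Rabs_pos|apply H].
Qed.

Lemma Series_sm (u : nat -> nat -> R) N : (forall n, (n < N)%nat -> ex_series (u n)) ->
  ex_series (fun i => sm N (fun n => u n i)) /\ Series (fun i => sm N (fun n => u n i)) = sm N (fun n => Series (u n)).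
Proof.
  induction N; intros H; simpl.
  - assert (Z : is_series (fun _ : nat => 0) 0).
    { eapply is_series_extR; [|apply (is_series_single 0 0)]. intros n. cbv beta. destruct (Nat.eqb n 0); auto. }
    split; [exists 0; exact Z|exact (is_series_unique _ _ Z)].
  - destruct IHN as [E1 E2]; [auto|]. split.
    + apply (@ex_series_plus R_AbsRing R_NormedModule); auto.
    + rewrite Series_plus, E2; auto.
Qed.

Lemma series_fubini (a b : nat -> nat -> R) :
  (forall n i, Rabs (a n i) <= b n i) -> (forall n, ex_series (b n)) -> ex_series (fun n => Series (b n)) ->
  (forall i, ex_series (fun n => a n i)) /\
  is_series (fun i => Series (fun n => a n i)) (Series (fun n => Series (a n))).
Proof.
  intros Hab Hb HB.
  assert (b0 : forall n i, 0 <= b n i) by (intros n i; eapply Rle_trans; [apply Rabs_pos|apply Hab]).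
  assert (Hbi : forall n i, b n i <= Series (b n)).
  { intros n i. apply Rle_trans with (sm (S i) (b n)).
    - apply (sm_term_le (S i) (b n) i); [intros; apply b0|lia].
    - apply sm_series_le; auto. now apply Series_correct. }
  assert (Ha : forall n, ex_series (a n)) by (intros n; apply (is_series_absR _ (b n)); auto).
  assert (Hcol : forall i, ex_series (fun n => a n i)).
  { intros i. apply (is_series_absR _ (fun n => Series (b n))); auto. intros n. eapply Rle_trans; [apply Hab|apply Hbi]. }
  split; auto.
  assert (HA : ex_series (fun n => Series (a n))).
  { apply (is_series_absR _ (fun n => Series (b n))); auto. intros n. now apply Series_abs_le. }
  apply filterlim_locally; intros eps. assert (He : 0 < eps / 3) by (destruct eps; simpl; lra).
  destruct (series_tail_small _ _ HB He) as [N HN]. specialize (HN N (le_n N)). rewrite <- sm_sum_n in HN.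
  set (N1 := S N) in *.
  destruct (Series_sm a N1 (fun n _ => Ha n)) as [E1 E2].
  destruct (series_tail_small _ _ E1 He) as [I HI]. exists I. intros i Hi. specialize (HI i Hi).
  change (Rabs (sum_n (fun i => Series (fun n => a n i)) i - Series (fun n => Series (a n))) < eps).
  rewrite <- sm_sum_n in *. set (I1 := S i) in *. rewrite E2 in HI.
  assert (T1 : Rabs (Series (fun n => Series (a n)) - sm N1 (fun n => Series (a n))) <= Series (fun n => Series (b n)) - sm N1 (fun n => Series (b n))).
  { unfold N1. rewrite !sm_sum_n. apply series_tail_le; auto. intros n. now apply Series_abs_le. }
  assert (T2 : Rabs (sm I1 (fun i => Series (fun n => a n i)) - sm I1 (fun i => sm N1 (fun n => a n i)))
     <= Series (fun n => Series (b n)) - sm N1 (fun n => Series (b n))).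
  { destruct (Series_sm (fun i n => a n i) I1 (fun i _ => Hcol i)) as [F1 F2].
    rewrite <- F2, <- (sm_swap N1 I1). unfold N1. rewrite !sm_sum_n. apply series_tail_le; auto.
    intros n. eapply Rle_trans; [apply sm_abs|]. apply Rle_trans with (sm I1 (b n)).
    - apply sm_le; intros; apply Hab.
    - apply sm_series_le; auto. now apply Series_correct. }
  pose proof (Rle_abs (Series (fun n => Series (b n)) - sm N1 (fun n => Series (b n)))) as HL.
  assert (Esw : sm N1 (fun n => sm I1 (a n)) = sm I1 (fun i => sm N1 (fun n => a n i))) by apply sm_swap.
  rewrite Rabs_minus_sym in HI. apply Rabs_def2 in HI. apply Rabs_le_between in T1, T2.
  apply Rabs_def1; lra.
Qed.

Lemma is_series_pairs (u : nat -> R) (l : R) : is_series u l -> is_series (fun n => u (2 * n)%nat + u (2 * n + 1)%nat) l.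
Proof.
  intros H. apply filterlim_locally; intros eps.
  destruct (proj1 (filterlim_locally _ _) H eps) as [N HN]. exists N. intros n Hn.
  specialize (HN (S (2 * n)) ltac:(lia)).
  change (Rabs (sum_n u (S (2 * n)) - l) < eps) in HN.
  change (Rabs (sum_n (fun n => u (2 * n)%nat + u (2 * n + 1)%nat) n - l) < eps).
  rewrite <- sm_sum_n in *. replace (S (S (2 * n))) with (2 * S n)%nat in HN by lia.
  now rewrite sm_double in HN.
Qed.

(** * Elementary estimates *)

Lemma exp_lipschitz u v M : exp u <= M -> exp v <= M -> Rabs (exp u - exp v) <= M * Rabs (u - v).
Proof.
  intros Hu Hv.
  assert (H : forall x y, exp x <= M -> exp x - exp y <= M * Rabs (x - y)).
  { intros x y Hx. pose proof (exp_pos x) as P.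
    assert (E : exp y = exp x * exp (y - x)) by (rewrite <- exp_plus; f_equal; ring).
    pose proof (exp_ineq1_le (y - x)) as I. pose proof (Rle_abs (x - y)) as A1. pose proof (Rabs_pos (x - y)).
    rewrite E. assert (exp x * (1 - exp (y - x)) <= exp x * Rabs (x - y)) by (apply Rmult_le_compat_l; lra).
    assert (exp x * Rabs (x - y) <= M * Rabs (x - y)) by (apply Rmult_le_compat_r; lra). lra. }
  pose proof (H u v Hu) as H1. pose proof (H v u Hv) as H2. rewrite (Rabs_minus_sym v u) in H2.
  apply Rabs_le. lra.
Qed.

Lemma pow_diff_le x y L i : Rabs x <= L -> Rabs y <= L -> Rabs (x ^ i - y ^ i) <= Rabs (x - y) * (L + 1) ^ i.
Proof.
  intros Hx Hy. pose proof (Rabs_pos x) as Px.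
  (* Subtracting [L^i] strengthens the claim enough for the induction to close. *)
  assert (H : Rabs (x ^ i - y ^ i) <= Rabs (x - y) * ((L + 1) ^ i - L ^ i)).
  { induction i; simpl; [rewrite !Rminus_diag, Rabs_R0; lra|].
    replace (x * x ^ i - y * y ^ i) with (x * (x ^ i - y ^ i) + (x - y) * y ^ i) by ring.
    eapply Rle_trans; [apply Rabs_triang|]. rewrite !Rabs_mult.
    assert (Hyi : Rabs (y ^ i) <= L ^ i) by (rewrite <- RPow_abs; apply pow_incr; split; [apply Rabs_pos|auto]).
    pose proof (Rabs_pos (x - y)). pose proof (Rabs_pos (x ^ i - y ^ i)).
    assert (L ^ i <= (L + 1) ^ i) by (apply pow_incr; lra).
    assert (T1 : Rabs x * Rabs (x ^ i - y ^ i) <= L * (Rabs (x - y) * ((L + 1) ^ i - L ^ i))) by (apply Rmult_le_compat; auto).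
    assert (T2 : Rabs (x - y) * Rabs (y ^ i) <= Rabs (x - y) * L ^ i) by (apply Rmult_le_compat_l; auto).
    assert (T3 : 0 <= Rabs (x - y) * ((L + 1) ^ i - L ^ i)) by (apply Rmult_le_pos; lra).
    nra. }
  eapply Rle_trans; [exact H|]. apply Rmult_le_compat_l; [apply Rabs_pos|].
  assert (0 <= L ^ i) by (apply pow_le; lra). lra.
Qed.

Lemma ln_lipschitz a b c : 0 < c -> c <= a -> c <= b -> Rabs (ln a - ln b) <= Rabs (a - b) / c.
Proof.
  intros Hc Ha Hb.
  assert (H : forall x y, c <= x -> c <= y -> ln x - ln y <= Rabs (x - y) / c).
  { intros x y Hx Hy. rewrite <- ln_div by lra.
    assert (Hr : 0 < x / y) by (apply Rdiv_lt_0_compat; lra).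
    pose proof (exp_ineq1_le (ln (x / y))) as E. rewrite exp_ln in E by auto.
    assert (E2 : ln (x / y) <= (x - y) / y) by (replace ((x - y) / y) with (x / y - 1) by (field; lra); lra).
    eapply Rle_trans; [exact E2|]. apply Rle_trans with (Rabs (x - y) / y).
    - apply Rmult_le_compat_r; [apply Rlt_le, Rinv_0_lt_compat; lra|apply Rle_abs].
    - apply Rmult_le_compat_l; [apply Rabs_pos|apply Rinv_le_contravar; lra]. }
  pose proof (H a b Ha Hb) as H1. pose proof (H b a Hb Ha) as H2. rewrite (Rabs_minus_sym b a) in H2.
  apply Rabs_le. lra.
Qed.

Lemma is_series_exp x : is_series (fun i => x ^ i / INR (fact i)) (exp x).
Proof.
  pose proof (is_exp_Reals x) as H. unfold is_pseries in H.
  eapply is_series_extR; [|exact H]. intros n. reflexivity.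
Qed.

(** * The difference of zeta functions *)

Section Zeta.
Variable (mu : nat -> R).
Hypothesis mu_pos : forall j, 0 < mu j.
Hypothesis mu_mono : forall i j, (i <= j)%nat -> mu i <= mu j.
Hypothesis mu_close : forall N, exists C, 0 < C /\ forall j, Rabs (mu j - INR (fr j)) <= C / INR (fr j) ^ N.
Hypothesis mu_prod_le : forall n, pd (2 * n) mu <= pd (2 * n) (fun i => INR (fr i)).
Hypothesis mu_prod_ge : exists C n0, 0 < C /\ forall n, (n0 <= n)%nat ->
  pd (2 * n) (fun i => INR (fr i)) * (2 - exp (C / (INR n + 1))) <= pd (2 * n) mu.

(** The signs are chosen so that the power [mu j ^ (-s)] is [exp (s * x j)], a convex function of
    [x j] for every real s. *)
Let x (j : nat) : R := - ln (mu j).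
Let y (j : nat) : R := - ln (INR (fr j)).

Lemma xy_close N : exists C, 0 < C /\ forall j, Rabs (x j - y j) <= C / INR (fr j) ^ N.
Proof.
  destruct (mu_close N) as [C [HC H]]. set (c := Rmin (mu 0) 1).
  assert (Hc : 0 < c) by (apply Rmin_pos; [apply mu_pos|lra]).
  exists (C / c); split; [now apply Rdiv_lt_0_compat|]. intros j. unfold x, y.
  replace (- ln (mu j) - - ln (INR (fr j))) with (- (ln (mu j) - ln (INR (fr j)))) by ring. rewrite Rabs_Ropp.
  pose proof (fr_pos j). eapply Rle_trans; [apply (ln_lipschitz _ _ c Hc)|].
  - pose proof (Rmin_l (mu 0) 1). pose proof (mu_mono 0 j ltac:(lia)). unfold c; lra.
  - pose proof (Rmin_r (mu 0) 1). unfold c; lra.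
  - replace (C / c / INR (fr j) ^ N) with (C / INR (fr j) ^ N / c).
    + apply Rmult_le_compat_r; [apply Rlt_le, Rinv_0_lt_compat; lra|apply H].
    + field. split; [lra|apply pow_nonzero; lra].
Qed.

(* Taylor coefficients at s = 3 of lambda^{-s} - beta^{-s}. *)
Definition tcoef (j i : nat) : R := (exp (3 * x j) * x j ^ i - exp (3 * y j) * y j ^ i) / INR (fact i).

Lemma tcoef_series j h : is_series (fun i => tcoef j i * h ^ i) (exp ((3 + h) * x j) - exp ((3 + h) * y j)).
Proof.
  assert (E : forall z, is_series (fun i => exp (3 * z) * ((h * z) ^ i / INR (fact i))) (exp ((3 + h) * z))).
  { intros z. replace (exp ((3 + h) * z)) with (exp (3 * z) * exp (h * z)) by (rewrite <- exp_plus; f_equal; ring).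
    apply (@is_series_scal R_AbsRing R_NormedModule), is_series_exp. }
  eapply is_series_extR; [|apply is_series_minusR; [apply (E (x j))|apply (E (y j))]].
  intros i. unfold tcoef. rewrite !Rpow_mult_distr. field. apply INR_fact_neq_0.
Qed.

(** The sum of the bounds over i is of order [|x j - y j| * exp (|h| * |ln fr j|)], that is
    [|x j - y j| * fr j ^ |h|]. Convergence for every h therefore needs [x j - y j] to decay faster
    than every power. *)
Lemma tcoef_summable h : exists b : nat -> nat -> R, (forall j i, Rabs (tcoef j i * h ^ i) <= b j i) /\
  (forall j, ex_series (b j)) /\ exists D, forall j, Series (b j) <= D / INR (fr j) ^ 2.
Proof.
  (* M powers of [fr j] compensate the growth [fr j ^ |h|], and two more give summability in j. *)
  destruct (INR_unbounded (Rabs h)) as [M HM].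
  destruct (xy_close 0) as [C1 [HC1 H1]]. destruct (xy_close (M + 2)) as [C2 [HC2 H2]].
  set (L := fun j => C1 + ln (INR (fr j))).
  assert (HL0 : forall j, 0 <= ln (INR (fr j))).
  { intros j. rewrite <- ln_1. apply ln_le; [lra|apply fr_pos]. }
  assert (HLy : forall j, Rabs (y j) <= L j).
  { intros j. unfold y, L. rewrite Rabs_Ropp, Rabs_right by (apply Rle_ge, HL0). lra. }
  assert (HLx : forall j, Rabs (x j) <= L j).
  { intros j. replace (x j) with ((x j - y j) + y j) by ring. eapply Rle_trans; [apply Rabs_triang|].
    specialize (H1 j). rewrite pow_O, Rdiv_1_r in H1. unfold y, L at 1. rewrite Rabs_Ropp, (Rabs_right (ln _)) by (apply Rle_ge, HL0). fold (y j). lra. }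
  set (E0 := exp (3 * x 0) + 1). assert (HE0 : 0 < E0) by (unfold E0; pose proof (exp_pos (3 * x 0)); lra).
  assert (HEx : forall j, exp (3 * x j) <= E0).
  { intros j. apply Rle_trans with (exp (3 * x 0)); [|unfold E0; lra].
    assert (Hle : 3 * x j <= 3 * x 0).
    { unfold x. pose proof (ln_le (mu 0) (mu j) (mu_pos 0) (mu_mono 0 j ltac:(lia))). lra. }
    destruct Hle as [Hl|Hl]; [left; now apply exp_increasing|right; now rewrite Hl]. }
  assert (HEy : forall j, exp (3 * y j) <= E0).
  { intros j. apply Rle_trans with 1; [|unfold E0; pose proof (exp_pos (3 * x 0)); lra].
    rewrite <- exp_0. assert (Hle : 3 * y j <= 0) by (unfold y; specialize (HL0 j); lra).
    destruct Hle as [Hl|Hl]; [left; now apply exp_increasing|right; now rewrite Hl]. }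
  (* The difference of powers contributes [E0], the difference of the exponentials at s = 3
     contributes [3 * E0]. *)
  set (D := fun j => 4 * E0 * Rabs (x j - y j)).
  exists (fun j i => D j * ((Rabs h * (L j + 1)) ^ i / INR (fact i))).
  assert (HD : forall j, 0 <= D j) by (intros j; unfold D; pose proof (Rabs_pos (x j - y j)); nra).
  assert (Hb : forall j, is_series (fun i => D j * ((Rabs h * (L j + 1)) ^ i / INR (fact i))) (D j * exp (Rabs h * (L j + 1)))).
  { intros j. apply (@is_series_scal R_AbsRing R_NormedModule), is_series_exp. }
  split; [|split].
  - intros j i. unfold tcoef. pose proof (INR_fact_lt_0 i) as Hf.
    assert (HT : Rabs (exp (3 * x j) * x j ^ i - exp (3 * y j) * y j ^ i) <= D j * (L j + 1) ^ i).
    { replace (exp (3 * x j) * x j ^ i - exp (3 * y j) * y j ^ i)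
        with (exp (3 * x j) * (x j ^ i - y j ^ i) + (exp (3 * x j) - exp (3 * y j)) * y j ^ i) by ring.
      eapply Rle_trans; [apply Rabs_triang|]. rewrite !Rabs_mult.
      pose proof (pow_diff_le (x j) (y j) (L j) i (HLx j) (HLy j)) as P1.
      pose proof (exp_lipschitz _ _ _ (HEx j) (HEy j)) as P2.
      replace (3 * x j - 3 * y j) with (3 * (x j - y j)) in P2 by ring. rewrite Rabs_mult, (Rabs_right 3) in P2 by lra.
      assert (P3 : Rabs (y j ^ i) <= (L j + 1) ^ i).
      { rewrite <- RPow_abs. apply pow_incr. split; [apply Rabs_pos|]. specialize (HLy j). lra. }
      rewrite (Rabs_right (exp (3 * x j))) by (apply Rle_ge, Rlt_le, exp_pos).
      pose proof (exp_pos (3 * x j)).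
      assert (T1 : exp (3 * x j) * Rabs (x j ^ i - y j ^ i) <= E0 * (Rabs (x j - y j) * (L j + 1) ^ i)).
      { apply Rmult_le_compat; auto using Rabs_pos. lra. }
      assert (T2 : Rabs (exp (3 * x j) - exp (3 * y j)) * Rabs (y j ^ i) <= E0 * (3 * Rabs (x j - y j)) * (L j + 1) ^ i).
      { apply Rmult_le_compat; auto using Rabs_pos. }
      unfold D. lra. }
    rewrite Rabs_mult, <- RPow_abs. unfold Rdiv at 1. rewrite Rabs_mult, (Rabs_right (/ INR (fact i))) by (apply Rle_ge, Rlt_le, Rinv_0_lt_compat; lra).
    rewrite Rpow_mult_distr. unfold Rdiv.
    replace (D j * (Rabs h ^ i * (L j + 1) ^ i * / INR (fact i))) with (D j * (L j + 1) ^ i * / INR (fact i) * Rabs h ^ i) by ring.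
    apply Rmult_le_compat_r; [apply pow_le, Rabs_pos|]. apply Rmult_le_compat_r; [apply Rlt_le, Rinv_0_lt_compat; lra|exact HT].
  - intros j. eexists; apply Hb.
  - exists (4 * E0 * C2 * exp (Rabs h * (C1 + 1))). intros j. rewrite (is_series_unique _ _ (Hb j)).
    pose proof (fr_pos j) as Hf. unfold D, L.
    assert (HX : exp (Rabs h * (C1 + ln (INR (fr j)) + 1)) <= exp (Rabs h * (C1 + 1)) * INR (fr j) ^ M).
    { replace (Rabs h * (C1 + ln (INR (fr j)) + 1)) with (Rabs h * (C1 + 1) + Rabs h * ln (INR (fr j))) by ring.
      rewrite exp_plus. apply Rmult_le_compat_l; [apply Rlt_le, exp_pos|].
      rewrite <- (Rpower_pow M) by lra. unfold Rpower.
      assert (Hle : Rabs h * ln (INR (fr j)) <= INR M * ln (INR (fr j))) by (apply Rmult_le_compat_r; [apply HL0|lra]).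
      destruct Hle as [Hl|Hl]; [left; now apply exp_increasing|right; now rewrite Hl]. }
    specialize (H2 j). rewrite pow_add in H2. assert (HfM : 0 < INR (fr j) ^ M) by (apply pow_lt; lra).
    assert (Hf2 : 0 < INR (fr j) ^ 2) by (apply pow_lt; lra).
    pose proof (exp_pos (Rabs h * (C1 + 1))) as HEp.
    apply Rle_trans with (4 * E0 * (C2 / (INR (fr j) ^ M * INR (fr j) ^ 2)) * (exp (Rabs h * (C1 + 1)) * INR (fr j) ^ M)).
    + apply Rmult_le_compat; auto.
      * pose proof (Rabs_pos (x j - y j)). nra.
      * apply Rlt_le, exp_pos.
      * apply Rmult_le_compat_l; lra.
    + right. field. split; lra.
Qed.

Definition ez (n : nat) (s : R) : R :=
  exp (s * x (2 * n)) - exp (s * y (2 * n)) + (exp (s * x (2 * n + 1)) - exp (s * y (2 * n + 1))).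
Definition gcoef (n i : nat) : R := tcoef (2 * n) i + tcoef (2 * n + 1) i.

Lemma ez_taylor h : (forall i, ex_series (fun n => gcoef n i)) ->
  ex_series (fun n => ez n (3 + h)) /\
  is_series (fun i => Series (fun n => gcoef n i) * h ^ i) (Series (fun n => ez n (3 + h))).
Proof.
  intros Hg. destruct (tcoef_summable h) as [b [Hb [Hbs [D HD]]]].
  set (b' := fun n i => b (2 * n)%nat i + b (2 * n + 1)%nat i).
  assert (b0 : forall j i, 0 <= b j i) by (intros j i; eapply Rle_trans; [apply Rabs_pos|apply Hb]).
  assert (Hb' : forall n, is_series (b' n) (Series (b (2 * n)%nat) + Series (b (2 * n + 1)%nat))).
  { intros n. apply is_series_plusR; now apply Series_correct. }
  assert (Sb0 : forall j, 0 <= Series (b j)).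
  { intros j. apply (is_series_ge0 (b j)); [now apply Series_correct|auto]. }
  assert (HSB : ex_series (fun n => Series (b' n))).
  { apply (is_series_absR _ (fun n => (2 * D) * / INR (S n) ^ 2)); [|apply ex_series_scalR, ex_series_inv_sq].
    intros n. rewrite (is_series_unique _ _ (Hb' n)). pose proof (Sb0 (2 * n)%nat). pose proof (Sb0 (2 * n + 1)%nat).
    rewrite Rabs_right by lra. pose proof (HD (2 * n)%nat) as D1. pose proof (HD (2 * n + 1)%nat) as D2.
    rewrite fr_even in D1. rewrite fr_odd in D2. unfold Rdiv in D1, D2. lra. }
  assert (Hez : forall n, is_series (fun i => gcoef n i * h ^ i) (ez n (3 + h))).
  { intros n. unfold ez, gcoef. eapply is_series_extR; [|apply is_series_plusR; [apply (tcoef_series (2 * n))|apply (tcoef_series (2 * n + 1))]].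
    intros i. cbv beta. ring. }
  assert (Hbd : forall n i, Rabs (gcoef n i * h ^ i) <= b' n i).
  { intros n i. unfold gcoef, b'. rewrite Rmult_plus_distr_r. eapply Rle_trans; [apply Rabs_triang|].
    apply Rplus_le_compat; apply Hb. }
  destruct (series_fubini (fun n i => gcoef n i * h ^ i) b' Hbd (fun n => ex_intro _ _ (Hb' n)) HSB) as [F1 F2].
  assert (Eez : forall n, Series (fun i => gcoef n i * h ^ i) = ez n (3 + h)) by (intros; now apply is_series_unique).
  split.
  - apply (is_series_absR _ (fun n => Series (b' n))); auto. intros n. rewrite <- Eez.
    apply Series_abs_le; [apply Hbd|eexists; apply Hb'].
  - rewrite <- (Series_ext _ _ Eez). eapply is_series_extR; [|exact F2].
    intros i. cbv beta. apply Series_scal_r.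
Qed.

Lemma gcoef_summable i : ex_series (fun n => gcoef n i).
Proof.
  destruct (tcoef_summable 1) as [b [Hb [Hbs [D HD]]]].
  assert (b0 : forall j i, 0 <= b j i) by (intros j k; eapply Rle_trans; [apply Rabs_pos|apply Hb]).
  apply (is_series_absR _ (fun n => (2 * D) * / INR (S n) ^ 2)); [|apply ex_series_scalR, ex_series_inv_sq].
  intros n. unfold gcoef. eapply Rle_trans; [apply Rabs_triang|].
  assert (HB : forall j, Rabs (tcoef j i) <= D / INR (fr j) ^ 2).
  { intros j. eapply Rle_trans; [|apply HD]. pose proof (Hb j i) as H1. rewrite pow1, Rmult_1_r in H1.
    eapply Rle_trans; [exact H1|]. apply Rle_trans with (sm (S i) (b j)).
    - apply (sm_term_le (S i) (b j) i); [intros; apply b0|lia].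
    - apply sm_series_le; auto. now apply Series_correct. }
  pose proof (HB (2 * n)%nat) as B1. pose proof (HB (2 * n + 1)%nat) as B2. rewrite fr_even in B1. rewrite fr_odd in B2.
  unfold Rdiv in *. lra.
Qed.

Lemma ez_entire s : is_series (fun i => Series (fun n => gcoef n i) * (s - 3) ^ i) (Series (fun n => ez n s)) /\ ex_series (fun n => ez n s).
Proof.
  destruct (ez_taylor (s - 3) gcoef_summable) as [E1 E2]. replace (3 + (s - 3)) with s in * by ring. auto.
Qed.

(** * Positivity *)

Definition Xs (n : nat) : R := sm (2 * n) (fun j => x j - y j).

Lemma Xs_ln n : Xs n = ln (pd (2 * n) (fun i => INR (fr i)) / pd (2 * n) mu).
Proof.
  assert (E : forall m, sm m (fun j => x j - y j) = ln (pd m (fun i => INR (fr i)) / pd m mu)).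
  { induction m; [simpl; rewrite Rdiv_1_r, ln_1; ring|]. cbn [sm pd]. rewrite IHm.
    assert (P1 : 0 < pd m (fun i => INR (fr i))) by (apply pd_pos; intros i _; pose proof (fr_pos i); lra).
    assert (P2 : 0 < pd m mu) by (apply pd_pos; auto). pose proof (fr_pos m). pose proof (mu_pos m).
    rewrite !ln_div, !ln_mult by (try apply Rmult_lt_0_compat; lra). unfold x, y. ring. }
  apply E.
Qed.

Lemma Xs_ge0 n : 0 <= Xs n.
Proof.
  rewrite Xs_ln. rewrite <- ln_1. apply ln_le; [lra|].
  assert (P2 : 0 < pd (2 * n) mu) by (apply pd_pos; auto).
  apply Rmult_le_reg_r with (pd (2 * n) mu); auto. unfold Rdiv. rewrite Rmult_assoc, Rinv_l, Rmult_1_r, Rmult_1_l by lra.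
  apply mu_prod_le.
Qed.

Lemma Xs_small eps : 0 < eps -> exists n0, forall n, (n0 <= n)%nat -> Xs n <= eps.
Proof.
  intros He. destruct mu_prod_ge as [C [n1 [HC H]]].
  assert (H1 : exp (- eps) < 1) by (rewrite <- exp_0; apply exp_increasing; lra).
  (* The solution of [2 - exp d = exp (- eps)]. *)
  set (d := ln (2 - exp (- eps))).
  assert (Hd : 0 < d) by (unfold d; rewrite <- ln_1; apply ln_increasing; lra).
  destruct (INR_unbounded (C / d)) as [n2 Hn2].
  exists (n1 + n2)%nat. intros n Hn. specialize (H n ltac:(lia)). rewrite Xs_ln.
  assert (P1 : 0 < pd (2 * n) (fun i => INR (fr i))) by (apply pd_pos; intros i _; pose proof (fr_pos i); lra).
  assert (P2 : 0 < pd (2 * n) mu) by (apply pd_pos; auto).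
  assert (Hcd : C / (INR n + 1) < d).
  { assert (INR n2 <= INR n) by (apply le_INR; lia). pose proof (pos_INR n2).
    apply Rmult_lt_reg_r with (INR n + 1); [lra|]. unfold Rdiv. rewrite Rmult_assoc, Rinv_l, Rmult_1_r by lra.
    apply (Rmult_lt_compat_r d) in Hn2; auto. unfold Rdiv in Hn2. rewrite Rmult_assoc, Rinv_l, Rmult_1_r in Hn2 by lra. nra. }
  apply exp_increasing in Hcd. unfold d in Hcd. rewrite exp_ln in Hcd by (pose proof (exp_pos (- eps)); lra).
  assert (HQ : pd (2 * n) (fun i => INR (fr i)) * exp (- eps) <= pd (2 * n) mu).
  { eapply Rle_trans; [|exact H]. apply Rmult_le_compat_l; lra. }
  rewrite <- (ln_exp eps). apply ln_le; [now apply Rdiv_lt_0_compat|].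
  apply Rmult_le_reg_r with (pd (2 * n) mu * exp (- eps)); [apply Rmult_lt_0_compat; [lra|apply exp_pos]|].
  replace (exp eps * (pd (2 * n) mu * exp (- eps))) with (pd (2 * n) mu * (exp eps * exp (- eps))) by ring.
  rewrite <- exp_plus, Rplus_opp_r, exp_0.
  replace (pd (2 * n) (fun i => INR (fr i)) / pd (2 * n) mu * (pd (2 * n) mu * exp (- eps)))
    with (pd (2 * n) (fun i => INR (fr i)) * exp (- eps)) by (field; lra). lra.
Qed.

Lemma Xs_S n : Xs (S n) = Xs n + ((x (2 * n) - y (2 * n)) + (x (2 * n + 1) - y (2 * n + 1))).
Proof.
  unfold Xs. rewrite !sm_double. reflexivity.
Qed.

(** As [Xs] tends to 0, [Xs n] is minus the sum of its later increments, which decay faster than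
    every power. This is what beats the weight [wt] for negative s. *)
Lemma Xs_decay M : exists D, 0 < D /\ forall n, Xs n <= D / INR (S n) ^ M.
Proof.
  destruct (xy_close (M + 2)) as [C [HC H]]. pose proof Qsum_pos as HQ.
  exists (2 * C * Qsum); split; [nra|]. intros n.
  assert (HS : forall k, 0 < INR (S k) ^ M) by (intros; apply pow_lt, INR_S_pos).
  assert (HT : forall k, Xs n - Xs (n + k) <= 2 * C / INR (S n) ^ M * (sm (n + k) (fun l => / INR (S l) ^ 2) - sm n (fun l => / INR (S l) ^ 2))).
  { induction k.
    - rewrite Nat.add_0_r. rewrite !Rminus_diag. lra.
    - rewrite Nat.add_succ_r, Xs_S.
      pose proof (H (2 * (n + k))%nat) as H1. pose proof (H (2 * (n + k) + 1)%nat) as H2.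
      rewrite fr_even in H1. rewrite fr_odd in H2.
      apply Rabs_le_between in H1, H2.
      assert (Hpow : C / INR (S (n + k)) ^ (M + 2) <= C / INR (S n) ^ M * / INR (S (n + k)) ^ 2).
      { rewrite pow_add. pose proof (INR_S_pos (n + k)) as P. pose proof (inv_sq_pos (n + k)) as P2.
        replace (C / (INR (S (n + k)) ^ M * INR (S (n + k)) ^ 2)) with (C * / INR (S (n + k)) ^ M * / INR (S (n + k)) ^ 2).
        - apply Rmult_le_compat_r; [lra|]. apply Rmult_le_compat_l; [lra|].
          apply Rinv_le_contravar; auto. apply pow_incr. split; [apply Rlt_le, INR_S_pos|apply le_INR; lia].
        - field. split; [|apply pow_nonzero]; lra. }
      change (sm (S (n + k)) (fun l => / INR (S l) ^ 2)) with (sm (n + k) (fun l => / INR (S l) ^ 2) + / INR (S (n + k)) ^ 2).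
      unfold Rdiv in *. nra. }
  apply le_epsilon. intros eps He. destruct (Xs_small eps He) as [n0 Hn0].
  specialize (HT n0). specialize (Hn0 (n + n0)%nat ltac:(lia)).
  assert (HB : sm (n + n0) (fun l => / INR (S l) ^ 2) - sm n (fun l => / INR (S l) ^ 2) <= Qsum).
  { pose proof (sm_series_le _ _ (n + n0) Qsum_series (fun k => Rlt_le _ _ (inv_sq_pos k))).
    assert (0 <= sm n (fun l => / INR (S l) ^ 2)) by (apply sm_ge0; intros; apply Rlt_le, inv_sq_pos). lra. }
  assert (2 * C / INR (S n) ^ M * (sm (n + n0) (fun l => / INR (S l) ^ 2) - sm n (fun l => / INR (S l) ^ 2)) <= 2 * C / INR (S n) ^ M * Qsum).
  { apply Rmult_le_compat_l; auto. apply Rlt_le, Rdiv_lt_0_compat; [lra|apply HS]. }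
  replace (2 * C * Qsum / INR (S n) ^ M) with (2 * C / INR (S n) ^ M * Qsum) by (unfold Rdiv; ring). lra.
Qed.

Lemma exp_tangent a b s : s * exp (s * b) * (a - b) <= exp (s * a) - exp (s * b).
Proof.
  pose proof (exp_ineq1_le (s * (a - b))) as H. pose proof (exp_pos (s * b)) as P.
  assert (E : exp (s * a) = exp (s * b) * exp (s * (a - b))) by (rewrite <- exp_plus; f_equal; ring).
  rewrite E. assert (exp (s * b) * (1 + s * (a - b)) <= exp (s * b) * exp (s * (a - b))) by (apply Rmult_le_compat_l; lra). lra.
Qed.

Let wt (s : R) (n : nat) : R := s * exp (s * - ln (INR (S n))).

(** [s * n^(-s)] is nonincreasing in n for either sign of s: for negative s the power grows but its
    coefficient is negative. *)
Lemma wt_decr s n : wt s (S n) <= wt s n.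
Proof.
  unfold wt. assert (Hl : ln (INR (S n)) <= ln (INR (S (S n)))).
  { apply ln_le; [apply INR_S_pos|apply le_INR; lia]. }
  destruct (Rle_dec 0 s) as [Hs|Hs].
  - apply Rmult_le_compat_l; auto. assert (Hle : s * - ln (INR (S (S n))) <= s * - ln (INR (S n))) by nra.
    destruct Hle as [H|H]; [left; now apply exp_increasing|right; now rewrite H].
  - assert (Hle : s * - ln (INR (S n)) <= s * - ln (INR (S (S n)))) by nra.
    assert (exp (s * - ln (INR (S n))) <= exp (s * - ln (INR (S (S n)))))
      by (destruct Hle as [H|H]; [left; now apply exp_increasing|right; now rewrite H]). nra.
Qed.

Lemma ez_tangent s n : wt s n * (Xs (S n) - Xs n) <= ez n s.
Proof.
  rewrite Xs_S. unfold ez, wt.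
  pose proof (exp_tangent (x (2 * n)) (y (2 * n)) s) as T1.
  pose proof (exp_tangent (x (2 * n + 1)) (y (2 * n + 1)) s) as T2.
  assert (Y1 : y (2 * n) = - ln (INR (S n))) by (unfold y; now rewrite fr_even).
  assert (Y2 : y (2 * n + 1) = - ln (INR (S n))) by (unfold y; now rewrite fr_odd).
  rewrite Y1 in *. rewrite Y2 in *. lra.
Qed.

(** Summation by parts: the tangent bounds have total [sum wt n * (Xs (n+1) - Xs n)], and replacing
    [wt n] by the smaller [wt (n+1)] costs nothing because [Xs] is nonnegative. *)
Lemma ez_abel s N : exp (s * x 0) - 1 - s * x 0 + wt s N * Xs (S N) <= sm (S N) (fun n => ez n s).
Proof.
  induction N.
  (* In the first pair only [x 1] is replaced by its tangent; keeping the exponential of [x 0]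
     produces the remainder that later detects equality. *)
  - simpl sm. rewrite Rplus_0_l. rewrite Xs_S. unfold Xs, ez, wt. simpl sm.
    assert (Y0 : y 0 = 0) by (unfold y, fr; simpl; rewrite ln_1; ring).
    assert (Y1 : y 1 = 0) by (unfold y, fr; simpl; rewrite ln_1; ring).
    change (2 * 0)%nat with O. change (0 + 1)%nat with 1%nat. rewrite Y0, Y1. simpl INR. rewrite ln_1, Ropp_0, Rmult_0_r, exp_0.
    pose proof (exp_ineq1_le (s * x 1)). simpl. lra.
  - change (sm (S (S N)) (fun n => ez n s)) with (sm (S N) (fun n => ez n s) + ez (S N) s).
    pose proof (ez_tangent s (S N)) as T. pose proof (wt_decr s N) as W. pose proof (Xs_ge0 (S N)). nra.
Qed.

Lemma ez_sum_lower s : exp (s * x 0) - 1 - s * x 0 <= Series (fun n => ez n s).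
Proof.
  destruct (ez_entire s) as [_ HS]. apply Series_correct in HS.
  apply le_epsilon. intros eps He.
  (* The weight is at most [|s| * n^M], so one more power makes the boundary term of order 1/n. *)
  destruct (INR_unbounded (Rabs s)) as [M HM]. destruct (Xs_decay (M + 1)) as [D [HD HX]].
  assert (HW : forall N, - (Rabs s * D / INR (S N)) <= wt s N * Xs (S N)).
  { intros N. pose proof (INR_S_pos N) as P. pose proof (Xs_ge0 (S N)) as X0.
    assert (Hw : Rabs (wt s N) <= Rabs s * INR (S N) ^ M).
    { unfold wt. rewrite Rabs_mult. apply Rmult_le_compat_l; [apply Rabs_pos|].
      rewrite Rabs_right by (apply Rle_ge, Rlt_le, exp_pos).
      rewrite <- (Rpower_pow M) by lra. unfold Rpower.
      assert (Hl : 0 <= ln (INR (S N))) by (rewrite <- ln_1; apply ln_le; [lra|rewrite S_INR; pose proof (pos_INR N); lra]).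
      assert (Hle : s * - ln (INR (S N)) <= INR M * ln (INR (S N))).
      { pose proof (Rle_abs (- s)) as A1. rewrite Rabs_Ropp in A1. nra. }
      destruct Hle as [H|H]; [left; now apply exp_increasing|right; now rewrite H]. }
    assert (HX' : Xs (S N) <= D / INR (S N) ^ (M + 1)).
    { eapply Rle_trans; [apply HX|]. apply Rmult_le_compat_l; [lra|]. apply Rinv_le_contravar; [apply pow_lt; lra|].
      apply pow_incr. split; [lra|apply le_INR; lia]. }
    assert (HP : Rabs (wt s N * Xs (S N)) <= Rabs s * D / INR (S N)).
    { rewrite Rabs_mult, (Rabs_right (Xs (S N))) by lra.
      apply Rle_trans with (Rabs s * INR (S N) ^ M * (D / INR (S N) ^ (M + 1))).
      - apply Rmult_le_compat; auto using Rabs_pos.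
      - right. rewrite pow_add, pow_1. field. split; [lra|apply pow_nonzero; lra]. }
    apply Rabs_le_between in HP. lra. }
  assert (Hl : is_lim_seq (sum_n (fun n => ez n s)) (Series (fun n => ez n s))) by exact HS.
  destruct (INR_unbounded (Rabs s * D / eps)) as [N0 HN0].
  assert (HR : exp (s * x 0) - 1 - s * x 0 - eps <= Series (fun n => ez n s)); [|lra].
  apply (is_lim_seq_le_loc (fun _ => exp (s * x 0) - 1 - s * x 0 - eps) (sum_n (fun n => ez n s))
    (exp (s * x 0) - 1 - s * x 0 - eps) (Series (fun n => ez n s))); auto; [|apply is_lim_seq_const].
  exists N0. intros N HN. rewrite <- sm_sum_n. pose proof (ez_abel s N) as A1. pose proof (HW N) as W.
  assert (Rabs s * D / INR (S N) <= eps); [|lra].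
  pose proof (INR_S_pos N) as P. apply Rmult_le_reg_r with (INR (S N)); auto.
  unfold Rdiv. rewrite Rmult_assoc, Rinv_l, Rmult_1_r by lra.
  assert (INR N0 <= INR (S N)) by (apply le_INR; lia).
  apply (Rmult_lt_compat_r eps) in HN0; auto. unfold Rdiv in HN0. rewrite Rmult_assoc, Rinv_l, Rmult_1_r in HN0 by lra. nra.
Qed.

(** * Identification of the entire function *)

Lemma is_series_fst (u : nat -> C) (l : C) : @is_series C_AbsRing C_NormedModule u l ->
  is_series (fun n => fst (u n)) (fst l) /\ is_series (fun n => snd (u n)) (snd l).
Proof.
  intros H.
  assert (E : forall n, fst (@sum_n C_AbelianMonoid u n) = sum_n (fun n => fst (u n)) n /\
                        snd (@sum_n C_AbelianMonoid u n) = sum_n (fun n => snd (u n)) n).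
  { induction n as [|n [IH1 IH2]]; [rewrite !sum_O; auto|].
    rewrite (@sum_Sn C_AbelianMonoid), !sum_n_SR, <- IH1, <- IH2. split; reflexivity. }
  assert (HB : forall eps : posreal, eventually (fun n => @ball C_UniformSpace l eps (@sum_n C_AbelianMonoid u n))).
  { intros eps. apply (proj1 (@filterlim_locally nat C_UniformSpace eventually _ _ l) H eps). }
  split; apply filterlim_locally; intros eps; destruct (HB eps) as [N HN]; exists N; intros n Hn;
  destruct (HN n Hn) as [B1 B2]; destruct (E n) as [E1 E2].
  - change (Rabs (sum_n (fun n => fst (u n)) n - fst l) < eps). rewrite <- E1. exact B1.
  - change (Rabs (sum_n (fun n => snd (u n)) n - snd l) < eps). rewrite <- E2. exact B2.
Qed.

Lemma cpow_neg_real z (s : R) : cpow_neg z (RtoC s) = (exp (s * - ln z), 0).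
Proof.
  unfold cpow_neg, Re, Im, RtoC; simpl. rewrite Rmult_0_l, cos_0, sin_0. f_equal; [|ring].
  rewrite Rmult_1_r. f_equal. ring.
Qed.

Lemma zeta_diff_series lam F s : (forall k, lam (S k) = mu k) -> zeta_diff lam F -> 1 < s ->
  is_series (fun n => ez n s) (fst (F (RtoC s))) /\ snd (F (RtoC s)) = 0.
Proof.
  intros Hlam [_ HZ] Hs. destruct (HZ (RtoC s) Hs) as [Za [Z [H1 [H2 E]]]].
  apply is_series_fst in H1, H2. destruct H1 as [A1 A2], H2 as [B1 B2].
  assert (S1 : is_series (fun k => exp (s * x k)) (fst Za)).
  { eapply is_series_extR; [|exact A1]. intros k. cbv beta. rewrite cpow_neg_real, Hlam. reflexivity. }
  assert (S2 : is_series (fun n => exp (s * - ln (INR (S n)))) (fst Z)).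
  { eapply is_series_extR; [|exact B1]. intros k. cbv beta. rewrite cpow_neg_real. reflexivity. }
  assert (Z1 : snd Za = 0).
  { rewrite <- (is_series_unique _ _ A2). apply is_series_unique. eapply is_series_extR; [|apply (is_series_single 0 0)].
    intros k. rewrite cpow_neg_real. simpl. destruct (Nat.eqb k 0); auto. }
  assert (Z2 : snd Z = 0).
  { rewrite <- (is_series_unique _ _ B2). apply is_series_unique. eapply is_series_extR; [|apply (is_series_single 0 0)].
    intros k. rewrite cpow_neg_real. simpl. destruct (Nat.eqb k 0); auto. }
  assert (E1 : fst (F (RtoC s)) = fst Za - 2 * fst Z) by (rewrite E; simpl; ring).
  assert (E2 : snd (F (RtoC s)) = snd Za - 2 * snd Z) by (rewrite E; simpl; ring).
  split.
  - rewrite E1.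
    eapply is_series_extR; [|apply is_series_minusR; [apply (is_series_pairs _ _ S1)|apply (is_series_scal 2 _ _ S2)]].
    intros n. cbv beta. unfold ez, y. rewrite fr_even, fr_odd.
    change (exp (s * x (2 * n)) + exp (s * x (2 * n + 1)) - 2 * exp (s * - ln (INR (S n)))
      = exp (s * x (2 * n)) - exp (s * - ln (INR (S n))) + (exp (s * x (2 * n + 1)) - exp (s * - ln (INR (S n))))). ring.
  - rewrite E2, Z1, Z2. ring.
Qed.

Lemma pseries_unique (a b : nat -> R) (f g : R -> R) :
  (forall h, is_series (fun n => a n * h ^ n) (f h)) -> (forall h, is_series (fun n => b n * h ^ n) (g h)) ->
  (forall h, Rabs h < 1 -> f h = g h) -> forall h, f h = g h.
Proof.
  intros Ha Hb Hfg.
  assert (HR : forall c k, (forall h : R, is_series (fun n => c n * h ^ n) (k h)) -> Rbar_lt 0 (CV_radius c) /\ forall h, PSeries c h = k h).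
  { intros c k Hc. split.
    (* Convergence at h = 1 already rules out a radius below 1. *)
    - destruct (Rbar_lt_dec (CV_radius c) (Rabs 1)) as [Hl|Hl].
      + exfalso. apply (CV_disk_outside c 1 Hl). apply ex_series_lim_0. eexists; apply (Hc 1).
      + apply Rbar_not_lt_le in Hl. eapply Rbar_lt_le_trans; [|exact Hl]. rewrite Rabs_R1. simpl. lra.
    - intros h. unfold PSeries. apply is_series_unique. apply Hc. }
  destruct (HR a f Ha) as [Ra Pa]. destruct (HR b g Hb) as [Rb Pb].
  assert (E : forall n, a n = b n).
  { intros n. pose proof (Derive_n_coef a n Ra) as Da. pose proof (Derive_n_coef b n Rb) as Db.
    apply Rmult_eq_reg_r with (INR (fact n)); [|apply INR_fact_neq_0]. rewrite <- Da, <- Db.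
    apply Derive_n_ext_loc. exists (mkposreal 1 Rlt_0_1). intros h Hh. rewrite Pa, Pb. apply Hfg.
    change (Rabs (h - 0) < 1) in Hh. now rewrite Rminus_0_r in Hh. }
  intros h. rewrite <- Pa, <- Pb. now apply PSeries_ext.
Qed.

Theorem zeta_diff_value lam F : (forall k, lam (S k) = mu k) -> zeta_diff lam F ->
  forall s, fst (F (RtoC s)) = Series (fun n => ez n s) /\ snd (F (RtoC s)) = 0.
Proof.
  (* About the centre 3, the points with [|h| < 1] stay in the region s > 1 where F is given by its
     defining series. *)
  intros Hlam HZ s. destruct (entire_real_taylor F 3 (proj1 HZ)) as [al [be H]].
  assert (Eh : forall h, 3 + h - 3 = h) by (intros; ring).
  assert (Es : s = 3 + (s - 3)) by ring.
  split.
  - rewrite Es.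
    apply (pseries_unique al (fun i => Series (fun n => gcoef n i)) (fun h => fst (F (RtoC (3 + h)))) (fun h => Series (fun n => ez n (3 + h)))).
    + intros h. destruct (H (3 + h)) as [H1 _]. now rewrite Eh in H1.
    + intros h. destruct (ez_entire (3 + h)) as [H1 _]. now rewrite Eh in H1.
    + intros h Hh. apply Rabs_def2 in Hh. symmetry. apply is_series_unique.
      apply (zeta_diff_series lam F (3 + h) Hlam HZ). lra.
  - rewrite Es.
    apply (pseries_unique be (fun _ => 0) (fun h => snd (F (RtoC (3 + h)))) (fun _ => 0)).
    + intros h. destruct (H (3 + h)) as [_ H1]. now rewrite Eh in H1.
    + intros h. eapply is_series_extR; [|apply (is_series_single 0 0)]. intros n. cbv beta. destruct (Nat.eqb n 0); ring.
    + intros h Hh. apply Rabs_def2 in Hh. apply (zeta_diff_series lam F (3 + h) Hlam HZ). lra.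
Qed.

Theorem zeta_diff_lower lam F s : (forall k, lam (S k) = mu k) -> zeta_diff lam F ->
  exp (- s * ln (mu 0)) - 1 + s * ln (mu 0) <= fst (F (RtoC s)).
Proof.
  intros Hlam HZ. rewrite (proj1 (zeta_diff_value lam F Hlam HZ s)).
  pose proof (ez_sum_lower s) as H. unfold x in H.
  replace (- s * ln (mu 0)) with (s * - ln (mu 0)) by ring. lra.
Qed.

End Zeta.

(** * Boundary values of holomorphic functions *)

(* [u + i v] is the boundary value of a holomorphic function on the disk: its negative modes vanish. *)
Definition hol (u v : R -> R) : Prop := sp u /\ sp v /\ forall k, (0 < k)%nat ->
  ig (fun t => u t * cos (INR k * t) - v t * sin (INR k * t)) = 0 /\
  ig (fun t => u t * sin (INR k * t) + v t * cos (INR k * t)) = 0.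

Lemma is_series_null (u : nat -> R) (l : R) : is_series u l -> (forall n, u n = 0) -> l = 0.
Proof.
  intros H H0. rewrite <- (is_series_unique _ _ H). apply is_series_unique.
  eapply is_series_extR; [|apply (is_series_single 0 0)]. intros n. cbv beta. rewrite H0. now destruct (Nat.eqb n 0).
Qed.

Lemma hol_coef u v k : hol u v -> (0 < k)%nat -> A u k = B v k /\ B u k = - A v k.
Proof.
  intros [U [V H]] Hk. destruct (H k Hk) as [H1 H2]. pose proof (sp_cont _ U). pose proof (sp_cont _ V).
  rewrite ig_minus in H1 by ct. rewrite ig_plus in H2 by ct. unfold Cc, Cs.
  rewrite !(ig_ext (fun t => _ * _ * 1) _ (fun t => Rmult_1_r _)). lra.
Qed.

(** The mean of a product of boundary values of holomorphic functions is the product of their means.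
    In Parseval's formula the modes of positive frequency cancel, real against imaginary part. *)
Lemma hol_ig u v x y : hol u v -> hol x y ->
  ig (fun t => u t * x t - v t * y t) = (A u 0 * A x 0 - A v 0 * A y 0) / (2 * PI) /\
  ig (fun t => u t * y t + v t * x t) = (A u 0 * A y 0 + A v 0 * A x 0) / (2 * PI).
Proof.
  intros HU HX. pose proof PI_RGT_0 as HPI.
  assert (PV : forall f h, sp f -> sp h ->
    is_series (fun n => / PI * (A f (S n) * A h (S n) + B f (S n) * B h (S n))) (ig (fun t => f t * h t) - A f 0 * A h 0 / (2 * PI))).
  { intros f h F H. rewrite (ig_ext (fun t => f t * h t) (fun t => f t * h t * 1)) by (intros; ring).
    apply (parseval _ _ circle_map_id); try apply sp_cont; try apply (sp_fsummable _ _ circle_map_id); auto; [apply F|apply H]. }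
  pose proof HU as [U [V _]]. pose proof HX as [X [Y _]].
  pose proof (sp_cont _ U). pose proof (sp_cont _ V). pose proof (sp_cont _ X). pose proof (sp_cont _ Y).
  rewrite ig_minus, ig_plus by ct. split.
  - assert (E : ig (fun t => u t * x t) - A u 0 * A x 0 / (2 * PI) - (ig (fun t => v t * y t) - A v 0 * A y 0 / (2 * PI)) = 0).
    { eapply is_series_null; [apply is_series_minusR; [apply (PV u x)|apply (PV v y)]; auto|].
      intros n. cbv beta. destruct (hol_coef u v (S n) HU ltac:(lia)) as [-> ->].
      destruct (hol_coef x y (S n) HX ltac:(lia)) as [-> ->]. ring. }
    unfold Rdiv in *. lra.
  - assert (E : ig (fun t => u t * y t) - A u 0 * A y 0 / (2 * PI) + (ig (fun t => v t * x t) - A v 0 * A x 0 / (2 * PI)) = 0).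
    { eapply is_series_null; [apply is_series_plusR; [apply (PV u y)|apply (PV v x)]; auto|].
      intros n. cbv beta. destruct (hol_coef u v (S n) HU ltac:(lia)) as [-> ->].
      destruct (hol_coef x y (S n) HX ltac:(lia)) as [-> ->]. ring. }
    unfold Rdiv in *. lra.
Qed.

Lemma sp_trig k : sp (fun t => cos (INR k * t)) /\ sp (fun t => sin (INR k * t)).
Proof. apply (cm_trig_sp _ _ circle_map_id k). Qed.

Lemma hol_shift u v m : hol u v ->
  hol (fun t => u t * cos (INR m * t) - v t * sin (INR m * t)) (fun t => u t * sin (INR m * t) + v t * cos (INR m * t)).
Proof.
  intros [U [V H]]. destruct (sp_trig m) as [Tc Ts].
  split; [|split].
  - apply (sp_minus (fun t => u t * cos (INR m * t)) (fun t => v t * sin (INR m * t))); now apply sp_mult.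
  - apply (sp_plus (fun t => u t * sin (INR m * t)) (fun t => v t * cos (INR m * t))); now apply sp_mult.
  - intros k Hk. destruct (H (m + k)%nat ltac:(lia)) as [H1 H2].
    split; [rewrite <- H1|rewrite <- H2]; apply ig_ext; intros t; rewrite plus_INR, (Rmult_plus_distr_r (INR m) (INR k) t), cos_plus, sin_plus; ring.
Qed.

Lemma A_0 f : A f 0 = ig f.
Proof. apply ig_ext; intros t. simpl INR. rewrite Rmult_0_l, cos_0. ring. Qed.

(** The mode -k of the product is the mean of [exp (i k t) (u + i v)] times [x + i y]. The first
    factor is again holomorphic, with mean zero since k > 0, so [hol_ig] gives 0. *)
Lemma hol_mult u v x y : hol u v -> hol x y -> hol (fun t => u t * x t - v t * y t) (fun t => u t * y t + v t * x t).
Proof.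
  intros HU HX. pose proof HU as [U [V H]]. pose proof HX as [X [Y _]]. split; [|split].
  - apply (sp_minus (fun t => u t * x t) (fun t => v t * y t)); now apply sp_mult.
  - apply (sp_plus (fun t => u t * y t) (fun t => v t * x t)); now apply sp_mult.
  - intros k Hk. destruct (hol_ig _ _ _ _ (hol_shift u v k HU) HX) as [H1 H2].
    destruct (H k Hk) as [E1 E2]. rewrite !A_0, E1, E2 in *.
    split; [etransitivity; [|etransitivity; [exact H1|unfold Rdiv; ring]]|etransitivity; [|etransitivity; [exact H2|unfold Rdiv; ring]]];
    apply ig_ext; intros t; ring.
Qed.

Lemma hol_const a b : hol (fun _ => a) (fun _ => b).
Proof.
  split; [apply sp_const|split; [apply sp_const|]]. intros k Hk.
  assert (E : ig (fun t => cos (INR k * t)) = 0 /\ ig (fun t => sin (INR k * t)) = 0).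
  { pose proof (cm_ig_cos _ _ circle_map_id (Z.of_nat k)) as E1. pose proof (cm_ig_sin _ _ circle_map_id (Z.of_nat k)) as E2.
    destruct (Z.eqb_spec (Z.of_nat k) 0); [lia|].
    split; [rewrite <- E1|rewrite <- E2]; apply ig_ext; intros t; rewrite INR_IZR_INZ; ring. }
  rewrite ig_minus, ig_plus, !ig_scal by ct. destruct E as [-> ->]. lra.
Qed.

Lemma hol_plus u v x y : hol u v -> hol x y -> hol (fun t => u t + x t) (fun t => v t + y t).
Proof.
  intros [U [V H]] [X [Y K]]. split; [now apply sp_plus|split; [now apply sp_plus|]].
  pose proof (sp_cont _ U). pose proof (sp_cont _ V). pose proof (sp_cont _ X). pose proof (sp_cont _ Y).
  intros k Hk. destruct (H k Hk) as [E1 E2], (K k Hk) as [K1 K2]. split.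
  - transitivity (0 + 0); [rewrite <- E1 at 1; rewrite <- K1, <- ig_plus by ct; apply ig_ext; intros; ring|ring].
  - transitivity (0 + 0); [rewrite <- E2 at 1; rewrite <- K2, <- ig_plus by ct; apply ig_ext; intros; ring|ring].
Qed.

(* [J = x + i y] satisfies [J n = (a + i b) J (n + 1)], so [|J 0| <= |a + i b|^n M]. *)
Lemma contracting_zero (x y : nat -> R) a b M : a ^ 2 + b ^ 2 < 1 ->
  (forall n, Rabs (x n) <= M /\ Rabs (y n) <= M) ->
  (forall n, x n = a * x (S n) - b * y (S n) /\ y n = a * y (S n) + b * x (S n)) -> x 0%nat = 0 /\ y 0%nat = 0.
Proof.
  intros Hab HM HJ. set (r := a ^ 2 + b ^ 2) in *. assert (Hr : 0 <= r) by (unfold r; nra).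
  set (s := fun n => x n ^ 2 + y n ^ 2).
  assert (Hs : forall n, s n = r * s (S n)).
  { intros n. unfold s, r. destruct (HJ n) as [-> ->]. ring. }
  assert (Hsn : forall n, s 0%nat = r ^ n * s n).
  { induction n; [simpl; ring|]. rewrite IHn, Hs. simpl. ring. }
  assert (Hb : forall n, 0 <= s n <= 2 * M ^ 2).
  { intros n. destruct (HM n) as [H1 H2]. apply pow_maj_Rabs with (n := 2%nat) in H1, H2. unfold s. nra. }
  assert (H0 : s 0%nat <= 0).
  { apply le_epsilon. intros eps He.
    assert (HM2 : 0 <= M ^ 2) by nra.
    destruct (pow_lt_1_zero r ltac:(rewrite Rabs_right; lra) (eps / (2 * M ^ 2 + 1)) ltac:(apply Rdiv_lt_0_compat; lra)) as [N HN].
    specialize (HN N (le_n N)). rewrite Rabs_right in HN by (apply Rle_ge, pow_le; lra).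
    rewrite (Hsn N). destruct (Hb N) as [B1 B2].
    assert (Hp : 0 <= r ^ N) by (apply pow_le; lra).
    apply Rmult_lt_compat_r with (r := 2 * M ^ 2 + 1) in HN; [|lra].
    unfold Rdiv in HN. rewrite Rmult_assoc, Rinv_l, Rmult_1_r in HN by lra. nra. }
  unfold s in H0. split; nra.
Qed.

Lemma sum_sq_zero x y : x ^ 2 + y ^ 2 = 0 -> x = 0 /\ y = 0.
Proof. intros H. split; nra. Qed.

(** * Equality in Weinstock's inequality *)

Section Rigidity.
Variables phi p : R -> R.
Hypothesis CM : circle_map phi p.
Hypothesis Hneg : forall m, (0 < m)%nat -> Ic phi 1 m = 0 /\ Is phi 1 m = 0.

Let Cphi : cont phi := cm_cont_phi _ _ CM.
Let Cp : cont p := cm_cont_p _ _ CM.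
Let cx : R := ig (fun t => cos (phi t)) / (2 * PI).
Let cy : R := ig (fun t => sin (phi t)) / (2 * PI).

Lemma rig_trig_sp : sp (fun t => cos (phi t)) /\ sp (fun t => sin (phi t)).
Proof.
  destruct (cm_trig_sp _ _ CM 1) as [H1 H2].
  replace (fun t => cos (phi t)) with (fun t => cos (INR 1 * phi t)) by (apply functional_extensionality; intros; simpl; now rewrite Rmult_1_l).
  replace (fun t => sin (phi t)) with (fun t => sin (INR 1 * phi t)) by (apply functional_extensionality; intros; simpl; now rewrite Rmult_1_l).
  auto.
Qed.

Lemma rig_hol1 : hol (fun t => cos (phi t)) (fun t => sin (phi t)).
Proof.
  destruct rig_trig_sp as [H1 H2]. split; [auto|split; auto]. intros k Hk. destruct (Hneg k Hk) as [E1 E2].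
  unfold Ic, Is, phase in *.
  split; [rewrite <- E1|rewrite <- E2]; apply ig_ext; intros t; simpl (INR 1); rewrite Rmult_1_l, ?cos_plus, ?sin_plus; ring.
Qed.

Lemma rig_hol n : hol (fun t => cos (INR n * phi t)) (fun t => sin (INR n * phi t)).
Proof.
  induction n.
  - replace (fun t => cos (INR 0 * phi t)) with (fun _ : R => 1) by (apply functional_extensionality; intros; simpl; now rewrite Rmult_0_l, cos_0).
    replace (fun t => sin (INR 0 * phi t)) with (fun _ : R => 0) by (apply functional_extensionality; intros; simpl; now rewrite Rmult_0_l, sin_0).
    apply hol_const.
  - replace (fun t => cos (INR (S n) * phi t)) with (fun t => cos (INR n * phi t) * cos (phi t) - sin (INR n * phi t) * sin (phi t)).
    2: { apply functional_extensionality; intros t. rewrite <- cos_plus, S_INR. f_equal; ring. }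
    replace (fun t => sin (INR (S n) * phi t)) with (fun t => cos (INR n * phi t) * sin (phi t) + sin (INR n * phi t) * cos (phi t)).
    2: { apply functional_extensionality; intros t. rewrite Rplus_comm, <- sin_plus, S_INR. f_equal; ring. }
    apply hol_mult; [exact IHn|exact rig_hol1].
Qed.

Let dn (t : R) : R := (cos (phi t) - cx) ^ 2 + (sin (phi t) - cy) ^ 2.

(** The integral of [|f - c|^2] is [2 pi (1 - |c|^2)]; if it were zero, f would be constant, against
    [p > 0]. *)
Lemma rig_c_lt1 : cx ^ 2 + cy ^ 2 < 1.
Proof.
  pose proof PI_RGT_0 as HPI. destruct rig_trig_sp as [Sc Ss].
  assert (E : ig dn = 2 * PI * (1 - (cx ^ 2 + cy ^ 2))).
  { unfold dn. rewrite (ig_ext _ (fun t => 1 + (cx ^ 2 + cy ^ 2) - (2 * cx * cos (phi t) + 2 * cy * sin (phi t)))).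
    - rewrite ig_minus, ig_const, ig_plus, !ig_scal by ct.
      assert (E1 : ig (fun t => cos (phi t)) = 2 * PI * cx) by (unfold cx; field; lra).
      assert (E2 : ig (fun t => sin (phi t)) = 2 * PI * cy) by (unfold cy; field; lra).
      rewrite E1, E2. ring.
    - intros t. pose proof (sin2_cos2 (phi t)) as T. unfold Rsqr in T. nra. }
  assert (Cd : cont dn) by (unfold dn; ct).
  assert (H0 : forall t, 0 <= dn t) by (intros; unfold dn; apply Rplus_le_le_0_compat; apply pow2_ge_0).
  pose proof (ig_ge0 dn Cd H0) as Hge.
  destruct (Rlt_dec (cx ^ 2 + cy ^ 2) 1) as [Hl|Hl]; auto. exfalso.
  assert (Ez : ig dn = 0) by (rewrite E in *; nra).
  assert (Pd : periodic2pi dn).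
  { intros t. unfold dn.
    pose proof (proj2 Sc t) as P1. pose proof (proj2 Ss t) as P2. cbv beta in P1, P2. rewrite ?P1, ?P2; reflexivity. }
  pose proof (ig_zero_nonneg dn Cd Pd H0 Ez) as Hd.
  assert (Hc : forall t, cos (phi t) = cx /\ sin (phi t) = cy) by (intros t; destruct (sum_sq_zero _ _ (Hd t)); lra).
  assert (D1 : forall t, - (sin (phi t) * p t) = 0).
  { intros t. pose proof (cm_der_cos _ _ CM 1 t) as D. apply is_derive_unique in D.
    rewrite (Derive_ext _ (fun _ => cx)) in D by (intros; rewrite Rmult_1_l; apply Hc).
    rewrite Derive_const, !Rmult_1_l in D. lra. }
  assert (D2 : forall t, cos (phi t) * p t = 0).
  { intros t. pose proof (cm_der_sin _ _ CM 1 t) as D. apply is_derive_unique in D.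
    rewrite (Derive_ext _ (fun _ => cy)) in D by (intros; rewrite Rmult_1_l; apply Hc).
    rewrite Derive_const, !Rmult_1_l in D. lra. }
  specialize (D1 0). specialize (D2 0). pose proof (cm_pos _ _ CM 0) as P. pose proof (sin2_cos2 (phi 0)) as T. unfold Rsqr in T.
  assert (sin (phi 0) = 0) by (apply Rmult_eq_reg_r with (p 0); lra).
  assert (cos (phi 0) = 0) by (apply Rmult_eq_reg_r with (p 0); lra). nra.
Qed.

Lemma rig_dn_pos t : 0 < dn t.
Proof.
  pose proof rig_c_lt1. pose proof (sin2_cos2 (phi t)) as T. unfold Rsqr in T. unfold dn.
  destruct (Req_dec (cos (phi t)) cx) as [E1|E1]; [destruct (Req_dec (sin (phi t)) cy) as [E2|E2]|]; [nra| |].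
  - assert (0 < (sin (phi t) - cy) ^ 2) by (apply pow2_gt_0; lra). pose proof (pow2_ge_0 (cos (phi t) - cx)). lra.
  - assert (0 < (cos (phi t) - cx) ^ 2) by (apply pow2_gt_0; lra). pose proof (pow2_ge_0 (sin (phi t) - cy)). lra.
Qed.

(* [hx + i hy] is [1 / (1 - conj c * f)] for [f = exp (i phi)] of mean [c = cx + i cy]. *)
Let hx (t : R) : R := (1 - (cx * cos (phi t) + cy * sin (phi t))) * / dn t.
Let hy (t : R) : R := (cx * sin (phi t) - cy * cos (phi t)) * / dn t.

Lemma rig_h_sp : sp hx /\ sp hy.
Proof.
  destruct rig_trig_sp as [Sc Ss].
  assert (Sd : sp dn).
  { unfold dn. apply (sp_plus (fun t => (cos (phi t) - cx) ^ 2) (fun t => (sin (phi t) - cy) ^ 2)).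
    - replace (fun t => (cos (phi t) - cx) ^ 2) with (fun t => (cos (phi t) - cx) * (cos (phi t) - cx)) by (apply functional_extensionality; intros; ring).
      apply (sp_mult (fun t => cos (phi t) - cx) (fun t => cos (phi t) - cx)); apply sp_minus; auto using sp_const.
    - replace (fun t => (sin (phi t) - cy) ^ 2) with (fun t => (sin (phi t) - cy) * (sin (phi t) - cy)) by (apply functional_extensionality; intros; ring).
      apply (sp_mult (fun t => sin (phi t) - cy) (fun t => sin (phi t) - cy)); apply sp_minus; auto using sp_const. }
  assert (Si : sp (fun t => / dn t)) by (apply sp_inv; auto; intros t; pose proof (rig_dn_pos t); lra).
  split.
  - apply (sp_mult (fun t => 1 - (cx * cos (phi t) + cy * sin (phi t))) (fun t => / dn t)); auto.
    apply (sp_minus (fun _ => 1) (fun t => cx * cos (phi t) + cy * sin (phi t))); [apply sp_const|].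
    apply (sp_plus (fun t => cx * cos (phi t)) (fun t => cy * sin (phi t))); now apply sp_scal.
  - apply (sp_mult (fun t => cx * sin (phi t) - cy * cos (phi t)) (fun t => / dn t)); auto.
    apply (sp_minus (fun t => cx * sin (phi t)) (fun t => cy * cos (phi t))); now apply sp_scal.
Qed.

(* h = 1 + conj c * f * h *)
Lemma rig_h_eq t :
  hx t = 1 + (cx * (cos (phi t) * hx t - sin (phi t) * hy t) + cy * (cos (phi t) * hy t + sin (phi t) * hx t)) /\
  hy t = cx * (cos (phi t) * hy t + sin (phi t) * hx t) - cy * (cos (phi t) * hx t - sin (phi t) * hy t).
Proof.
  pose proof (rig_dn_pos t) as P. pose proof (sin2_cos2 (phi t)) as T. unfold Rsqr in T.
  assert (E : dn t = (1 - (cx * cos (phi t) + cy * sin (phi t))) ^ 2 + (cx * sin (phi t) - cy * cos (phi t)) ^ 2).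
  { unfold dn.
    replace ((cos (phi t) - cx) ^ 2 + (sin (phi t) - cy) ^ 2)
      with ((1 - (cx * cos (phi t) + cy * sin (phi t))) ^ 2 + (cx * sin (phi t) - cy * cos (phi t)) ^ 2
        + (sin (phi t) * sin (phi t) + cos (phi t) * cos (phi t) - 1) * (1 - cx ^ 2 - cy ^ 2)) by ring.
    rewrite T. ring. }
  assert (E1 : (1 - (cx * cos (phi t) + cy * sin (phi t))) * hx t + (cx * sin (phi t) - cy * cos (phi t)) * hy t = 1).
  { unfold hx, hy. transitivity (dn t * / dn t); [rewrite E at 3; ring|apply Rinv_r; lra]. }
  split; [lra|]. unfold hx, hy. ring.
Qed.

(* Fourier moments of [f^n * h] against a weight orthogonal to all [f^n] shrink geometrically. *)
Lemma rig_h_moments (x y : R -> R) (n0 : nat) : cont x -> cont y -> periodic2pi x -> periodic2pi y ->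
  (forall n, (n0 <= n)%nat -> ig (fun t => cos (INR n * phi t) * x t - sin (INR n * phi t) * y t) = 0 /\
            ig (fun t => cos (INR n * phi t) * y t + sin (INR n * phi t) * x t) = 0) ->
  ig (fun t => (cos (INR n0 * phi t) * hx t - sin (INR n0 * phi t) * hy t) * x t
             - (cos (INR n0 * phi t) * hy t + sin (INR n0 * phi t) * hx t) * y t) = 0 /\
  ig (fun t => (cos (INR n0 * phi t) * hx t - sin (INR n0 * phi t) * hy t) * y t
             + (cos (INR n0 * phi t) * hy t + sin (INR n0 * phi t) * hx t) * x t) = 0.
Proof.
  intros Cx Cy Px Py H. destruct rig_h_sp as [Hx Hy]. pose proof (sp_cont _ Hx) as Chx. pose proof (sp_cont _ Hy) as Chy.
  set (fx := fun (n : nat) t => cos (INR n * phi t) * hx t - sin (INR n * phi t) * hy t).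
  set (fy := fun (n : nat) t => cos (INR n * phi t) * hy t + sin (INR n * phi t) * hx t).
  assert (Cfx : forall n, cont (fx n)) by (intros; unfold fx; ct).
  assert (Cfy : forall n, cont (fy n)) by (intros; unfold fy; ct).
  destruct (cont_bounded _ Cx Px) as [Mx [HMx Bx]]. destruct (cont_bounded _ Cy Py) as [My [HMy By]].
  destruct (cont_bounded _ Chx (proj2 Hx)) as [Nx [HNx Dx]]. destruct (cont_bounded _ Chy (proj2 Hy)) as [Ny [HNy Dy]].
  assert (Bf : forall n t, Rabs (fx n t) <= Nx + Ny /\ Rabs (fy n t) <= Nx + Ny).
  { intros n t. destruct (Rabs_trig_le (INR n * phi t)) as [T1 T2]. specialize (Dx t). specialize (Dy t).
    pose proof (Rabs_pos (cos (INR n * phi t))). pose proof (Rabs_pos (sin (INR n * phi t))).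
    pose proof (Rabs_pos (hx t)). pose proof (Rabs_pos (hy t)). unfold fx, fy. split.
    - eapply Rle_trans; [apply Rabs_triang|]. rewrite Rabs_Ropp, !Rabs_mult. nra.
    - eapply Rle_trans; [apply Rabs_triang|]. rewrite !Rabs_mult. nra. }
  apply (contracting_zero (fun k => ig (fun t => fx (k + n0)%nat t * x t - fy (k + n0)%nat t * y t))
     (fun k => ig (fun t => fx (k + n0)%nat t * y t + fy (k + n0)%nat t * x t)) cx (- cy) (2 * PI * ((Nx + Ny) * (Mx + My)))).
  - pose proof rig_c_lt1. nra.
  - intros k. split; (apply ig_abs_le; [pose proof (Cfx (k + n0)%nat); pose proof (Cfy (k + n0)%nat); ct|]); intros t;
    destruct (Bf (k + n0)%nat t) as [F1 F2]; specialize (Bx t); specialize (By t);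
    pose proof (Rabs_pos (fx (k + n0)%nat t)); pose proof (Rabs_pos (fy (k + n0)%nat t));
    pose proof (Rabs_pos (x t)); pose proof (Rabs_pos (y t));
    (eapply Rle_trans; [apply Rabs_triang|]); rewrite ?Rabs_Ropp, !Rabs_mult; nra.
  - intros k. destruct (H (k + n0)%nat ltac:(lia)) as [H1 H2]. change (S k + n0)%nat with (S (k + n0)). set (n := (k + n0)%nat) in *.
    pose proof (Cfx n). pose proof (Cfy n). pose proof (Cfx (S n)). pose proof (Cfy (S n)).
    assert (Erec : forall t, fx n t = cos (INR n * phi t) + (cx * fx (S n) t + cy * fy (S n) t) /\
                             fy n t = sin (INR n * phi t) + (cx * fy (S n) t - cy * fx (S n) t)).
    { intros t. destruct (rig_h_eq t) as [E1 E2]. unfold fx, fy.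
      assert (EC : cos (INR (S n) * phi t) = cos (INR n * phi t) * cos (phi t) - sin (INR n * phi t) * sin (phi t))
        by (rewrite <- cos_plus, S_INR; f_equal; ring).
      assert (ES : sin (INR (S n) * phi t) = sin (INR n * phi t) * cos (phi t) + cos (INR n * phi t) * sin (phi t))
        by (rewrite <- sin_plus, S_INR; f_equal; ring).
      rewrite EC, ES. clear - E1 E2.
      set (cn := cos (INR n * phi t)). set (sn := sin (INR n * phi t)).
      split;
      [transitivity (cn * (1 + (cx * (cos (phi t) * hx t - sin (phi t) * hy t) + cy * (cos (phi t) * hy t + sin (phi t) * hx t)))
         - sn * (cx * (cos (phi t) * hy t + sin (phi t) * hx t) - cy * (cos (phi t) * hx t - sin (phi t) * hy t)))
      |transitivity (cn * (cx * (cos (phi t) * hy t + sin (phi t) * hx t) - cy * (cos (phi t) * hx t - sin (phi t) * hy t))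
         + sn * (1 + (cx * (cos (phi t) * hx t - sin (phi t) * hy t) + cy * (cos (phi t) * hy t + sin (phi t) * hx t))))];
      try ring; rewrite <- E1, <- E2; reflexivity. }
    rewrite <- !ig_scal by ct. split.
    + rewrite <- ig_minus by ct. rewrite <- (Rplus_0_l (ig (fun t => cx * _ - - cy * _))) , <- H1, <- ig_plus by ct.
      apply ig_ext; intros t. destruct (Erec t) as [-> ->]. ring.
    + rewrite <- ig_plus by ct. rewrite <- (Rplus_0_l (ig (fun t => cx * _ + - cy * _))), <- H2, <- ig_plus by ct.
      apply ig_ext; intros t. destruct (Erec t) as [-> ->]. ring.
Qed.

(** The weight is [exp (i k t)], orthogonal to every power [f^n] because these have no negative
    modes. *)
Lemma rig_hol_h : hol hx hy.
Proof.
  destruct rig_h_sp as [Hx Hy]. split; [auto|split; auto]. intros k Hk. destruct (sp_trig k) as [[T1 P1] [T2 P2]].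
  destruct (rig_h_moments (fun t => cos (INR k * t)) (fun t => sin (INR k * t)) 0) as [M1 M2]; try (now apply smooth_cont); auto.
  - intros n _. destruct (proj2 (proj2 (rig_hol n)) k Hk) as [E1 E2]. split; auto.
  - split; [rewrite <- M1|rewrite <- M2]; apply ig_ext; intros t; simpl (INR 0); rewrite Rmult_0_l, cos_0, sin_0; ring.
Qed.

(** Against [p] the powers [f^n] with n >= 1 integrate to 0, since [p dt = d phi]; hence so does
    [f h], and in [h = 1 + conj c f h] only the constant 1 contributes. *)
Lemma rig_h_weight : ig (fun t => hx t * p t) = 2 * PI.
Proof.
  destruct rig_h_sp as [Hx Hy]. pose proof (sp_cont _ Hx) as Chx. pose proof (sp_cont _ Hy) as Chy.
  destruct (rig_h_moments p (fun _ => 0) 1) as [M1 M2]; auto; try apply cont_const.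
  - apply (cm_sp _ _ CM).
  - intros t; reflexivity.
  - intros n Hn. pose proof (cm_ig_cos _ _ CM (Z.of_nat n)) as E1. pose proof (cm_ig_sin _ _ CM (Z.of_nat n)) as E2.
    destruct (Z.eqb_spec (Z.of_nat n) 0); [lia|].
    split; [etransitivity; [|exact E1]|etransitivity; [|exact E2]]; apply ig_ext; intros t; rewrite INR_IZR_INZ; ring.
  - assert (N1 : ig (fun t => (cos (phi t) * hx t - sin (phi t) * hy t) * p t) = 0).
    { rewrite <- M1. apply ig_ext; intros t; simpl (INR 1); rewrite Rmult_1_l; ring. }
    assert (N2 : ig (fun t => (cos (phi t) * hy t + sin (phi t) * hx t) * p t) = 0).
    { rewrite <- M2. apply ig_ext; intros t; simpl (INR 1); rewrite Rmult_1_l; ring. }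
    rewrite (ig_ext _ (fun t => p t + (cx * ((cos (phi t) * hx t - sin (phi t) * hy t) * p t)
       + cy * ((cos (phi t) * hy t + sin (phi t) * hx t) * p t)))).
    + rewrite !ig_plus, !ig_scal, N1, N2, (cm_ig_p _ _ CM) by ct. ring.
    + intros t. destruct (rig_h_eq t) as [E _]. rewrite E at 1. ring.
Qed.

Let gx (t : R) : R := (cos (phi t) - cx) * hx t - (sin (phi t) - cy) * hy t.
Let gy (t : R) : R := (cos (phi t) - cx) * hy t + (sin (phi t) - cy) * hx t.

Lemma rig_hol_g : hol gx gy /\ A gx 0 = 0 /\ A gy 0 = 0.
Proof.
  pose proof PI_RGT_0 as HPI.
  assert (Hf : hol (fun t => cos (phi t) - cx) (fun t => sin (phi t) - cy)).
  { apply (hol_plus _ _ (fun _ => - cx) (fun _ => - cy)); [apply rig_hol1|apply hol_const]. }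
  split; [apply hol_mult; [exact Hf|exact rig_hol_h]|].
  destruct (hol_ig _ _ _ _ Hf rig_hol_h) as [E1 E2]. rewrite !A_0 in *.
  assert (M1 : ig (fun t => cos (phi t) - cx) = 0) by (rewrite ig_minus, ig_const by ct; unfold cx; field; lra).
  assert (M2 : ig (fun t => sin (phi t) - cy) = 0) by (rewrite ig_minus, ig_const by ct; unfold cy; field; lra).
  rewrite M1, M2 in *. unfold gx, gy. rewrite E1, E2. split; unfold Rdiv; ring.
Qed.

Let Gx (t : R) : R := cos (phi t) * ((cos (phi t) - cx) ^ 2 - (sin (phi t) - cy) ^ 2) + 2 * sin (phi t) * (cos (phi t) - cx) * (sin (phi t) - cy).
Let Gy (t : R) : R := 2 * cos (phi t) * (cos (phi t) - cx) * (sin (phi t) - cy) - sin (phi t) * ((cos (phi t) - cx) ^ 2 - (sin (phi t) - cy) ^ 2).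

(* On the unit circle [g = (f - c) / (1 - conj c * f)] equals [conj f * (f - c)^2 / |f - c|^2]. *)
Lemma rig_g_G t : gx t = Gx t * / dn t /\ gy t = Gy t * / dn t.
Proof.
  pose proof (sin2_cos2 (phi t)) as T. unfold Rsqr in T. unfold gx, gy, hx, hy, Gx, Gy.
  set (c := cos (phi t)) in *. set (s := sin (phi t)) in *. split.
  - transitivity (((c - cx) * (c * c + s * s - (cx * c + cy * s)) - (s - cy) * (cx * s - cy * c)) * / dn t);
      [rewrite (Rplus_comm (c * c)), T; ring|f_equal; ring].
  - transitivity (((c - cx) * (cx * s - cy * c) + (s - cy) * (c * c + s * s - (cx * c + cy * s))) * / dn t);
      [rewrite (Rplus_comm (c * c)), T; ring|f_equal; ring].
Qed.

Lemma rig_g_unit t : gx t ^ 2 + gy t ^ 2 = 1.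
Proof.
  destruct (rig_g_G t) as [-> ->]. pose proof (rig_dn_pos t) as P.
  pose proof (sin2_cos2 (phi t)) as T. unfold Rsqr in T.
  assert (E : Gx t ^ 2 + Gy t ^ 2 = dn t ^ 2).
  { transitivity ((sin (phi t) * sin (phi t) + cos (phi t) * cos (phi t)) * dn t ^ 2); [unfold Gx, Gy, dn; ring|rewrite T; ring]. }
  rewrite !Rpow_mult_distr, <- Rmult_plus_distr_r, E. rewrite <- Rpow_mult_distr, Rinv_r by lra. ring.
Qed.

(** The left side is the angular speed of the unimodular g; the right side is [p (2 Re h - 1)],
    which is p times the Poisson kernel of the point c. *)
Lemma rig_g_derive t : gx t * Derive gy t - gy t * Derive gx t = 2 * (hx t * p t) - p t.
Proof.
  pose proof (rig_dn_pos t) as P. pose proof (sin2_cos2 (phi t)) as T. unfold Rsqr in T.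
  assert (Ep : ex_derive phi t) by (eexists; apply (cm_der _ _ CM)).
  assert (Dp : Derive phi t = p t) by (apply is_derive_unique, (cm_der _ _ CM)).
  assert (DGx : is_derive Gx t (p t * Gy t - 2 * p t * (sin (phi t) - cy))).
  { unfold Gx. auto_derive; [repeat split; auto|]. change (Derive (fun x => phi x) t) with (Derive phi t). rewrite Dp.
    transitivity (p t * Gy t - 2 * p t * (sin (phi t) - cy) * (sin (phi t) * sin (phi t) + cos (phi t) * cos (phi t)));
      [unfold Gy; ring|rewrite T; ring]. }
  assert (DGy : is_derive Gy t (2 * p t * (cos (phi t) - cx) - p t * Gx t)).
  { unfold Gy. auto_derive; [repeat split; auto|]. change (Derive (fun x => phi x) t) with (Derive phi t). rewrite Dp.
    transitivity (2 * p t * (cos (phi t) - cx) * (sin (phi t) * sin (phi t) + cos (phi t) * cos (phi t)) - p t * Gx t);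
      [unfold Gx; ring|rewrite T; ring]. }
  assert (Di : exists e : R, is_derive (fun t => / dn t) t e).
  { unfold dn in *. eexists. auto_derive; [repeat split; auto; lra|reflexivity]. }
  destruct Di as [e De].
  assert (Dgx : Derive gx t = (p t * Gy t - 2 * p t * (sin (phi t) - cy)) * / dn t + Gx t * e).
  { rewrite (Derive_ext _ (fun t => Gx t * / dn t)) by (intros; apply rig_g_G). apply is_derive_unique. now apply (is_derive_mult_R Gx (fun t => / dn t)). }
  assert (Dgy : Derive gy t = (2 * p t * (cos (phi t) - cx) - p t * Gx t) * / dn t + Gy t * e).
  { rewrite (Derive_ext _ (fun t => Gy t * / dn t)) by (intros; apply rig_g_G). apply is_derive_unique. now apply (is_derive_mult_R Gy (fun t => / dn t)). }
  pose proof (rig_g_unit t) as Un. destruct (rig_g_G t) as [E1 E2].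
  rewrite Dgx, Dgy.
  assert (EX : (cos (phi t) - cx) * Gx t + (sin (phi t) - cy) * Gy t = (1 - (cx * cos (phi t) + cy * sin (phi t))) * dn t).
  { transitivity ((sin (phi t) * sin (phi t) + cos (phi t) * cos (phi t) - (cx * cos (phi t) + cy * sin (phi t))) * dn t);
      [unfold Gx, Gy, dn; ring|rewrite T; ring]. }
  transitivity (2 * p t * / dn t * (/ dn t * ((cos (phi t) - cx) * Gx t + (sin (phi t) - cy) * Gy t)) - p t * (gx t ^ 2 + gy t ^ 2)).
  - rewrite E1, E2. ring.
  - rewrite EX, Un. unfold hx. field. lra.
Qed.

(** The angular speed integrates to [2 pi], so g winds once, and its enclosed area is half of
    that. *)
Lemma rig_omega_g : omega gx gy = PI.
Proof.
  destruct rig_hol_g as [[Sx [Sy _]] _]. destruct rig_h_sp as [Hx Hy]. pose proof (sp_cont _ Hx) as Chx.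
  pose proof (omega_anti gx gy Sx Sy) as E.
  assert (E2 : omega gx gy - omega gy gx = 2 * (2 * PI) - 2 * PI).
  { unfold omega. pose proof (sp_cont _ Sx). pose proof (sp_cont _ Sy).
    pose proof (sp_cont _ (sp_Derive _ Sx)). pose proof (sp_cont _ (sp_Derive _ Sy)).
    rewrite <- ig_minus by ct. rewrite (ig_ext _ _ rig_g_derive), ig_minus, ig_scal, rig_h_weight, (cm_ig_p _ _ CM) by ct. reflexivity. }
  lra.
Qed.

(** Winding number one gives [sum m N_m = PI^2] and unit modulus gives [sum N_m = PI^2] over the
    frequencies m >= 1. Subtracting, [sum (m - 1) N_m = 0], so only frequency 1 survives. *)
Lemma rig_g_mode1 : exists al be, forall t, gx t = al * cos t - be * sin t /\ gy t = be * cos t + al * sin t.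
Proof.
  pose proof PI_RGT_0 as HPI. destruct rig_hol_g as [Hg [Mx My]]. pose proof Hg as [Sx [Sy _]].
  pose proof (sp_cont _ Sx) as Cx. pose proof (sp_cont _ Sy) as Cy.
  assert (Hc : forall m, A gy (S m) = - B gx (S m) /\ B gy (S m) = A gx (S m)).
  { intros m. destruct (hol_coef gx gy (S m) Hg ltac:(lia)). lra. }
  set (N := fun m => A gx (S m) ^ 2 + B gx (S m) ^ 2).
  assert (S1 : is_series (fun m => INR (S m) * / PI * N m) PI).
  { pose proof (omega_series gx gy Sx Sy) as H. rewrite rig_omega_g in H. eapply is_series_extR; [|exact H].
    intros m. cbv beta. unfold N. destruct (Hc m) as [-> ->]. ring. }
  assert (S2 : is_series (fun m => / PI * N m) (ig (fun t => gx t ^ 2))).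
  { pose proof (parseval _ _ circle_map_id gx gx Cx (proj2 Sx) (sp_fsummable _ _ circle_map_id _ Sx) Cx (proj2 Sx)) as H.
    rewrite Mx in H. replace (ig (fun t => gx t ^ 2)) with (ig (fun t => gx t * gx t * 1) - 0 * 0 / (2 * PI)).
    - eapply is_series_extR; [|exact H]. intros m. cbv beta. unfold N. ring.
    - rewrite (ig_ext _ (fun t => gx t ^ 2)) by (intros; ring). unfold Rdiv; ring. }
  assert (S3 : is_series (fun m => / PI * N m) (ig (fun t => gy t ^ 2))).
  { pose proof (parseval _ _ circle_map_id gy gy Cy (proj2 Sy) (sp_fsummable _ _ circle_map_id _ Sy) Cy (proj2 Sy)) as H.
    rewrite My in H. replace (ig (fun t => gy t ^ 2)) with (ig (fun t => gy t * gy t * 1) - 0 * 0 / (2 * PI)).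
    - eapply is_series_extR; [|exact H]. intros m. cbv beta. unfold N. destruct (Hc m) as [-> ->]. ring.
    - rewrite (ig_ext _ (fun t => gy t ^ 2)) by (intros; ring). unfold Rdiv; ring. }
  assert (Hx2 : ig (fun t => gx t ^ 2) = PI).
  { assert (E1 : ig (fun t => gx t ^ 2) = ig (fun t => gy t ^ 2)).
    { rewrite <- (is_series_unique _ _ S2). exact (is_series_unique _ _ S3). }
    assert (E2 : ig (fun t => gx t ^ 2) + ig (fun t => gy t ^ 2) = 2 * PI * 1).
    { rewrite <- ig_plus by ct. rewrite <- ig_const. apply ig_ext. apply rig_g_unit. }
    lra. }
  rewrite Hx2 in S2.
  assert (Hz : forall m, A gx (S (S m)) = 0 /\ B gx (S (S m)) = 0).
  { intros m.
    assert (S4 : is_series (fun m => INR m * / PI * N m) 0).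
    { replace 0 with (PI - PI) by ring. eapply is_series_extR; [|apply is_series_minusR; [exact S1|exact S2]].
      intros k. cbv beta. rewrite S_INR. ring. }
    assert (N0 : forall k, 0 <= N k) by (intros; unfold N; apply Rplus_le_le_0_compat; apply pow2_ge_0).
    assert (T0 : forall k, 0 <= INR k * / PI * N k).
    { intros k. pose proof (pos_INR k). pose proof (Rinv_0_lt_compat _ HPI).
      repeat apply Rmult_le_pos; auto; lra. }
    pose proof (is_series_zero_terms _ _ S4 T0 (Rle_refl 0) (S m)) as Z. cbv beta in Z.
    assert (NZ : N (S m) = 0).
    { pose proof (INR_inv_PI_pos m). apply Rmult_eq_reg_l with (INR (S m) * / PI); lra. }
    apply sum_sq_zero in NZ. exact NZ. }
  assert (HF : forall f, sp f -> A f 0 = 0 -> (forall m, A f (S (S m)) = 0 /\ B f (S (S m)) = 0) ->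
     forall t, f t = / PI * (A f 1 * cos t + B f 1 * sin t)).
  { intros f Sf M0 Z t.
    pose proof (fourier_expansion _ _ circle_map_id f (sp_cont _ Sf) (proj2 Sf) (sp_fsummable _ _ circle_map_id _ Sf) t) as H.
    rewrite M0 in H. unfold Rdiv in H. rewrite Rmult_0_l, Rminus_0_r in H.
    rewrite <- (is_series_unique _ _ H).
    replace (/ PI * (A f 1 * cos t + B f 1 * sin t)) with (fterm (fun t => t) (fun _ => 1) f t 0)
      by (unfold fterm; simpl (INR 1); rewrite Rmult_1_l; ring).
    apply is_series_unique. eapply is_series_extR; [|apply (is_series_single 0 (fterm (fun t => t) (fun _ => 1) f t 0))].
    intros [|m]; cbv beta; simpl Nat.eqb; [reflexivity|]. unfold fterm. destruct (Z m) as [-> ->]. ring. }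
  exists (/ PI * A gx 1), (- (/ PI * B gx 1)). intros t.
  rewrite (HF gx Sx Mx Hz t), (HF gy Sy My).
  - destruct (Hc 0%nat) as [-> ->]. split; ring.
  - intros m. destruct (Hc (S m)) as [-> ->], (Hz m) as [-> ->]. split; ring.
Qed.

Theorem weinstock_rigidity : exists c k : C, Cmod c < 1 /\ Cmod k = 1 /\
  forall t, (cis (phi t) - c = (1 - Cconj c * cis (phi t)) * (k * cis t))%C.
Proof.
  destruct rig_g_mode1 as [al [be Hg]]. pose proof rig_c_lt1 as Hc.
  exists (cx, cy), (al, be). split; [|split].
  - unfold Cmod. rewrite <- sqrt_1. apply sqrt_lt_1_alt. simpl. simpl in Hc. split; [nra|lra].
  - unfold Cmod. rewrite <- sqrt_1. f_equal. pose proof (rig_g_unit 0) as Un. destruct (Hg 0) as [E1 E2].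
    rewrite E1, E2, cos_0, sin_0 in Un. simpl fst; simpl snd. rewrite <- Un. ring.
  - intros t. destruct (Hg t) as [E1 E2]. destruct (rig_h_eq t) as [H1 H2].
    (* By [rig_h_eq], h is the inverse of [1 - conj c f], so [g = (f - c) h] can be solved for f -
       c; this is the real part. *)
    assert (F1 : cos (phi t) - cx = (1 - (cx * cos (phi t) + cy * sin (phi t))) * gx t + (cx * sin (phi t) - cy * cos (phi t)) * gy t).
    { transitivity ((cos (phi t) - cx) * ((1 - (cx * cos (phi t) + cy * sin (phi t))) * hx t + (cx * sin (phi t) - cy * cos (phi t)) * hy t)
         + (sin (phi t) - cy) * ((cx * sin (phi t) - cy * cos (phi t)) * hx t - (1 - (cx * cos (phi t) + cy * sin (phi t))) * hy t));
        [|unfold gx, gy; ring].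
      replace ((1 - (cx * cos (phi t) + cy * sin (phi t))) * hx t + (cx * sin (phi t) - cy * cos (phi t)) * hy t) with 1 by lra.
      replace ((cx * sin (phi t) - cy * cos (phi t)) * hx t - (1 - (cx * cos (phi t) + cy * sin (phi t))) * hy t) with 0 by lra. ring. }
    assert (F2 : sin (phi t) - cy = (1 - (cx * cos (phi t) + cy * sin (phi t))) * gy t - (cx * sin (phi t) - cy * cos (phi t)) * gx t).
    { transitivity ((sin (phi t) - cy) * ((1 - (cx * cos (phi t) + cy * sin (phi t))) * hx t + (cx * sin (phi t) - cy * cos (phi t)) * hy t)
         - (cos (phi t) - cx) * ((cx * sin (phi t) - cy * cos (phi t)) * hx t - (1 - (cx * cos (phi t) + cy * sin (phi t))) * hy t));
        [|unfold gx, gy; ring].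
      replace ((1 - (cx * cos (phi t) + cy * sin (phi t))) * hx t + (cx * sin (phi t) - cy * cos (phi t)) * hy t) with 1 by lra.
      replace ((cx * sin (phi t) - cy * cos (phi t)) * hx t - (1 - (cx * cos (phi t) + cy * sin (phi t))) * hy t) with 0 by lra. ring. }
    rewrite E1, E2 in F1, F2. apply injective_projections; simpl.
    + etransitivity; [exact F1|ring].
    + etransitivity; [exact F2|ring].
Qed.

End Rigidity.

(** * Moebius transformations of the disk *)

Definition mobius (k c w : C) : C := (k * ((w - c) / (1 - Cconj c * w)))%C.

Lemma Cmod_sub_le a b : Cmod a - Cmod b <= Cmod (a - b).
Proof.
  pose proof (Cmod_triangle (a - b) b) as H. replace (a - b + b)%C with a in H by ring. lra.
Qed.

Lemma Cmod_cis t : Cmod (cis t) = 1.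
Proof.
  unfold Cmod. transitivity (sqrt 1); [|apply sqrt_1]. f_equal. unfold cis; simpl.
  pose proof (sin2_cos2 t) as T. unfold Rsqr in T. lra.
Qed.

Lemma Cmod_lt_sq x y : 0 <= x -> 0 <= y -> x ^ 2 <= y ^ 2 -> x <= y.
Proof. intros; nra. Qed.

Section Mobius.
Variables k c : C.
Hypothesis Hc : Cmod c < 1.
Hypothesis Hk : Cmod k = 1.

Lemma mobius_denom w : Cmod w <= 1 -> 1 - Cmod c <= Cmod (1 - Cconj c * w)%C.
Proof.
  intros Hw. eapply Rle_trans; [|apply Cmod_sub_le]. rewrite Cmod_1, Cmod_mult, Cmod_conj.
  pose proof (Cmod_ge_0 c). nra.
Qed.

Lemma mobius_denom0 w : Cmod w <= 1 -> (1 - Cconj c * w)%C <> 0.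
Proof. intros Hw. apply Cmod_gt_0. pose proof (mobius_denom w Hw). lra. Qed.

Lemma mobius_num_le w : Cmod w <= 1 -> Cmod (w - c) <= Cmod (1 - Cconj c * w).
Proof.
  intros Hw. apply Cmod_lt_sq; try apply Cmod_ge_0.
  pose proof (Cmod_ge_0 w). pose proof (Cmod_ge_0 c).
  (* This product is [|1 - conj c w|^2 - |w - c|^2]. *)
  assert (H1 : 0 <= (1 - Cmod c ^ 2) * (1 - Cmod w ^ 2)) by (apply Rmult_le_pos; nra).
  rewrite !Cmod2_alt in *. destruct c as [c1 c2], w as [w1 w2]. simpl in *. nra.
Qed.

Lemma mobius_le1 w : Cmod w <= 1 -> Cmod (mobius k c w) <= 1.
Proof.
  intros Hw. unfold mobius. pose proof (mobius_denom w Hw). rewrite Cmod_mult, Hk, Cmod_div by now apply mobius_denom0.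
  pose proof (mobius_num_le w Hw). rewrite Rmult_1_l. apply Rmult_le_reg_r with (Cmod (1 - Cconj c * w)); [lra|].
  unfold Rdiv. rewrite Rmult_assoc, Rinv_l by lra. lra.
Qed.

Lemma k_neq0 : k <> 0.
Proof. apply Cmod_gt_0. lra. Qed.

Lemma norm_c_neq1 : (1 - Cconj c * c)%C <> 0.
Proof. apply mobius_denom0. lra. Qed.

(** This one identity yields injectivity, continuity up to the boundary and the complex
    derivative. *)
Lemma mobius_diff w z : Cmod w <= 1 -> Cmod z <= 1 ->
  (mobius k c w - mobius k c z = k * (1 - Cconj c * c) * (w - z) / ((1 - Cconj c * w) * (1 - Cconj c * z)))%C.
Proof.
  intros Hw Hz. pose proof (mobius_denom0 w Hw). pose proof (mobius_denom0 z Hz). unfold mobius. field. auto.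
Qed.

Lemma mobius_aut : disk_conformal_aut (mobius k c).
Proof.
  pose proof k_neq0 as Hk0. pose proof norm_c_neq1 as Hcc. pose proof (Cmod_ge_0 c) as Hc0.
  split; [exact mobius_le1|split; [|split; [|split]]].
  - intros z w Hz Hw E. pose proof (mobius_diff z w Hz Hw) as D. rewrite E in D.
    pose proof (mobius_denom0 w Hw). pose proof (mobius_denom0 z Hz).
    assert (E2 : (k * (1 - Cconj c * c) * (z - w))%C = 0).
    { replace (k * (1 - Cconj c * c) * (z - w))%C
        with (k * (1 - Cconj c * c) * (z - w) / ((1 - Cconj c * z) * (1 - Cconj c * w)) * ((1 - Cconj c * z) * (1 - Cconj c * w)))%C by (field; auto).
      rewrite <- D. ring. }
    destruct (classic (z = w)) as [Ezw|Ezw]; auto. exfalso.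
    apply (Cmult_neq_0 (k * (1 - Cconj c * c)) (z - w)); auto; [now apply Cmult_neq_0|].
    intros E0. apply Ezw. replace z with (z - w + w)%C by ring. rewrite E0. ring.
  (* The preimage is [(u + c) / (1 + conj c u)]; that it lies in the disk is [mobius_num_le] at
     -u. *)
  - intros w Hw. set (u := (Cconj k * w)%C).
    assert (Hu : Cmod u <= 1) by (unfold u; rewrite Cmod_mult, Cmod_conj, Hk; lra).
    assert (Hd : (1 + Cconj c * u)%C <> 0).
    { apply Cmod_gt_0. pose proof (mobius_denom (- u) ltac:(now rewrite Cmod_opp)) as D.
      replace (1 - Cconj c * - u)%C with (1 + Cconj c * u)%C in D by ring. lra. }
    assert (Hkk : (k * Cconj k)%C = 1) by (rewrite <- Cmod2_conj, Hk; f_equal; ring).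
    exists ((u + c) / (1 + Cconj c * u))%C.
    assert (Hz : Cmod ((u + c) / (1 + Cconj c * u)) <= 1).
    { rewrite Cmod_div by auto. pose proof (mobius_num_le (- u) ltac:(now rewrite Cmod_opp)) as D.
      replace (1 - Cconj c * - u)%C with (1 + Cconj c * u)%C in D by ring.
      replace (- u - c)%C with (- (u + c))%C in D by ring. rewrite Cmod_opp in D.
      apply Cmod_gt_0 in Hd. apply Rmult_le_reg_r with (Cmod (1 + Cconj c * u)); [lra|].
      unfold Rdiv. rewrite Rmult_assoc, Rinv_l by lra. lra. }
    split; [exact Hz|]. pose proof (mobius_denom0 _ Hz) as Hd2.
    transitivity (k * u)%C; [|unfold u; transitivity (k * Cconj k * w)%C; [ring|rewrite Hkk; ring]].
    unfold mobius.
    assert (E1 : ((u + c) / (1 + Cconj c * u) - c = u * (1 - Cconj c * c) / (1 + Cconj c * u))%C) by (field; auto).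
    assert (E2 : (1 - Cconj c * ((u + c) / (1 + Cconj c * u)) = (1 - Cconj c * c) / (1 + Cconj c * u))%C) by (field; auto).
    rewrite E1, E2. field. auto.
  - intros z Hz eps He. set (L := (1 - Cmod c) ^ 2).
    assert (HL : 0 < L) by (unfold L; apply pow_lt; lra).
    assert (H2 : Cmod (1 - Cconj c * c) <= 2).
    { eapply Rle_trans; [apply Cmod_triangle|]. rewrite Cmod_opp, Cmod_1, Cmod_mult, Cmod_conj. nra. }
    exists (eps * L / 2); split; [apply Rdiv_lt_0_compat; [nra|lra]|]. intros w Hw Hd.
    rewrite mobius_diff by auto. pose proof (mobius_denom w Hw) as D1. pose proof (mobius_denom z Hz) as D2.
    pose proof (mobius_denom0 w Hw). pose proof (mobius_denom0 z Hz).
    rewrite Cmod_div by (now apply Cmult_neq_0). rewrite !Cmod_mult, Hk.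
    assert (HP : L <= Cmod (1 - Cconj c * w) * Cmod (1 - Cconj c * z)) by (unfold L; simpl; rewrite Rmult_1_r; apply Rmult_le_compat; lra).
    apply Rmult_lt_reg_r with (Cmod (1 - Cconj c * w) * Cmod (1 - Cconj c * z)); [lra|].
    unfold Rdiv. rewrite Rmult_assoc, Rinv_l, Rmult_1_r by lra.
    pose proof (Cmod_ge_0 (w - z)). pose proof (Cmod_ge_0 (1 - Cconj c * c)).
    apply Rle_lt_trans with (2 * Cmod (w - z)); [nra|].
    apply Rlt_le_trans with (eps * L); [lra|]. apply Rmult_le_compat_l; lra.
  - intros z Hz. apply cdiff_cd. exists (k * (1 - Cconj c * c) / ((1 - Cconj c * z) * (1 - Cconj c * z)))%C.
    intros eps He. pose proof (mobius_denom0 z (Rlt_le _ _ Hz)) as Z0. pose proof (mobius_denom z (Rlt_le _ _ Hz)) as D2.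
    set (L := (1 - Cmod c) ^ 3). assert (HL : 0 < L) by (unfold L; apply pow_lt; lra).
    exists (Rmin (1 - Cmod z) (eps * L / 2)). split; [apply Rmin_pos; [lra|apply Rdiv_lt_0_compat; [nra|lra]]|].
    intros w Hw. pose proof (Rmin_l (1 - Cmod z) (eps * L / 2)). pose proof (Rmin_r (1 - Cmod z) (eps * L / 2)).
    assert (Hw1 : Cmod w <= 1).
    { replace w with ((w - z) + z)%C by ring. eapply Rle_trans; [apply Cmod_triangle|]. lra. }
    pose proof (mobius_denom0 w Hw1) as W0. pose proof (mobius_denom w Hw1) as D1.
    rewrite mobius_diff by lra.
    replace (k * (1 - Cconj c * c) * (w - z) / ((1 - Cconj c * w) * (1 - Cconj c * z)) - k * (1 - Cconj c * c) / ((1 - Cconj c * z) * (1 - Cconj c * z)) * (w - z))%C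
      with (k * (1 - Cconj c * c) * Cconj c * (w - z) / ((1 - Cconj c * w) * ((1 - Cconj c * z) * (1 - Cconj c * z))) * (w - z))%C by (field; auto).
    rewrite Cmod_mult. apply Rmult_le_compat_r; [apply Cmod_ge_0|].
    rewrite Cmod_div by (apply Cmult_neq_0; auto; now apply Cmult_neq_0). rewrite !Cmod_mult, Cmod_conj, Hk.
    set (dw := Cmod (1 - Cconj c * w)) in *. set (dz := Cmod (1 - Cconj c * z)) in *.
    assert (HP : L <= dw * (dz * dz)).
    { unfold L; simpl; rewrite Rmult_1_r. apply Rmult_le_compat; try lra; [nra|]. apply Rmult_le_compat; lra. }
    assert (H2 : Cmod (1 - Cconj c * c) <= 2).
    { eapply Rle_trans; [apply Cmod_triangle|]. rewrite Cmod_opp, Cmod_1, Cmod_mult, Cmod_conj. nra. }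
    apply Rmult_le_reg_r with (dw * (dz * dz)); [lra|].
    unfold Rdiv. rewrite Rmult_assoc, Rinv_l, Rmult_1_r by lra.
    pose proof (Cmod_ge_0 (w - z)). pose proof (Cmod_ge_0 (1 - Cconj c * c)).
    apply Rle_trans with (2 * Cmod (w - z)).
    + apply Rmult_le_compat_r; [lra|]. rewrite Rmult_1_l.
      replace 2 with (2 * 1) by ring. apply Rmult_le_compat; lra.
    + apply Rle_trans with (eps * L); [lra|]. apply Rmult_le_compat_l; lra.
Qed.

End Mobius.

(** * The inverse of a circle map *)

Section Inverse.
Variables phi p : R -> R.
Hypothesis CM : circle_map phi p.

Lemma cm_shift_nat n t : phi (t + INR n * (2 * PI)) = phi t + INR n * (2 * PI).
Proof.
  induction n; [simpl; rewrite !Rmult_0_l, !Rplus_0_r; auto|].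
  rewrite S_INR. replace (t + (INR n + 1) * (2 * PI)) with (t + INR n * (2 * PI) + 2 * PI) by ring.
  rewrite (cm_shift _ _ CM), IHn. ring.
Qed.

Lemma cm_surj y : exists x, phi x = y.
Proof.
  pose proof PI_RGT_0 as HPI.
  destruct (INR_unbounded (Rabs (y - phi 0))) as [n Hn]. pose proof (pos_INR n) as Hn0.
  pose proof (cm_shift_nat n 0) as E1. pose proof (cm_shift_nat n (- (INR n * (2 * PI)))) as E2.
  rewrite Rplus_0_l in E1. rewrite Rplus_opp_l in E2.
  pose proof PI2_1. assert (H2 : INR n <= INR n * (2 * PI)) by nra. apply Rabs_def2 in Hn.
  destruct (IVT_gen phi (- (INR n * (2 * PI))) (INR n * (2 * PI)) y) as [x [_ Hx]].
  - intros x. apply continuity_pt_filterlim. apply (cm_cont_phi _ _ CM).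
  - rewrite Rmin_left, Rmax_right by lra. lra.
  - now exists x.
Qed.

Lemma cm_expanding : exists c, 0 < c /\ forall x y, c * Rabs (x - y) <= Rabs (phi x - phi y).
Proof.
  destruct (cont_pos_lower p (cm_cont_p _ _ CM) (proj2 (cm_sp _ _ CM)) (cm_pos _ _ CM)) as [c [Hc H]].
  exists c; split; auto.
  assert (HL : forall x y, x < y -> c * (y - x) <= phi y - phi x).
  { intros x y Hxy. destruct (MVT_gen phi x y p) as [z [_ Hz]].
    - intros; apply (cm_der _ _ CM).
    - intros z _. apply continuity_pt_filterlim. apply (cm_cont_phi _ _ CM).
    - rewrite Hz. apply Rmult_le_compat_r; [lra|apply H]. }
  intros x y. destruct (Rtotal_order x y) as [Hl|[->|Hl]].
  - specialize (HL x y Hl). rewrite (Rabs_minus_sym x), (Rabs_minus_sym (phi x)), Rabs_right by lra.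
    eapply Rle_trans; [exact HL|apply Rle_abs].
  - rewrite !Rminus_diag, Rabs_R0. lra.
  - specialize (HL y x Hl). rewrite Rabs_right by lra. eapply Rle_trans; [exact HL|apply Rle_abs].
Qed.

(** [psi] is any pointwise right inverse; that [phi] expands distances supplies both its continuity
    and the bound on the difference quotient. *)
Lemma inverse_derive psi : (forall y, phi (psi y) = y) -> forall t, is_derive psi t (/ p (psi t)).
Proof.
  intros Hpsi t. apply is_derive_Reals. intros eps He.
  destruct cm_expanding as [c [Hc HE]]. set (x0 := psi t). pose proof (cm_pos _ _ CM x0) as Hp.
  pose proof (cm_der _ _ CM x0) as D. apply is_derive_Reals in D.
  destruct (D (eps * c * p x0 / 2)) as [d Hd]; [apply Rdiv_lt_0_compat; [repeat apply Rmult_lt_0_compat; lra|lra]|].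
  assert (Hd2 : 0 < c * d) by (apply Rmult_lt_0_compat; [lra|apply cond_pos]).
  exists (mkposreal _ Hd2). intros h Hh0 Hh. simpl in Hh.
  set (e := psi (t + h) - x0).
  pose proof (HE (psi (t + h)) x0) as H1. unfold x0 in H1 at 2. rewrite !Hpsi in H1. replace (t + h - t) with h in H1 by ring.
  fold e in H1.
  assert (He0 : e <> 0).
  { intros E. apply Hh0. assert (E2 : psi (t + h) = x0) by (unfold e in E; lra).
    apply (f_equal phi) in E2. unfold x0 in E2. rewrite !Hpsi in E2. lra. }
  assert (Hed : Rabs e < d) by (apply Rmult_lt_reg_l with c; lra).
  specialize (Hd e He0 Hed).
  assert (E : phi (x0 + e) - phi x0 = h).
  { unfold e. replace (x0 + (psi (t + h) - x0)) with (psi (t + h)) by ring. unfold x0. rewrite !Hpsi. ring. }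
  rewrite E in Hd.
  replace (e / h - / p x0) with (- (h / e - p x0) * (e / h) * / p x0) by (field; repeat split; auto; lra).
  rewrite !Rabs_mult, Rabs_Ropp, (Rabs_right (/ p x0)) by (apply Rle_ge, Rlt_le, Rinv_0_lt_compat; lra).
  assert (Heh : Rabs (e / h) <= / c).
  { unfold Rdiv. rewrite Rabs_mult, Rabs_inv. apply Rabs_pos_lt in Hh0.
    apply Rmult_le_reg_r with (Rabs h); auto. rewrite Rmult_assoc, Rinv_l, Rmult_1_r by lra.
    apply Rmult_le_reg_l with c; auto. rewrite <- Rmult_assoc, Rinv_r, Rmult_1_l by lra. exact H1. }
  apply Rle_lt_trans with ((eps * c * p x0 / 2) * / c * / p x0).
  - apply Rmult_le_compat_r; [apply Rlt_le, Rinv_0_lt_compat; lra|].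
    apply Rmult_le_compat; try apply Rabs_pos; lra.
  - replace (eps * c * p x0 / 2 * / c * / p x0) with (eps / 2) by (field; lra). lra.
Qed.

(** The functions [G (psi t)] with G smooth form a class closed under differentiation, since [psi']
    is [/ p (psi t)]. *)
Lemma inverse_smooth psi : (forall y, phi (psi y) = y) -> smooth psi.
Proof.
  intros Hpsi.
  apply (smooth_coind (fun f => exists G, smooth G /\ f = fun t => G (psi t))).
  - intros f [G [HG ->]]. exists (fun t => Derive G (psi t) * / p (psi t)). split.
    + intros t. eapply is_derive_eq; [apply (is_derive_comp_R G psi); [now apply smooth_is_derive|now apply inverse_derive]|ring].
    + exists (fun x => Derive G x * / p x). split; [|reflexivity].
      apply smooth_mult; [now apply smooth_Derive|]. apply smooth_inv; [apply (cm_sp _ _ CM)|].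
      intros x. pose proof (cm_pos _ _ CM x). lra.
  - exists (fun x => x). split; [apply smooth_id|reflexivity].
Qed.

Lemma inverse_exists : exists psi, forall y, phi (psi y) = y.
Proof.
  assert (H : forall y, exists x, phi x = y) by exact cm_surj.
  exists (fun y => proj1_sig (ClassicalEpsilon.constructive_indefinite_description _ (H y))).
  intros y. exact (proj2_sig (ClassicalEpsilon.constructive_indefinite_description _ (H y))).
Qed.

Theorem conf_equiv_of_no_negative_modes (a : R -> R) : (forall t, p t = / a t) -> (forall t, 0 < a t) ->
  (forall m, (0 < m)%nat -> Ic phi 1 m = 0 /\ Is phi 1 m = 0) -> conf_equiv a (fun _ => 1).
Proof.
  intros Hp Ha Hneg. destruct (weinstock_rigidity phi p CM Hneg) as [c [k [Hc [Hk E]]]].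
  destruct inverse_exists as [psi Hpsi].
  assert (Hk' : Cmod (Cconj k) = 1) by now rewrite Cmod_conj.
  (* The rigidity identity at [psi t] says that this map sends [cis t] to [cis (psi t)]; conjugating
     k inverts the unimodular factor. *)
  exists (mobius (Cconj k) c), psi. split; [left; now apply mobius_aut|split; [now apply inverse_smooth|split]].
  - intros t. specialize (E (psi t)). rewrite Hpsi in E.
    assert (Ht : Cmod (cis t) <= 1) by (rewrite Cmod_cis; lra).
    pose proof (mobius_denom0 c Hc (cis t) Ht) as D0.
    unfold mobius. rewrite E.
    assert (Hkk : (Cconj k * k)%C = 1) by (rewrite Cmult_comm, <- Cmod2_conj, Hk; f_equal; ring).
    transitivity (Cconj k * k * cis (psi t))%C; [field; auto|rewrite Hkk; ring].
  - intros t. rewrite (is_derive_unique _ _ _ (inverse_derive psi Hpsi t)), Hp, Rinv_inv.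
    pose proof (Ha (psi t)). rewrite Rabs_right by lra. field. lra.
Qed.

End Inverse.

(** * Boundary modes of disk automorphisms *)

Definition disk_cont (H : C -> C) : Prop := forall z, Cmod z <= 1 -> forall eps, 0 < eps -> exists delta, 0 < delta /\
  forall w, Cmod w <= 1 -> Cmod (w - z) < delta -> Cmod (H w - H z) < eps.

Lemma trig_lipschitz x y : Rabs (cos x - cos y) <= Rabs (x - y) /\ Rabs (sin x - sin y) <= Rabs (x - y).
Proof.
  split.
  - destruct (MVT_gen cos y x (fun t => - sin t)) as [z [_ ->]].
    + intros; apply is_derive_cos.
    + intros; apply continuity_cos.
    + rewrite Rabs_mult, Rabs_Ropp. pose proof (proj2 (Rabs_trig_le z)). pose proof (Rabs_pos (x - y)). nra.
  - destruct (MVT_gen sin y x cos) as [z [_ ->]].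
    + intros; apply is_derive_sin.
    + intros; apply continuity_sin.
    + rewrite Rabs_mult. pose proof (proj1 (Rabs_trig_le z)). pose proof (Rabs_pos (x - y)). nra.
Qed.

Lemma Cmod_polar r t : 0 <= r -> Cmod (r * cos t, r * sin t) = r.
Proof.
  intros Hr. replace (r * cos t, r * sin t) with (RtoC r * cis t)%C by (unfold cis, RtoC, Cmult; simpl; f_equal; ring).
  rewrite Cmod_mult, Cmod_cis, Cmod_R, Rabs_right by lra. ring.
Qed.

Lemma disk_cont_radial H t eps : disk_cont H -> 0 < eps ->
  locally_2d (fun s r => Cmod (H (Rmin r 1 * cos s, Rmin r 1 * sin s) - H (cis t)) < eps) t 1.
Proof.
  intros HC He. destruct (HC (cis t) ltac:(rewrite Cmod_cis; lra) eps He) as [d [Hd Hb]].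
  assert (Hd2 : 0 < Rmin (d / 4) 1) by (apply Rmin_pos; lra).
  exists (mkposreal _ Hd2). intros s r Hs Hr. simpl in Hs, Hr.
  pose proof (Rmin_l (d / 4) 1). pose proof (Rmin_r (d / 4) 1).
  apply Rabs_def2 in Hr as Hr'. set (m := Rmin r 1).
  assert (Hm : 0 <= m <= 1 /\ Rabs (m - 1) <= Rabs (r - 1)).
  { unfold m, Rmin. destruct (Rle_dec r 1); [split; [lra|lra]|]. split; [lra|]. rewrite Rminus_diag, Rabs_R0. apply Rabs_pos. }
  destruct Hm as [Hm Hm1]. apply Hb; [rewrite Cmod_polar; lra|].
  eapply Rle_lt_trans; [apply Cmod_le_abs|]. simpl.
  destruct (trig_lipschitz s t) as [L1 L2]. destruct (Rabs_trig_le s) as [B1 B2]. pose proof (Rabs_pos (m - 1)).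
  replace (m * cos s + - cos t) with ((m - 1) * cos s + (cos s - cos t)) by ring.
  replace (m * sin s + - sin t) with ((m - 1) * sin s + (sin s - sin t)) by ring.
  pose proof (Rabs_triang ((m - 1) * cos s) (cos s - cos t)) as T1. pose proof (Rabs_triang ((m - 1) * sin s) (sin s - sin t)) as T2.
  rewrite Rabs_mult in T1, T2. pose proof (Rabs_pos (cos s)). pose proof (Rabs_pos (sin s)). nra.
Qed.

(** Continuity on the closed disk makes the circles of radius r < 1 approximate the boundary values
    uniformly. *)
Lemma radial_approx H (u v : R -> R) eps : disk_cont H -> (forall t, H (cis t) = (u t, v t)) -> 0 < eps ->
  exists r, 0 < r < 1 /\ forall t, Rabs (polarU H r t - u t) <= eps /\ Rabs (polarV H r t - v t) <= eps.
Proof.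
  intros HC HB He.
  (* Capping the radius at 1 extends the function beyond the disk, so that uniform continuity
     applies at full neighbourhoods of r = 1. *)
  set (F1 := fun t r => fst (H (Rmin r 1 * cos t, Rmin r 1 * sin t))).
  set (F2 := fun t r => snd (H (Rmin r 1 * cos t, Rmin r 1 * sin t))).
  assert (E1 : forall t, F1 t 1 = u t /\ F2 t 1 = v t).
  { intros t. unfold F1, F2. rewrite Rmin_left, !Rmult_1_l by lra. change (cos t, sin t) with (cis t). now rewrite HB. }
  assert (C12 : forall t, continuity_2d_pt F1 t 1 /\ continuity_2d_pt F2 t 1).
  { intros t. split; intros e; destruct (disk_cont_radial H t e HC (cond_pos e)) as [d Hd]; exists d; intros s r Hs Hr;
    (eapply Rle_lt_trans; [|apply (Hd s r Hs Hr)]).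
    - rewrite (proj1 (E1 t)). eapply Rle_trans; [|apply (proj1 (Cmod_ge_abs _))]. simpl. rewrite HB. simpl. apply Rle_refl.
    - rewrite (proj2 (E1 t)). eapply Rle_trans; [|apply (proj2 (Cmod_ge_abs _))]. simpl. rewrite HB. simpl. apply Rle_refl. }
  destruct (uniform_continuity_2d_1d F1 0 (2 * PI) 1 (fun t _ => proj1 (C12 t)) (mkposreal eps He)) as [d1 H1].
  destruct (uniform_continuity_2d_1d F2 0 (2 * PI) 1 (fun t _ => proj2 (C12 t)) (mkposreal eps He)) as [d2 H2].
  simpl in H1, H2. pose proof (cond_pos d1). pose proof (cond_pos d2).
  set (d := Rmin (Rmin d1 d2) (/ 2)).
  assert (Hd : 0 < d /\ d <= d1 /\ d <= d2 /\ d <= / 2).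
  { unfold d. pose proof (Rmin_l (Rmin d1 d2) (/ 2)). pose proof (Rmin_r (Rmin d1 d2) (/ 2)).
    pose proof (Rmin_l d1 d2). pose proof (Rmin_r d1 d2). repeat split; try lra. repeat apply Rmin_pos; lra. }
  exists (1 - d). split; [lra|].
  assert (HI : forall t, 0 <= t <= 2 * PI -> Rabs (polarU H (1 - d) t - u t) <= eps /\ Rabs (polarV H (1 - d) t - v t) <= eps).
  { intros t Ht. assert (E2 : F1 t (1 - d) = polarU H (1 - d) t /\ F2 t (1 - d) = polarV H (1 - d) t).
    { unfold F1, F2, polarU, polarV. rewrite Rmin_left by lra. auto. }
    destruct (E1 t) as [<- <-]. destruct E2 as [<- <-].
    split; left; [apply H1|apply H2]; try lra; rewrite Rminus_diag, Rabs_R0; lra. }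
  assert (Pu : periodic2pi u /\ periodic2pi v).
  { assert (E : forall t, u t = fst (H (cis t)) /\ v t = snd (H (cis t))) by (intros t; now rewrite HB).
    assert (Pc : forall t, cis (t + 2 * PI) = cis t).
    { intros t. destruct (trig_shift_Z t 1) as [T1 T2]. rewrite Rmult_1_l in T1, T2. unfold cis. now rewrite T1, T2. }
    split; intros t; [destruct (E (t + 2 * PI)) as [-> _], (E t) as [-> _]|destruct (E (t + 2 * PI)) as [_ ->], (E t) as [_ ->]];
    now rewrite Pc. }
  intros t. destruct (polar_periodic H (1 - d)) as [Q1 Q2]. destruct Pu as [P1 P2]. split.
  - destruct (periodic_reduce (fun t => polarU H (1 - d) t - u t) t) as [y [Hy ->]]; [intros x; now rewrite Q1, P1|]. apply HI; lra.
  - destruct (periodic_reduce (fun t => polarV H (1 - d) t - v t) t) as [y [Hy ->]]; [intros x; now rewrite Q2, P2|]. apply HI; lra.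
Qed.

(** Inside the disk the negative modes vanish on every circle, by [polar_neg_modes] with X = 0;
    uniform approximation carries this to the boundary. *)
Lemma boundary_modes H (u v : R -> R) : disk_cont H -> (forall z, Cmod z < 1 -> exists l, cd H z l) ->
  (forall t, H (cis t) = (u t, v t)) -> cont u -> cont v -> forall k, (0 < k)%nat ->
  ig (fun t => u t * cos (INR k * t) - v t * sin (INR k * t)) = 0 /\
  ig (fun t => u t * sin (INR k * t) + v t * cos (INR k * t)) = 0.
Proof.
  intros HC HD HB Cu Cv k Hk. pose proof PI_RGT_0 as HPI.
  assert (HH : forall z, Cmod z < exp 0 -> exists l, cd H z l) by (intros z Hz; rewrite exp_0 in Hz; auto).
  assert (HS : forall eps, 0 < eps -> Rabs (ig (fun t => u t * cos (INR k * t) - v t * sin (INR k * t))) <= 2 * PI * (2 * eps) /\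
     Rabs (ig (fun t => u t * sin (INR k * t) + v t * cos (INR k * t))) <= 2 * PI * (2 * eps)).
  { intros eps He. destruct (radial_approx H u v eps HC HB He) as [r [Hr HA]].
    assert (Hr' : 0 < r < exp 0) by (rewrite exp_0; lra).
    destruct (polar_cont H 0 HH r Hr') as [C1 C2].
    destruct (polar_neg_modes H 0 HH k r Hk Hr') as [M1 M2]. unfold IU, IV in *. rewrite <- INR_IZR_INZ in *.
    split.
    - rewrite <- (Rminus_0_r (ig _)), <- M1, <- ig_minus by ct. apply ig_abs_le; [ct|]. intros t.
      replace (u t * cos (INR k * t) - v t * sin (INR k * t) - (polarU H r t * cos (INR k * t) - polarV H r t * sin (INR k * t)))
        with (- (polarU H r t - u t) * cos (INR k * t) + (polarV H r t - v t) * sin (INR k * t)) by ring.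
      apply Rabs_trig_comb_le; [rewrite Rabs_Ropp|]; apply HA.
    - rewrite <- (Rminus_0_r (ig _)), <- M2, <- ig_minus by ct. apply ig_abs_le; [ct|]. intros t.
      replace (u t * sin (INR k * t) + v t * cos (INR k * t) - (polarU H r t * sin (INR k * t) + polarV H r t * cos (INR k * t)))
        with (- (polarV H r t - v t) * cos (INR k * t) + - (polarU H r t - u t) * sin (INR k * t)) by ring.
      apply Rabs_trig_comb_le; rewrite Rabs_Ropp; apply HA. }
  assert (HZ : forall x, (forall eps, 0 < eps -> Rabs x <= 2 * PI * (2 * eps)) -> x = 0).
  { intros x Hx. destruct (Req_dec x 0) as [E|E]; auto. exfalso. apply Rabs_pos_lt in E.
    specialize (Hx (Rabs x / (8 * PI)) ltac:(apply Rdiv_lt_0_compat; lra)).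
    replace (2 * PI * (2 * (Rabs x / (8 * PI)))) with (Rabs x / 2) in Hx by (field; lra). lra. }
  split; apply HZ; intros eps He; apply (HS eps He).
Qed.

Lemma disk_cont_mult F G : disk_cont F -> disk_cont G -> (forall z, Cmod z <= 1 -> Cmod (F z) <= 1) ->
  (forall z, Cmod z <= 1 -> Cmod (G z) <= 1) -> disk_cont (fun z => F z * G z)%C.
Proof.
  intros HF HG BF BG z Hz eps He.
  destruct (HF z Hz (eps / 2) ltac:(lra)) as [d1 [Hd1 H1]]. destruct (HG z Hz (eps / 2) ltac:(lra)) as [d2 [Hd2 H2]].
  exists (Rmin d1 d2). split; [now apply Rmin_pos|]. intros w Hw Hd.
  pose proof (Rmin_l d1 d2). pose proof (Rmin_r d1 d2).
  specialize (H1 w Hw ltac:(lra)). specialize (H2 w Hw ltac:(lra)). specialize (BF w Hw). specialize (BG z Hz).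
  replace (F w * G w - F z * G z)%C with (F w * (G w - G z) + (F w - F z) * G z)%C by ring.
  eapply Rle_lt_trans; [apply Cmod_triangle|]. rewrite !Cmod_mult.
  pose proof (Cmod_ge_0 (F w)). pose proof (Cmod_ge_0 (G z)). pose proof (Cmod_ge_0 (G w - G z)). pose proof (Cmod_ge_0 (F w - F z)). nra.
Qed.

Lemma disk_cont_pow F n : disk_cont F -> (forall z, Cmod z <= 1 -> Cmod (F z) <= 1) ->
  disk_cont (fun z => Cpow (F z) n) /\ forall z, Cmod z <= 1 -> Cmod (Cpow (F z) n) <= 1.
Proof.
  intros HF BF. induction n as [|n [IH1 IH2]].
  - split; [|intros; simpl; rewrite Cmod_1; lra]. intros z Hz eps He. exists 1; split; [lra|]. intros w Hw _. simpl.
    replace (1 - 1)%C with (RtoC 0) by (apply injective_projections; simpl; ring). rewrite Cmod_0. lra.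
  - split.
    + apply (disk_cont_mult F (fun z => Cpow (F z) n)); auto.
    + intros z Hz. simpl. rewrite Cmod_mult. specialize (BF z Hz). specialize (IH2 z Hz).
      pose proof (Cmod_ge_0 (F z)). pose proof (Cmod_ge_0 (F z ^ n)%C). nra.
Qed.

Lemma cis_pow x n : Cpow (cis x) n = cis (INR n * x).
Proof.
  induction n.
  - simpl. rewrite Rmult_0_l. unfold cis. now rewrite cos_0, sin_0.
  - change (Cpow (cis x) (S n)) with (cis x * Cpow (cis x) n)%C. rewrite IHn, S_INR.
    replace ((INR n + 1) * x) with (x + INR n * x) by ring. unfold cis, Cmult; simpl. rewrite cos_plus, sin_plus. f_equal; ring.
Qed.

(** The power [P^m] is holomorphic in the disk, continuous up to the boundary, and equals
    [exp (i m chi)] there. *)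
Lemma aut_modes P chi m k : disk_conformal_aut P -> (forall t, P (cis t) = cis (chi t)) -> cont chi -> (0 < k)%nat ->
  ig (fun t => cos (INR k * t + INR m * chi t)) = 0 /\ ig (fun t => sin (INR k * t + INR m * chi t)) = 0.
Proof.
  intros [B [_ [_ [CT D]]]] HB Cc Hk.
  destruct (disk_cont_pow P m CT B) as [HC _].
  destruct (boundary_modes (fun z => Cpow (P z) m) (fun t => cos (INR m * chi t)) (fun t => sin (INR m * chi t)) HC) with (k := k) as [M1 M2]; auto.
  - intros z Hz. destruct (proj1 (cdiff_cd P z) (D z Hz)) as [l Hl]. apply (cd_pow P z l m Hl).
  - intros t. rewrite HB. apply cis_pow.
  - ct.
  - ct.
  - split; [rewrite <- M1|rewrite <- M2]; apply ig_ext; intros t; rewrite Rplus_comm, ?cos_plus, ?sin_plus; ring.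
Qed.

(** * Conformal invariance *)

Lemma nonvanishing_sign f : cont f -> (forall t, f t <> 0) -> exists e, (e = 1 \/ e = -1) /\ forall t, 0 < e * f t.
Proof.
  intros Cf H0.
  assert (Cf' : continuity f) by (intros x; apply continuity_pt_filterlim; apply Cf).
  exists (if Rlt_dec 0 (f 0) then 1 else -1). split; [destruct (Rlt_dec 0 (f 0)); auto|]. intros t.
  apply Rnot_le_lt; intros Hl. destruct (IVT_gen f 0 t 0 Cf') as [x [_ Hx]]; [|now apply (H0 x)].
  pose proof (H0 t). pose proof (H0 0). unfold Rmin, Rmax.
  destruct (Rlt_dec 0 (f 0)); destruct (Rle_dec (f 0) (f t)); lra.
Qed.

Lemma zero_derive_const f : (forall x, is_derive f x 0) -> forall x y, f x = f y.
Proof.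
  intros H x y. destruct (MVT_gen f y x (fun _ => 0)) as [z [_ E]].
  - intros; apply H.
  - intros z _. apply continuity_pt_filterlim. apply (ex_derive_continuous f). exists 0; apply H.
  - lra.
Qed.

Lemma periodic_primitive F : cont F -> periodic2pi F ->
  exists G : R -> R, (forall x, is_derive G x (F x)) /\ forall x, G (x + 2 * PI) - G x = ig F.
Proof.
  intros CF PF. set (G := (fun x => RInt F 0 x) : R -> R).
  assert (DG : forall x, is_derive G x (F x)).
  { intros x. apply (is_derive_RInt F G 0 x); [|apply CF].
    exists (mkposreal 1 Rlt_0_1). intros y _. apply (@RInt_correct R_CompleteNormedModule), cont_ex_RInt; auto. }
  exists G. split; auto. intros x. rewrite (zero_derive_const (fun x => G (x + 2 * PI) - G x)) with (y := 0).
  - unfold G, ig. rewrite RInt_point, Rplus_0_l. apply Rminus_0_r.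
  - intros y. eapply is_derive_eq.
    + apply (@is_derive_minus R_AbsRing R_NormedModule (fun x => G (x + 2 * PI)) G); [|apply DG].
      apply (is_derive_comp_R G (fun x => x + 2 * PI) y (F (y + 2 * PI)) 1); [apply DG|]. auto_derive; [auto|reflexivity].
    + rewrite PF, Rmult_1_l. apply (@plus_opp_r R_AbelianGroup).
Qed.

Lemma ig_change_var F psi e : cont F -> periodic2pi F -> smooth psi -> (e = 1 \/ e = -1) ->
  psi (2 * PI) = psi 0 + e * (2 * PI) -> ig (fun t => F (psi t) * Derive psi t) = e * ig F.
Proof.
  intros CF PF Sp He Hs. destruct (periodic_primitive F CF PF) as [G [DG HK]].
  pose proof (smooth_cont _ Sp) as Cpsi. pose proof (smooth_cont _ (smooth_Derive _ Sp)) as CD.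
  rewrite (ig_derive (fun t => G (psi t))).
  - rewrite Hs. destruct He as [-> | ->].
    + rewrite !Rmult_1_l. apply HK.
    + pose proof (HK (psi 0 + -1 * (2 * PI))) as E. replace (psi 0 + -1 * (2 * PI) + 2 * PI) with (psi 0) in E by ring. lra.
  - intros t. eapply is_derive_eq; [apply (is_derive_comp_R G psi); [apply DG|now apply smooth_is_derive]|ring].
  - apply (cont_mult (fun t => F (psi t)) (Derive psi)); auto. now apply (cont_comp F psi).
Qed.

Section Converse.
Variables phi p : R -> R.
Hypothesis CM : circle_map phi p.

(** The boundary map [psi] inverts [phi] up to rotation and reflection. Vanishing modes of the
    powers of the automorphism become, after the substitution by [psi], vanishing modes of
    [exp (i k phi)]; [sg] records the orientations involved. *)
Lemma conf_equiv_modes a : (forall t, p t = / a t) -> (forall t, 0 < a t) -> conf_equiv a (fun _ => 1) ->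
  exists sg, (sg = 1 \/ sg = -1) /\ forall k m, (0 < k)%nat -> (0 < m)%nat ->
    ig (fun t => cos (INR k * phi t + sg * INR m * t)) = 0 /\ ig (fun t => sin (INR k * phi t + sg * INR m * t)) = 0.
Proof.
  intros Hp Ha [P [psi [HP [Sp [HB HD]]]]]. pose proof PI_RGT_0 as HPI.
  pose proof (smooth_cont _ Sp) as Cpsi. pose proof (smooth_cont _ (smooth_Derive _ Sp)) as CD.
  assert (D0 : forall t, Derive psi t <> 0).
  (* Because [/ 0 = 0], a zero of the derivative would turn the conformal relation into 1 = 0. *)
  { intros t E. specialize (HD t). rewrite E, Rabs_R0, Rinv_0 in HD. lra. }
  destruct (nonvanishing_sign (Derive psi) CD D0) as [e [He Hs]].
  assert (Hee : e * e = 1) by (destruct He as [-> | ->]; ring).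
  assert (Da : forall t, Derive psi t = e * a (psi t)).
  { intros t. specialize (HD t). specialize (Hs t).
    assert (EA : Rabs (Derive psi t) = e * Derive psi t).
    { destruct He as [-> | ->]; [rewrite Rabs_right; lra|rewrite Rabs_left; lra]. }
    rewrite EA in HD.
    assert (E : e * Derive psi t = a (psi t)).
    { replace (a (psi t)) with (e * Derive psi t * (/ (e * Derive psi t) * a (psi t))) by (field; split; [apply D0|destruct He; lra]).
      rewrite <- HD. ring. }
    rewrite <- E. rewrite <- Rmult_assoc, Hee. ring. }
  (* The derivative of [phi (psi t)] is [p * psi' = (/ a) * e * a = e], where e is the constant sign
     of [psi']. *)
  assert (Hphi : forall t, phi (psi t) = phi (psi 0) + e * t).
  { intros t. assert (E : phi (psi t) - e * t = phi (psi 0) - e * 0); [|lra].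
    apply (zero_derive_const (fun t => phi (psi t) - e * t)). intros x. eapply is_derive_eq.
    - apply (@is_derive_minus R_AbsRing R_NormedModule (fun t => phi (psi t)) (fun t => e * t)).
      + apply (is_derive_comp_R phi psi); [apply (cm_der _ _ CM)|now apply smooth_is_derive].
      + apply (is_derive_scal (fun t => t) x e 1). apply (@is_derive_id R_AbsRing).
    - rewrite Da, Hp. pose proof (Ha (psi x)). unfold minus, plus, opp, scal; simpl. unfold mult; simpl. field. lra. }
  assert (Hshift : forall t, psi (t + 2 * PI) = psi t + e * (2 * PI)).
  { assert (Inj : forall x y, phi x = phi y -> x = y).
    { intros x y E. destruct (Rtotal_order x y) as [Hl|[Hl|Hl]]; auto; apply (cm_mono _ _ CM) in Hl; lra. }
    intros t. apply Inj. rewrite (Hphi (t + 2 * PI)). destruct He as [-> | ->].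
    - pose proof (Hphi t) as E. rewrite !Rmult_1_l, (cm_shift _ _ CM). lra.
    - pose proof (cm_shift _ _ CM (psi t + -1 * (2 * PI))) as E.
      replace (psi t + -1 * (2 * PI) + 2 * PI) with (psi t) in E by ring. pose proof (Hphi t). lra. }
  (* In the anticonformal case the conjugate map is used, which reverses the boundary angle. *)
  assert (HQ : exists Q d, (d = 1 \/ d = -1) /\ disk_conformal_aut Q /\ forall t, Q (cis t) = cis (d * psi t)).
  { destruct HP as [HP|HP].
    - exists P, 1. split; [auto|split; auto]. intros t. now rewrite Rmult_1_l.
    - exists (fun z => Cconj (P z)), (-1). split; [auto|split; auto]. intros t. rewrite HB.
      replace (-1 * psi t) with (- psi t) by ring. unfold cis, Cconj. simpl. now rewrite cos_neg, sin_neg. }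
  destruct HQ as [Q [d [Hd [HA HQB]]]].
  exists (e * d). split; [destruct He as [-> | ->], Hd as [-> | ->]; lra|]. intros k m Hk Hm.
  set (Th := fun t => INR k * t + INR m * (d * psi t)).
  assert (HT : ig (fun t => cos (Th t)) = 0 /\ ig (fun t => sin (Th t)) = 0).
  { apply (aut_modes Q (fun t => d * psi t) m k HA HQB); [ct|auto]. }
  assert (DT : forall t, is_derive Th t (INR k + INR m * d * Derive psi t)).
  { intros t. unfold Th. auto_derive; [now apply smooth_ex_derive|]. change (Derive (fun x => psi x) t) with (Derive psi t). ring. }
  assert (CT : cont Th) by (unfold Th; ct).
  assert (Zed : exists z, e * d = IZR z) by (destruct He as [-> | ->], Hd as [-> | ->]; [exists 1%Z|exists (-1)%Z|exists (-1)%Z|exists 1%Z]; ring).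
  destruct Zed as [z Hz].
  assert (PT : forall t, cos (Th (t + 2 * PI)) = cos (Th t) /\ sin (Th (t + 2 * PI)) = sin (Th t)).
  { intros t. unfold Th. rewrite Hshift.
    replace (INR k * (t + 2 * PI) + INR m * (d * (psi t + e * (2 * PI))))
      with (INR k * t + INR m * (d * psi t) + IZR (Z.of_nat k + Z.of_nat m * z) * (2 * PI)).
    - apply trig_shift_Z.
    - rewrite plus_IZR, mult_IZR, <- !INR_IZR_INZ, <- Hz. ring. }
  assert (Hmd : INR m * d <> 0).
  { assert (0 < INR m) by (apply lt_0_INR; lia). destruct Hd as [-> | ->]; lra. }
  (* The exact derivative of [sin Th] integrates to 0 and equals [k cos Th + m d psi' cos Th]; the
     first part is already known to vanish. The factor [psi'] is what the change of variables
     requires. *)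
  assert (I1 : ig (fun t => cos (Th t) * Derive psi t) = 0).
  { apply Rmult_eq_reg_l with (INR m * d); auto. rewrite Rmult_0_r.
    assert (E : ig (fun t => INR k * cos (Th t) + INR m * d * (cos (Th t) * Derive psi t)) = 0).
    { apply (ig_derive0 (fun t => sin (Th t))).
      - intros t. eapply is_derive_eq; [apply (is_derive_comp_R sin Th); [apply is_derive_sin|apply DT]|ring].
      - ct.
      - intros t. apply PT. }
    rewrite ig_plus, !ig_scal, (proj1 HT) in E by ct. lra. }
  assert (I2 : ig (fun t => sin (Th t) * Derive psi t) = 0).
  { apply Rmult_eq_reg_l with (INR m * d); auto. rewrite Rmult_0_r.
    assert (E : ig (fun t => - (INR k * sin (Th t) + INR m * d * (sin (Th t) * Derive psi t))) = 0).
    { apply (ig_derive0 (fun t => cos (Th t))).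
      - intros t. eapply is_derive_eq; [apply (is_derive_comp_R cos Th); [apply is_derive_cos|apply DT]|ring].
      - ct.
      - intros t. apply PT. }
    rewrite ig_opp, ig_plus, !ig_scal, (proj2 HT) in E by ct. lra. }
  pose proof (cm_cont_phi _ _ CM) as Cphi.
  assert (PF : forall x, cos (INR k * phi (x + 2 * PI) + e * d * INR m * (x + 2 * PI)) = cos (INR k * phi x + e * d * INR m * x) /\
                         sin (INR k * phi (x + 2 * PI) + e * d * INR m * (x + 2 * PI)) = sin (INR k * phi x + e * d * INR m * x)).
  { intros x. rewrite (cm_shift _ _ CM).
    replace (INR k * (phi x + 2 * PI) + e * d * INR m * (x + 2 * PI))
      with (INR k * phi x + e * d * INR m * x + IZR (Z.of_nat k + Z.of_nat m * z) * (2 * PI)).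
    - apply trig_shift_Z.
    - rewrite plus_IZR, mult_IZR, <- !INR_IZR_INZ, <- Hz. ring. }
  set (c := INR k * phi (psi 0)).
  assert (EA : forall t, INR k * phi (psi t) + e * d * INR m * psi t = c + e * Th t).
  { intros t. rewrite Hphi. unfold c, Th. ring. }
  assert (ES : forall t, cos (e * Th t) = cos (Th t) /\ sin (e * Th t) = e * sin (Th t)).
  { intros t. destruct He as [-> | ->]; [rewrite !Rmult_1_l; auto|].
    replace (-1 * Th t) with (- Th t) by ring. rewrite cos_neg, sin_neg. split; ring. }
  assert (E0 : psi (2 * PI) = psi 0 + e * (2 * PI)) by (rewrite <- Hshift; f_equal; ring).
  split.
  - assert (E : ig (fun t => cos (INR k * phi (psi t) + e * d * INR m * psi t) * Derive psi t) = 0).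
    { rewrite (ig_ext _ (fun t => cos c * (cos (Th t) * Derive psi t) - e * sin c * (sin (Th t) * Derive psi t))).
      - rewrite ig_minus, !ig_scal, I1, I2 by ct. ring.
      - intros t. rewrite EA, cos_plus. destruct (ES t) as [-> ->]. ring. }
    rewrite (ig_change_var (fun x => cos (INR k * phi x + e * d * INR m * x)) psi e) in E; auto; [|ct|intros x; apply PF].
    destruct He as [-> | ->]; lra.
  - assert (E : ig (fun t => sin (INR k * phi (psi t) + e * d * INR m * psi t) * Derive psi t) = 0).
    { rewrite (ig_ext _ (fun t => sin c * (cos (Th t) * Derive psi t) + e * cos c * (sin (Th t) * Derive psi t))).
      - rewrite ig_plus, !ig_scal, I1, I2 by ct. ring.
      - intros t. rewrite EA, sin_plus. destruct (ES t) as [-> ->]. ring. }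
    rewrite (ig_change_var (fun x => sin (INR k * phi x + e * d * INR m * x)) psi e) in E; auto; [|ct|intros x; apply PF].
    destruct He as [-> | ->]; lra.
Qed.

Lemma omega_cos_sin : omega (fun t => cos (INR 1 * phi t)) (fun t => sin (INR 1 * phi t)) = PI.
Proof.
  unfold omega. rewrite (ig_ext _ (fun t => cos (INR 1 * phi t) * cos (INR 1 * phi t) * p t)).
  - rewrite (cm_ortho_cc _ _ CM). reflexivity.
  - intros t. rewrite (proj1 (Derive_trig _ _ CM 1 t)). simpl. ring.
Qed.

(** The sign -1 is impossible: [exp (- i phi)] would have no negative modes, hence be an equality
    case of the area inequality, although its area is [- PI] and energies are nonnegative. *)
Theorem conf_equiv_no_negative_modes a : (forall t, p t = / a t) -> (forall t, 0 < a t) -> conf_equiv a (fun _ => 1) ->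
  forall k m, (0 < k)%nat -> (0 < m)%nat -> Ic phi k m = 0 /\ Is phi k m = 0.
Proof.
  intros Hp Ha HE. destruct (conf_equiv_modes a Hp Ha HE) as [sg [[-> | ->] H]]; intros k m Hk Hm.
  - destruct (H k m Hk Hm) as [H1 H2]. unfold Ic, Is, phase.
    split; [rewrite <- H1|rewrite <- H2]; apply ig_ext; intros t; f_equal; ring.
  - exfalso. destruct (cm_trig_sp _ _ CM 1) as [Sc Ss]. pose proof PI_RGT_0 as HPI. pose proof (cm_cont_phi _ _ CM) as Cphi.
    set (f := fun t => cos (INR 1 * phi t)) in *. set (g := fun t => sin (INR 1 * phi t)) in *.
    set (h := fun t => -1 * g t). assert (Sh : sp h) by now apply sp_scal.
    pose proof (q_ge0 f Sc). pose proof (q_ge0 h Sh).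
    assert (Ew : omega f h = - PI).
    { rewrite <- omega_cos_sin. fold f g. unfold omega, h.
      rewrite (ig_ext _ (fun t => -1 * (f t * Derive g t))) by (intros t; rewrite Derive_scal; ring).
      pose proof (sp_cont _ Sc). pose proof (sp_cont _ (sp_Derive _ Ss)). rewrite ig_scal by ct. ring. }
    assert (E : q f f + q h h - 2 * omega f h = 0); [|lra].
    eapply is_series_null; [apply (q_omega_gap f h Sc Sh)|]. intros n. cbv beta.
    destruct (H 1%nat (S n) ltac:(lia) ltac:(lia)) as [Z1 Z2].
    assert (E1 : A f (S n) - B h (S n) = 0).
    { rewrite <- Z1. unfold Cc, Cs. rewrite <- ig_minus by (unfold h, f, g; ct). apply ig_ext; intros t. unfold h, f, g.
      replace (INR 1 * phi t + -1 * INR (S n) * t) with (INR 1 * phi t - INR (S n) * t) by ring. rewrite cos_minus. ring. }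
    assert (E2 : B f (S n) + A h (S n) = 0).
    { rewrite <- (Ropp_involutive (B f (S n) + _)), <- Ropp_0. f_equal. rewrite <- Z2. unfold Cc, Cs.
      rewrite <- ig_plus, <- ig_opp by (unfold h, f, g; ct). apply ig_ext; intros t. unfold h, f, g.
      replace (INR 1 * phi t + -1 * INR (S n) * t) with (INR 1 * phi t - INR (S n) * t) by ring. rewrite sin_minus. ring. }
    rewrite E1, E2. ring.
Qed.

End Converse.

(** * From the Steklov spectrum to a circle diffeomorphism *)

Lemma spectral_of_steklov a lam : smooth a -> periodic2pi a -> (forall t, 0 < a t) ->
  / (2 * PI) * RInt (fun t => / a t) 0 (2 * PI) = 1 -> steklov_spectrum a lam ->
  exists phi g, spectral phi (fun t => / a t) g lam.
Proof.
  intros Sa Pa Ha Hn [Hmono [u [Hu [Heig [Hon Hpars]]]]]. pose proof PI_RGT_0 as HPI.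
  assert (Ha0 : forall t, a t <> 0) by (intros t; pose proof (Ha t); lra).
  assert (Sp : sp (fun t => / a t)) by (apply sp_inv; auto; split; auto).
  assert (Sq : sp (fun t => sqrt (a t))) by (split; [now apply smooth_sqrt|intros t; now rewrite Pa]).
  assert (Hs : forall t, 0 < sqrt (a t)) by (intros; now apply sqrt_lt_R0).
  assert (Hss : forall t, sqrt (a t) * sqrt (a t) = a t) by (intros; apply sqrt_sqrt, Rlt_le, Ha).
  assert (Hi : forall t, / a t = / sqrt (a t) * / sqrt (a t)) by (intros t; rewrite <- Rinv_mult, Hss; reflexivity).
  assert (Si : sp (fun t => / sqrt (a t))) by (apply sp_inv; auto; intros t; pose proof (Hs t); lra).
  destruct (periodic_primitive _ (sp_cont _ Sp) (proj2 Sp)) as [phi [D1 D2]].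
  (* The normalisation of [a] makes the primitive [phi] advance by exactly [2 pi] per turn. *)
  assert (Hig : ig (fun t => / a t) = 2 * PI).
  { unfold ig. apply Rmult_eq_reg_l with (/ (2 * PI)); [|apply Rinv_neq_0_compat; lra]. rewrite Hn. field. lra. }
  exists phi, (fun j t => sqrt (a t) * u j t).
  split.
  - split; auto.
    + intros t. now apply Rinv_0_lt_compat.
    + intros t. specialize (D2 t). lra.
  - intros j. apply (sp_mult (fun t => sqrt (a t)) (u j)); auto. apply Hu.
  - intros j t. specialize (Heig j t). unfold Lambda_a in Heig. specialize (Hs t).
    apply Rmult_eq_reg_l with (sqrt (a t)); [|lra]. rewrite Heig, Hi. field. lra.
  - intros i j. rewrite <- Hon. apply ig_ext. intros t. specialize (Hs t). rewrite Hi. field. lra.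
  - intros f Hf.
    assert (Sf : sp (fun t => f t * / sqrt (a t))) by (apply (sp_mult f (fun t => / sqrt (a t))); auto).
    assert (E : forall h, wip (fun t => / a t) f (fun t => sqrt (a t) * h t) = L2ip (fun t => f t * / sqrt (a t)) h).
    { intros h. apply ig_ext. intros t. specialize (Hs t). rewrite Hi. field. lra. }
    replace (wip (fun t => / a t) f f) with (L2ip (fun t => f t * / sqrt (a t)) (fun t => f t * / sqrt (a t))).
    + eapply is_series_extR; [|apply (Hpars _ (proj1 Sf) (proj2 Sf))]. intros j. cbv beta. now rewrite E.
    + apply ig_ext. intros t. specialize (Hs t). rewrite Hi. field. lra.
  - exact Hmono.
Qed.

(** * Equality: first eigenvalue one, and vanishing negative modes *)

Section Equality.
Variables (phi p : R -> R) (g : nat -> R -> R) (lam : nat -> R).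
Hypothesis SC : spectral phi p g lam.
Let CM : circle_map phi p := sc_cm _ _ _ _ SC.

Lemma rr_le f : mu lam 0 = 1 -> sp f -> wip p f (fun _ => 1) = 0 -> rr p g lam f f <= wip p f f.
Proof.
  intros H1 Hf H0. pose proof (gm_parseval _ _ _ _ SC f Hf H0) as S1.
  pose proof (Series_correct _ (rr_ex _ _ _ _ SC f f Hf Hf)) as S2.
  rewrite <- (is_series_unique _ _ S1). apply Series_le; [|eexists; exact S1].
  intros l. pose proof (mu_mono _ _ _ _ SC 0 l ltac:(lia)) as Hl. rewrite H1 in Hl.
  pose proof (pow2_ge_0 (wip p f (gm g l))) as W.
  replace (wip p f (gm g l) * wip p f (gm g l) / mu lam l) with (wip p f (gm g l) ^ 2 * / mu lam l) by (unfold Rdiv; ring).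
  pose proof (Rinv_0_lt_compat (mu lam l) ltac:(lra)) as I0.
  assert (I1 : / mu lam l <= 1) by (rewrite <- Rinv_1; apply Rinv_le_contravar; lra).
  split; [apply Rmult_le_pos; lra|]. rewrite <- (Rmult_1_r (wip p f (gm g l) ^ 2)) at 2. now apply Rmult_le_compat_l.
Qed.

(** With all [mu >= 1], duality bounds the energies of [cos phi] and [sin phi] by their norms [PI].
    Their area is [PI], so the area inequality is an equality and each term of its gap vanishes. *)
Lemma first_eigenvalue_one : mu lam 0 = 1 -> forall m, (0 < m)%nat -> Ic phi 1 m = 0 /\ Is phi 1 m = 0.
Proof.
  intros H1 m Hm. pose proof PI_RGT_0 as HPI. pose proof (cm_cont_phi _ _ CM) as Cphi. pose proof (cm_cont_p _ _ CM) as Cp.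
  destruct (cm_trig_sp _ _ CM 1) as [Sc Ss].
  set (f := fun t => cos (INR 1 * phi t)) in *. set (h := fun t => sin (INR 1 * phi t)) in *.
  set (mh := fun t => -1 * h t). assert (Sm : sp mh) by now apply sp_scal.
  assert (Q1 : q h h <= PI).
  { eapply Rle_trans; [apply (q_le_rr _ _ _ _ SC f h Sc Ss)|].
    - unfold wip. rewrite (ig_ext _ (fun t => cos (IZR 1 * phi t) * p t)) by (intros t; unfold f; simpl; ring).
      apply (cm_ig_cos _ _ CM 1).
    - intros t. eapply is_derive_eq; [apply (cm_der_sin _ _ CM)|unfold f; simpl; ring].
    - eapply Rle_trans; [apply rr_le; auto|].
      + unfold wip. rewrite (ig_ext _ (fun t => cos (IZR 1 * phi t) * p t)) by (intros t; unfold f; simpl; ring).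
        apply (cm_ig_cos _ _ CM 1).
      + unfold wip, f. rewrite (cm_ortho_cc _ _ CM). unfold nsq. simpl. lra. }
  assert (Q2 : q f f <= PI).
  { assert (M0 : wip p mh (fun _ => 1) = 0).
    { unfold wip. rewrite (ig_ext _ (fun t => -1 * (sin (IZR 1 * phi t) * p t))) by (intros t; unfold mh, h; simpl; ring).
      rewrite ig_scal, (cm_ig_sin _ _ CM) by ct. ring. }
    eapply Rle_trans; [apply (q_le_rr _ _ _ _ SC mh f Sm Sc M0)|].
    - intros t. eapply is_derive_eq; [apply (cm_der_cos _ _ CM)|unfold mh, h; simpl; ring].
    - eapply Rle_trans; [apply rr_le; auto|].
      unfold wip. rewrite (ig_ext _ (fun t => sin (INR 1 * phi t) * sin (INR 1 * phi t) * p t)) by (intros t; unfold mh, h; ring).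
      rewrite (cm_ortho_ss _ _ CM). simpl. lra. }
  pose proof (omega_cos_sin _ _ CM) as W. fold f h in W.
  destruct m as [|m]; [lia|].
  assert (Z : INR (S m) * / PI * ((A f (S m) - B h (S m)) ^ 2 + (B f (S m) + A h (S m)) ^ 2) = 0).
  { apply (is_series_zero_terms _ _ (q_omega_gap f h Sc Ss)); [|lra].
    intros n. apply Rmult_le_pos; [apply Rlt_le, INR_inv_PI_pos|]. apply Rplus_le_le_0_compat; apply pow2_ge_0. }
  assert (Z2 : (A f (S m) - B h (S m)) ^ 2 + (B f (S m) + A h (S m)) ^ 2 = 0).
  { pose proof (INR_inv_PI_pos m). apply Rmult_eq_reg_l with (INR (S m) * / PI); [rewrite Rmult_0_r; exact Z|lra]. }
  apply sum_sq_zero in Z2. destruct (coef_phase _ _ CM 1 (S m)) as [<- <-]. exact Z2.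
Qed.

(** The residuals [Kt] consist of negative modes only, so they vanish and [mu_exact] applies. *)
Lemma no_negative_modes_spectrum : (forall k m, (0 < k)%nat -> (0 < m)%nat -> Ic phi k m = 0 /\ Is phi k m = 0) ->
  forall j, mu lam j = INR (fr j).
Proof.
  intros H. apply (mu_exact _ _ _ _ SC). intros i.
  assert (K0 : forall t, Kt phi p i t = 0).
  { intros t. rewrite (Kt_defect _ _ _ _ SC i t).
    assert (Hfr : (0 < fr i)%nat) by (apply Nat.lt_0_succ).
    destruct (Nat.even i).
    - rewrite (is_series_null _ _ (Lambda_cos_defect _ _ CM (fr i) t)); [ring|].
      intros n. cbv beta. destruct (H (fr i) (S n) Hfr ltac:(lia)) as [-> ->]. ring.
    - rewrite (is_series_null _ _ (Lambda_sin_defect _ _ CM (fr i) t)); [ring|].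
      intros n. cbv beta. destruct (H (fr i) (S n) Hfr ltac:(lia)) as [-> ->]. ring. }
  unfold kap, wip. rewrite (ig_ext _ (fun _ => 0)) by (intros t; rewrite K0; ring). rewrite ig_const. ring.
Qed.

End Equality.

Theorem theorem1p2 (a : R -> R) (lam : nat -> R) (F : C -> C) :
  smooth a -> periodic2pi a -> (forall t, 0 < a t) ->
  / (2 * PI) * RInt (fun t => / a t) 0 (2 * PI) = 1 ->
  steklov_spectrum a lam ->
  zeta_diff lam F ->
  (forall s : R, Im (F (RtoC s)) = 0 /\ 0 <= Re (F (RtoC s))) /\
  ((exists s : R, s <> 0 /\ F (RtoC s) = RtoC 0) <-> conf_equiv a (fun _ => 1)).
Proof.
  intros Sa Pa Ha Hn HS HZ.
  destruct (spectral_of_steklov a lam Sa Pa Ha Hn HS) as [phi [g SC]].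
  assert (HL : forall k, lam (S k) = mu lam k) by reflexivity.
  pose proof (zeta_diff_value (mu lam) (mu_pos _ _ _ _ SC) (mu_mono _ _ _ _ SC) (mu_asymptotics _ _ _ _ SC)
    lam F HL HZ) as HV.
  assert (HLow : forall s, exp (- s * ln (mu lam 0)) - 1 + s * ln (mu lam 0) <= fst (F (RtoC s))).
  { intros s. apply (zeta_diff_lower (mu lam) (mu_pos _ _ _ _ SC) (mu_mono _ _ _ _ SC) (mu_asymptotics _ _ _ _ SC)
      (prod_mu_le _ _ _ _ SC) (prod_mu_ge _ _ _ _ SC) lam F s HL HZ). }
  split; [|split].
  - intros s. split; [apply HV|]. pose proof (HLow s). pose proof (exp_ineq1_le (- s * ln (mu lam 0))). unfold Re. lra.
  - intros [s [Hs0 Es]].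
    assert (M1 : mu lam 0 = 1).
    (* The inequality [exp u >= 1 + u] is strict unless u = 0, so [s * ln (mu 0) = 0], and s is
       nonzero. *)
    { pose proof (HLow s) as H. rewrite Es in H. simpl in H.
      assert (E : - s * ln (mu lam 0) = 0).
      { destruct (Req_dec (- s * ln (mu lam 0)) 0) as [E|E]; auto. apply exp_ineq1 in E. lra. }
      assert (E2 : ln (mu lam 0) = 0) by (apply Rmult_eq_reg_l with (- s); lra).
      rewrite <- (exp_ln (mu lam 0)) by apply (mu_pos _ _ _ _ SC). now rewrite E2, exp_0. }
    apply (conf_equiv_of_no_negative_modes phi (fun t => / a t) (sc_cm _ _ _ _ SC) a); auto.
    now apply (first_eigenvalue_one phi (fun t => / a t) g lam SC).
  (* The value s = 2 lies where F is given by its defining series, whose pairs cancel termwise once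
     the spectrum is 0, 1, 1, 2, 2, .... *)
  - intros HE. exists 2. split; [lra|].
    pose proof (no_negative_modes_spectrum _ _ _ _ SC
      (conf_equiv_no_negative_modes phi (fun t => / a t) (sc_cm _ _ _ _ SC) a (fun t => eq_refl) Ha HE)) as Hmu.
    destruct (zeta_diff_series (mu lam) lam F 2 HL HZ) as [S1 S2]; [lra|].
    apply injective_projections; [|exact S2]. apply (is_series_null _ _ S1).
    intros n. unfold ez. rewrite !Hmu. ring.
Qed.
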